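(* Let $q$ be a power of a prime, $G=\mathrm{U}(4)_{\mathbb{F}_q}$ with $\mu$, $T$, $B$ as in the context (signature $(r,s)=(3,1)$), and let $S$ be a $k$-scheme with a morphism $\zeta\colon S\to G\text{-}\mathtt{Zip}^\mu$ satisfying conditions (a), (b), (c) of the context. Then $$\langle C_S\rangle=\langle C_{\mathrm{zip}}\rangle=\{(a_1,a_2,a_3,a_4)\in\mathbb{Z}^4: a_1\ge a_2\ge a_3,\ (q-1)(a_1-a_4)+(a_3-a_4)\le0\}.$$
   Context: Notation: $k=\overline{\mathbb{F}}_q$, $\sigma$ the $q$-power Frobenius. For a connected reductive group $G$ over $\mathbb{F}_q$ and a cocharacter $\mu\colon\mathbb{G}_{m,k}\to G_k$: let $P=P_-(\mu)$ (resp. $P_+(\mu)$) be the parabolic subgroup of $G_k$ consisting of $g$ such that $t\mapsto\mu(t)^{-1}g\mu(t)$ (resp. $t\mapsto\mu(t)g\mu(t)^{-1}$) extends to a morphism $\mathbb{A}^1_k\to G_k$; $L$ the centralizer of $\mu$; $Q=(P_+(\mu))^{(q)}$, $M=L^{(q)}$, $\varphi\colon L\to M$ the $q$-Frobenius. The zip group is $E=\{(x,y)\in P\times Q:\varphi(\bar x)=\bar y\}$ ($\bar x$, $\bar y$ the Levi components), acting on $G_k$ by $(x,y)\cdot g=xgy^{-1}$; $G\text{-}\mathtt{Zip}^\mu:=[E\backslash G_k]$. Fix a Borel pair $(B,T)$ over $\mathbb{F}_q$ with $B\subset P$; positive roots are those with root groups in the opposite Borel $B^+$; $I$ the simple roots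 of $L$, $W$ the Weyl group, $w_0$ its longest element, $w_{0,I}$ the longest element of $W_I$, $z=\sigma(w_{0,I})w_0$. For $\lambda\in X^*(T)$, $V_I(\lambda)=\mathrm{Ind}_B^P(\lambda)=\{f\colon P\to\mathbb{A}^1: f(xb)=\lambda(b)^{-1}f(x)\}$ and $\mathcal{V}_I(\lambda)$ its associated vector bundle on $G\text{-}\mathtt{Zip}^\mu$. The zip flag stack is $[E'\backslash G_k]$, $E'=E\cap(B\times G_k)$, and $\mathcal{F}_w=[E'\backslash BwBz^{-1}]$ for $w\in W$. Condition on $(S,\zeta)$: (a) $\zeta$ smooth; (b) $\zeta$ surjective on each connected component of $S$; (c) for each $w\in W$ of length 1, $\overline{\mathrm{Flag}(S)}_w$ is pseudo-complete (global regular functions are locally constant), where $\mathrm{Flag}(S)=S\times_{G\text{-}\mathtt{Zip}^\mu}[E'\backslash G_k]$ and $\mathrm{Flag}(S)_w$ is the preimage of $\mathcal{F}_w$. $\mathcal{V}_I(\lambda)$ on $S$ is the pullback. $C_{\mathrm{zip}}=\{\lambda: H^0(G\text{-}\mathtt{Zip}^\mu,\mathcal{V}_I(\lambda))\neq0\}$, $C_S=\{\lambda: H^0(S,\mathcal{V}_I(\lambda))\neq0\}$, $\langle C\rangle=\{\lambda:\exists N\ge1, N\lambda\in C\}$. Specifics: $V$ is an $n$-dimensional $\mathbb{F}_{q^2}$-vector space ($n=4$) with a nondegenerate hermitian form whose matrix in a basis is the antidiagonal matrix $J$ of ones, and $G=\mathrm{U}(V,\psi)$; then $G_k\simeq\mathrm{GL}_{n,k}$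 and the Frobenius acts on $\mathrm{GL}_n(k)$ by $A\mapsto J\sigma({}^tA)^{-1}J$. $T$ is the diagonal torus and $B$ the lower-triangular Borel (both defined over $\mathbb{F}_q$), $X^*(T)=\mathbb{Z}^n$ via $\mathrm{diag}(x_i)\mapsto\prod x_i^{a_i}$, and $\mu(x)=\mathrm{diag}(xI_r,I_s)$ under $G_k\simeq\mathrm{GL}_{n,k}$, with $(r,s)=(3,1)$. *)

(* Defs.v *)
(* Schemes over k are handled through their functors of points
   (Demazure-Gabriel).  Test rings are the nonzero commutative k-algebras;
   a scheme has exactly one point with values in the zero ring, so nothing is
   lost by leaving that ring out. *)
From HB Require Import structures.
From mathcomp Require Import all_boot all_order all_fingroup all_algebra.
From mathcomp Require Import mpoly.

Set Implicit Arguments.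
Unset Strict Implicit.
Unset Printing Implicit Defensive.

Import Order.TTheory GRing.Theory Num.Theory.
Local Open Scope ring_scope.

(* k is an algebraic closure of its subfield F_q = {c | c ^+ q = c}. *)
Definition is_Fq_closure (q : nat) (k : closedFieldType) : Prop :=
  (exists p e : nat, [/\ prime p, (0 < e)%N, q = (p ^ e)%N & p \in [pchar k]])
  /\ (forall x : k, exists2 P : {poly k},
        P \is monic /\ (forall i, P`_i ^+ q = P`_i) & root P x).

Section Algebras.
Variable k : fieldType.
Implicit Types A B C K : comUnitAlgType k.

Definition is_field K : Prop := forall a : K, a != 0 -> a \is a GRing.unit.

Definition unit_ideal A (D : A -> Prop) : Prop :=
  exists n (c d : 'I_n -> A),
    (forall i, D (d i)) /\ \sum_(i < n) c i * d i = 1.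

(* u exhibits B as the localization A[1/f]. *)
Definition is_loc A B (f : A) (u : {lrmorphism A -> B}) : Prop :=
  [/\ u f \is a GRing.unit,
      forall b, exists a n, b * u f ^+ n = u a
    & forall a, u a = 0 -> exists n, f ^+ n * a = 0].

Definition fin_pres A B (h : {lrmorphism A -> B}) : Prop :=
  exists (n : nat) (y : 'I_n -> B) (m : nat) (r : 'I_m -> {mpoly A[n]}),
    (forall b, exists P : {mpoly A[n]}, mmap h y P = b) /\
    (forall P : {mpoly A[n]}, mmap h y P = 0 <->
       exists c : 'I_m -> {mpoly A[n]}, P = \sum_(i < m) c i * r i).

Definition sqzero_ext A B (p : {lrmorphism A -> B}) : Prop :=
  (forall b, exists a, p a = b) /\
  (forall a a', p a = 0 -> p a' = 0 -> a * a' = 0).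

Definition formally_smooth A B (h : {lrmorphism A -> B}) : Prop :=
  forall C C0 (p : {lrmorphism C -> C0}), sqzero_ext p ->
  forall (u : {lrmorphism A -> C}) (v : {lrmorphism B -> C0}),
    v \o h =1 p \o u ->
  exists w : {lrmorphism B -> C}, w \o h =1 u /\ p \o w =1 v.

Definition formally_unramified A B (h : {lrmorphism A -> B}) : Prop :=
  forall C C0 (p : {lrmorphism C -> C0}), sqzero_ext p ->
  forall w w' : {lrmorphism B -> C},
    w \o h =1 w' \o h -> p \o w =1 p \o w' -> w =1 w'.

Definition smooth_ring A B (h : {lrmorphism A -> B}) : Prop :=
  fin_pres h /\ formally_smooth h.

Definition spec_surjective A B (h : {lrmorphism A -> B}) : Prop :=
  forall K (x : {lrmorphism A -> K}), is_field K ->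
  exists K' (i : {lrmorphism K -> K'}) (y : {lrmorphism B -> K'}),
    is_field K' /\ y \o h =1 i \o x.

Definition etale_cover A B (h : {lrmorphism A -> B}) : Prop :=
  [/\ smooth_ring h, formally_unramified h & spec_surjective h].

End Algebras.

Section Schemes.
Variable k : fieldType.
Implicit Types A B C K : comUnitAlgType k.

Record presheaf := Presheaf {
  pt :> comUnitAlgType k -> Type;
  pmap : forall A B, {lrmorphism A -> B} -> pt A -> pt B;
  pmap_id : forall A (u : {lrmorphism A -> A}) x, u =1 id -> pmap u x = x;
  pmap_comp : forall A B C (u : {lrmorphism A -> B}) (v : {lrmorphism B -> C})
                (w : {lrmorphism A -> C}) x,
    w =1 v \o u -> pmap w x = pmap v (pmap u x)
}.

Record mor (X Y : presheaf) := Mor {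
  mor_fun :> forall A, X A -> Y A;
  mor_nat : forall A B (u : {lrmorphism A -> B}) (x : X A),
    mor_fun (pmap u x) = pmap u (mor_fun x)
}.

Definition subfun (X : presheaf) := forall A, X A -> Prop.

(* On Spec A, the pullback of U is the union of the D(a) for a in D. *)
Definition open_sub (X : presheaf) (U : subfun X) : Prop :=
  forall A (x : X A), exists D : A -> Prop,
  forall B (u : {lrmorphism A -> B}),
    U B (pmap u x) <-> unit_ideal (fun b : B => exists2 a, D a & u a = b).

(* On Spec A, the pullback of Z is the common zero scheme of D. *)
Definition closed_sub (X : presheaf) (Z : subfun X) : Prop :=
  forall A (x : X A), exists D : A -> Prop,
  forall B (u : {lrmorphism A -> B}),
    Z B (pmap u x) <-> (forall a, D a -> u a = 0).

(* Testing agreement on every C under both B i and B j is the same as testing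
   it on the localization at f i * f j, when the latter is nonzero. *)
Definition zariski_sheaf (X : presheaf) : Prop :=
  forall A n (f : 'I_n -> A) (B : 'I_n -> comUnitAlgType k)
    (u : forall i, {lrmorphism A -> B i}) (x : forall i, X (B i)),
  unit_ideal (fun a : A => exists i, a = f i) ->
  (forall i, is_loc (f i) (u i)) ->
  (forall i j C (v : {lrmorphism B i -> C}) (w : {lrmorphism B j -> C}),
     v \o u i =1 w \o u j -> pmap v (x i) = pmap w (x j)) ->
  exists! y : X A, forall i, pmap (u i) y = x i.

(* U is an open subfunctor represented by R, with universal point xi. *)
Definition affine_chart (X : presheaf) (R : comUnitAlgType k) (xi : X R)
    (U : subfun X) : Prop :=
  [/\ open_sub U, U R xi
    & forall A (x : X A), U A x ->
      exists u : {lrmorphism R -> A}, pmap u xi = x /\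
        forall v : {lrmorphism R -> A}, pmap v xi = x -> v =1 u].

Definition is_scheme (X : presheaf) : Prop :=
  zariski_sheaf X /\
  forall K (x : X K), is_field K ->
  exists R (xi : X R) (U : subfun X), affine_chart xi U /\ U K x.

Definition smooth_mor (X Y : presheaf) (f : mor X Y) : Prop :=
  forall K (x : X K), is_field K ->
  exists (R R' : comUnitAlgType k) (xi : X R) (eta : Y R')
    (U : subfun X) (V : subfun Y) (h : {lrmorphism R' -> R}),
    [/\ affine_chart xi U, affine_chart eta V, U K x,
        pmap h eta = f R xi & smooth_ring h].

Definition nonempty_scheme (X : presheaf) : Prop :=
  exists K, is_field K /\ inhabited (X K).

(* Subsets of the underlying topological space |X|.  A point of |X| is a class
   of field-valued points of X up to field extension; the open subsets are
   those of the open subfunctors. *)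
Definition is_pset (X : presheaf) (Z : subfun X) : Prop :=
  forall K K' (u : {lrmorphism K -> K'}) (x : X K),
    is_field K -> is_field K' -> (Z K x <-> Z K' (pmap u x)).

Definition meets (X : presheaf) (Z U : subfun X) : Prop :=
  exists K (x : X K), [/\ is_field K, Z K x & U K x].

Definition connected_pset (X : presheaf) (Z : subfun X) : Prop :=
  meets Z Z /\
  forall U V : subfun X, open_sub U -> open_sub V ->
    (forall K (x : X K), is_field K -> Z K x -> U K x \/ V K x) ->
    meets Z U -> meets Z V ->
    exists K (x : X K), [/\ is_field K, Z K x, U K x & V K x].

Definition connected_component (X : presheaf) (Z : subfun X) : Prop :=
  [/\ is_pset Z, connected_pset Z
    & forall Z' : subfun X, is_pset Z' -> connected_pset Z' ->
      (forall K (x : X K), is_field K -> Z K x -> Z' K x) ->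
      forall K (x : X K), is_field K -> Z' K x -> Z K x].

(* The closure of W in |X| with its reduced scheme structure, that is the
   smallest closed subscheme whose underlying set contains W. *)
Definition reduced_closure (X : presheaf) (W : subfun X) : subfun X :=
  fun A x => forall Z : subfun X, closed_sub Z ->
    (forall K (y : X K), is_field K -> W K y -> Z K y) -> Z A x.

(* Only the values of f on Z matter. *)
Definition regular_on (X : presheaf) (Z : subfun X) (f : forall A, X A -> A) :
    Prop :=
  forall A B (u : {lrmorphism A -> B}) (x : X A),
    Z A x -> f B (pmap u x) = u (f A x).

(* f is a constant c i of k on D(g i), and the D(g i) cover Spec A. *)
Definition locally_constant_on (X : presheaf) (Z : subfun X)
    (f : forall A, X A -> A) : Prop :=
  forall A (x : X A), Z A x ->
  exists n (g : 'I_n -> A) (c : 'I_n -> k),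
    \sum_(i < n) g i = 1 /\ forall i, g i * (f A x - (c i)%:A) = 0.

End Schemes.

Section UnitaryGroup.

Definition gl (A : comUnitRingType) := {g : 'M[A]_4 | g \in unitmx}.

Section Law.
Variable A : comUnitRingType.

Lemma gl1_subproof : (1%:M : 'M[A]_4) \in unitmx.
Proof. exact: unitmx1. Qed.
Lemma glM_subproof (g h : gl A) : \val g *m \val h \in unitmx.
Proof. by rewrite unitmx_mul (valP g) (valP h). Qed.
Lemma glV_subproof (g : gl A) : invmx (\val g) \in unitmx.
Proof. by rewrite unitmx_inv (valP g). Qed.

Definition gl1 : gl A := exist (fun M : 'M_4 => M \in unitmx) _ gl1_subproof.
Definition glM (g h : gl A) : gl A := exist (fun M : 'M_4 => M \in unitmx) _ (glM_subproof g h).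
Definition glV (g : gl A) : gl A := exist (fun M : 'M_4 => M \in unitmx) _ (glV_subproof g).

Lemma glMA (g h l : gl A) : glM g (glM h l) = glM (glM g h) l.
Proof. by apply: val_inj; rewrite /= mulmxA. Qed.
Lemma gl1M (g : gl A) : glM gl1 g = g.
Proof. by apply: val_inj; rewrite /= mul1mx. Qed.
Lemma glM1 (g : gl A) : glM g gl1 = g.
Proof. by apply: val_inj; rewrite /= mulmx1. Qed.
Lemma glVM (g h : gl A) : glV (glM g h) = glM (glV h) (glV g).
Proof.
have [gU hU] := (valP g, valP h); apply: val_inj => /=.
rewrite -[RHS](mulKmx (glM_subproof g h)) -[_ *m _ *m _]mulmxA.
by rewrite [_ *m (invmx _ *m _)]mulmxA mulmxV // mul1mx mulmxV // mulmx1.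
Qed.
Lemma glV1 : glV gl1 = gl1.
Proof. by apply: val_inj; rewrite /= invmx1. Qed.
End Law.

Lemma gl_map_subproof (A B : comUnitRingType) (u : {rmorphism A -> B})
  (g : gl A) : map_mx u (\val g) \in unitmx.
Proof.
by rewrite unitmxE det_map_mx rmorph_unit // -unitmxE (valP g).
Qed.
Definition gl_map (A B : comUnitRingType) (u : {rmorphism A -> B}) (g : gl A) :
  gl B := exist (fun M : 'M_4 => M \in unitmx) _ (gl_map_subproof u g).

Lemma gl_mapM (A B : comUnitRingType) (u : {rmorphism A -> B}) (g h : gl A) :
  gl_map u (glM g h) = glM (gl_map u g) (gl_map u h).
Proof. by apply: val_inj; rewrite /= map_mxM. Qed.
Lemma gl_mapV (A B : comUnitRingType) (u : {rmorphism A -> B}) (g : gl A) :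
  gl_map u (glV g) = glV (gl_map u g).
Proof.
apply: val_inj => /=; have gU := valP g.
rewrite -[LHS](mulmxK (gl_map_subproof u g)) -map_mxM mulVmx // map_mx1.
by rewrite mul1mx.
Qed.

Definition J (A : comUnitRingType) : 'M[A]_4 :=
  \matrix_(i, j) ((i + j == 3)%N)%:R.

Lemma JJ (A : comUnitRingType) : J A *m J A = 1%:M.
Proof.
apply/matrixP => i j; rewrite !mxE (bigD1 (rev_ord i)) //= !mxE.
have -> : (i + (4 - i.+1))%N = 3 by rewrite subSS subnKC // -ltnS.
have -> : (4 - i.+1 + j == 3)%N = (i == j).
  by case: i j => [[|[|[|[|i]]]] ?] [[|[|[|[|j]]]] ?].
rewrite eqxx mul1r big1 ?addr0 // => l nli; rewrite !mxE.
suff -> : (i + l == 3)%N = false by rewrite mul0r.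
apply/negbTE; apply: contraNneq nli => il3; apply/eqP/val_inj => /=.
by rewrite -[LHS](addKn i) il3 subSS.
Qed.

Lemma theta_subproof (A : comUnitRingType) (g : gl A) :
  J A *m invmx (\val g)^T *m J A \in unitmx.
Proof.
have JU : J A \in unitmx by case: (mulmx1_unit (JJ A)).
by rewrite !unitmx_mul JU /= unitmx_inv unitmx_tr (valP g).
Qed.

(* g |-> J g^{-T} J: the change between the two identifications of the unitary
   group with GL_4 over k that differ by the nontrivial automorphism of
   F_{q^2} / F_q. *)
Definition theta (A : comUnitRingType) (g : gl A) : gl A :=
  exist (fun M : 'M_4 => M \in unitmx) _ (theta_subproof g).

Variable q : nat.

(* h is the image of g under the relative q-Frobenius of the F_q-form U(4). *)
Definition is_frob (A : comUnitRingType) (g h : gl A) : Prop :=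
  \val h = J A *m invmx (map_mx (fun a => a ^+ q) (\val g))^T *m J A.

Definition mu (R : nzRingType) (t : R) : 'M[R]_4 :=
  diag_mx (\row_(i < 4) if (i < 3)%N then t else 1).

(* [lim_minus g l]: t |-> mu(t)^-1 g mu(t) extends to a morphism h from the
   affine line to GL_4, and h(0) = l; [lim_plus] uses mu(t) g mu(t)^-1. *)
Definition lim_minus (A : comUnitRingType) (g l : gl A) : Prop :=
  exists h h' : 'M[{poly A}]_4,
    [/\ h *m h' = 1%:M,
        mu 'X *m h = map_mx polyC (\val g) *m mu 'X
      & \val l = map_mx (horner^~ 0) h].

Definition lim_plus (A : comUnitRingType) (g l : gl A) : Prop :=
  exists h h' : 'M[{poly A}]_4,
    [/\ h *m h' = 1%:M,
        h *m mu 'X = mu 'X *m map_mx polyC (\val g)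
      & \val l = map_mx (horner^~ 0) h].

Definition in_P (A : comUnitRingType) (g : gl A) : Prop :=
  exists l, lim_minus g l.
Definition in_Pplus (A : comUnitRingType) (g : gl A) : Prop :=
  exists l, lim_plus g l.

Definition in_L (A : comUnitRingType) (g : gl A) : Prop :=
  mu 'X *m map_mx polyC (\val g) = map_mx polyC (\val g) *m mu 'X.

(* The unipotent radicals are the elements with limit 1; the Levi component of
   x in P is the l in L such that x = l v with v in the unipotent radical. *)
Definition levi_P (A : comUnitRingType) (x l : gl A) : Prop :=
  in_L l /\ exists2 v, lim_minus v (gl1 A) & x = glM l v.
Definition levi_Pplus (A : comUnitRingType) (x l : gl A) : Prop :=
  in_L l /\ exists2 v, lim_plus v (gl1 A) & x = glM l v.

(* P_+ and L are cut out in GL_4 by equations over the prime field, so their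
   Frobenius twists, for the F_q-form U(4), are their images under theta. *)
Definition in_Q (A : comUnitRingType) (y : gl A) : Prop := in_Pplus (theta y).
Definition levi_Q (A : comUnitRingType) (y m : gl A) : Prop :=
  levi_Pplus (theta y) (theta m).

Definition zipE (A : comUnitRingType) (x y : gl A) : Prop :=
  [/\ in_P x, in_Q y
    & exists l m, [/\ levi_P x l, levi_Q y m & is_frob l m]].

Definition in_B (A : comUnitRingType) (b : gl A) : Prop :=
  forall i j : 'I_4, (i < j)%N -> \val b i j = 0.

Definition zipE' (A : comUnitRingType) (x y : gl A) : Prop :=
  zipE x y /\ in_B x.

Definition perm_gl (A : comUnitRingType) (w : 'S_4) : gl A :=
  exist (fun M : 'M_4 => M \in unitmx) _ (unitmx_perm A w).

Definition w0 : 'S_4 := perm (@rev_ord_inj 4).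
(* W_I permutes the first three indices; its longest element swaps the outer
   two of them. *)
Definition w0I : 'S_4 := tperm (inord 0) (inord 2).

(* sigma acts on permutation matrices through theta, their entries being 0
   and 1. *)
Definition zgl (A : comUnitRingType) : gl A :=
  glM (theta (perm_gl A w0I)) (perm_gl A w0).

Definition perm_length (w : 'S_4) : nat :=
  #|[set ij : 'I_4 * 'I_4 | (ij.1 < ij.2)%N && (w ij.2 < w ij.1)%N]|.

(* g in B w B z^-1; for A a field these are all the A-rational points of that
   locally closed subset, by the Bruhat decomposition over A. *)
Definition in_cell (w : 'S_4) (A : comUnitRingType) (g : gl A) : Prop :=
  exists b b' : gl A, [/\ in_B b, in_B b'
    & g = glM (glM (glM b (perm_gl A w)) b') (glV (zgl A))].

Definition chi (lam : 'rV[int]_4) (A : comUnitRingType) (b : gl A) : A :=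
  \prod_(i < 4) (\val b i i) ^ (lam 0 i).

End UnitaryGroup.

Section Zips.
Variables (q : nat) (k : fieldType).
Implicit Types A B K : comUnitAlgType k.

Program Definition Gk : presheaf k :=
  @Presheaf k (fun A => gl A) (fun A B u => gl_map u) _ _.
Next Obligation.
by apply: val_inj; apply/matrixP => i j; rewrite !mxE; apply: H.
Qed.
Next Obligation.
by apply: val_inj; apply/matrixP => i j; rewrite !mxE; apply: H.
Qed.

(* A k-functor X with a left action of E and an E-equivariant map to G_k, i.e.
   the quotient [E \ X] over [E \ G_k].  Only the values of [zact] on E
   matter. *)
Record zip_space := ZipSpace {
  zsp :> presheaf k;
  zact : forall A, gl A -> gl A -> zsp A -> zsp A;
  zphi : mor zsp Gk;
  zact_nat : forall A B (u : {lrmorphism A -> B}) (x y : gl A) (p : zsp A),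
    zipE q x y ->
    pmap u (zact x y p) = zact (gl_map u x) (gl_map u y) (pmap u p);
  zact1 : forall A (p : zsp A), zact (gl1 A) (gl1 A) p = p;
  zactM : forall A (x y x' y' : gl A) (p : zsp A),
    zipE q x y -> zipE q x' y' ->
    zact (glM x x') (glM y y') p = zact x y (zact x' y' p);
  zphi_equiv : forall A (x y : gl A) (p : zsp A), zipE q x y ->
    zphi A (zact x y p) = glM (glM x (zphi A p)) (glV y)
}.

(* G-Zip^mu itself: X = G_k. *)
Program Definition GZip : zip_space :=
  @ZipSpace Gk (fun A x y (g : gl A) => glM (glM x g) (glV y))
    (@Mor k Gk Gk (fun A g => g) _) _ _ _ _.
Next Obligation. by rewrite !gl_mapM gl_mapV. Qed.
Next Obligation. by rewrite gl1M glV1 glM1. Qed.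
Next Obligation. by rewrite glVM !glMA. Qed.

(* A morphism zeta : S -> [E \ G_k]: an E-torsor pi : X -> S with an
   E-equivariant map X -> G_k.  E is smooth, so torsors may be taken locally
   trivial for the etale topology; E is affine, so X is a scheme. *)
Record zip_mor (S : presheaf k) := ZipMor {
  ztot :> zip_space;
  zscheme : is_scheme ztot;
  zpi : mor ztot S;
  zpi_inv : forall A (x y : gl A) (p : ztot A), zipE q x y ->
    zpi A (zact x y p) = zpi A p;
  zfree : forall A (x y : gl A) (p : ztot A), zipE q x y ->
    zact x y p = p -> x = gl1 A /\ y = gl1 A;
  ztrans : forall A (p p' : ztot A), zpi A p = zpi A p' ->
    exists x y : gl A, zipE q x y /\ zact x y p = p';
  zlocal : forall A (s : S A), exists B (h : {lrmorphism A -> B}) (p : ztot B),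
    etale_cover h /\ zpi B p = pmap h s
}.

(* Smoothness and surjectivity of zeta are tested after base change along the
   smooth atlas G_k -> [E \ G_k]; the base change of zeta is X -> G_k. *)
Definition zip_smooth (S : presheaf k) (zeta : zip_mor S) : Prop :=
  smooth_mor (zphi zeta).

Definition zip_surj_components (S : presheaf k) (zeta : zip_mor S) : Prop :=
  forall Z : subfun S, connected_component Z ->
  forall K (g : gl K), is_field K ->
  exists K' (u : {lrmorphism K -> K'}) (p : zeta K'),
    [/\ is_field K', Z K' (zpi zeta K' p) & zphi zeta K' p = gl_map u g].

(* Flag(S) = [E' \ X].  Its stratum w, the reduced closure of that stratum and
   the regular functions on this closure are given on X by the preimage of
   B w B z^-1, the reduced closure of this preimage and the E'-invariant
   regular functions on that. *)
Definition flag_stratum (X : zip_space) (w : 'S_4) : subfun X :=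
  fun A p => in_cell w (zphi X A p).

Definition flag_closure_pseudo_complete (X : zip_space) (w : 'S_4) : Prop :=
  let Z := reduced_closure (flag_stratum w : subfun X) in
  forall f : (forall A, X A -> A),
    regular_on Z f ->
    (forall A (x y : gl A) (p : X A), zipE' q x y -> Z A p ->
       f A (zact x y p) = f A p) ->
    locally_constant_on Z f.

(* A section of V_I(lam) over [E \ X]: an E-equivariant map s from X to V_I(lam),
   E acting on V_I(lam) through its projection to P, that is by left
   translation.  It is written uncurried as F(p, g) = s(p)(g), a function on
   X x P; only the values of F on X x P matter. *)
Definition is_section (X : zip_space) (lam : 'rV[int]_4)
    (F : forall A, X A -> gl A -> A) : Prop :=
  [/\ forall A B (u : {lrmorphism A -> B}) (p : X A) (g : gl A), in_P g ->
        F B (pmap u p) (gl_map u g) = u (F A p g),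
      forall A (p : X A) (g b : gl A), in_P g -> in_B b ->
        F A p (glM g b) = (chi lam b)^-1 * F A p g
    & forall A (x y : gl A) (p : X A) (g : gl A), zipE q x y -> in_P g ->
        F A (zact x y p) g = F A p (glM (glV x) g)].

Definition H0_nonzero (X : zip_space) (lam : 'rV[int]_4) : Prop :=
  exists F : (forall A, X A -> gl A -> A),
    is_section lam F /\
    exists A (p : X A) (g : gl A), in_P g /\ F A p g != 0.

End Zips.

Arguments GZip q k : clear implicits.

Definition C_zip (q : nat) (k : fieldType) : 'rV[int]_4 -> Prop :=
  H0_nonzero (GZip q k).
Definition C_S (q : nat) (k : fieldType) (S : presheaf k)
  (zeta : zip_mor q S) : 'rV[int]_4 -> Prop := H0_nonzero zeta.

Definition saturation (C : 'rV[int]_4 -> Prop) (lam : 'rV[int]_4) : Prop :=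
  exists N : nat, (1 <= N)%N /\ C (lam *+ N).

Definition weight (a1 a2 a3 a4 : int) : 'rV[int]_4 :=
  \row_(i < 4) nth 0 [:: a1; a2; a3; a4] i.

(* Main.v *)
(** Let [h = (g z)^-1], where g is the image in G of a point p of X.  The zip group
    acts on h by [h |-> b * h * c], where c runs through P and b is lower
    triangular as soon as c is.  A section of weight [lam] is a regular
    function f of p on which E' acts through the character [- lam].

    For the upper bound, f is restricted to [h03 = 0], then to [h13 = 0] and to
    [h02 = 0], each time after division by the largest power of that coordinate,
    which shifts the weight by a multiple of [tau]; the orders m1 and m2 of the
    first two divisions are bounded because along a root subgroup of the Levi f
    is a polynomial of degree at most [lam_a - lam_b].  The result is divided
    further by the coordinates [h01], [h12], [h23] until one of them is left,
    that is on the preimage of the closure of a stratum of length one.  There a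
    suitable power of the function, multiplied by a power of the coordinate and
    by units, is invariant, hence locally constant, and vanishes where h is lower
    triangular, which is absurd as soon as the exponent of the coordinate is
    positive.  This gives one linear inequality for each order of division, and a
    positive combination of four of them is the third inequality of the cone.
    Local rings of smooth schemes being domains, a function that does not vanish
    near some point of a component of S does not vanish near any point of it, so
    that all this can be done near points with h lower triangular, which exist by
    surjectivity on components.

    For the lower bound, products of three explicit semi-invariants and a power
    of [det] realize a multiple of every weight in the cone. *)
Require Import Defs.
From HB Require Import structures.
From mathcomp Require Import all_boot all_order all_fingroup all_algebra.
From mathcomp Require Import generic_quotient ring_quotient mpoly boolp.
From mathcomp Require classical_sets.
From mathcomp Require Import ring zify.

Set Implicit Arguments.
Unset Strict Implicit.
Unset Printing Implicit Defensive.

Import Order.TTheory GRing.Theory Num.Theory.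
Local Open Scope ring_scope.
Local Notation pmap := Defs.pmap.

(** * Quotients and localizations of algebras *)

(** Test algebras are arbitrary, so no function field is at hand and orders of vanishing are read
    off in germs. What replaces it is lifting: matrix entries lift freely through square-zero
    extensions, so an entry not yet set to zero is a nonzerodivisor on each chart, and so is the
    next one on its zero locus. Orders are controlled only at points with h lower triangular, which
    exist on every component; where division fails elsewhere, the quotient is set to zero on an open
    and closed part. A group element with values in a residue field cannot move a whole
    neighbourhood; the generic element of the group does, and its parameters are eliminated
    afterwards.

    The constants come from linear algebra. On a curve, the weights of the unit diagonal entries and
    of det span the kernel of a linear form phi with phi(tau) = -D for the coordinate of the curve
    and D = q^2 - q + 1. The combination q phi23 + phi12 + phi23 + phi01 is (q^2 - 1)(v3 - v0), and
    the orders of division left over in it carry multiples of D - q = (q - 1)^2, hence the right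
    sign. *)

Section AlgebraOf.
Variables (k : fieldType) (Q : comNzRingType) (j : {rmorphism k -> Q}).

(** The redex keeps [j] inside the type, so that the scaling structure, which depends on [j], can be
    a canonical instance on it. *)
Definition algof : Type := (fun _ : {rmorphism k -> Q} => (Q : Type)) j.
HB.instance Definition _ := GRing.ComNzRing.on algof.

Definition algof_scale (a : k) (x : algof) : algof := j a * (x : Q).

Fact algof_scaleA a b v : algof_scale a (algof_scale b v) = algof_scale (a * b) v.
Proof. by rewrite /algof_scale rmorphM mulrA. Qed.
Fact algof_scale1 : left_id 1 algof_scale.
Proof. by move=> v; rewrite /algof_scale rmorph1 mul1r. Qed.
Fact algof_scaleDr : right_distributive algof_scale +%R.
Proof. by move=> a u v; rewrite /algof_scale mulrDr. Qed.
Fact algof_scaleDl v : {morph algof_scale^~ v : a b / a + b}.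
Proof. by move=> a b; rewrite /algof_scale rmorphD mulrDl. Qed.
HB.instance Definition _ := GRing.Zmodule_isLmodule.Build k algof
  algof_scaleA algof_scale1 algof_scaleDr algof_scaleDl.

Fact algof_scaleAl (a : k) (u v : algof) : a *: (u * v) = a *: u * v.
Proof. by rewrite /GRing.scale /= /algof_scale mulrA. Qed.
HB.instance Definition _ := GRing.Lmodule_isLalgebra.Build k algof algof_scaleAl.
Fact algof_scaleAr (a : k) (u v : algof) : a *: (u * v) = u * (a *: v).
Proof. by rewrite /GRing.scale /= /algof_scale mulrCA. Qed.
HB.instance Definition _ := GRing.Lalgebra_isAlgebra.Build k algof algof_scaleAr.

(** The ring comes without a chosen inverse; units and inverses are picked classically, which is
    what makes every nonzero quotient a test algebra. *)
Definition algof_unit : pred algof := fun x => `[< exists y : algof, y * x = 1 >].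
Definition algof_inv (x : algof) : algof :=
  if pselect (exists y : algof, y * x = 1) is left h then projT1 (cid h) else x.
Fact algof_mulVx : {in algof_unit, left_inverse 1 algof_inv *%R}.
Proof.
move=> x /asboolP h; rewrite /algof_inv; case: pselect => // h'.
by case: (cid h') => y /=.
Qed.
Fact algof_unitPl (x y : algof) : y * x = 1 -> algof_unit x.
Proof. by move=> e; apply/asboolP; exists y. Qed.
Fact algof_invr_out : {in [predC algof_unit], algof_inv =1 id}.
Proof.
move=> x /asboolPn h; rewrite /algof_inv; case: pselect => // h'.
Qed.
HB.instance Definition _ := GRing.ComNzRing_hasMulInverse.Build algof
  algof_mulVx algof_unitPl algof_invr_out.

Lemma algof_inE (a : k) : a%:A = j a :> algof.
Proof. exact: mulr1. Qed.

End AlgebraOf.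

Section Algebras.
Variable k : fieldType.
Notation alg := (comUnitAlgType k).
Implicit Types A B C K : alg.

Lemma alg_of_ring (Q : comNzRingType) (j : {rmorphism k -> Q}) :
  exists (A : alg) (f : {rmorphism Q -> A}) (g : {rmorphism A -> Q}),
    [/\ cancel f g, cancel g f & forall a, f (j a) = a%:A].
Proof.
exists (algof j : alg), [the {rmorphism Q -> algof j} of idfun],
  [the {rmorphism algof j -> Q} of idfun].
by split=> // a; rewrite algof_inE.
Qed.

Lemma lrmorph_of A B (f : {rmorphism A -> B}) :
  (forall a : k, f a%:A = a%:A) -> exists g : {lrmorphism A -> B}, g =1 f.
Proof.
move=> hf.
have sc : scalable f by move=> a x; rewrite -mulr_algl rmorphM hf mulr_algl.
pose F : A -> B := f.
pose m1 := GRing.isZmodMorphism.Build A B F (rmorphB f).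
pose m2 := GRing.isMonoidMorphism.Build A B F (rmorphism_monoidP f).
pose m3 := GRing.isScalable.Build k A B *:%R F sc.
by exists (HB.pack_for {lrmorphism A -> B} F m1 m2 m3).
Qed.

End Algebras.

Record ideal (R : comNzRingType) (I : R -> Prop) : Prop := Ideal {
  ideal0 : I 0;
  idealD : forall a b, I a -> I b -> I (a + b);
  idealM : forall a b, I b -> I (a * b) }.

Section IdealTheory.
Variables (R : comNzRingType) (I : R -> Prop) (hI : ideal I).

Lemma idealN a : I a -> I (- a).
Proof. by move=> h; rewrite -mulN1r; apply: idealM. Qed.
Lemma idealB a b : I a -> I b -> I (a - b).
Proof. by move=> h1 h2; apply: idealD => //; apply: idealN. Qed.
Lemma idealMr a b : I a -> I (a * b).
Proof. by move=> h; rewrite mulrC; apply: idealM. Qed.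
Lemma ideal_sum (T : Type) (r : seq T) (P : pred T) (F : T -> R) :
  (forall i, P i -> I (F i)) -> I (\sum_(i <- r | P i) F i).
Proof.
move=> h; elim/big_ind: _ => //; [exact: (ideal0 hI)|exact: (idealD hI)].
Qed.
Lemma idealDr a b : I a -> I (b + a) -> I b.
Proof. by move=> ha hb; rewrite -[b](addrK a); apply: idealB. Qed.
End IdealTheory.

Section QuotientByIdeal.
Variables (R : comNzRingType) (I : R -> Prop) (hI : ideal I) (hI1 : ~ I 1).

(** The dummy [let] records the two hypotheses in the term: the ideal instance on the predicate
    rests on them. *)
Definition ideal_pred : {pred R} := let _ := (hI, hI1) in fun r => `[< I r >].
Fact ideal_predP : idealr_closed ideal_pred.
Proof.
split=> [||a u v].
- by rewrite unfold_in; apply/asboolP; apply: (ideal0 hI).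
- by rewrite unfold_in; apply/asboolPn.
rewrite !unfold_in => /asboolP hu /asboolP hv; apply/asboolP.
by apply: (idealD hI) => //; apply: (idealM hI).
Qed.
HB.instance Definition _ := isIdealr.Build R ideal_pred ideal_predP.

Lemma ring_quotient :
  exists (Q : comNzRingType) (f : {rmorphism R -> Q}),
    (forall x, exists r, f r = x) /\ (forall r, f r = 0 <-> I r).
Proof.
pose T := {ideal_quot ideal_pred}; pose p : R -> T := \pi_T%qT.
have p0 : p 0 = 0 by exact: (rmorph0 [the {rmorphism R -> T} of p]).
exists T, [the {rmorphism R -> T} of p]; split=> [x|r] /=.
  by exists (repr x); rewrite /p reprK.
have e : (r \in ideal_pred) = (p r == p 0).
  by rewrite -(@Quotient.idealrBE R ideal_pred) subr0.
rewrite p0 unfold_in in e; split=> [h|h].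
  by apply/asboolP; rewrite e; apply/eqP.
by apply/eqP; rewrite -e; apply/asboolP.
Qed.
End QuotientByIdeal.

Lemma quotient_alg (k : fieldType) (R : comNzRingType) (j : {rmorphism k -> R})
    (I : R -> Prop) : ideal I -> ~ I 1 ->
  exists (A : comUnitAlgType k) (f : {rmorphism R -> A}),
    [/\ forall a, f (j a) = a%:A, forall x, exists r, f r = x
      & forall r, f r = 0 <-> I r].
Proof.
move=> hI hI1; have [Q [f [fs fk]]] := ring_quotient hI hI1.
have [A [g [h [gK hK e]]]] := alg_of_ring (f \o j).
exists A, (g \o f); split=> [a|x|r] /=; first exact: e.
  by have [r er] := fs (h x); exists r; rewrite /= er hK.
rewrite -fk; split=> [h0|h0]; last by rewrite /= h0 rmorph0.
by apply: (can_inj gK); rewrite h0 rmorph0.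
Qed.

Lemma factor_surj (k : fieldType) (R : comNzRingType) (A B : comUnitAlgType k)
    (f : {rmorphism R -> A}) (g : {rmorphism R -> B}) (j : k -> R) :
    (forall x, exists r, f r = x) -> (forall r, f r = 0 -> g r = 0) ->
    (forall a, f (j a) = a%:A) -> (forall a, g (j a) = a%:A) ->
  exists h : {lrmorphism A -> B}, forall r, h (f r) = g r.
Proof.
move=> fs fg fj gj.
pose s x := projT1 (cid (fs x)); have sK x : f (s x) = x by rewrite /s; case: cid.
pose h0 x := g (s x).
have hE r : h0 (f r) = g r.
  by apply/eqP; rewrite -subr_eq0 -rmorphB fg // rmorphB sK subrr.
have hz : zmod_morphism h0.
  by move=> x y; rewrite -(sK x) -(sK y) -rmorphB !hE rmorphB.
have hm : monoid_morphism h0.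
  split=> [|x y]; first by rewrite -(rmorph1 f) hE rmorph1.
  by rewrite -(sK x) -(sK y) -rmorphM !hE rmorphM.
pose m1 := GRing.isZmodMorphism.Build A B h0 hz.
pose m2 := GRing.isMonoidMorphism.Build A B h0 hm.
have [h hh] := lrmorph_of (f := HB.pack_for {rmorphism A -> B} h0 m1 m2)
  (fun a => etrans (congr1 h0 (esym (fj a))) (etrans (hE _) (gj a))).
by exists h => r; rewrite hh /= hE.
Qed.

Lemma horner_rmorph (R Q : comNzRingType) (v : {rmorphism R -> Q}) (b : Q) :
  exists g : {rmorphism {poly R} -> Q}, (forall a, g a%:P = v a) /\ g 'X = b.
Proof.
have cb : commr_rmorph v b by move=> x; apply: mulrC.
exists [the {rmorphism {poly R} -> Q} of horner_morph cb]; split=> [a|] /=.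
  by rewrite horner_morphC.
by rewrite horner_morphX.
Qed.

Lemma mmap_rmorph (R Q : comNzRingType) n (v : {rmorphism R -> Q}) (y : 'I_n -> Q) :
  exists g : {rmorphism {mpoly R[n]} -> Q},
    [/\ forall a, g a%:MP = v a, forall i, g 'X_i = y i & forall p, g p = mmap v y p].
Proof.
exists [the {rmorphism {mpoly R[n]} -> Q} of mmap v y]; split=> //= [a|i].
  by rewrite mmapC.
by rewrite mmapX mmap1U.
Qed.

Section FieldPoints.
Variable k : fieldType.
Notation alg := (comUnitAlgType k).
Implicit Types A B C K : alg.

Definition in_algm A : {rmorphism k -> A} := [the {rmorphism k -> A} of in_alg A].

Section MaximalIdeal.
Variables (R : comNzRingType) (I : R -> Prop) (hI : ideal I) (hI1 : ~ I 1).

Record overideal := OverIdeal {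
  oi :> R -> Prop; oiP : ideal oi; oi1 : ~ oi 1; oiS : forall a, I a -> oi a }.

Lemma maximal_ideal : exists J : R -> Prop,
  [/\ ideal J, ~ J 1, forall a, I a -> J a
    & forall a, ~ J a -> exists b, J (1 - b * a)].
Proof.
pose le (J J' : overideal) := `[< forall a, J a -> J' a >].
have [||A tot|J maxJ] := @classical_sets.ZL_preorder overideal (OverIdeal hI hI1 (fun=> id)) le.
- by move=> J; apply/asboolP.
- by move=> J J' J'' /asboolP h /asboolP h'; apply/asboolP => a /h /h'.
- have [[J0 AJ0]|A0] := pselect (exists J, A J); last first.
    exists (OverIdeal hI hI1 (fun=> id)) => J AJ; case: A0; by exists J.
  pose U a := exists J : overideal, A J /\ J a.
  have hU : ideal U.
    split=> [|a b [J [AJ Ja]] [J' [AJ' Jb]]|a b [J [AJ Jb]]].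
    - by exists J0; split=> //; apply: (ideal0 (oiP J0)).
    - have [/asboolP le1|/asboolP le1] := tot _ _ AJ AJ'.
        by exists J'; split=> //; apply: (idealD (oiP J')) => //; apply: le1.
      by exists J; split=> //; apply: (idealD (oiP J)) => //; apply: le1.
    - by exists J; split=> //; apply: (idealM (oiP J)).
  have hU1 : ~ U 1 by move=> [J [_ /oi1]].
  have hUI a : I a -> U a by exists J0; split=> //; apply: oiS.
  exists (OverIdeal hU hU1 hUI) => J AJ; apply/asboolP => a Ja; by exists J.
exists J; split; [exact: oiP|exact: oi1|exact: oiS|move=> a nJa].
apply: contrapT => nex.
pose J' x := exists b, J (x - b * a).
have hJ' : ideal J'.
  split=> [|x y [b hb] [c hc]|x y [b hb]].
  - by exists 0; rewrite mul0r subr0; apply: (ideal0 (oiP J)).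
  - by exists (b + c); rewrite mulrDl opprD addrACA; apply: (idealD (oiP J)).
  - by exists (x * b); rewrite -mulrA -mulrBr; apply: (idealM (oiP J)).
have J'1 : ~ J' 1 by move=> [b hb]; apply: nex; exists b.
have JJ' x : J x -> J' x by exists 0; rewrite mul0r subr0.
have J'I x : I x -> J' x by move=> /(oiS J); apply: JJ'.
have /asboolP h := maxJ (OverIdeal hJ' J'1 J'I) (introT (asboolP _) JJ').
by apply: nJa; apply: h; exists 1; rewrite mul1r subrr; apply: (ideal0 (oiP J)).
Qed.
End MaximalIdeal.

Lemma field_point A (I : A -> Prop) : ideal I -> ~ I 1 ->
  exists K (x : {lrmorphism A -> K}), is_field K /\ forall a, I a -> x a = 0.
Proof.
move=> hI hI1; have [J [hJ J1 JI maxJ]] := maximal_ideal hI hI1.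
have [K [f [fj fs fk]]] := @quotient_alg k A (in_algm A) J hJ J1.
have [x xE] := lrmorph_of fj.
exists K, x; split=> [c nc|a /JI]; last by rewrite xE fk.
have [r er] := fs c.
have nJr : ~ J r by move=> /fk h; move: nc; rewrite -er h eqxx.
have [b hb] := maxJ r nJr.
apply/unitrP; exists (f b); suff h : f b * c = 1 by rewrite (mulrC c).
by apply/eqP; rewrite -er -rmorphM eq_sym -subr_eq0 -(rmorph1 f) -rmorphB; apply/eqP/fk.
Qed.

Definition gen_ideal (R : comNzRingType) (D : R -> Prop) (a : R) : Prop :=
  exists n (c d : 'I_n -> R), (forall i, D (d i)) /\ a = \sum_(i < n) c i * d i.

Lemma gen_idealP (R : comNzRingType) (D : R -> Prop) : ideal (gen_ideal D).
Proof.
split=> [|_ _ [n [c [d [hd ->]]]] [m [c' [d' [hd' ->]]]]|a _ [n [c [d [hd ->]]]]].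
- by exists 0, (fun=> 0), (fun=> 0); split=> [[]//|]; rewrite big_ord0.
- exists (n + m)%N, (fun i => match split i with inl j => c j | inr j => c' j end),
    (fun i => match split i with inl j => d j | inr j => d' j end).
  split=> [i|]; first by case: (split i).
  rewrite big_split_ord /=; congr (_ + _); apply: eq_bigr => i _.
    by case: (splitP (lshift m i)) => j /= e; [rewrite (val_inj e)|have := ltn_ord i; rewrite e ltnNge leq_addr].
  case: (splitP (rshift n i)) => j /= e; last by rewrite (val_inj (addnI e)).
  by have := ltn_ord j; rewrite -e ltnNge leq_addr.
- exists n, (fun i => a * c i), d; split=> //.
  by rewrite mulr_sumr; apply: eq_bigr => i _; rewrite mulrA.
Qed.

Lemma gen_ideal_in (R : comNzRingType) (D : R -> Prop) a : D a -> gen_ideal D a.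
Proof. by exists 1%N, (fun=> 1), (fun=> a); split=> //; rewrite big_ord1 mul1r. Qed.

Lemma gen_ideal_min (R : comNzRingType) (D I : R -> Prop) a :
  ideal I -> (forall d, D d -> I d) -> gen_ideal D a -> I a.
Proof.
move=> hI h [n [c [d [hd ->]]]]; apply: (ideal_sum hI) => i _.
by apply: (idealM hI); apply: h.
Qed.

Lemma unit_idealE A (D : A -> Prop) : unit_ideal D <-> gen_ideal D 1.
Proof.
by split=> -[n [c [d [hd e]]]]; exists n, c, d; split=> //; rewrite e.
Qed.

(** This dichotomy carries all local-to-global arguments: let [D] be the set of elements after whose
    inversion a property holds; if no field-valued point kills all of [D], then [D] covers Spec
    A. *)
Lemma point_or_unit A (D : A -> Prop) : unit_ideal D \/
  exists K (x : {lrmorphism A -> K}), is_field K /\ forall a, D a -> x a = 0.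
Proof.
have [|h] := pselect (gen_ideal D 1); first by move/unit_idealE; left.
right; have [K [x [hK hx]]] := field_point (gen_idealP D) h.
by exists K, x; split=> // a /gen_ideal_in/hx.
Qed.

Lemma unit_ideal_point A (D : A -> Prop) K (x : {lrmorphism A -> K}) :
  unit_ideal D -> exists2 a, D a & x a != 0.
Proof.
move=> [n [c [d [hd e]]]]; apply: contrapT => h.
have /eqP := congr1 x e; rewrite rmorph_sum rmorph1 big1 ?(eq_sym 0) ?oner_eq0 //.
move=> i _; rewrite rmorphM /=; suff -> : x (d i) = 0 by rewrite mulr0.
by apply/eqP; apply: contrapT => /negP h'; apply: h; exists (d i).
Qed.

Lemma unit_ideal_map A B (u : {lrmorphism A -> B}) (D : A -> Prop) :
  unit_ideal D -> unit_ideal (fun b : B => exists2 a, D a & u a = b).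
Proof.
move=> [n [c [d [hd e]]]]; exists n, (u \o c), (u \o d).
split=> [i|]; first by exists (d i).
by rewrite -(rmorph1 u) -e rmorph_sum; apply: eq_bigr => i _ /=; rewrite rmorphM.
Qed.

Lemma unit_field K (a : K) : is_field K -> (a \is a GRing.unit) = (a != 0).
Proof.
move=> hK; apply/idP/idP => [|/hK//].
by apply: contraL => /eqP ->; rewrite unitr0.
Qed.

Lemma field_mul K (a b : K) : is_field K -> a * b = 0 -> a = 0 \/ b = 0.
Proof.
move=> hK; have [->|/hK ua] := eqVneq a 0; first by left.
by move=> /(congr1 ( *%R a^-1)); rewrite mulrA mulVr // mul1r mulr0; right.
Qed.

Lemma field_expf K (a : K) n : is_field K -> a != 0 -> a ^+ n != 0.
Proof. by move=> hK /hK ha; rewrite -unit_field // unitrX. Qed.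

Lemma unit_of_points A (a : A) :
  (forall K (x : {lrmorphism A -> K}), is_field K -> x a != 0) -> a \is a GRing.unit.
Proof.
move=> h; have [[n [c [d [hd e]]]]|[K [x [hK hx]]]] := point_or_unit (eq a); last first.
  by have := h K x hK; rewrite hx // eqxx.
have e' : (\sum_i c i) * a = 1.
  by rewrite -e mulr_suml; apply: eq_bigr => i _; rewrite (hd i).
by apply/unitrP; exists (\sum_i c i); rewrite (mulrC a).
Qed.

End FieldPoints.

Section Localization.
Variable k : fieldType.
Notation alg := (comUnitAlgType k).
Implicit Types A B C K : alg.

Lemma poly_alg A : exists (C : alg) (e : {rmorphism {poly A} -> C}) (g : {rmorphism C -> {poly A}}),
  [/\ cancel e g, cancel g e & forall a : k, e (a%:A)%:P = a%:A].
Proof.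
exact: (@alg_of_ring k {poly A} ([the {rmorphism A -> {poly A}} of polyC] \o in_algm A)).
Qed.

Lemma polyC_lr A C (e : {rmorphism {poly A} -> C}) :
  (forall a : k, e (a%:A)%:P = a%:A) -> exists c : {lrmorphism A -> C}, forall a, c a = e a%:P.
Proof.
move=> h.
by have [c cE] := lrmorph_of (f := e \o [the {rmorphism A -> {poly A}} of polyC]) h; exists c.
Qed.

(** The localization is the quotient of A[X] by aX - 1; non-nilpotency of [a] keeps this quotient
    nonzero, as test algebras must be. *)
Lemma loc_exists A (a : A) : (forall n, a ^+ n != 0) ->
  exists (B : alg) (u : {lrmorphism A -> B}), is_loc a u.
Proof.
move=> ha.
pose R := {poly A}; pose r : R := a *: 'X - 1.
pose I (p : R) := exists s, p = s * r.
have hI : ideal I.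
  split=> [|_ _ [s ->] [t ->]|p _ [s ->]]; first by exists 0; rewrite mul0r.
    by exists (s + t); rewrite mulrDl.
  by exists (p * s); rewrite mulrA.
(* Comparing coefficients in b = s(aX - 1) gives s_i = - a^i b, and s_i is zero from i = [size s]
   on. *)
have key b s : b%:P = s * r -> exists n, a ^+ n * b = 0.
  move=> e.
  have c0 i : (s * r)`_i.+1 = a * s`_i - s`_i.+1.
    by rewrite mulrBr mulr1 coefB -scalerAr coefZ coefMX.
  have s0 : s`_0 = - b.
    have := congr1 (fun p : R => p`_0) e.
    by rewrite coefC eqxx mulrBr mulr1 coefB -scalerAr coefZ coefMX /= mulr0 sub0r => ->; rewrite opprK.
  have si i : s`_i = - (a ^+ i * b).
    elim: i => [|i IH]; first by rewrite expr0 mul1r.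
    have := congr1 (fun p : R => p`_i.+1) e; rewrite c0 coefC /= => /eqP.
    by rewrite eq_sym subr_eq0 => /eqP <-; rewrite IH mulrN mulrA -exprS.
  exists (size s); have := si (size s); rewrite nth_default // => /eqP.
  by rewrite eq_sym oppr_eq0 => /eqP.
have hI1 : ~ I 1.
  by move=> [s /key[n]] /eqP; rewrite mulr1 (negbTE (ha n)).
pose j : {rmorphism k -> R} := [the {rmorphism A -> R} of polyC] \o in_algm A.
have [B [f [fj fs fk]]] := @quotient_alg k R j I hI hI1.
have [u uE] := polyC_lr fj.
exists B, u.
have fX : u a * f 'X = 1.
  rewrite uE -rmorphM mul_polyC; apply/eqP; rewrite -subr_eq0 -(rmorph1 f) -rmorphB.
  by apply/eqP/fk; exists 1; rewrite mul1r.
split=> [|b|b].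
- by apply/unitrP; exists (f 'X); split; rewrite // mulrC.
- have [p <-] := fs b; elim/poly_ind: p => [|p c [a' [n e]]].
    by exists 0, 0; rewrite !rmorph0 mul0r.
  exists (a' + c * a ^+ n.+1), n.+1; rewrite !rmorphD !rmorphM /= mulrDl -uE !rmorphXn.
  by congr (_ + _); rewrite -e exprS -mulrA (mulrA (f 'X)) (mulrC (f 'X)) fX mul1r.
- move=> e; have /fk[s /key//] : f b%:P = 0 by rewrite -uE.
Qed.

Lemma loc_univ A B C (a : A) (u : {lrmorphism A -> B}) (v : {lrmorphism A -> C}) :
  is_loc a u -> v a \is a GRing.unit -> exists w : {lrmorphism B -> C}, w \o u =1 v.
Proof.
move=> [ua fr tor] va.
pose P b c := exists a' n, b * u a ^+ n = u a' /\ c * v a ^+ n = v a'.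
have Pex b : exists c, P b c.
  have [a' [n e]] := fr b; exists (v a' / v a ^+ n), a', n; split=> //.
  by rewrite divrK // unitrX.
have Pun b c c' : P b c -> P b c' -> c = c'.
  move=> [x [n [e1 e2]]] [y [m [e3 e4]]].
  have : u (x * a ^+ m - y * a ^+ n) = 0.
    by rewrite rmorphB !rmorphM /= !rmorphXn /= -e1 -e3 mulrAC subrr.
  move=> /tor[l e]; have := congr1 v e.
  rewrite rmorph0 rmorphM rmorphXn /= => /(congr1 ( *%R (v a ^- l))).
  rewrite mulrA mulVr ?unitrX // mul1r mulr0 rmorphB !rmorphM /= !rmorphXn /= -e2 -e4.
  move/eqP; rewrite subr_eq0 [X in _ == X]mulrAC => /eqP h.
  have un : v a ^+ n * v a ^+ m \is a GRing.unit by rewrite unitrM !unitrX.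
  by apply: (mulIr un); rewrite !mulrA h.
pose w0 b := projT1 (cid (Pex b)); have w0P b : P b (w0 b) by rewrite /w0; case: cid.
have wu x : w0 (u x) = v x.
  by apply: Pun (w0P _) _; exists x, 0; rewrite !mulr1.
have hD x y : w0 (x + y) = w0 x + w0 y.
  apply: Pun (w0P _) _; have [a1 [n [e1 e2]]] := w0P x; have [b1 [m [e3 e4]]] := w0P y.
  exists (a1 * a ^+ m + b1 * a ^+ n), (n + m)%N.
  rewrite !rmorphD !rmorphM /= !rmorphXn /= -e1 -e2 -e3 -e4 !mulrDl !exprD !mulrA.
  by split; congr (_ + _); rewrite mulrAC.
have hM x y : w0 (x * y) = w0 x * w0 y.
  apply: Pun (w0P _) _; have [a1 [n [e1 e2]]] := w0P x; have [b1 [m [e3 e4]]] := w0P y.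
  exists (a1 * b1), (n + m)%N.
  by rewrite !rmorphM /= -e1 -e2 -e3 -e4 !exprD; split; rewrite mulrACA.
have h1 : w0 1 = 1 by rewrite -(rmorph1 u) wu rmorph1.
have hz : zmod_morphism w0.
  move=> x y; apply/eqP; rewrite eq_sym subr_eq -hD; apply/eqP.
  by rewrite subrK.
pose m1 := GRing.isZmodMorphism.Build B C w0 hz.
pose m2 := GRing.isMonoidMorphism.Build B C w0 (h1, hM).
have [|w wE] := lrmorph_of (f := HB.pack_for {rmorphism B -> C} w0 m1 m2).
  by move=> c; rewrite -(rmorph_alg u) /= wu rmorph_alg.
by exists w => x /=; rewrite wE /= wu.
Qed.

Lemma loc_hom_uniq A B C (a : A) (u : {lrmorphism A -> B}) (w w' : {lrmorphism B -> C}) :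
  is_loc a u -> w \o u =1 w' \o u -> w =1 w'.
Proof.
move=> [ua fr _] e b; have [a' [n eb]] := fr b.
have un : w (u a) ^+ n \is a GRing.unit by rewrite unitrX // rmorph_unit.
apply: (mulIr un); rewrite -{1}rmorphXn -rmorphM eb.
by rewrite -[w (u a)]/((w \o u) a) e /= -rmorphXn -rmorphM eb -[RHS]/((w' \o u) a') -e.
Qed.

Lemma point_exists A (a : A) : (forall n, a ^+ n != 0) ->
  exists K (x : {lrmorphism A -> K}), is_field K /\ x a != 0.
Proof.
move=> /loc_exists[B [u hu]]; have [ua _ _] := hu.
have [||K [x [hK _]]] := @field_point k B (fun b => b = 0).
- by split=> [|a1 b -> ->|a1 b ->]; rewrite ?addr0 ?mulr0.
- by move/eqP; rewrite oner_eq0.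
exists K, (x \o u); split=> //=.
by rewrite -unit_field // rmorph_unit.
Qed.

Lemma loc_at A K (x : {lrmorphism A -> K}) (a : A) : is_field K -> x a != 0 ->
  exists (B : alg) (u : {lrmorphism A -> B}) (y : {lrmorphism B -> K}),
    is_loc a u /\ y \o u =1 x.
Proof.
move=> hK xa.
have [|B [u hu]] := @loc_exists A a.
  by move=> n; apply: contra_neq (field_expf n hK xa) => e; rewrite -rmorphXn e rmorph0.
have [|y yu] := loc_univ (v := x) hu; first by rewrite unit_field.
by exists B, u, y.
Qed.

Lemma is_field_of_loc A B (a : A) (u : {lrmorphism A -> B}) K (y : {lrmorphism B -> K}) :
  is_field K -> is_loc a u -> y (u a) != 0.
Proof. by move=> hK hu; case: hu => ua _ _; rewrite -unit_field // rmorph_unit. Qed.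

Lemma local_zero A (b : A) :
  (forall K (x : {lrmorphism A -> K}), is_field K -> exists2 a, x a != 0 & a * b = 0) -> b = 0.
Proof.
move=> h; have [[n [c [d [hd e]]]]|[K [x [hK hx]]]] := point_or_unit (fun a => a * b = 0); last first.
  by have [a xa ab] := h K x hK; rewrite hx // eqxx in xa.
by rewrite -[b]mul1r -e mulr_suml big1 // => i _; rewrite -mulrA hd mulr0.
Qed.

Lemma local_zero_loc A (b : A) :
  (forall K (x : {lrmorphism A -> K}), is_field K -> exists2 a, x a != 0 &
     forall B (u : {lrmorphism A -> B}), is_loc a u -> u b = 0) -> b = 0.
Proof.
move=> h; apply: local_zero => K x hK; have [a xa ha] := h K x hK.
have [B [u [y [hu _]]]] := loc_at hK xa.
have [_ _ /(_ b (ha B u hu))[n e]] := hu.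
by exists (a ^+ n) => //; rewrite rmorphXn field_expf.
Qed.

End Localization.

Section Gluing.
Variable k : fieldType.
Notation alg := (comUnitAlgType k).
Implicit Types A B C K : alg.

Lemma choose_fin (n : nat) (T : 'I_n -> Type) (P : forall i, T i -> Prop) :
  (forall i, exists x : T i, P i x) -> exists f : forall i, T i, forall i, P i (f i).
Proof. by move=> h; exists (fun i => projT1 (cid (h i))) => i; case: cid. Qed.

Lemma uniform_bound (n : nat) (P : 'I_n -> nat -> Prop) :
  (forall i a b, (a <= b)%N -> P i a -> P i b) ->
  (forall i, exists a, P i a) -> exists a, forall i, P i a.
Proof.
move=> hmon /choose_fin[f hf]; exists (\sum_i f i)%N => i.
by apply: hmon (hf i); rewrite (bigD1 i) //= leq_addr.
Qed.

(** [P] is a partial function on the algebras over A, compatible with base change and defined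
    locally on Spec A. The glued value is built with a partition of unity, as in the proof that the
    structure presheaf of an affine scheme is a sheaf. *)
Lemma affine_glue A (P : forall B, {lrmorphism A -> B} -> B -> Prop) :
    (forall B C (u : {lrmorphism A -> B}) (v : {lrmorphism B -> C})
       (w : {lrmorphism A -> C}) c, w =1 v \o u -> P B u c -> P C w (v c)) ->
    (forall B u c c', P B u c -> P B u c' -> c = c') ->
    (forall K (x : {lrmorphism A -> K}), is_field K -> exists2 a, x a != 0 &
       exists B u (c : B), is_loc a u /\ P B u c) ->
  exists c : A, forall B u c', P B u c' -> u c = c'.
Proof.
move=> hnat hfun hloc.
pose D a := exists B u (c : B), is_loc a u /\ P B u c.
have [[n [e [d [hd e1]]]]|[K [x [hK hx]]]] := point_or_unit D; last first.
  by have [a xa Da] := hloc K x hK; rewrite hx ?eqxx in xa.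
have [B hB] := choose_fin hd; have [u hu] := choose_fin hB.
have [c hc] := choose_fin hu => {hd hB hu}.
have [N hN] : exists N, forall i, exists a, c i * u i (d i) ^+ N = u i a.
  apply: uniform_bound => [i m m' lm [a ea]|i].
    exists (a * d i ^+ (m' - m)).
    by rewrite rmorphM /= rmorphXn /= -ea -mulrA -exprD subnKC.
  by have [[_ /(_ (c i))[a [m ea]] _] _] := hc i; exists m, a.
have [a ha] := choose_fin hN.
have [M hM] : exists M, forall i, forall j, (d i * d j) ^+ M * (d j ^+ N * a i - d i ^+ N * a j) = 0.
  apply: uniform_bound => [i m m' lm h j|i].
    by rewrite -(subnK lm) exprD -mulrA h mulr0.
  apply: uniform_bound => [j m m' lm h|j].
    by rewrite -(subnK lm) exprD -mulrA h mulr0.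
  (* If [d i * d j] is nilpotent the overlap is empty: the zero ring is not a test algebra, so this
     case is settled apart. *)
  have [[m em]|nn] := pselect (exists m, (d i * d j) ^+ m = 0).
    by exists m; rewrite em mul0r.
  have [|C [v hv]] := @loc_exists k A (d i * d j).
    by move=> m; apply/eqP => em; apply: nn; exists m.
  have [vu fr tor] := hv; apply: tor.
  have [[ui hui] [uj huj]] := ((hc i), (hc j)).
  move: vu; rewrite rmorphM unitrM => /andP[vi vj].
  have [wi hwi] := loc_univ ui vi; have [wj hwj] := loc_univ uj vj.
  have e3 : wi (c i) = wj (c j).
    apply: (hfun C v); first by apply: (hnat _ _ (u i)) hui => t; rewrite hwi.
    by apply: (hnat _ _ (u j)) huj => t; rewrite hwj.
  have ei : wi (c i) * v (d i) ^+ N = v (a i).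
    by rewrite -hwi -[v (a i)]hwi /= -rmorphXn -rmorphM ha.
  have ej : wj (c j) * v (d j) ^+ N = v (a j).
    by rewrite -hwj -[v (a j)]hwj /= -rmorphXn -rmorphM ha.
  by rewrite rmorphB !rmorphM /= !rmorphXn /= -ei -ej e3 mulrCA [X in _ - X]mulrCA (mulrC (v (d j) ^+ N)) subrr.
pose L := (N + M)%N; pose a' i := d i ^+ M * a i.
have hL i : c i * u i (d i) ^+ L = u i (a' i).
  by rewrite exprD mulrA ha rmorphM /= rmorphXn mulrC.
have hij i j : d j ^+ L * a' i = d i ^+ L * a' j.
  apply/eqP; rewrite -subr_eq0 -(hM i j); apply/eqP.
  rewrite /a' /L !exprD exprMn.
  by move: (d i ^+ N) (d i ^+ M) (d j ^+ N) (d j ^+ M) (a i) (a j) => *; ring.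
have [[m [f [dd [hdd f1]]]]|[K [x [hK hx]]]] :=
    point_or_unit (fun b => exists i, b = d i ^+ L); last first.
  have [b [i ->] xb] : exists2 b, (exists i, b = d i) & x b != 0.
    by apply: unit_ideal_point; exists n, e, d; split=> // i; exists i.
  by have /eqP := hx _ (ex_intro _ i erefl); rewrite rmorphXn (negbTE (field_expf _ hK xb)).
have [s hs] := choose_fin hdd.
pose r := \sum_i f i * a' (s i).
have hr j : d j ^+ L * r = a' j.
  rewrite mulr_sumr -[RHS]mul1r -f1 mulr_suml; apply: eq_bigr => i _.
  by rewrite mulrCA hij hs mulrA.
have hur i : u i r = c i.
  have [[ui _ _] _] := hc i.
  have un : u i (d i) ^+ L \is a GRing.unit by rewrite unitrX.
  by apply: (mulIr un); rewrite hL -hr rmorphM /= rmorphXn mulrC.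
exists r => C v c' hP; apply/eqP; rewrite -subr_eq0; apply/eqP.
apply: local_zero_loc => K y hK.
have [b [i ->] xb] : exists2 b, (exists i, b = d i) & (y \o v) b != 0.
  by apply: unit_ideal_point; exists n, e, d; split=> // i; exists i.
exists (v (d i)) => // C' v' hv'; have [v'u _ _] := hv'.
have [hi Pi] := hc i; have [w hw] := @loc_univ _ _ _ _ _ _ (v' \o v) hi v'u.
apply/eqP; rewrite rmorphB /= subr_eq0; apply/eqP.
have -> : v' (v r) = w (u i r) by rewrite -[RHS]/((w \o u i) r) hw.
rewrite hur; apply: (hfun _ (v' \o v)); first by apply: (hnat _ _ (u i)) Pi => t; rewrite hw.
exact: (hnat _ _ v).
Qed.

End Gluing.

(** * Noetherian rings and local rings of smooth algebras *)

Section Noetherian.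

Definition span (R : comNzRingType) (b : nat -> R) (N : nat) (p : R) : Prop :=
  exists c : 'I_N -> R, p = \sum_(i < N) c i * b i.

Lemma span_ideal (R : comNzRingType) (b : nat -> R) N : ideal (span b N).
Proof.
split=> [|_ _ [c ->] [d ->]|a _ [c ->]].
- by exists (fun=> 0); rewrite big1 // => i _; rewrite mul0r.
- exists (fun i => c i + d i); rewrite -big_split /=.
  by apply: eq_bigr => i _; rewrite mulrDl.
- exists (fun i => a * c i); rewrite mulr_sumr.
  by apply: eq_bigr => i _; rewrite mulrA.
Qed.

Lemma span_in (R : comNzRingType) (b : nat -> R) N i : (i < N)%N -> span b N (b i).
Proof.
move=> iN; exists (fun j => (j == Ordinal iN)%:R).
rewrite (bigD1 (Ordinal iN)) //= eqxx mul1r big1 ?addr0 // => j /negbTE ->.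
by rewrite mul0r.
Qed.

(* Equivalent to the ascending chain condition, by dependent choice. *)
Definition noeth (R : comNzRingType) : Prop :=
  forall b : nat -> R, exists N, span b N (b N).

Lemma noeth_surj (R Q : comNzRingType) (f : {rmorphism R -> Q}) :
  (forall x, exists r, f r = x) -> noeth R -> noeth Q.
Proof.
move=> fs hR b; pose s i := projT1 (cid (fs (b i))).
have sK i : f (s i) = b i by rewrite /s; case: cid.
have [N [c e]] := hR s; exists N, (f \o c).
rewrite -sK e rmorph_sum; apply: eq_bigr => i _ /=.
by rewrite rmorphM /= sK.
Qed.

Lemma dependent_seq (T : Type) (Q : seq T -> T -> Prop) :
  (forall s, exists x, Q s x) -> exists b : nat -> T, forall N, Q (mkseq b N) (b N).
Proof.
move=> h; pose G s := projT1 (cid (h s)).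
pose fs := fix fs N := if N is N'.+1 then rcons (fs N') (G (fs N')) else [::].
exists (fun N => G (fs N)) => N.
suff -> : mkseq (fun N => G (fs N)) N = fs N by apply: (projT2 (cid (h (fs N)))).
elim: N => // N IH; rewrite /mkseq -[N.+1]addn1 iotaD map_cat /= add0n cats1.
by rewrite -/(mkseq _ _) IH addn1.
Qed.

Lemma mkseq_span (R : comNzRingType) (b : nat -> R) N p :
  span b N p <-> gen_ideal (fun x => x \in mkseq b N) p.
Proof.
split=> [[c ->]|].
  apply: (ideal_sum (gen_idealP _)) => i _; apply: (idealM (gen_idealP _)).
  by apply: gen_ideal_in; apply: map_f; rewrite mem_iota /= add0n.
apply: gen_ideal_min; first exact: span_ideal.
by move=> d /mapP[i]; rewrite mem_iota /= add0n => iN ->; apply: span_in.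
Qed.

Lemma noeth_fg (R : comNzRingType) (I : R -> Prop) : noeth R -> ideal I ->
  exists m (r : nat -> R), (forall i, (i < m)%N -> I (r i)) /\ forall a, I a -> span r m a.
Proof.
move=> hR hI; apply: contrapT => nfg.
(* The guard on the members of [s] makes a choice possible for every [s]; it holds along the
   sequence that is constructed. *)
have [s|b hb] := @dependent_seq R (fun s x => I x /\
    ((forall y, y \in s -> I y) -> ~ gen_ideal (fun y => y \in s) x)).
  have [hs|ns] := pselect (forall y, y \in s -> I y); last first.
    by exists 0; split; [apply: (ideal0 hI)|move=> /ns].
  apply: contrapT => nx; apply: nfg; exists (size s), (nth 0 s).
  split=> [i ins|a Ia]; first by apply: hs; rewrite mem_nth.
  apply/mkseq_span; rewrite mkseq_nth; apply: contrapT => na.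
  by apply: nx; exists a.
have [N /mkseq_span hN] := hR b.
have [_ h] := hb N; apply: h hN.
by move=> y /mapP[i _ ->]; have [] := hb i.
Qed.

(** Hilbert's argument: each [f N] has least degree among the elements of the ideal outside the span
    of the previous ones. A relation between leading coefficients would produce such an element of
    smaller degree. *)
Lemma noeth_poly (R : comNzRingType) : noeth R -> noeth {poly R}.
Proof.
move=> hR b; apply: contrapT => /forallNP nb.
pose I := gen_ideal (fun p => exists i, p = b i).
have hI : ideal I by apply: gen_idealP.
have Ib p : I p -> exists M, span b M p.
  apply: (gen_ideal_min (I := fun p => exists M, span b M p)) => [|_ [i ->]]; last first.
    by exists i.+1; apply: span_in.
  have mono M M' x : (M <= M')%N -> span b M x -> span b M' x.
    move=> le [c ->]; apply: (ideal_sum (span_ideal b M')) => i _.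
    apply: (idealM (span_ideal b M')); apply: span_in.
    exact: leq_trans (ltn_ord i) le.
  split=> [|x y [M hx] [M' hy]|x y [M hy]].
  - by exists 0%N; apply: (ideal0 (span_ideal b 0)).
  - exists (maxn M M'); apply: (idealD (span_ideal b _)).
      by apply: mono hx; rewrite leq_maxl.
    by apply: mono hy; rewrite leq_maxr.
  - by exists M; apply: (idealM (span_ideal b M)).
have [s|f hf] := @dependent_seq {poly R} (fun s x => I x /\
    ((forall y, y \in s -> I y) -> ~ gen_ideal (fun y => y \in s) x /\
      forall y, I y -> ~ gen_ideal (fun y => y \in s) y -> (size x <= size y)%N)).
  have [hs|ns] := pselect (forall y, y \in s -> I y); last first.
    by exists 0; split; [apply: (ideal0 hI)|move=> /ns].
  pose P n := `[< exists x : {poly R}, [/\ size x = n, I x & ~ gen_ideal (fun y => y \in s) x] >].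
  have exP : exists n, P n.
    have [M hM] : exists M, forall y, y \in s -> span b M y.
      elim: s hs {P} => [|y s IH] hs; first by exists 0%N.
      have [|M hM] := IH; first by move=> z zs; apply: hs; rewrite inE zs orbT.
      have [M' hM'] : exists M, span b M y by apply: Ib; apply: hs; rewrite inE eqxx.
      have mono M1 M2 x : (M1 <= M2)%N -> span b M1 x -> span b M2 x.
        move=> le [c ->]; apply: (ideal_sum (span_ideal b M2)) => i _.
        apply: (idealM (span_ideal b M2)); apply: span_in.
        exact: leq_trans (ltn_ord i) le.
      exists (maxn M M') => z; rewrite inE => /predU1P[->|zs].
        by apply: mono hM'; rewrite leq_maxr.
      by apply: mono (hM _ zs); rewrite leq_maxl.
    exists (size (b M)); apply/asboolP; exists (b M); split=> //.
      by apply: gen_ideal_in; exists M.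
    by move=> h; apply: (nb M); apply: gen_ideal_min h; [apply: span_ideal|].
  case: (ex_minnP exP) => n /asboolP[x [sx Ix nx]] hmin.
  exists x; split=> // _; split=> // y Iy ny; rewrite sx; apply: hmin.
  by apply/asboolP; exists y.
have fI N : I (f N) by have [] := hf N.
have fN N : ~ span f N (f N).
  have [_ h] := hf N; have [|h1 _] := h; first by move=> y /mapP[i _ ->].
  by move=> /mkseq_span.
have fmin N y : I y -> ~ span f N y -> (size (f N) <= size y)%N.
  have [_ h] := hf N; have [|_ h1] := h; first by move=> z /mapP[i _ ->].
  by move=> Iy ny; apply: h1 => // /mkseq_span.
have mono M M' x : (M <= M')%N -> span f M x -> span f M' x.
  move=> le [c ->]; apply: (ideal_sum (span_ideal f M')) => i _.
  apply: (idealM (span_ideal f M')); apply: span_in.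
  exact: leq_trans (ltn_ord i) le.
have [N [c e]] := hR (fun i => lead_coef (f i)).
have sle (i : 'I_N) : (size (f i) <= size (f N))%N.
  apply: fmin => // h; apply: (fN N); apply: mono h; exact: ltnW.
have f0 i : (0 < size (f i))%N.
  rewrite size_poly_gt0; apply/eqP => h; apply: (fN i); rewrite h.
  exact: (ideal0 (span_ideal f i)).
pose g := \sum_(i < N) (c i *: 'X^(size (f N) - size (f i))) * f i.
have gs : span f N g by exists (fun i => c i *: 'X^(size (f N) - size (f i))).
have : (size (f N) <= size (f N - g)%R)%N.
  apply: fmin; last first.
    by move=> h; apply: (fN N); apply: (idealDr (span_ideal f N)) h; apply: (idealN (span_ideal f N)).
  apply: (idealB hI) => //; apply: (ideal_sum hI) => i _.
  by apply: (idealM hI).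
have sg : (size g <= size (f N))%N.
  apply: leq_trans (size_sum _ _ _) _; apply/bigmax_leqP => i _.
  rewrite -scalerAl; apply: leq_trans (size_scale_leq _ _) _.
  have fi0 : f i != 0 by rewrite -size_poly_gt0.
  by rewrite mulrC size_mulXn // subnK // sle.
have gl : g`_(size (f N)).-1 = lead_coef (f N).
  rewrite e coef_sum; apply: eq_bigr => i _.
  rewrite -scalerAl coefZ mulrC (mulrC 'X^_) coefMXn.
  have h : ((size (f N)).-1 < size (f N) - size (f i))%N = false.
    by move: (f0 i) (sle i) (f0 N); case: (size (f N)) => // a; case: (size (f i)) => // d *; lia.
  rewrite h lead_coefE mulrC; congr (_ * _); congr (_`_ _).
  by move: (f0 i) (sle i) (f0 N); case: (size (f N)) => // a; case: (size (f i)) => // d *; lia.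
rewrite leqNgt => /negP; apply.
have [n en] : exists n, size (f N) = n.+1 by exists (size (f N)).-1; rewrite prednK.
rewrite en ltnS; apply/leq_sizeP => j; rewrite leq_eqVlt => /predU1P[<-|lt].
  by rewrite coefB; move: gl; rewrite lead_coefE en /= => ->; rewrite subrr.
rewrite coefB !nth_default ?subrr // ?en //.
by apply: leq_trans sg _; rewrite en.
Qed.

Lemma noeth_field (F : fieldType) : noeth F.
Proof.
move=> b; have [b0|b0] := eqVneq (b 0%N) 0.
  by exists 0%N; rewrite b0; apply: (ideal0 (span_ideal b 0)).
by exists 1%N, (fun=> b 1%N / b 0%N); rewrite big_ord1 divfK.
Qed.

Lemma noeth_mpoly (R : comNzRingType) n : noeth R -> noeth {mpoly R[n]}.
Proof.
move=> hR; elim: n => [|n IH].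
  apply: (noeth_surj (f := [the {rmorphism R -> {mpoly R[0]}} of @mpolyC 0 R])) hR => p.
  exists p@_0%MM; apply/mpolyP => m; rewrite mcoeffC.
  by have -> : m = 0%MM by [apply/mnmP; case]; rewrite eqxx mulr1.
have [ci [ciC ciX _]] := mmap_rmorph [the {rmorphism R -> _} of @mpolyC n.+1 R]
  (fun i : 'I_n => 'X_(lift ord_max i) : {mpoly R[n.+1]}).
have [g [gC gX]] := horner_rmorph ci ('X_ord_max : {mpoly R[n.+1]}).
apply: (noeth_surj (f := g)) (noeth_poly IH) => p /=.
elim/mpolyind: p => [|a m p _ _ [q hq]]; first by exists 0; rewrite rmorph0.
have [q' hq'] : exists q' : {poly {mpoly R[n]}}, g q' = a *: 'X_[m].
  have mono (i : 'I_n.+1) : exists q', g q' = 'X_i.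
    case: (unliftP ord_max i) => [j ->|->]; last by exists 'X.
    by exists ('X_j)%:P; rewrite gC ciX.
  have [s hs] := choose_fin mono.
  exists ((a%:MP)%:P * \prod_i s i ^+ m i); rewrite rmorphM rmorph_prod /=.
  rewrite gC ciC -mul_mpolyC mpolyXE_id; congr (_ * _).
  by apply: eq_bigr => i _; rewrite rmorphXn /= hs.
by exists (q' + q); rewrite rmorphD /= hq hq'.
Qed.

End Noetherian.

Section IdealPowers.
Variables (R : comNzRingType) (m : nat) (r : 'I_m -> R).

(* pw N is the N-th power of the ideal generated by r. *)
Fixpoint pw (N : nat) (b : R) : Prop :=
  if N is N'.+1 then exists a : 'I_m -> R, (forall i, pw N' (a i)) /\ b = \sum_i a i * r i
  else True.

Lemma pwS N b :
  pw N.+1 b <-> exists a : 'I_m -> R, (forall i, pw N (a i)) /\ b = \sum_i a i * r i.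
Proof. by []. Qed.

Lemma pw_ideal N : ideal (pw N).
Proof.
elim: N => [|N IH]; first by split.
split=> [|_ _ /pwS[a [ha ->]] /pwS[b [hb ->]]|c _ /pwS[a [ha ->]]]; apply/pwS.
- exists (fun=> 0); split=> [i|]; first by apply: (ideal0 IH).
  by rewrite big1 // => i _; rewrite mul0r.
- exists (fun i => a i + b i); split=> [i|]; first by apply: (idealD IH).
  by rewrite -big_split; apply: eq_bigr => i _; rewrite mulrDl.
- exists (fun i => c * a i); split=> [i|]; first by apply: (idealM IH).
  by rewrite mulr_sumr; apply: eq_bigr => i _; rewrite mulrA.
Qed.

Lemma pw_leS N b : pw N.+1 b -> pw N b.
Proof.
by move=> /pwS[a [ha ->]]; apply: (ideal_sum (pw_ideal N)) => i _; apply: (idealMr (pw_ideal N)).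
Qed.

Lemma pw_le M N b : (M <= N)%N -> pw N b -> pw M b.
Proof.
move=> /subnK <-; elim: (N - M)%N => // d IH; rewrite addSn => /pw_leS; exact: IH.
Qed.

Lemma pwM M N a b : pw M a -> pw N b -> pw (M + N) (a * b).
Proof.
elim: M a => [|M IH] a; first by move=> _ hb; apply: (idealM (pw_ideal N)).
move=> /pwS[c [hc ->]] hb; apply/pwS; exists (fun i => c i * b); split=> [i|]; first exact: IH.
by rewrite mulr_suml; apply: eq_bigr => i _; rewrite mulrAC.
Qed.

Lemma pw_gen i : pw 1 (r i).
Proof.
exists (fun j => (j == i)%:R); split=> //.
rewrite (bigD1 i) //= eqxx mul1r big1 ?addr0 // => j /negbTE ->.
by rewrite mul0r.
Qed.

End IdealPowers.

Lemma mmap_closed (R Q : comNzRingType) n (f : {rmorphism R -> Q}) (y : 'I_n -> Q)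
    (S : Q -> Prop) :
    (forall a b, S a -> S b -> S (a + b)) -> (forall a b, S a -> S b -> S (a * b)) ->
    (forall c, S (f c)) -> (forall i, S (y i)) -> forall p, S (mmap f y p).
Proof.
move=> hD hM hC hy p; have [g [gC gX gE]] := mmap_rmorph f y; rewrite -gE.
have h1 : S 1 by have := hC 1; rewrite rmorph1.
elim/mpolyind: p => [|a m p _ _ ih]; first by have := hC 0; rewrite !rmorph0.
rewrite rmorphD; apply: (hD) => //; rewrite -mul_mpolyC rmorphM gC; apply: (hM) => //.
rewrite mpolyXE_id rmorph_prod; apply: (big_ind S) => [|x z|i _]; [exact: h1|exact: hM|rewrite rmorphXn gX].
by elim: (m i) => [|d IH]; rewrite ?expr0 // exprS; apply: hM.
Qed.

Lemma mmap_uniq (R Q : comNzRingType) n (g g' : {rmorphism {mpoly R[n]} -> Q}) :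
  (forall c, g c%:MP = g' c%:MP) -> (forall i, g 'X_i = g' 'X_i) -> g =1 g'.
Proof.
move=> hC hX p; elim/mpolyind: p => [|a m p _ _ ih]; first by rewrite !rmorph0.
rewrite !rmorphD ih; congr (_ + _); rewrite -mul_mpolyC !rmorphM hC; congr (_ * _).
rewrite mpolyXE_id !rmorph_prod; apply: eq_bigr => i _.
by rewrite !rmorphXn hX.
Qed.

Section ArtinRees.
Variables (R : comNzRingType) (m : nat) (r : 'I_m -> R).
Hypothesis hR : noeth R.

(* The powers r^a T^|a| generate the Rees algebra, a quotient of R[y_1..y_m]. *)
Lemma artin_rees (b : nat -> R) : (forall N, pw r N (b N)) ->
  exists N (q : 'I_N -> R), (forall i, pw r 1 (q i)) /\ b N = \sum_(i < N) q i * b i.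
Proof.
move=> hb.
have [E [EC EX EE]] := mmap_rmorph [the {rmorphism R -> {poly R}} of polyC]
  (fun i => (r i)%:P * 'X).
have lift N c : pw r N c -> exists B : {mpoly R[m]}, E B = c%:P * 'X^N.
  elim: N c => [|N IH] c; first by exists c%:MP; rewrite EC expr0 mulr1.
  move=> /pwS[a [ha ->]]; have [B hB] := choose_fin (fun i => IH _ (ha i)).
  exists (\sum_i B i * 'X_i); rewrite !rmorph_sum mulr_suml /=.
  apply: eq_bigr => i _; rewrite rmorphM /= hB EX rmorphM exprSr mulrACA.
  by [].
have deg1 p : forall j, pw r 1 (E p)`_j.+1.
  rewrite EE; move: p; apply: (mmap_closed (S := fun x : {poly R} => forall j, pw r 1 x`_j.+1)) => [p q hp hq j|p q hp hq j|c j|i j].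
  - by rewrite coefD; apply: (idealD (pw_ideal r 1)).
  - rewrite coefM; apply: (ideal_sum (pw_ideal r 1)) => i _.
    case: i => [[|i] hi] /=; first by rewrite subn0; apply: (idealM (pw_ideal r 1)).
    by apply: (idealMr (pw_ideal r 1)).
  - by rewrite /= coefC; apply: (ideal0 (pw_ideal r 1)).
  - rewrite coefMX coefC /=; case: eqP => _; last by apply: (ideal0 (pw_ideal r 1)).
    exact: pw_gen.
have [B hB] : exists B : nat -> {mpoly R[m]}, forall N, E (B N) = (b N)%:P * 'X^N.
  by exists (fun N => projT1 (cid (lift _ _ (hb N)))) => N; case: cid.
have [N [c e]] := noeth_mpoly (n := m) hR B.
(* In the coefficient of T^N only the part of degree N - i of [c i] meets [b i], and since N - i > 0
   that part lies in the ideal. *)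
exists N, (fun i : 'I_N => (E (c i))`_(N - i)); split=> [i|].
  by have := ltn_ord i; rewrite -subn_gt0; case: (N - i)%N => // d _; apply: deg1.
have := congr1 (fun p : {poly R} => p`_N) (congr1 E e).
rewrite hB coefMXn ltnn subnn coefC eqxx => ->.
rewrite rmorph_sum coef_sum; apply: eq_bigr => i _.
rewrite rmorphM /= hB mulrA coefMXn ltnNge (ltnW (ltn_ord i)) /=.
by rewrite coefMC.
Qed.

End ArtinRees.

Section Order.
Variables (L : idomainType) (n : nat) (xi : 'I_n -> L).
Let P : comNzRingType := {mpoly L[n]}.
Let r (i : 'I_n) : P := 'X_i - (xi i)%:MP.

(* Taylor expansion at xi: 'X_i is sent to xi_i + T 'X_i. *)
Lemma taylor : exists W : {rmorphism {mpoly L[n]} -> {poly {mpoly L[n]}}},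
  [/\ forall p, (W p)`_0 = (p.@[xi])%:MP &
  forall N p, (forall j, (j < N)%N -> (W p)`_j = 0) -> pw r N p].
Proof.
have [W [WC WX WE]] := mmap_rmorph
  ([the {rmorphism P -> {poly P}} of polyC] \o [the {rmorphism L -> P} of @mpolyC n L])
  (fun i => (xi i)%:MP%:P + ('X_i)%:P * 'X).
have [ev [evC evX _]] := mmap_rmorph [the {rmorphism L -> P} of @mpolyC n L] r.
exists W; split=> [p|N p h].
  have [e0 [e0C e0X]] := horner_rmorph [the {rmorphism P -> P} of idfun] (0 : P).
  have h0 q : e0 q = q`_0.
    elim/poly_ind: q => [|q c IH]; first by rewrite rmorph0 coef0.
    by rewrite rmorphD rmorphM e0X mulr0 add0r e0C coefD coefMX coefC add0r.
  pose g2 : {rmorphism P -> P} := [the {rmorphism L -> P} of @mpolyC n L] \o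
    [the {rmorphism P -> L} of meval xi].
  rewrite -h0 -[RHS]/(g2 p); apply: (mmap_uniq (g := e0 \o W)) => [c|i] /=.
    by rewrite WC /= e0C mevalC.
  by rewrite WX rmorphD rmorphM /= e0X mulr0 addr0 e0C mevalXU.
have hom : forall q j, pw r j (ev (W q)`_j).
  move=> q; rewrite WE; move: q; apply: (mmap_closed (S := fun x : {poly P} => forall j, pw r j (ev x`_j))) => [p1 p2 h1 h2 j|p1 p2 h1 h2 j|c j|i j].
  - by rewrite coefD rmorphD; apply: (idealD (pw_ideal r j)).
  - rewrite coefM rmorph_sum; apply: (ideal_sum (pw_ideal r j)) => i _.
    by rewrite rmorphM /= -{1}(subnKC (ltn_ord i : (i <= j)%N)); apply: pwM.
  - rewrite /= coefC; case: j => [|j] //=; rewrite rmorph0; by apply: (ideal0 (pw_ideal r j.+1)).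
  - rewrite coefD !coefC coefMX coefC; case: j => [|[|j]] //=; rewrite add0r.
      by rewrite evX; apply: (pw_gen r i).
    by rewrite rmorph0; apply: (ideal0 (pw_ideal r j.+2)).
(* Setting T = 1 and replacing ['X_i] by ['X_i - xi_i] recovers p from its expansion; the
   coefficient of T^j then lands in the j-th power of the ideal of the point. *)
have [S [SC SX]] := horner_rmorph ev (1 : P).
have SE q : S q = \sum_(j < size q) ev q`_j.
  rewrite -{1}(coefK q) poly_def rmorph_sum /=; apply: eq_bigr => j _.
  by rewrite -mul_polyC rmorphM rmorphXn /= SX expr1n mulr1 SC.
have SW q : S (W q) = q.
  apply: (mmap_uniq (g := S \o W) (g' := [the {rmorphism P -> P} of idfun])) => [c|i] /=.
    by rewrite WC /= SC evC.
  by rewrite WX rmorphD rmorphM /= SX mulr1 !SC evC evX /r addrCA subrr addr0.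
rewrite -(SW p) SE; apply: (ideal_sum (pw_ideal r N)) => j _.
have [jN|Nj] := ltnP j N; first by rewrite h // rmorph0; apply: (ideal0 (pw_ideal r N)).
by apply: pw_le (hom p j).
Qed.

End Order.

Lemma coef_mul_zero (R : idomainType) (p q : {poly R}) M :
  (forall j, (j < M.*2)%N -> (p * q)`_j = 0) ->
  (forall j, (j < M)%N -> p`_j = 0) \/ (forall j, (j < M)%N -> q`_j = 0).
Proof.
move=> h; apply: contrapT => /not_orP[/existsNP[a /not_implyP[aM /eqP pa]] /existsNP[b /not_implyP[bM /eqP qb]]].
have exa : exists i, p`_i != 0 by exists a.
have exb : exists i, q`_i != 0 by exists b.
case: (ex_minnP exa) => i pi mi; case: (ex_minnP exb) => j qj mj.
have := h (i + j)%N; rewrite coefM.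
have iN : (i < (i + j).+1)%N by rewrite ltnS leq_addr.
rewrite (bigD1 (Ordinal iN)) //= addKn big1 ?addr0 => [e|l nl].
  have /eqP : p`_i * q`_j = 0.
    apply: e; rewrite -addnn; apply: leq_ltn_trans (leq_add (mi _ pa) (mj _ qb)) _.
    by rewrite -addSn leq_add // ltnW.
  by rewrite mulf_eq0 (negbTE pi) (negbTE qj).
have [li|il|li] := ltngtP l i.
- have -> : p`_l = 0 by apply: contraTeq li => /mi; rewrite -leqNgt.
  by rewrite mul0r.
- have -> : q`_(i + j - l) = 0.
    have : (i + j - l < j)%N by have := ltn_ord l; lia.
    by apply: contraTeq => /mj; rewrite -leqNgt.
  by rewrite mulr0.
- by case/eqP: nl; apply: val_inj.
Qed.

Section LinearBasis.
Variables (A Q : comNzRingType) (d : {rmorphism A -> Q}).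
Hypothesis dom : forall a e, d a != 0 -> d e != 0 -> d (a * e) != 0.

(** A maximal family independent over the image of [d], with 1 put first, and [a] a common
    denominator. It serves to split a relation with coefficients in Q into relations with
    coefficients in A, one for each member of the family. *)
Lemma lin_basis s (v : nat -> Q) : exists r (b : nat -> Q) (a : A),
  [/\ d a != 0, b 0%N = 1,
      forall c : nat -> A, \sum_(l < r.+1) d (c l) * b l = 0 ->
        forall l, (l < r.+1)%N -> d (c l) = 0
    & forall i, (i < s)%N -> exists c : nat -> A, d a * v i = \sum_(l < r.+1) d (c l) * b l].
Proof.
elim: s => [|s [r [b [a [a0 b0 hi hv]]]]].
  exists 0%N, (fun=> 1), 1; split=> //; first by rewrite rmorph1 oner_neq0.
  by move=> c; rewrite big_ord1 mulr1 => h [].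
have [[e [c [e0 he]]]|ne] := pselect (exists e (c : nat -> A),
    d e != 0 /\ d e * v s + \sum_(l < r.+1) d (c l) * b l = 0).
  exists r, b, (a * e); split=> // [|i]; first exact: dom.
  rewrite ltnS leq_eqVlt => /predU1P[->|/hv[c' hc']].
    exists (fun l => - (a * c l)); rewrite rmorphM -mulrA.
    move/eqP: he; rewrite addr_eq0 => /eqP ->; rewrite mulrN mulr_sumr -sumrN.
    by apply: eq_bigr => l _; rewrite rmorphN rmorphM mulNr mulrA.
  exists (fun l => e * c' l); rewrite rmorphM mulrAC hc' mulr_suml.
  by apply: eq_bigr => l _; rewrite rmorphM mulrAC (mulrC (d (c' l))).
pose b' l := if l == r.+1 then v s else b l.
have bb (l : 'I_r.+1) : b' l = b l by rewrite /b' (ltn_eqF (ltn_ord l)).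
exists r.+1, b', a; split=> // [c|i].
  rewrite big_ord_recr /= {2}/b' eqxx; under eq_bigr do rewrite bb.
  move=> h; have cr : d (c r.+1) = 0.
    apply/eqP; apply: contrapT => /negP h'; apply: ne; exists (c r.+1), c.
    by rewrite addrC.
  move: h; rewrite cr mul0r addr0 => /hi h l.
  by rewrite ltnS leq_eqVlt => /predU1P[->|/h].
rewrite ltnS leq_eqVlt => /predU1P[->|/hv[c hc]].
  exists (fun l => if l == r.+1 then a else 0).
  rewrite big_ord_recr /= {2}/b' !eqxx big1 ?add0r // => l _.
  by rewrite (ltn_eqF (ltn_ord l)) rmorph0 mul0r.
exists (fun l => if l == r.+1 then 0 else c l).
rewrite big_ord_recr /= eqxx rmorph0 mul0r addr0 hc; apply: eq_bigr => l _.
by rewrite bb (ltn_eqF (ltn_ord l)).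
Qed.

Lemma mpoly_basis n (ps : seq {mpoly Q[n]}) : exists r (b : nat -> Q) (a : A),
  [/\ d a != 0, b 0%N = 1,
      forall q : nat -> {mpoly A[n]},
        \sum_(l < r.+1) (b l)%:MP * map_mpoly d (q l) = 0 ->
        forall l, (l < r.+1)%N -> map_mpoly d (q l) = 0
    & forall p, p \in ps -> exists q : nat -> {mpoly A[n]},
        (d a)%:MP * p = \sum_(l < r.+1) (b l)%:MP * map_mpoly d (q l)].
Proof.
pose cs := flatten [seq [seq p@_m | m <- msupp p] | p <- ps].
have [r [b [a [a0 b0 hi hv]]]] := lin_basis (size cs) (nth 0 cs).
exists r, b, a; split=> // [q|p pps].
  move=> h l lr; apply/mpolyP => m; rewrite mcoeff0 mcoeff_map_mpoly.
  apply: (hi (fun l => (q l)@_m)) lr; have := congr1 (mcoeff m) h.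
  rewrite mcoeff0 raddf_sum /= => e; rewrite -[RHS]e; apply: eq_bigr => i _.
  by rewrite mcoeffCM mcoeff_map_mpoly mulrC.
have hc m : exists c : nat -> A, d a * p@_m = \sum_(l < r.+1) d (c l) * b l.
  have [mp|nmp] := boolP (m \in msupp p); last first.
    exists (fun=> 0); rewrite memN_msupp_eq0 // mulr0 big1 // => l _.
    by rewrite rmorph0 mul0r.
  have : p@_m \in cs by apply/flatten_mapP; exists p => //; apply: map_f.
  by move=> /(nthP 0)[i ics <-]; apply: hv.
pose c m := projT1 (cid (hc m)).
have cP m : d a * p@_m = \sum_(l < r.+1) d (c m l) * b l by rewrite /c; case: cid.
exists (fun l => \sum_(m <- msupp p) c m l *: 'X_[m]).
apply/mpolyP => m; rewrite mcoeffCM cP raddf_sum /=.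
have [mp|nmp] := boolP (m \in msupp p).
  apply: eq_bigr => l _; rewrite mcoeffCM mcoeff_map_mpoly mulrC; congr (_ * d _).
  rewrite raddf_sum /= (bigD1_seq m) //= mcoeffZ mcoeffX eqxx mulr1 big1 ?addr0 //.
  by move=> m' /negbTE nm; rewrite mcoeffZ mcoeffX nm mulr0.
rewrite -cP memN_msupp_eq0 // mulr0 big1 // => l _.
rewrite mcoeffCM mcoeff_map_mpoly raddf_sum /= big1_seq ?rmorph0 ?mulr0 // => m' /andP[_ m'p].
by rewrite mcoeffZ mcoeffX; case: eqP nmp => [<-|_ _]; rewrite ?m'p ?mulr0.
Qed.

End LinearBasis.

Section SmoothAlgebras.
Variable k : fieldType.
Notation alg := (comUnitAlgType k).
Implicit Types A B C K : alg.

Definition prod_ideal (R : comNzRingType) (J : R -> Prop) : R -> Prop :=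
  gen_ideal (fun x => exists a b, [/\ J a, J b & x = a * b]).

(* phi lifts the identity of B = P / J through P / J^2 -> B. *)
Lemma smooth_section A B (h : {lrmorphism A -> B}) n (y : 'I_n -> B)
    (P := {mpoly A[n]}) (J := fun p : P => mmap h y p = 0) :
    formally_smooth h -> (forall b, exists p : P, mmap h y p = b) ->
  exists phi : {rmorphism P -> P}, [/\ forall a, phi a%:MP = a%:MP,
     forall p, mmap h y (phi p) = mmap h y p & forall p, J p -> prod_ideal J (phi p)].
Proof.
move=> sm hs.
have [pi [piC piX piE]] := mmap_rmorph h y.
have JE p : J p <-> pi p = 0 by rewrite piE.
have hI : ideal (prod_ideal J) by apply: gen_idealP.
have J2J p : prod_ideal J p -> J p.
  rewrite JE; apply: (gen_ideal_min (I := fun p => pi p = 0)) => [|_ [a [b [/JE ha _ ->]]]].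
    split=> [|a b ha hb|a b hb]; rewrite ?rmorph0 ?rmorphD ?rmorphM ?ha ?hb ?mulr0 ?addr0 //.
  by rewrite rmorphM ha mul0r.
have hI1 : ~ prod_ideal J 1 by move=> /J2J/JE/eqP; rewrite rmorph1 oner_eq0.
pose j : {rmorphism k -> P} := [the {rmorphism A -> P} of @mpolyC n A] \o in_algm A.
have [C [f [fj fs fk]]] := @quotient_alg k P j (prod_ideal J) hI hI1.
have [p pE] := factor_surj (g := pi) fs (fun r hr => proj1 (JE r) (J2J _ (proj1 (fk r) hr))) fj
  (fun a => etrans (piC _) (rmorph_alg h a)).
have [u uE] := lrmorph_of (f := f \o [the {rmorphism A -> P} of @mpolyC n A]) fj.
have [||w [wh pw]] := sm C B p _ u [the {lrmorphism B -> B} of idfun].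
- split=> [b|a a' ha ha'].
    by have [q <-] := hs b; exists (f q); rewrite pE piE.
  have [[r er] [r' er']] := (fs a, fs a'); rewrite -er -er' -rmorphM.
  apply/fk; apply: gen_ideal_in; exists r, r'; split=> //; apply/JE; rewrite -pE ?er ?er' //.
- by move=> a /=; rewrite uE /= pE piC.
have [g hg] := choose_fin (fun i => fs (w (y i))).
have [phi [phiC phiX _]] := mmap_rmorph [the {rmorphism A -> P} of @mpolyC n A] g.
have key q : f (phi q) = w (pi q).
  apply: (mmap_uniq (g := f \o phi) (g' := w \o pi)) => [c|i] /=.
    by rewrite phiC piC -[RHS]/((w \o h) c) wh uE.
  by rewrite phiX piX hg.
exists phi; split=> // [q|q /JE hq].
  by rewrite -!piE -pE key -[LHS]/((p \o w) (pi q)) pw.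
by apply/fk; rewrite key hq rmorph0.
Qed.

Definition fingen B : Prop := exists n (y : 'I_n -> B),
  forall b, exists p : {mpoly k^o[n]}, mmap (in_alg B) y p = b.

Definition fsmooth B : Prop := forall C C0 (p : {lrmorphism C -> C0}), sqzero_ext p ->
  forall v : {lrmorphism B -> C0}, exists w : {lrmorphism B -> C}, p \o w =1 v.

Lemma noeth_fingen B : fingen B -> noeth B.
Proof.
move=> [n [y hy]].
have [g [_ _ gE]] := mmap_rmorph (in_algm B) y.
apply: (noeth_surj (f := g)) => [b|]; last exact: (noeth_mpoly (@noeth_field k)).
by have [p <-] := hy b; exists p; rewrite gE.
Qed.

Section FieldAsDomain.
Variables (K : alg) (hK : is_field K).
Definition fieldof : Type := (fun _ : is_field K => (K : Type)) hK.
HB.instance Definition _ := GRing.ComUnitRing.on fieldof.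
Fact fieldof_axiom : GRing.field_axiom fieldof.
Proof. exact: hK. Qed.
HB.instance Definition _ := GRing.ComUnitRing_isField.Build fieldof fieldof_axiom.
End FieldAsDomain.

Lemma field_dom K : is_field K -> exists (L : fieldType) (f : {rmorphism K -> L}),
  injective f.
Proof.
move=> hK; exists (fieldof hK : fieldType), [the {rmorphism K -> fieldof hK} of idfun].
by [].
Qed.

(* f vanishes in the local ring at the point y. *)
Definition germ0 B K (y : {lrmorphism B -> K}) (f : B) : Prop :=
  exists2 s, y s != 0 & s * f = 0.

(** Write B = P / J with P a polynomial ring, and let [phi] lift the identity of B with phi(J)
    inside J^2. If f g = 0, the iterates of [phi] send a product of representatives into higher and
    higher powers of J, hence to high order at the point; polynomials over a field have no zero
    divisors, so one of f, g has representatives of arbitrarily high order. Krull's intersection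
    theorem kills its germ. No completion and no dimension theory are used. *)
Lemma smooth_local_domain B K (y : {lrmorphism B -> K}) f g :
  fingen B -> fsmooth B -> is_field K -> f * g = 0 -> germ0 y f \/ germ0 y g.
Proof.
move=> [n [z hz]] sm hK fg.
have [in_lr in_lrE] := lrmorph_of (f := [the {rmorphism k^o -> B} of in_algm B]) (fun a => congr1 (in_alg B) (mulr1 a)).
have smA : formally_smooth in_lr.
  move=> C C0 p hp u v e; have [w hw] := sm _ _ p hp v; exists w; split=> // a /=.
  by rewrite -[a]mulr1 -[a * 1]/(a *: (1 : k^o)) !linearZ /= !rmorph1.
pose P := {mpoly k^o[n]}.
have hz' b : exists p : P, mmap in_lr z p = b.
  have [p <-] := hz b; exists p; rewrite /mmap; apply: eq_bigr => m _.
  by rewrite in_lrE.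
have [phi [phiC phi_id phiJ]] := smooth_section smA hz'.
have [pi [piC piX piE]] := mmap_rmorph in_lr z.
have [L [i injL]] := field_dom hK.
pose iy : {rmorphism B -> L} := i \o y.
pose d : {rmorphism k^o -> L} := iy \o in_lr.
pose xi j := iy (z j).
have [W [W0 Wpw]] := taylor xi.
pose mp : {rmorphism P -> {mpoly L[n]}} := [the {rmorphism _ -> _} of map_mpoly d].
pose r (j : 'I_n) : {mpoly L[n]} := 'X_j - (xi j)%:MP.
have evE p : (mp p).@[xi] = iy (pi p).
  apply: (mmap_uniq (g := [the {rmorphism {mpoly L[n]} -> L} of meval xi] \o mp) (g' := iy \o pi)) => [c|j] /=.
    by rewrite map_mpolyC mevalC piC.
  by rewrite map_mpolyX mevalXU piX.
pose ord M p := forall j, (j < M)%N -> (W (mp p))`_j = 0.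
pose J p := pi p = 0.
have phiJ' p : J p -> prod_ideal J (phi p).
  rewrite /J piE => /phiJ; apply: gen_ideal_min; first exact: gen_idealP.
  by move=> _ [a [b [ha hb ->]]]; apply: gen_ideal_in; exists a, b; rewrite /J !piE.
have ordD M p q : ord M p -> ord M q -> ord M (p + q).
  by move=> hp hq j jM; rewrite !rmorphD coefD hp ?hq ?addr0.
have ordM M N p q : ord M p -> ord N q -> ord (M + N)%N (p * q).
  move=> hp hq j jM; rewrite !rmorphM coefM big1 // => l _.
  have [lM|Ml] := ltnP l M; first by rewrite hp ?mul0r.
  by rewrite hq ?mulr0 //; have := ltn_ord l; lia.
have ord_id M : ideal (ord M).
  split=> [j _|a b|a b hb]; rewrite ?rmorph0 ?coef0 //; first exact: ordD.
  by rewrite -[M]add0n; apply: ordM.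
(* As [phi] maps J into J^2, each iteration doubles the order at the point. *)
have ordJ N p : J p -> ord (2 ^ N)%N (iter N phi p).
  elim: N p => [|N IH] p Jp.
    by case=> [|//] _; rewrite W0 evE Jp rmorph0 mpolyC0.
  rewrite iterSr; pose S p := ord (2 ^ N.+1)%N (iter N phi p).
  have itD q q' : iter N phi (q + q') = iter N phi q + iter N phi q'.
    by elim: N {IH S} => //= N ->; rewrite rmorphD.
  have itM q q' : iter N phi (q * q') = iter N phi q * iter N phi q'.
    by elim: N {IH S itD} => //= N ->; rewrite rmorphM.
  have it0 : iter N phi 0 = 0 by elim: N {IH S itD itM} => //= N ->; rewrite rmorph0.
  apply: (gen_ideal_min (I := S)) (phiJ' _ Jp) => [|_ [a [b [ha hb ->]]]].
    split=> [|a b|a b]; rewrite /S ?it0 ?itD ?itM; first exact: (ideal0 (ord_id _)).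
      exact: ordD.
    exact: (idealM (ord_id _)).
  by rewrite /S itM expnS mul2n -addnn; apply: ordM; apply: IH.
have phi_it N p : pi (iter N phi p) = pi p.
  by elim: N => //= N IH; rewrite piE phi_id -piE.
have itM N q q' : iter N phi (q * q') = iter N phi q * iter N phi q'.
  by elim: N => //= N ->; rewrite rmorphM.
have [[F hF] [G hG]] := (hz' f, hz' g); rewrite -piE in hF; rewrite -piE in hG.
have alt N : ord (2 ^ N)%N (iter N.+1 phi F) \/ ord (2 ^ N)%N (iter N.+1 phi G).
  apply: coef_mul_zero => j jN; rewrite -!rmorphM -itM.
  have JFG : J (F * G) by rewrite /J rmorphM hF hG.
  by apply: (ordJ N.+1 _ JFG); rewrite expnS mul2n.
have ord_le M N p : (M <= N)%N -> ord N p -> ord M p.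
  by move=> le hp j jM; apply: hp; apply: leq_trans le.
(* Krull's intersection theorem: Artin-Rees writes a representative of high order as a combination
   of the previous ones with coefficients vanishing at the point, so that [s = 1 - \sum c_i] sends
   [E] into the ideal generated by J over the field L. *)
have key E e : pi E = e -> (forall M, exists q, ord M q /\ pi q = pi E) -> germ0 y e.
  move=> hE hall.
  pose q M := projT1 (cid (hall M)).
  have qP M : ord M (q M) /\ pi (q M) = pi E by rewrite /q; case: cid.
  have [||N [c [hc ec]]] := @artin_rees {mpoly L[n]} n r _ (fun M => mp (q M)).
  - exact: (noeth_mpoly (@noeth_field L)).
  - by move=> N; apply: Wpw; have [] := qP N.
  pose s := 1 - \sum_(i < N) c i.
  have es : s * mp E = \sum_(i < N) c i * mp (q i - E) - mp (q N - E).
    have -> : \sum_(i < N) c i * mp (q i - E) = mp (q N) - (\sum_(i < N) c i) * mp E.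
      rewrite ec mulr_suml -sumrB; apply: eq_bigr => l _.
      by rewrite (rmorphB mp) mulrBr.
    by rewrite (rmorphB mp) /s; ring.
  have pwxi p : pw r 1 p -> p.@[xi] = 0.
    move=> /pwS[a [_ ->]]; rewrite raddf_sum /= big1 // => j _.
    by rewrite mevalM /r mevalB mevalXU mevalC subrr mulr0.
  have sxi : s.@[xi] = 1.
    have h0 : (\sum_(i < N) c i).@[xi] = 0.
      by rewrite raddf_sum /= big1 // => j _; apply: pwxi.
    by rewrite /s mevalB meval1 h0 subr0.
  have dom : forall a e, d a != 0 -> d e != 0 -> d (a * e) != 0.
    by move=> a e' ha he; rewrite rmorphM mulf_neq0.
  (* The polynomial [s] has coefficients in L and not in k. Expanding along elements independent
     over k, one of its components [S l] is defined over k, does not vanish at the point and sends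
     [E] into J. *)
  have [t [b [a [a0 b0 hi hp]]]] := mpoly_basis dom (s :: [seq c i | i <- enum 'I_N]).
  have [S hS] := hp s (mem_head _ _).
  have hc' (i0 : 'I_N) : exists q : nat -> P, (d a)%:MP * c i0 = \sum_(l < t.+1) (b l)%:MP * map_mpoly d (q l).
    by apply: hp; rewrite inE map_f ?orbT // mem_enum.
  have [Q hQ] := choose_fin hc'.
  pose T l : P := S l * E - (\sum_(i0 < N) Q i0 l * (q i0 - E) - (if l == 0%N then a *: (q N - E) else 0)).
  have eT : \sum_(l < t.+1) (b l)%:MP * map_mpoly d (T l) = 0.
    have h1 : (d a)%:MP * (s * mp E) = \sum_(l < t.+1) (b l)%:MP * mp (S l * E).
      rewrite mulrA hS mulr_suml; apply: eq_bigr => l _.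
      by rewrite (rmorphM mp) mulrA.
    have h2 i0 : (d a)%:MP * (c i0 * mp (q i0 - E)) =
        \sum_(l < t.+1) (b l)%:MP * mp (Q i0 l * (q i0 - E)).
      rewrite mulrA hQ mulr_suml; apply: eq_bigr => l _.
      by rewrite (rmorphM mp) mulrA.
    have h3 : (d a)%:MP * mp (q N - E) =
        \sum_(l < t.+1) (b l)%:MP * mp (if l == 0%N :> nat then a *: (q N - E) else 0).
      rewrite big_ord_recl /= b0 mpolyC1 mul1r big1 ?addr0 => [|l _]; last first.
        by rewrite (rmorph0 mp) mulr0.
      by rewrite -mul_mpolyC (rmorphM mp) /= map_mpolyC.
    transitivity ((d a)%:MP * (s * mp E - (\sum_(i < N) c i * mp (q i - E) - mp (q N - E)))); last first.
      by rewrite es subrr mulr0.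
    have h4 : (d a)%:MP * (\sum_(i < N) c i * mp (q i - E)) =
        \sum_(l < t.+1) (b l)%:MP * mp (\sum_(i < N) Q i l * (q i - E)).
      rewrite mulr_sumr (eq_bigr _ (fun i _ => h2 i)) exchange_big /=.
      by apply: eq_bigr => l _; rewrite (rmorph_sum mp) mulr_sumr.
    rewrite 2!mulrBr h1 h3 h4 -!sumrB; apply: eq_bigr => l _.
    by rewrite -[map_mpoly d (T l)]/(mp (T l)) /T (rmorphB mp) (rmorphB mp) !mulrBr.
  have Tz l : (l < t.+1)%N -> T l = 0.
    move=> lt; have := hi _ eT l lt => e0; apply/mpolyP => m.
    have := congr1 (mcoeff m) e0; rewrite mcoeff_map_mpoly !mcoeff0 => /eqP.
    by rewrite fmorph_eq0 => /eqP.
  have [l sl] : exists l : 'I_t.+1, iy (pi (S l)) != 0.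
    apply: contrapT => /forallNP h; move: a0; have := congr1 (meval xi) hS.
    rewrite mevalM mevalC sxi mulr1 raddf_sum /= => ->; rewrite big1 ?eqxx // => l _.
    rewrite mevalM -[map_mpoly d _]/(mp _) evE; move: (h l) => /negP; rewrite negbK => /eqP ->.
    by rewrite mulr0.
  exists (pi (S l)).
    by apply: contra_neq sl => e0; rewrite /iy /= e0 rmorph0.
  rewrite -hE -rmorphM; have /eqP := Tz l (ltn_ord l); rewrite subr_eq0 => /eqP ->.
  rewrite rmorphB rmorph_sum big1 ?sub0r => [|i0 _]; last first.
    by rewrite rmorphM rmorphB; have [_ ->] := qP i0; rewrite subrr mulr0.
  case: eqP => _; last by rewrite rmorph0 oppr0.
  by rewrite -mul_mpolyC rmorphM rmorphB; have [_ ->] := qP N; rewrite subrr mulr0 oppr0.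
have [hl|/existsNP[N0 nF]] := pselect (forall M, exists N, (M <= N)%N /\ ord (2 ^ N)%N (iter N.+1 phi F)).
  left; apply: key hF _ => M; have [N [MN oN]] := hl M.
  exists (iter N.+1 phi F); split; last exact: phi_it.
  by apply: ord_le oN; apply: leq_trans MN (ltnW (ltn_expl _ _)).
right; apply: key hG _ => M; pose N := maxn M N0.
have [oF|oG] := alt N.
  by case: nF; exists N; split=> //; rewrite leq_maxr.
exists (iter N.+1 phi G); split; last exact: phi_it.
by apply: ord_le oG; apply: leq_trans (leq_maxl M N0) (ltnW (ltn_expl _ _)).
Qed.

End SmoothAlgebras.

Section SmoothConsequences.
Variable k : fieldType.
Notation alg := (comUnitAlgType k).
Implicit Types A B C K : alg.

(** The annihilator of c is finitely generated. If c has a nonzero germ at y, each generator has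
    zero germ there, the local ring being a domain; on the open set where the finitely many elements
    killing the generators are invertible the annihilator is zero. *)
Lemma smooth_germ_open B K (y : {lrmorphism B -> K}) c :
    fingen B -> fsmooth B -> is_field K -> ~ germ0 y c ->
  exists2 d, y d != 0 & forall K' (y' : {lrmorphism B -> K'}),
    is_field K' -> y' d != 0 -> ~ germ0 y' c.
Proof.
move=> fg sm hK nc.
have hI : ideal (fun a => a * c = 0).
  by split=> [|a b ha hb|a b hb]; rewrite ?mul0r // ?mulrDl ?ha ?hb ?addr0 // -mulrA hb mulr0.
have [m [r [hr hs]]] := noeth_fg (noeth_fingen fg) hI.
have hloc (i : 'I_m) : exists s, y s != 0 /\ s * r i = 0.
  have [[s ys e]|//] := smooth_local_domain y fg sm hK (hr i (ltn_ord i)).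
  by exists s.
have [s hs'] := choose_fin hloc.
exists (\prod_i s i).
  rewrite rmorph_prod -unit_field //; apply: (big_ind (fun x => x \is a GRing.unit)) => [|a b|i _].
  - exact: unitr1.
  - by rewrite unitrM => -> ->.
  - by rewrite unit_field //; have [] := hs' i.
move=> K' y' hK' ys [t yt /hs[e te]].
have /(congr1 y') : (\prod_i s i) * t = 0.
  rewrite te mulr_sumr big1 // => i _; rewrite (bigD1 i) //=.
  have [_ e0] := hs' i; set X := \prod_(_ | _) _.
  by transitivity (s i * r i * (X * e i)); [ring|rewrite e0 mul0r].
rewrite rmorphM rmorph0 => /(field_mul hK')[/eqP|/eqP]; first by rewrite (negbTE ys).
by rewrite (negbTE yt).
Qed.

Lemma germ0_mul B K (y : {lrmorphism B -> K}) c d :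
  fingen B -> fsmooth B -> is_field K -> germ0 y (c * d) -> germ0 y c \/ germ0 y d.
Proof.
move=> fg sm hK [s ys e]; rewrite mulrA in e.
have [[t yt e']|] := smooth_local_domain y fg sm hK e; last by right.
left; exists (t * s); last by rewrite -mulrA.
by rewrite rmorphM -unit_field // unitrM !unit_field // yt.
Qed.

Lemma germ0_point B K (y : {lrmorphism B -> K}) c : is_field K -> germ0 y c -> y c = 0.
Proof.
move=> hK [s ys /(congr1 y)]; rewrite rmorphM rmorph0 => /(field_mul hK)[/eqP|//].
by rewrite (negbTE ys).
Qed.

Lemma germ0_zero B c :
  (forall K (y : {lrmorphism B -> K}), is_field K -> germ0 y c) -> c = 0.
Proof.
move=> h; apply: local_zero => K y hK; have [s ys e] := h K y hK.
by exists s.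
Qed.

Lemma smooth_reduced B (c : B) n : fingen B -> fsmooth B -> c ^+ n = 0 -> c = 0.
Proof.
move=> fg sm e; apply: germ0_zero => K y hK; elim: n e => [|n IH].
  by move/eqP; rewrite expr0 oner_eq0.
rewrite exprS => /(smooth_local_domain y fg sm hK)[//|[s ys e]].
have h : germ0 y (c ^+ n) by exists s.
elim: n h {IH e} => [[s' ys' e']|n IH].
  by move: ys'; rewrite -[s']mulr1 -(expr0 c) e' rmorph0 eqxx.
by rewrite exprS => /germ0_mul[||||/IH].
Qed.

Lemma smooth_nonzerodivisor B (u b : B) : fingen B -> fsmooth B ->
  (forall K (y : {lrmorphism B -> K}), is_field K -> ~ germ0 y u) -> u * b = 0 -> b = 0.
Proof.
move=> fg sm hu e; apply: germ0_zero => K y hK.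
by have [/(hu K y hK)|] := smooth_local_domain y fg sm hK e.
Qed.

(** Krull's intersection theorem without passing to the local ring: Artin-Rees is applied to the
    elements [s N * c], denominators included, which lie in the powers of (u). *)
Lemma germ0_krull B K (y : {lrmorphism B -> K}) (u c : B) : fingen B -> is_field K -> y u = 0 ->
  (forall N, exists2 s, y s != 0 & exists b, s * c = u ^+ N * b) -> germ0 y c.
Proof.
move=> fg hK yu h.
pose s N := s2val (cid2 (h N)).
have ys N : y (s N) != 0 by rewrite /s; case: cid2.
have hs N : exists b, s N * c = u ^+ N * b by rewrite /s; case: cid2.
pose r (i : 'I_1) := u.
have [N|N [q [hq e]]] := @artin_rees B 1 r (noeth_fingen fg) (fun N => s N * c).
  have [b ->] := hs N; elim: N b => // N IH b; apply/pwS.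
  exists (fun=> u ^+ N * b); split=> [i|]; first exact: IH.
  by rewrite big_ord1 /r exprSr mulrAC.
exists (s N - \sum_(i < N) q i * s i); last first.
  rewrite mulrBl e mulr_suml -sumrB big1 // => i _.
  by rewrite mulrA subrr.
have -> : y (s N - \sum_(i < N) q i * s i) = y (s N); last exact: ys.
rewrite rmorphB rmorph_sum big1 /= ?subr0 // => i _.
have /pwS[a [_ ->]] := hq i.
by rewrite big_ord1 !rmorphM /= yu mulr0 mul0r.
Qed.

End SmoothConsequences.

(** * Going down for smooth maps *)

Section GoingDown.
Variable k : fieldType.
Notation alg := (comUnitAlgType k).
Implicit Types A B C D K : alg.

(** A need not be noetherian: finitely many polynomials over A are lifted to a polynomial ring over
    k, where Artin-Rees applies. Each variable goes to a constant or to a variable, so an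
    endomorphism over A can be lifted as well. *)
Lemma finite_coefficients A n (L : seq {mpoly A[n]}) :
  exists s (rho : {rmorphism {mpoly k[s]} -> {mpoly A[n]}}),
    [/\ forall c, rho c%:MP = (c%:A)%:MP,
        forall p, p \in L -> exists p', rho p' = p,
        forall i, exists p', rho p' = 'X_i
      & forall g, (exists a, rho 'X_g = a%:MP) \/ exists i, rho 'X_g = 'X_i].
Proof.
pose cs := flatten [seq [seq p@_m | m <- msupp p] | p <- L].
have [rho [rC rX _]] := mmap_rmorph ([the {rmorphism A -> _} of @mpolyC n A] \o in_algm A)
  (fun g : 'I_(size cs + n) => match split g with inl i => (nth 0 cs i)%:MP | inr i => 'X_i end).
have rXi i : rho 'X_(rshift _ i) = 'X_i by rewrite rX (unsplitK (inr _ i)).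
exists (size cs + n)%N, rho; split=> // [p pL|i|g]; first last.
- by rewrite rX; case: split => i; [left; exists (nth 0 cs i)|right; exists i].
- by exists 'X_(rshift _ i).
have hc m : exists c', rho c' = (p@_m)%:MP.
  have [mp|nmp] := boolP (m \in msupp p); last first.
    by exists 0; rewrite memN_msupp_eq0 // rmorph0.
  have : p@_m \in cs by apply/flatten_mapP; exists p => //; apply: map_f.
  move=> /(nthP 0)[i ics <-]; exists 'X_(lshift _ (Ordinal ics)).
  by rewrite rX (unsplitK (inl _ (Ordinal ics))).
pose c m := projT1 (cid (hc m)); have cP m : rho (c m) = (p@_m)%:MP by rewrite /c; case: cid.
exists (\sum_(m <- msupp p) c m * \prod_i 'X_(rshift _ i) ^+ m i).
rewrite rmorph_sum [RHS]mpolyE; apply: eq_bigr => m _ /=.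
rewrite rmorphM /= cP -mul_mpolyC mpolyXE_id rmorph_prod; congr (_ * _).
by apply: eq_bigr => i _; rewrite rmorphXn /= rXi.
Qed.

(** Here C is the tensor product of B and D over A, and b is shown not to be nilpotent on it: a
    generization of the image of y lifts to B. In place of flatness the section [phi] is used: if a
    power of b were zero in C, its iterates under [phi] would lie in growing powers of the ideal of
    B, and Artin-Rees would force that power to vanish at y. *)
Lemma going_down A B D K (h : {lrmorphism A -> B}) (d : {lrmorphism A -> D})
    (y : {lrmorphism B -> K}) (b : B) :
    smooth_ring h -> (forall u v : D, u * v = 0 -> u = 0 \/ v = 0) -> is_field K ->
    (forall a, d a = 0 -> y (h a) = 0) -> y b != 0 ->
  exists C (i : {lrmorphism B -> C}) (j : {lrmorphism D -> C}),
    i \o h =1 j \o d /\ forall N, i b ^+ N != 0.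
Proof.
move=> [[n [z [m [r [hz hr]]]]] sm] domD hK hd yb.
pose P := {mpoly A[n]}; pose PD := {mpoly D[n]}.
have [pi [piC piX piE]] := mmap_rmorph h z.
pose mp : {rmorphism P -> PD} := [the {rmorphism _ -> _} of map_mpoly d].
have mpC a : mp a%:MP = (d a)%:MP by rewrite /= map_mpolyC.
have mpX i : mp 'X_i = 'X_i by rewrite /= map_mpolyX.
have [beta hbeta] := hz b; rewrite -piE in hbeta.
pose I (p : PD) := exists c : 'I_m -> PD, p = \sum_i c i * mp (r i).
have hI : ideal I.
  split=> [|_ _ [c ->] [c' ->]|a _ [c ->]].
  - by exists (fun=> 0); rewrite big1 // => i _; rewrite mul0r.
  - exists (fun i => c i + c' i); rewrite -big_split; apply: eq_bigr => i _.
    by rewrite mulrDl.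
  - exists (fun i => a * c i); rewrite mulr_sumr; apply: eq_bigr => i _.
    by rewrite mulrA.
have mp0 p : mp p = 0 -> y (pi p) = 0.
  move=> e; rewrite piE /mmap rmorph_sum big1 // => mm _; rewrite rmorphM /= hd ?mul0r //.
  by have := congr1 (mcoeff mm) e; rewrite mcoeff_map_mpoly mcoeff0.
have pir i : pi (r i) = 0.
  rewrite piE hr; exists (fun j => (j == i)%:R).
  rewrite (bigD1 i) //= eqxx mul1r big1 ?addr0 // => j /negbTE ->.
  by rewrite mul0r.
have piJ p : pi p = 0 -> exists c : 'I_m -> P, p = \sum_i c i * r i by rewrite piE hr.
have claim N : ~ I (mp (beta ^+ N)).
  move=> [c hc].
  have dom : forall a e, d a != 0 -> d e != 0 -> d (a * e) != 0.
    move=> a e ha he; rewrite rmorphM; apply/eqP => /domD[]/eqP; exact/negP.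
  have [t [bb [a [a0 b0 hi hp]]]] := mpoly_basis dom [seq c i | i <- enum 'I_m].
  have hc' (i : 'I_m) : exists q : nat -> P, (d a)%:MP * c i = \sum_(l < t.+1) (bb l)%:MP * map_mpoly d (q l).
    by apply: hp; rewrite map_f // mem_enum.
  have [Q hQ] := choose_fin hc'.
  (* The component along [bb 0 = 1] turns a relation over D into one with coefficients coming from
     A, at the price of the factor [d a]. *)
  pose T l : P := (if l == 0%N then a%:MP * beta ^+ N else 0) - \sum_i Q i l * r i.
  have eT : \sum_(l < t.+1) (bb l)%:MP * map_mpoly d (T l) = 0.
    have h1 : (d a)%:MP * mp (beta ^+ N) =
        \sum_(l < t.+1) (bb l)%:MP * mp (\sum_i Q i l * r i).
      rewrite hc mulr_sumr; under eq_bigr do rewrite mulrA hQ mulr_suml.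
      rewrite exchange_big; apply: eq_bigr => l _ /=.
      rewrite (rmorph_sum mp) mulr_sumr; apply: eq_bigr => i _.
      by rewrite (rmorphM mp) mulrA.
    have h2 : (d a)%:MP * mp (beta ^+ N) = \sum_(l < t.+1) (bb l)%:MP *
        mp (if l == 0%N :> nat then a%:MP * beta ^+ N else 0).
      rewrite big_ord_recl /= b0 mpolyC1 mul1r big1 ?addr0 => [|l _]; last first.
        by rewrite (rmorph0 mp) mulr0.
      by rewrite (rmorphM mp) mpC.
    transitivity ((d a)%:MP * mp (beta ^+ N) - (d a)%:MP * mp (beta ^+ N)); last by rewrite subrr.
    rewrite {1}h2 h1 -sumrB; apply: eq_bigr => l _.
    by rewrite -[map_mpoly d (T l)]/(mp (T l)) /T (rmorphB mp) mulrBr.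
  have := hi _ eT 0%N (ltn0Sn _); rewrite /T /= -[map_mpoly d _]/(mp _) (rmorphB mp).
  move=> /eqP; rewrite subr_eq0 (rmorphM mp) mpC => /eqP eq0.
  pose c' i := Q i 0%N.
  have [phi [phiC phi_id phiJ]] := smooth_section sm hz.
  have hM (j : 'I_m) : exists M : 'I_m -> 'I_m -> P, phi (r j) = \sum_l \sum_l' M l l' * r l * r l'.
    have : prod_ideal (fun p => mmap h z p = 0) (phi (r j)) by apply: phiJ; rewrite -piE.
    apply: (gen_ideal_min (I := fun p => exists M : 'I_m -> 'I_m -> P,
        p = \sum_l \sum_l' M l l' * r l * r l')) => [|_ [p [q [hp' hq ->]]]].
      split=> [|_ _ [M ->] [M' ->]|e _ [M ->]].
      - by exists (fun _ _ => 0); rewrite big1 // => l _; rewrite big1 // => l' _; rewrite !mul0r.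
      - exists (fun l l' => M l l' + M' l l'); rewrite -big_split; apply: eq_bigr => l _.
        by rewrite -big_split; apply: eq_bigr => l' _; rewrite !mulrDl.
      - exists (fun l l' => e * M l l'); rewrite mulr_sumr; apply: eq_bigr => l _.
        by rewrite mulr_sumr; apply: eq_bigr => l' _; rewrite !mulrA.
    have [cp ->] : exists c : 'I_m -> P, p = \sum_i c i * r i by apply: piJ; rewrite piE.
    have [cq ->] : exists c : 'I_m -> P, q = \sum_i c i * r i by apply: piJ; rewrite piE.
    exists (fun l l' => cp l * cq l'); rewrite mulr_suml; apply: eq_bigr => l _.
    by rewrite mulr_sumr; apply: eq_bigr => l' _; ring.
  have [M hM'] := choose_fin hM.
  (* All the data of the argument: the relations, the coefficients found above, the images of the
     variables under [phi], and the matrices writing [phi (r j)] as a quadratic form in the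
     relations. *)
  pose L := [seq r j | j <- enum 'I_m] ++ [seq c' j | j <- enum 'I_m] ++
    [seq phi 'X_i | i <- enum 'I_n] ++
    flatten [seq flatten [seq [seq M j l l' | l' <- enum 'I_m] | l <- enum 'I_m] | j <- enum 'I_m].
  have [s [rho [rhoC rhoL rhoX rhog]]] := finite_coefficients L.
  have hr0 j : exists e, rho e = r j by apply: rhoL; rewrite mem_cat map_f // mem_enum.
  have hc0 j : exists e, rho e = c' j.
    by apply: rhoL; rewrite !mem_cat (map_f c') ?orbT // mem_enum.
  have [r' hr'] := choose_fin hr0; have [c2 hc2] := choose_fin hc0.
  have hM2 j l l' : exists e, rho e = M j l l'.
    apply: rhoL; rewrite !mem_cat; apply/orP; right; apply/orP; right; apply/orP; right.
    apply/flatten_mapP; exists j; first by rewrite mem_enum.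
    apply/flatten_mapP; exists l; first by rewrite mem_enum.
    by apply/mapP; exists l' => //; rewrite mem_enum.
  pose M2 j l l' := projT1 (cid (hM2 j l l')).
  have M2P j l l' : rho (M2 j l l') = M j l l' by rewrite /M2; case: cid.
  have hg (g : 'I_s) : exists e, rho e = phi (rho 'X_g).
    have [[a' ea]|[i ->]] := rhog g; first by exists 'X_g; rewrite ea phiC.
    by apply: rhoL; rewrite !mem_cat (map_f (fun i => phi 'X_i)) ?orbT // mem_enum.
  have [g' hg'] := choose_fin hg.
  have [phi' [phi'C phi'X _]] := mmap_rmorph [the {rmorphism k -> _} of @mpolyC s k] g'.
  have phi'E p : rho (phi' p) = phi (rho p).
    apply: (mmap_uniq (g := rho \o phi') (g' := phi \o rho)) => [e|g] /=.
      by rewrite phi'C !rhoC phiC.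
    by rewrite phi'X hg'.
  have phi'I i p : rho (iter i phi' p) = iter i phi (rho p).
    by elim: i => //= i IH; rewrite phi'E IH.
  have itD i q q' : iter i phi (q + q') = iter i phi q + iter i phi q'.
    by elim: i => //= i ->; rewrite rmorphD.
  have itM i q q' : iter i phi (q * q') = iter i phi q * iter i phi q'.
    by elim: i => //= i ->; rewrite rmorphM.
  have it0 i : iter i phi 0 = 0 by elim: i => //= i ->; rewrite rmorph0.
  have itS i (J : finType) (F : J -> P) : iter i phi (\sum_j F j) = \sum_j iter i phi (F j).
    exact: (big_morph _ (itD i) (it0 i)).
  have itC i a' : iter i phi a'%:MP = a'%:MP by elim: i => //= i ->.
  have hE i : forall j, exists e, pw r' i.+1 e /\ rho e = iter i phi (r j).
    elim: i => [|i IH] j; first by exists (r' j); split; [apply: pw_gen|apply: hr'].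
    have [e he] := choose_fin IH.
    exists (\sum_l \sum_l' iter i phi' (M2 j l l') * e l * e l'); split.
      apply: (ideal_sum (pw_ideal r' i.+2)) => l _; apply: (ideal_sum (pw_ideal r' i.+2)) => l' _.
      rewrite -mulrA; apply: (idealM (pw_ideal r' i.+2)).
      have [h1 _] := he l; have [h2 _] := he l'.
      by apply: pw_le (pwM h1 h2); rewrite addSn addnS !ltnS leq_addr.
    rewrite iterSr hM' itS rmorph_sum; apply: eq_bigr => l _.
    rewrite itS rmorph_sum; apply: eq_bigr => l' _.
    rewrite !itM !rmorphM phi'I M2P; have [_ ->] := he l; have [_ ->] := he l'.
    by [].
  have hb i : exists e, pw r' i e /\ rho e = iter i phi (\sum_j c' j * r j).
    have [e he] := choose_fin (hE i).
    exists (\sum_j iter i phi' (c2 j) * e j); split.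
      apply: (ideal_sum (pw_ideal r' i)) => j _; apply: (idealM (pw_ideal r' i)).
      by have [h1 _] := he j; apply: pw_leS.
    rewrite itS rmorph_sum; apply: eq_bigr => j _.
    by rewrite itM rmorphM phi'I hc2; have [_ ->] := he j.
  pose bs i := projT1 (cid (hb i)).
  have bsP i : pw r' i (bs i) /\ rho (bs i) = iter i phi (\sum_j c' j * r j).
    by rewrite /bs; case: cid.
  (* The lifts of the iterates of the relation lie in growing powers of one ideal of a polynomial
     ring over k. After cancelling [d a], the relation obtained here is evaluated at y: the
     coefficients [q i] map to 0 in B, and the remaining term is [y b ^+ N]. *)
  have [N0 [q [hq eq]]] := artin_rees (noeth_mpoly (n := s) (@noeth_field k)) (fun i => proj1 (bsP i)).
  have [phiD [phiDC phiDX _]] := mmap_rmorph [the {rmorphism D -> _} of @mpolyC n D] (fun i => mp (phi 'X_i)).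
  have phiDE p : phiD (mp p) = mp (phi p).
    apply: (mmap_uniq (g := phiD \o mp) (g' := mp \o phi)) => [e|g] /=.
      by rewrite map_mpolyC phiDC phiC map_mpolyC.
    by rewrite map_mpolyX phiDX.
  have phiDI i p : iter i phiD (mp p) = mp (iter i phi p).
    by elim: i => //= i ->; rewrite phiDE.
  have mpb i : mp (rho (bs i)) = (d a)%:MP * mp (iter i phi (beta ^+ N)).
    have [_ ->] := bsP i; rewrite -phiDI -eq0 -mpC -rmorphM phiDI itM itC.
    by rewrite rmorphM.
  have canc p : (d a)%:MP * p = 0 -> p = 0 :> PD.
    move=> e; apply/mpolyP => mm; have := congr1 (mcoeff mm) e.
    by rewrite mcoeffCM !mcoeff0 => /domD[/eqP|//]; rewrite (negbTE a0).
  have : mp (iter N0 phi (beta ^+ N) - \sum_(i < N0) rho (q i) * iter i phi (beta ^+ N)) = 0.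
    apply: canc; rewrite rmorphB mulrBr -mpb eq !rmorph_sum mulr_sumr -sumrB big1 // => i _.
    by rewrite !rmorphM /= mpb mulrCA subrr.
  move=> /mp0; rewrite rmorphB rmorph_sum rmorphB rmorph_sum /= big1 => [|i _]; last first.
    have /pwS[a' [_ e]] := hq i.
    rewrite e !rmorphM rmorph_sum rmorph_sum rmorph_sum big1 ?mul0r // => j _.
    by rewrite rmorphM hr' !rmorphM /= pir rmorph0 mulr0.
  have phi_it i p : pi (iter i phi p) = pi p.
    by elim: i => //= i IH; rewrite piE phi_id -piE.
  rewrite subr0 phi_it !rmorphXn /= hbeta => /eqP.
  by rewrite (negbTE (field_expf N hK yb)).
have I1 : ~ I 1 by have := claim 0%N; rewrite expr0 rmorph1.
pose j0 : {rmorphism k -> PD} := [the {rmorphism D -> PD} of @mpolyC n D] \o in_algm D.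
have [C [f [fj fs fk]]] := @quotient_alg k PD j0 I hI I1.
have [j jE] := lrmorph_of (f := f \o [the {rmorphism D -> PD} of @mpolyC n D]) fj.
have [||||i iE] := @factor_surj k P B C pi (f \o mp) (fun c => c%:A%:MP).
- by move=> x; have [p <-] := hz x; exists p.
- move=> p /piJ[c ->]; apply/fk; exists (fun i => mp (c i)).
  by rewrite rmorph_sum; apply: eq_bigr => i _; rewrite rmorphM.
- by move=> c; rewrite piC; exact: (rmorph_alg h c).
- by move=> c; rewrite /= map_mpolyC -fj; congr (f _%:MP); exact: (rmorph_alg d c).
exists C, i, j; split=> [a|N] /=.
  by rewrite -piC iE /= map_mpolyC jE.
have -> : i b ^+ N = f (mp (beta ^+ N)).
  by rewrite -hbeta iE (rmorphXn mp) (rmorphXn f).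
by apply/eqP => /fk; apply: claim.
Qed.

End GoingDown.

(** * The zip group in coordinates *)

Section Shapes.
Variable A : comUnitRingType.
Implicit Types g h c v : 'M[A]_4.

Lemma lt3_max (i : 'I_4) : (i < 3)%N = (i != ord_max).
Proof. by rewrite ltn_neqAle -ltnS ltn_ord andbT. Qed.

Lemma sum4 (V : nmodType) (F : 'I_4 -> V) : \sum_i F i = \sum_(i | i != ord_max) F i + F ord_max.
Proof. by rewrite (bigD1 ord_max) //= addrC. Qed.

Definition Pshape g : Prop := forall i, i != ord_max -> g i ord_max = 0.

Lemma Pshape_unit g h : g *m h = 1%:M -> Pshape g -> Pshape h /\ g ord_max ord_max * h ord_max ord_max = 1.
Proof.
move=> e gP; have e' := mulmx1C e.
have hg : h ord_max ord_max * g ord_max ord_max = 1.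
  have := congr1 (fun M : 'M_4 => M ord_max ord_max) e'.
  rewrite !mxE sum4 eqxx big1 ?add0r // => i ni.
  by rewrite gP // mulr0.
split=> [i ni|]; last by rewrite mulrC.
have := congr1 (fun M : 'M_4 => M i ord_max) e'.
rewrite !mxE sum4 (negbTE ni) big1 ?add0r => [h0|j nj]; last by rewrite gP // mulr0.
by rewrite -[LHS]mulr1 -hg mulrCA h0 mulr0.
Qed.

Lemma polyC_X (a : A) (p : {poly A}) : 'X * p = a%:P -> a = 0.
Proof. by move=> /(congr1 (coefp 0%N)); rewrite /= coefXM coefC. Qed.

Lemma mul_muL n (M : 'M[{poly A}]_(4, n)) i j :
  (mu 'X *m M) i j = (if (i < 3)%N then 'X else 1) * M i j.
Proof. by rewrite mul_diag_mx !mxE. Qed.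
Lemma mul_muR n (M : 'M[{poly A}]_(n, 4)) i j :
  (M *m mu 'X) i j = M i j * (if (j < 3)%N then 'X else 1).
Proof. by rewrite mul_mx_diag !mxE. Qed.

(** This is mu(X)^-1 g mu(X), written without a negative power of X; for g in P the entries that
    would need one are zero. *)
Definition dilate g : 'M[{poly A}]_4 :=
  \matrix_(i, j) ((g i j)%:P * (if (i == ord_max) && (j != ord_max) then 'X else 1)).

Definition levi g : 'M[A]_4 :=
  \matrix_(i, j) (if (i == ord_max) == (j == ord_max) then g i j else 0).

Lemma mu_inj (M N : 'M[{poly A}]_4) : mu 'X *m M = mu 'X *m N -> M = N.
Proof.
move=> e; apply/matrixP => i j; have := congr1 (fun M : 'M_4 => M i j) e.
rewrite !mul_muL; case: ifP => _; rewrite ?mul1r // => /polyP h.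
by apply/polyP => l; have := h l.+1; rewrite !coefXM.
Qed.

Lemma mu_dilate g : Pshape g -> mu 'X *m dilate g = map_mx polyC g *m mu 'X.
Proof.
move=> gP; apply/matrixP => i j; rewrite mul_muL mul_muR !mxE !lt3_max.
have [->|ni] := eqVneq i ord_max; have [->|nj] := eqVneq j ord_max => //=.
- by rewrite mul1r.
- by rewrite mul1r.
- by rewrite gP // polyC0 !mul0r mulr0.
- by rewrite mulr1 mulrC.
Qed.

Lemma dilate_mul g h : Pshape g -> Pshape h -> g *m h = 1%:M -> dilate g *m dilate h = 1%:M.
Proof.
move=> gP hP e; apply: mu_inj; rewrite mulmxA mu_dilate // -mulmxA mu_dilate //.
by rewrite mulmxA -map_mxM e map_mx1 mul1mx mulmx1.
Qed.

Lemma dilate0 g : Pshape g -> map_mx (horner^~ 0) (dilate g) = levi g.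
Proof.
move=> gP; apply/matrixP => i j; rewrite !mxE.
have [->|ni] := eqVneq i ord_max; have [->|nj] := eqVneq j ord_max => //=.
- by rewrite hornerM !hornerC mulr1.
- by rewrite hornerMX mulr0.
- by rewrite hornerM !hornerC mulr1 gP.
- by rewrite hornerM !hornerC mulr1.
Qed.

Lemma lim_minusP (g l : gl A) : lim_minus g l <-> Pshape (val g) /\ val l = levi (val g).
Proof.
split=> [[h [h' [_ e el]]]|[gP el]].
  have gP : Pshape (val g).
    move=> i ni; have := congr1 (fun M : 'M_4 => M i ord_max) e.
    by rewrite mul_muL mul_muR lt3_max ni mulr1 mxE => /polyC_X.
  split=> //; rewrite el -(dilate0 gP); congr (map_mx _ _).
  by apply: mu_inj; rewrite e mu_dilate.
have e := mulmxV (valP g); have [hP _] := Pshape_unit e gP.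
exists (dilate (val g)), (dilate (invmx (val g))); split.
- exact: dilate_mul.
- exact: mu_dilate.
- by rewrite dilate0.
Qed.

Lemma lim_plusP (g l : gl A) : lim_plus g l <-> Pshape (val g)^T /\ val l = levi (val g).
Proof.
have tr_mu : (mu 'X)^T = mu 'X :> 'M[{poly A}]_4 by rewrite /mu tr_diag_mx.
have levi_tr (M : 'M[A]_4) : (levi M)^T = levi M^T.
  by apply/matrixP => i j; rewrite !mxE eq_sym; case: eqP.
have trg : (val g)^T \in unitmx by rewrite unitmx_tr; exact: valP.
have trl : (val l)^T \in unitmx by rewrite unitmx_tr; exact: valP.
pose g' : gl A := exist (fun M : 'M_4 => M \in unitmx) _ trg.
pose l' : gl A := exist (fun M : 'M_4 => M \in unitmx) _ trl.
(* Transposition exchanges the two limits, as mu is diagonal. *)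
have -> : lim_plus g l <-> lim_minus g' l'.
  split=> [[h [h' [e1 e2 e3]]]|[h [h' [e1 e2 e3]]]]; exists h^T, h'^T.
    split; rewrite /= ?e3 -?map_trmx //.
      by rewrite -trmx_mul (mulmx1C e1) trmx1.
    by have := congr1 trmx e2; rewrite !trmx_mul tr_mu map_trmx.
  split.
  - by rewrite -trmx_mul (mulmx1C e1) trmx1.
  - by have := congr1 trmx e2; rewrite !trmx_mul tr_mu map_trmx /= trmxK.
  - by rewrite -map_trmx -e3 trmxK.
rewrite lim_minusP /= -levi_tr; split=> -[h1 h2]; split=> //.
  by rewrite -[LHS]trmxK h2 trmxK.
by rewrite h2.
Qed.

Lemma leviM g h : Pshape g -> Pshape h -> levi (g *m h) = levi g *m levi h.
Proof.
move=> gP hP; apply/matrixP => i j; rewrite !mxE !sum4 !mxE eqxx.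
have [->|ni] := eqVneq i ord_max; have [->|nj] := eqVneq j ord_max; rewrite ?eqxx ?(negbTE ni) ?(negbTE nj) /=.
- rewrite !big1 // => l nl; first by rewrite !mxE eqxx (negbTE nl) mul0r.
  by rewrite hP ?mulr0.
- by rewrite mulr0 addr0 big1 // => l nl; rewrite !mxE eqxx (negbTE nl) mul0r.
- by rewrite mul0r addr0 big1 // => l nl; rewrite !mxE eqxx (negbTE nl) mulr0.
- rewrite gP // !mul0r !addr0; apply: eq_bigr => l nl; by rewrite !mxE (negbTE ni) (negbTE nl) (negbTE nj).
Qed.

Lemma levi_id g : levi (levi g) = levi g.
Proof. by apply/matrixP => i j; rewrite !mxE; case: eqP. Qed.
Lemma levi1 : levi 1%:M = 1%:M.
Proof. by apply/matrixP => i j; rewrite !mxE; case: ifP => //; case: (i =P j) => // ->; rewrite eqxx. Qed.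
Lemma Pshape_levi g : Pshape (levi g).
Proof. by move=> i ni; rewrite mxE (negbTE ni) eqxx. Qed.

Lemma in_PP (g : gl A) : in_P g <-> Pshape (val g).
Proof.
split=> [[l /lim_minusP[]//]|gP].
have e := mulmxV (valP g); have [hP e33] := Pshape_unit e gP.
have lU : levi (val g) *m levi (invmx (val g)) = 1%:M.
  by rewrite -leviM // e levi1.
have [lu _] := mulmx1_unit lU.
by exists (exist (fun M : 'M_4 => M \in unitmx) _ lu); apply/lim_minusP.
Qed.

Lemma in_LP (g : gl A) : in_L g <-> levi (val g) = val g.
Proof.
split=> [e|e]; last first.
  have gP : Pshape (val g) by rewrite -e; exact: Pshape_levi.
  rewrite /in_L -mu_dilate //; congr (_ *m _); rewrite -e; apply/matrixP => i j.
  by rewrite !mxE; case: (i == ord_max); case: (j == ord_max); rewrite /= ?mulr1 ?polyC0 ?mul0r.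
apply/matrixP => i j; rewrite mxE; case: ifP => // nij; apply/esym.
have := congr1 (fun M : 'M_4 => M i j) e; rewrite mul_muL mul_muR !lt3_max !mxE.
move: nij; case: (i == ord_max); case: (j == ord_max) => //= _; rewrite ?mul1r ?mulr1.
  by move=> /esym; rewrite mulrC => /polyC_X.
exact: polyC_X.
Qed.
End Shapes.

Definition mkgl (A : comUnitRingType) (M : 'M[A]_4) (h : M \in unitmx) : gl A :=
  exist (fun M : 'M_4 => M \in unitmx) M h.

Lemma gl_eq (A : comUnitRingType) (g h : gl A) : val g = val h -> g = h.
Proof. exact: val_inj. Qed.

Section ZipGroup.
Variables (q : nat) (A : comUnitRingType) (fr : {rmorphism A -> A}).
Hypothesis frE : forall a, fr a = a ^+ q.
Implicit Types (c v M : 'M[A]_4) (w : 'I_4 -> A).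

Definition colu w : 'M[A]_4 :=
  \matrix_(i, j) (if (j == ord_max) && (i != ord_max) then w i else (i == j)%:R).
(* The general element of Q over c, up to Jconj: the Levi part is the Frobenius
   twist of that of c and the unipotent part is w. *)
Definition frm (n : nat) c w : 'M[A]_4 :=
  \matrix_(i, j) (if (j == ord_max) && (i != ord_max) then w i else levi c i j ^+ n).

Lemma coluE M : Pshape M^T -> levi M = 1%:M -> M = colu (fun i => M i ord_max).
Proof.
move=> MP e; apply/matrixP => i j; rewrite mxE.
have [->|ni] := eqVneq i ord_max; have [->|nj] := eqVneq j ord_max => //=.
- by have := congr1 (fun M : 'M_4 => M ord_max ord_max) e; rewrite !mxE eqxx.
- by have := MP j nj; rewrite mxE => ->.
- by have := congr1 (fun M : 'M_4 => M i j) e; rewrite !mxE (negbTE ni) (negbTE nj).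
Qed.

Lemma coluM w w' : colu w *m colu w' = colu (fun i => w i + w' i).
Proof.
apply/matrixP => i j; rewrite !mxE sum4 !mxE eqxx /=.
have [->|ni] := eqVneq i ord_max; have [->|nj] := eqVneq j ord_max; rewrite ?eqxx ?(negbTE ni) ?(negbTE nj) /=.
- by rewrite mulr1 big1 ?add0r // => l nl; rewrite !mxE (negbTE nl) [ord_max == l]eq_sym (negbTE nl) mul0r.
- rewrite mulr0 addr0 big1 // => l nl.
  by rewrite !mxE (negbTE nl) [ord_max == l]eq_sym (negbTE nl) mul0r.
- rewrite mulr1 (bigD1 i) //= big1 ?addr0 => [|l /andP[nl nli]].
    by rewrite !mxE (negbTE ni) !eqxx /= mul1r addrC.
  by rewrite !mxE (negbTE nl) [i == l]eq_sym (negbTE nli) mul0r.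
- rewrite mulr0 addr0 (bigD1 i) //= big1 ?addr0 => [|l /andP[nl nli]].
    by rewrite !mxE (negbTE ni) (negbTE nj) eqxx mul1r.
  by rewrite !mxE (negbTE nl) [i == l]eq_sym (negbTE nli) mul0r.
Qed.

Lemma colu0 : colu (fun=> 0) = 1%:M.
Proof. by apply/matrixP => i j; rewrite !mxE; case: ifP => // /andP[/eqP-> ni]; rewrite (negbTE ni). Qed.
Lemma coluN w : colu w *m colu (fun i => - w i) = 1%:M.
Proof.
rewrite coluM -colu0; congr colu; apply: functional_extensionality_dep => i.
by rewrite subrr.
Qed.
Lemma colu_shape w : Pshape (colu w)^T /\ levi (colu w) = 1%:M.
Proof.
split=> [i ni|]; first by rewrite !mxE eqxx andbF eq_sym (negbTE ni).
apply/matrixP => i j; rewrite !mxE; have [->|nij] := eqVneq i j; first by case: (j == ord_max).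
by case: (i == ord_max); case: (j == ord_max).
Qed.

Lemma map_frob c : map_mx (fun a => a ^+ q) c = map_mx fr c.
Proof. by apply/matrixP => i j; rewrite !mxE frE. Qed.
Lemma levi_fr c : levi (map_mx fr c) = map_mx fr (levi c).
Proof. by apply/matrixP => i j; rewrite !mxE; case: ifP => // _; rewrite rmorph0. Qed.

Lemma frm_colu c w : colu w *m map_mx fr (levi c) = frm q c (fun i => w i * fr (c ord_max ord_max)).
Proof.
apply/matrixP => i j; rewrite !mxE sum4 !mxE eqxx -frE /=.
have [->|ni] := eqVneq i ord_max; have [->|nj] := eqVneq j ord_max; rewrite ?eqxx ?(negbTE ni) ?(negbTE nj) /=.
- rewrite mul1r big1 ?add0r // => l nl.
  by rewrite !mxE (negbTE nl) [ord_max == l]eq_sym (negbTE nl) mul0r.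
- by rewrite rmorph0 mulr0 addr0 big1 // => l nl; rewrite !mxE (negbTE nl) [ord_max == l]eq_sym (negbTE nl) mul0r.
- by rewrite big1 ?add0r // => l nl; rewrite !mxE (negbTE nl) rmorph0 mulr0.
- rewrite rmorph0 mulr0 addr0 (bigD1 i) //= big1 ?addr0 => [|l /andP[nl nli]].
    by rewrite !mxE (negbTE ni) (negbTE nj) eqxx mul1r.
  by rewrite !mxE (negbTE nl) [i == l]eq_sym (negbTE nli) mul0r.
Qed.

Lemma levi_inv c : Pshape c -> c \in unitmx -> levi c *m levi (invmx c) = 1%:M.
Proof.
move=> cP cU; have e := mulmxV cU; have [hP _] := Pshape_unit e cP.
by rewrite -leviM // e levi1.
Qed.

Lemma invmx_eq n (M N : 'M[A]_n) : M *m N = 1%:M -> invmx M = N.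
Proof.
move=> e; have [MU _] := mulmx1_unit e.
by rewrite -[LHS]mulmx1 -e mulmxA mulVmx // mul1mx.
Qed.

Lemma frm_decomp c w : Pshape c -> c \in unitmx -> exists w',
  colu w' *m map_mx fr (levi c) = frm q c w.
Proof.
move=> cP cU; have e := mulmxV cU; have [hP c33] := Pshape_unit e cP.
exists (fun i => w i * fr (invmx c ord_max ord_max)); rewrite frm_colu.
congr (frm _ _); apply: functional_extensionality_dep => i.
by rewrite -mulrA -rmorphM mulrC [_ * c _ _]mulrC c33 rmorph1 mul1r.
Qed.

Lemma frm_unit c w : Pshape c -> c \in unitmx -> frm q c w \in unitmx.
Proof.
move=> cP cU; have [w' <-] := frm_decomp w cP cU.
rewrite unitmx_mul; have [-> _] := mulmx1_unit (coluN w').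
have := levi_inv cP cU => /(congr1 (map_mx fr)); rewrite map_mxM map_mx1.
by case/mulmx1_unit.
Qed.

Lemma Jtr : (J A)^T = J A.
Proof. by apply/matrixP => i j; rewrite !mxE addnC. Qed.
Lemma JU : J A \in unitmx.
Proof. by case: (mulmx1_unit (JJ A)). Qed.

(** An anti-automorphism, polynomial in the entries; [theta] is its composite with inversion, which
    is why the second components of zip elements are described through it. *)
Definition Jconj M := J A *m M^T *m J A.
Lemma JconjK M : Jconj (Jconj M) = M.
Proof.
rewrite /Jconj !trmx_mul Jtr trmxK !mulmxA JJ mul1mx -mulmxA JJ mulmx1.
by [].
Qed.
Lemma JconjM M N : Jconj (M *m N) = Jconj N *m Jconj M.
Proof. by rewrite /Jconj trmx_mul !mulmxA -[_ *m J A *m J A]mulmxA JJ mulmx1. Qed.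
Lemma Jconj1 : Jconj 1%:M = 1%:M.
Proof. by rewrite /Jconj trmx1 mulmx1 JJ. Qed.
Lemma Jconj_unit M : M \in unitmx -> Jconj M \in unitmx.
Proof. by move=> MU; rewrite !unitmx_mul JU unitmx_tr MU. Qed.
Lemma thetaE (y : gl A) : val (theta y) *m Jconj (val y) = 1%:M.
Proof.
have -> : val (theta y) = Jconj (invmx (val y)) by rewrite /Jconj /= trmx_inv.
by rewrite -JconjM mulmxV ?Jconj1 //; exact: valP.
Qed.

Lemma map_unit M : M \in unitmx -> map_mx fr M \in unitmx.
Proof. by move=> MU; rewrite unitmxE det_map_mx rmorph_unit // -unitmxE. Qed.
Lemma levi_tr M : levi M^T = (levi M)^T.
Proof. by apply/matrixP => i j; rewrite !mxE eq_sym; case: eqP. Qed.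
Lemma PshapeM M N : Pshape M -> Pshape N -> Pshape (M *m N).
Proof.
move=> MP NP i ni; rewrite mxE sum4 MP // mul0r addr0 big1 // => l nl.
by rewrite NP ?mulr0.
Qed.

(** The Levi part of y is forced by that of x, so E is parametrized by P and the unipotent radical
    of Q. The parameter c is the inverse of x because c will multiply from the right. *)
Lemma zipEP (x y : gl A) : zipE q x y <->
  exists (c : gl A) w, [/\ Pshape (val c), x = glV c & val y = Jconj (frm q (val c) w)].
Proof.
split=> [[/in_PP xP yQ [l [m [[/in_LP lL [v /lim_minusP[vP v1] ex]] [/in_LP mL [v2 /lim_plusP[v2P v21] ey]] em]]]]|].
  have xU := valP x; have [cP _] := Pshape_unit (mulmxV xU) xP.
  have vU := valP v; have [viP _] := Pshape_unit (mulmxV vU) vP.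
  have lU := valP l; have lP : Pshape (val l) by rewrite -lL; exact: Pshape_levi.
  have [liP _] := Pshape_unit (mulmxV lU) lP.
  have vi1 : levi (invmx (val v)) = 1%:M.
    by have := levi_inv vP vU; rewrite -v1 mul1mx.
  have lc : levi (invmx (val x)) = invmx (val l).
    have -> : invmx (val x) = invmx (val v) *m invmx (val l).
      apply: invmx_eq; rewrite ex /= mulmxA -[_ *m _ *m invmx (val v)]mulmxA mulmxV //.
      by rewrite mulmx1 mulmxV.
    rewrite leviM // vi1 mul1mx; apply/esym/invmx_eq; rewrite -{1}lL.
    exact: levi_inv.
  have eth : Jconj (val y) = invmx (val v2) *m map_mx fr (levi (invmx (val x))).
    have v2U := valP v2.
    rewrite -(invmx_eq (thetaE y)) ey; apply: invmx_eq.
    rewrite -[val (glM _ _)]/(val (theta m) *m val v2).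
    have -> : val (theta m) = map_mx fr (val l).
      have -> : val (theta m) = Jconj (invmx (val m)) by rewrite /Jconj /= trmx_inv.
      rewrite -[RHS]JconjK; congr Jconj; apply: invmx_eq; rewrite em map_frob.
      have -> : J A *m invmx (map_mx fr (val l))^T *m J A = Jconj (invmx (map_mx fr (val l))).
        by rewrite /Jconj trmx_inv.
      by rewrite -JconjM mulmxV ?Jconj1 // map_unit.
    rewrite -mulmxA [val v2 *m _]mulmxA mulmxV // mul1mx lc -map_mxM mulmxV //.
    by rewrite map_mx1.
  have v2U : (val v2)^T \in unitmx by rewrite unitmx_tr; exact: valP.
  have [wP _] := Pshape_unit (mulmxV v2U) v2P.
  have v2i : invmx (val v2) = colu (fun i => invmx (val v2) i ord_max).
    apply: coluE; first by rewrite trmx_inv.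
    have : levi (val v2)^T *m levi (invmx (val v2)^T) = 1%:M by apply: levi_inv.
    by rewrite -trmx_inv !levi_tr -v21 trmx1 mul1mx => /(congr1 trmx); rewrite trmxK trmx1.
  exists (glV x), (fun i => invmx (val v2) i ord_max * fr (invmx (val x) ord_max ord_max)).
  split=> //; first by apply: gl_eq; rewrite /= invmxK.
  by rewrite -frm_colu -v2i -eth JconjK.
move=> [c [w [cP ex ey]]]; have cU := valP c; have [hP _] := Pshape_unit (mulmxV cU) cP.
have lcU : levi (val c) \in unitmx by case: (mulmx1_unit (levi_inv cP cU)).
have [w' ew] := frm_decomp w cP cU.
have frU : map_mx fr (levi (val c)) \in unitmx by exact: map_unit.
have [wU wU'] := mulmx1_unit (coluN w').
pose l := glV (mkgl lcU); pose v := glM (mkgl lcU) (glV c).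
pose m := mkgl (Jconj_unit frU); pose v2 := mkgl wU'.
have thm : val (theta m) = invmx (map_mx fr (levi (val c))).
  by rewrite -[RHS]/(invmx _) -(JconjK (map_mx _ _)); apply/esym/invmx_eq/mulmx1C/thetaE.
have lLm : Pshape (invmx (levi (val c))) /\ levi (invmx (levi (val c))) = invmx (levi (val c)).
  have P1 : Pshape (levi (val c)) by exact: Pshape_levi.
  have [P2 _] := Pshape_unit (mulmxV lcU) P1; split=> //.
  by apply/esym/invmx_eq; rewrite -{1}levi_id; apply: levi_inv.
have e2 : theta y = glM (theta m) v2.
  apply: gl_eq; rewrite -[val (glM _ _)]/(val (theta m) *m val v2) thm.
  have := thetaE y; rewrite ey JconjK -ew => e.
  have <- : val (theta y) *m colu w' = invmx (map_mx fr (levi (val c))).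
    by rewrite -[RHS]mul1mx; apply: (canRL (mulmxK frU)); rewrite -mulmxA.
  by rewrite -mulmxA coluN mulmx1.
have [lP lL] := lLm.
have eL : invmx (map_mx fr (levi (val c))) = map_mx fr (invmx (levi (val c))).
  by apply: invmx_eq; rewrite -map_mxM mulmxV ?map_mx1.
have LP : levi (val (theta m)) = val (theta m) by rewrite thm eL levi_fr lL.
have LtP : Pshape (val (theta m))^T by rewrite -LP -levi_tr; exact: Pshape_levi.
have [v2P v21] := colu_shape (fun i => - w' i).
have pl : lim_plus (theta y) (theta m).
  rewrite e2; apply/lim_plusP; split; rewrite -[val (glM _ _)]/(val (theta m) *m val v2).
    by rewrite trmx_mul; apply: PshapeM.
  by rewrite -[RHS]trmxK -levi_tr trmx_mul leviM // !levi_tr v21 trmx1 mul1mx trmxK LP.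
split; first by apply/in_PP; rewrite ex.
  by exists (theta m).
exists l, m; split.
- split; first exact/in_LP.
  exists v; last by apply: gl_eq; rewrite ex /= mulmxA mulVmx // mul1mx.
  apply/lim_minusP; split; first by apply: PshapeM => //; exact: Pshape_levi.
  by rewrite leviM ?levi_id ?levi_inv //; exact: Pshape_levi.
- split; first exact/in_LP.
  by exists v2 => //; apply/lim_plusP; rewrite v21.
- by rewrite /is_frob map_frob /= -eL -trmx_inv invmxK.
Qed.
End ZipGroup.

Lemma frob_exists (q : nat) (k : closedFieldType) (A : comUnitAlgType k) :
  is_Fq_closure q k -> exists fr : {rmorphism A -> A}, forall a, fr a = a ^+ q.
Proof.
move=> [[p [e [pp e0 -> pk]]] _].
have pA : p \in [pchar A].
  have := pk; rewrite !inE => /andP[-> /eqP h]; rewrite -(scaler_nat p (1 : A)) h.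
  by rewrite scale0r eqxx.
have hD (x y : A) : (x + y) ^+ (p ^ e) = x ^+ (p ^ e) + y ^+ (p ^ e).
  apply: exprDn_pchar; apply: (@sub_in_pnat (pred1 p)); last by rewrite pnatX pnat_id.
  by move=> r _ /eqP ->.
pose f (x : A) := x ^+ (p ^ e).
have p0 : (0 < p ^ e)%N by rewrite expn_gt0 prime_gt0.
have f0 : f 0 = 0 by rewrite /f expr0n eqn0Ngt p0.
have fN x : f (- x) = - f x.
  by apply/eqP; rewrite -subr_eq0 opprK -hD addNr -[_ ^+ _]/(f 0) f0.
have fB : additive f by move=> x y; rewrite -fN; apply: hD.
have fM : monoid_morphism f by split=> [|x y]; rewrite /f ?expr1n // exprMn.
pose F1 := GRing.isZmodMorphism.Build A A f fB.
pose F2 := GRing.isMonoidMorphism.Build A A f fM.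
by exists (HB.pack_for {rmorphism A -> A} f F1 F2).
Qed.

Section Coordinates.
Variables (q : nat) (A : comUnitRingType).
Implicit Types (c g b : 'M[A]_4) (w : 'I_4 -> A).

Definition Pi : 'M[A]_4 := perm_mx w0I.
Lemma w0IK : involutive w0I. Proof. by move=> i; rewrite /w0I tpermK. Qed.
Lemma PiPi : Pi *m Pi = 1%:M.
Proof. by rewrite /Pi -perm_mxM /w0I tperm2 perm_mx1. Qed.
Lemma Pi_conj g i j : (Pi *m g *m Pi) i j = g (w0I i) (w0I j).
Proof.
rewrite /Pi -[X in _ *m perm_mx X](invgK w0I) -col_permE -row_permE !mxE.
by congr (g _ _); apply: (canLR (permK _)); rewrite ?w0IK.
Qed.

Lemma J_perm : J A = perm_mx w0.
Proof.
apply/matrixP => i j; rewrite !mxE permE -val_eqE.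
by case: i j => [[|[|[|[|i]]]] ?] [[|[|[|[|j]]]] ?].
Qed.

Lemma JZ : J A *m val (zgl A) = Pi.
Proof.
rewrite /= -[perm_mx w0]J_perm !mulmxA JJ mul1mx -mulmxA JJ mulmx1.
rewrite tr_perm_mx; apply: invmx_eq; rewrite -perm_mxM.
by rewrite /w0I tpermV tperm2 perm_mx1.
Qed.

(** For the zip element with parameters (c, w) and second component y this is z^-1 y z, the factor
    by which it multiplies h from the left. *)
Definition bmat c w := Pi *m (frm q c w)^T *m Pi.
Lemma bmatE c w i j : bmat c w i j = frm q c w (w0I j) (w0I i).
Proof. by rewrite Pi_conj mxE. Qed.

Definition lower c : Prop := forall i j : 'I_4, (i < j)%N -> c i j = 0.
Lemma lower_P c : lower c -> Pshape c.
Proof. by move=> h i ni; apply: h; rewrite lt3_max. Qed.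

Lemma w0I_max : w0I ord_max = ord_max.
Proof. by rewrite /w0I tpermD // -val_eqE /= inordK. Qed.
Lemma w0I_eqmax i : (w0I i == ord_max) = (i == ord_max).
Proof. by rewrite -{1}w0I_max (inj_eq perm_inj). Qed.

Lemma w0I_lt (i j : 'I_4) : (i < j)%N -> j != ord_max -> (w0I j < w0I i)%N.
Proof.
have e0 : inord 0 = 0 :> 'I_4 by apply: val_inj; rewrite /= inordK.
have e2 : inord 2 = 2%:R :> 'I_4 by apply: val_inj; rewrite /= inordK.
rewrite /w0I e0 e2; case: i => [[|[|[|[|i]]]] ?] //; case: j => [[|[|[|[|j]]]] ?] // _ _.
all: by rewrite !permE /=.
Qed.

(** Transposition turns lower into upper triangular matrices and [w0I], which reverses the first
    three indices, turns them back; the column w ends up in the last row. *)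
Lemma bmat_lower c w : (0 < q)%N -> lower c -> lower (bmat c w).
Proof.
move=> q0 cL i j ij; rewrite bmatE !mxE !w0I_eqmax.
have ni : i != ord_max by rewrite -lt3_max; apply: leq_trans ij _; rewrite -ltnS.
rewrite (negbTE ni) /=; have [->|nj] := eqVneq j ord_max.
  by rewrite expr0n eqn0Ngt q0.
by rewrite cL ?expr0n ?eqn0Ngt ?q0 //; exact: w0I_lt.
Qed.
Lemma bmat_diag c w i : bmat c w i i = c (w0I i) (w0I i) ^+ q.
Proof. by rewrite bmatE !mxE eqxx; case: eqP => // ->; rewrite eqxx. Qed.

(** Lower triangular factors add to an entry only multiples of entries above it or to its right, so
    a corner of the zero region is merely rescaled. *)
Lemma corner_entry b g c (i j : 'I_4) : lower b -> lower c ->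
  (forall k l : 'I_4, (k <= i)%N -> (j <= l)%N -> (k, l) != (i, j) -> g k l = 0) ->
  (b *m g *m c) i j = b i i * g i j * c j j.
Proof.
move=> bL cL h; rewrite mxE (bigD1 j) //= big1 ?addr0 => [|l nl].
  rewrite mxE (bigD1 i) //= big1 ?addr0 // => k nk.
  have [ki|ik] := leqP k i; last by rewrite bL ?mul0r.
  by rewrite h ?mulr0 // xpair_eqE (negbTE nk).
have [jl|lj] := leqP j l; last by rewrite cL ?mulr0.
rewrite mxE big1 ?mul0r // => k _.
have [ki|ik] := leqP k i; last by rewrite bL ?mul0r.
by rewrite h ?mulr0 // xpair_eqE (negbTE nl) andbF.
Qed.
End Coordinates.

Section FrmChar.
Variables (q : nat) (A : comUnitRingType) (fr : {rmorphism A -> A}).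
Hypothesis frE : forall a, fr a = a ^+ q.
Implicit Types (c : 'M[A]_4) (w : 'I_4 -> A).

Lemma frm_char c (M : 'M[A]_4) : Pshape M^T -> levi M = map_mx fr (levi c) ->
  M = frm q c (fun i => M i ord_max).
Proof.
move=> MP e; apply/matrixP => i j; rewrite mxE -frE.
have := congr1 (fun M : 'M_4 => M i j) e; rewrite !mxE.
have [->|ni] := eqVneq i ord_max; have [->|nj] := eqVneq j ord_max => //= _.
by rewrite rmorph0; have := MP j nj; rewrite mxE.
Qed.
Lemma frm_levi c w : Pshape (frm q c w)^T /\ levi (frm q c w) = map_mx fr (levi c).
Proof.
split=> [i ni|].
  rewrite !mxE eqxx andbF eq_sym (negbTE ni) -frE /=.
  by rewrite rmorph0.
apply/matrixP => i j; rewrite !mxE -frE.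
by case: (i == ord_max); case: (j == ord_max) => //=; rewrite rmorph0.
Qed.
Lemma frm_mul c c' w w' : Pshape c -> Pshape c' ->
  exists w2, frm q c' w' *m frm q c w = frm q (c' *m c) w2.
Proof.
move=> cP c'P; have [P1 e1] := frm_levi c w; have [P2 e2] := frm_levi c' w'.
eexists; apply: frm_char; first by rewrite trmx_mul; apply: PshapeM.
apply: trmx_inj; rewrite -levi_tr trmx_mul [LHS]leviM // !levi_tr e1 e2 -trmx_mul -map_mxM.
by rewrite leviM.
Qed.
Lemma frm_inv c w : Pshape c -> c \in unitmx ->
  exists w2, frm q c w *m frm q (invmx c) w2 = 1%:M.
Proof.
move=> cP cU; have FU := frm_unit frE w cP cU.
have [FP e] := frm_levi c w.
have FtU : (frm q c w)^T \in unitmx by rewrite unitmx_tr.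
have [P2 _] := Pshape_unit (mulmxV FtU) FP.
have lP := levi_inv cP cU.
exists (fun i => invmx (frm q c w) i ord_max).
rewrite -frm_char ?mulmxV // ?trmx_inv //.
have h : levi (frm q c w) *m levi (invmx (frm q c w)) = 1%:M.
  have := levi_inv FP FtU; rewrite -trmx_inv !levi_tr -trmx_mul => /(congr1 trmx).
  by rewrite trmxK trmx1 => /mulmx1C.
rewrite -(invmx_eq h) e; apply: invmx_eq; rewrite -map_mxM lP.
by rewrite map_mx1.
Qed.
End FrmChar.

Section ZipSpace.
Variables (q : nat) (k : fieldType) (X : zip_space q k).
Notation alg := (comUnitAlgType k).
Implicit Types A B C K : alg.
Hypothesis q0 : (0 < q)%N.
Hypothesis hfr : forall A, exists fr : {rmorphism A -> A}, forall a, fr a = a ^+ q.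

Lemma zglE A : val (zgl A) = J A *m Pi A.
Proof. by rewrite -JZ mulmxA JJ mul1mx. Qed.
Lemma zglV_E A : invmx (val (zgl A)) = Pi A *m J A.
Proof.
apply: invmx_eq; rewrite zglE mulmxA -[_ *m Pi A *m Pi A]mulmxA PiPi mulmx1.
exact: JJ.
Qed.

Lemma zgl_map A B (u : {rmorphism A -> B}) : gl_map u (zgl A) = zgl B.
Proof.
apply: gl_eq; rewrite -[LHS]/(map_mx u (val (zgl A))) !zglE map_mxM map_perm_mx; congr (_ *m _).
by apply/matrixP => i j; rewrite !mxE rmorph_nat.
Qed.

(* After this change of variable E' acts through lower triangular matrices on both
   sides. *)
Definition gmat A (g : gl A) : 'M[A]_4 := invmx (val g *m val (zgl A)).
Definition gc A (p : X A) : 'M[A]_4 := gmat (zphi X A p).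

Lemma gmat_unit A (g : gl A) : gmat g \in unitmx.
Proof. by rewrite unitmx_inv unitmx_mul (valP g) (valP (zgl A)). Qed.

Lemma invmx_map A B (u : {rmorphism A -> B}) (M : 'M[A]_4) : M \in unitmx ->
  invmx (map_mx u M) = map_mx u (invmx M).
Proof. by move=> MU; apply: invmx_eq; rewrite -map_mxM mulmxV ?map_mx1. Qed.

Lemma gmat_map A B (u : {rmorphism A -> B}) (g : gl A) : gmat (gl_map u g) = map_mx u (gmat g).
Proof.
rewrite /gmat -invmx_map; last by rewrite unitmx_mul (valP g) (valP (zgl A)).
by rewrite map_mxM -(zgl_map u).
Qed.

Definition ungmat A (g : 'M[A]_4) (gU : g \in unitmx) : gl A :=
  glM (glV (mkgl gU)) (glV (zgl A)).
Lemma ungmatK A (g : 'M[A]_4) (gU : g \in unitmx) : gmat (ungmat gU) = g.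
Proof.
apply: invmx_eq; rewrite -[val (ungmat gU)]/(invmx g *m invmx (val (zgl A))).
by rewrite mulmxKV ?mulVmx //; exact: (valP (zgl A)).
Qed.
Lemma gmat_inj A (g h : gl A) : gmat g = gmat h -> g = h.
Proof.
move=> /(congr1 invmx); rewrite !invmxK => /(congr1 (mulmxr (invmx (val (zgl A))))) /=.
by rewrite !mulmxK; [move/gl_eq|exact: (valP (zgl A))|exact: (valP (zgl A))].
Qed.

Lemma gc_unit A (p : X A) : gc p \in unitmx. Proof. exact: gmat_unit. Qed.
Lemma gc_map A B (u : {lrmorphism A -> B}) (p : X A) : gc (pmap u p) = map_mx u (gc p).
Proof. by rewrite /gc mor_nat gmat_map. Qed.

Definition yof A (c : 'M[A]_4) (w : 'I_4 -> A) : gl A :=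
  insubd (gl1 A) (Jconj (frm q c w)).
(* (c, w) are coordinates on E; the inverse of c makes this an action from the
   right. *)
Definition eact A (c : gl A) (w : 'I_4 -> A) (p : X A) : X A :=
  zact (glV c) (yof (val c) w) p.

Lemma yofE A (c : gl A) (w : 'I_4 -> A) : Pshape (val c) ->
  val (yof (val c) w) = Jconj (frm q (val c) w).
Proof.
have [fr frE] := hfr A; move=> cP; rewrite val_insubd Jconj_unit //.
by apply: (frm_unit frE) => //; exact: valP.
Qed.

Lemma glVV A (c : gl A) : glV (glV c) = c.
Proof. by apply: gl_eq; rewrite /= invmxK. Qed.

Lemma zipE_yof A (c : gl A) (w : 'I_4 -> A) : Pshape (val c) -> zipE q (glV c) (yof (val c) w).
Proof.
have [fr frE] := hfr A; move=> cP; apply/(zipEP frE); exists c, w; split=> //.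
exact: yofE.
Qed.

Lemma zipE_eact A (x y : gl A) : zipE q x y -> exists (c : gl A) (w : 'I_4 -> A),
  [/\ Pshape (val c), x = glV c, y = yof (val c) w & forall p, zact x y p = eact c w p].
Proof.
have [fr frE] := hfr A; move=> /(zipEP frE)[c [w [cP ex ey]]].
have eyy : y = yof (val c) w by apply: gl_eq; rewrite yofE.
by exists c, w; split=> // p; rewrite /eact -ex -eyy.
Qed.

Lemma conj_invmx A (c g y z : 'M[A]_4) : c \in unitmx -> g \in unitmx -> y \in unitmx ->
    z \in unitmx ->
  invmx (invmx c *m g *m invmx y *m z) = (invmx z *m y *m z) *m invmx (g *m z) *m c.
Proof.
move=> cU gU yU zU; apply: invmx_eq.
have gzU : g *m z \in unitmx by rewrite unitmx_mul gU.
rewrite !mulmxA -[_ *m z *m invmx z]mulmxA mulmxV // mulmx1 mulmxKV //.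
by rewrite -[_ *m g *m z]mulmxA mulmxK // mulVmx.
Qed.

Lemma gc_eact A (c : gl A) (w : 'I_4 -> A) (p : X A) : Pshape (val c) ->
  gc (eact c w p) = bmat q (val c) w *m gc p *m val c.
Proof.
move=> cP; have zy := zipE_yof w cP; rewrite /gc zphi_equiv //.
have [fr frE] := hfr A.
set g := zphi X A p; have yU := valP (yof (val c) w); have zU := valP (zgl A).
have e : bmat q (val c) w = invmx (val (zgl A)) *m val (yof (val c) w) *m val (zgl A).
  rewrite yofE // zglV_E zglE /bmat /Jconj !mulmxA -[Pi A *m J A *m J A]mulmxA JJ mulmx1.
  by rewrite -[_ *m J A *m J A]mulmxA JJ mulmx1.
by rewrite /gmat e; apply: conj_invmx => //; [apply: (valP c)|apply: (valP g)].
Qed.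

Lemma eact_nat A B (u : {lrmorphism A -> B}) (c : gl A) (w : 'I_4 -> A) (p : X A) : Pshape (val c) ->
  pmap u (eact c w p) = eact (gl_map u c) (u \o w) (pmap u p).
Proof.
have [fr frE] := hfr A; have [fr' frE'] := hfr B.
move=> cP; rewrite /eact zact_nat; last exact: zipE_yof.
rewrite gl_mapV; congr (zact _ _ _); apply: gl_eq.
have cP' : Pshape (val (gl_map u c)) by move=> i ni; rewrite mxE cP ?rmorph0.
rewrite yofE //= yofE // /Jconj !map_mxM -map_trmx.
have -> : map_mx u (J A) = J B by apply/matrixP => i j; rewrite !mxE rmorph_nat.
congr (_ *m _^T *m _); apply/matrixP => i j; rewrite !mxE.
by case: ifP => // _; case: ifP => _; rewrite rmorphXn ?rmorph0.
Qed.

Lemma eact_comp A (c c' : gl A) (w w' : 'I_4 -> A) : Pshape (val c) -> Pshape (val c') ->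
  exists w2, forall p, eact c w (eact c' w' p) = eact (glM c' c) w2 p.
Proof.
have [fr frE] := hfr A; move=> cP c'P; have [w2 e] := frm_mul frE w w' cP c'P.
exists w2 => p; rewrite /eact -zactM; try exact: zipE_yof.
rewrite glVM; congr (zact _ _ _); apply: gl_eq.
have ccP : Pshape (val (glM c' c)) by exact: PshapeM.
by rewrite -[val (glM (yof _ _) _)]/(_ *m _) !yofE //= -e JconjM.
Qed.

Lemma eact_inv A (c : gl A) (w : 'I_4 -> A) : Pshape (val c) ->
  exists w2, forall p, eact (glV c) w2 (eact c w p) = p.
Proof.
have [fr frE] := hfr A; move=> cP; have [w2 e] := frm_inv frE w cP (valP c).
have iP : Pshape (val (glV c)) by case: (Pshape_unit (mulmxV (valP c)) cP).
exists w2 => p; rewrite /eact -zactM; try exact: zipE_yof.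
rewrite -[RHS]zact1; congr (zact _ _ _); apply: gl_eq.
  by rewrite /= invmxK mulmxV //; exact: valP.
by rewrite -[LHS]/(_ *m _) !yofE // -JconjM e Jconj1.
Qed.

Lemma lower_inv A (c : gl A) : lower (val c) -> lower (val (glV c)).
Proof.
move=> cL; have cU := valP c.
have trg (M : 'M[A]_4) : lower M <-> is_trig_mx M.
  by split=> [h|/is_trig_mxP h i j]; [apply/is_trig_mxP => i j; apply: h|exact: h].
have d : forall i, val c i i \is a GRing.unit.
  move=> i; have : \det (val c) \is a GRing.unit by rewrite -unitmxE.
  have cT : is_trig_mx (val c) by apply/trg.
  rewrite (det_trig cT) (bigD1 i) //= unitrM.
  by case/andP.
suff h n : forall i j : 'I_4, (i < n)%N -> (i < j)%N -> invmx (val c) i j = 0.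
  by move=> i j; apply: h (ltn_ord i).
elim: n => // n IH i j; rewrite ltnS => ni ij.
have := congr1 (fun M : 'M_4 => M i j) (mulmxV cU); rewrite !mxE (bigD1 i) //= big1 => [|l nl].
  by rewrite addr0 -val_eqE (ltn_eqF ij) => h; apply: (mulrI (d i)); rewrite mulr0.
have [li|il] := ltnP l i; last by rewrite cL ?mul0r // ltn_neqAle il eq_sym nl.
by rewrite IH ?mulr0 //; [apply: leq_trans ni|apply: ltn_trans ij].
Qed.
Definition Y (S : seq ('I_4 * 'I_4)) : subfun X := fun A p => forall ij, ij \in S -> gc p ij.1 ij.2 = 0.

(* S is closed under going up and right, so E' preserves [Y S]. *)
Definition stair (S : seq ('I_4 * 'I_4)) : Prop := forall ij, ij \in S ->
  (ij.1 < ij.2)%N /\ forall kl : 'I_4 * 'I_4, (kl.1 <= ij.1)%N -> (ij.2 <= kl.2)%N -> kl \in S.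

Lemma Y_map S A B (u : {lrmorphism A -> B}) (p : X A) : Y S p -> Y S (pmap u p).
Proof. by move=> h ij hij; rewrite gc_map mxE h ?rmorph0. Qed.

Lemma Y_eact S A (c : gl A) w (p : X A) : stair S -> lower (val c) -> Y S p -> Y S (eact c w p).
Proof.
move=> st cL pY [i j] hij; rewrite gc_eact; last exact: lower_P.
have [_ h] := st _ hij; rewrite corner_entry //; last by move=> k' l hk hl _; apply: (pY (k', l)); exact: (h (k', l)).
  by rewrite pY // mulr0 mul0r.
exact: bmat_lower.
Qed.

Lemma entry_eact S (ij : 'I_4 * 'I_4) A (c : gl A) w (p : X A) : stair (ij :: S) -> lower (val c) -> Y S p ->
  gc (eact c w p) ij.1 ij.2 =
  val c (w0I ij.1) (w0I ij.1) ^+ q * val c ij.2 ij.2 * gc p ij.1 ij.2.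
Proof.
case: ij => i j st cL pY; rewrite gc_eact; last exact: lower_P.
have [_ h] := st _ (mem_head _ _); rewrite corner_entry //=; last first.
  by move=> k' l hk hl ne; apply: (pY (k', l)); have := h (k', l) hk hl; rewrite inE (negbTE ne).
  exact: bmat_lower.
by rewrite bmat_diag mulrAC.
Qed.
End ZipSpace.

(** * Localized polynomial rings and elimination of generic parameters *)

Section PolynomialExtensions.
Variable k : fieldType.
Notation alg := (comUnitAlgType k).
Implicit Types A B C K R T : alg.

Lemma mpoly_alg A n : exists (C : alg) (e : {rmorphism {mpoly A[n]} -> C})
    (g : {rmorphism C -> {mpoly A[n]}}),
  [/\ cancel e g, cancel g e & forall a : k, e (a%:A)%:MP = a%:A].
Proof.
exact: (alg_of_ring ([the {rmorphism A -> {mpoly A[n]}} of @mpolyC n A] \o in_algm A)).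
Qed.

Section Generic.
Variables (n : nat) (D : {mpoly k[n]}) (D0 : D != 0).

Definition gev B (b : 'I_n -> B) : B := mmap (in_alg B) b D.

Lemma mmap_comp (A B C : comNzRingType) (f : {rmorphism A -> B}) (g : {rmorphism B -> C}) m (y : 'I_m -> B) p :
  g (mmap f y p) = mmap (g \o f) (g \o y) p.
Proof.
rewrite /mmap rmorph_sum; apply: eq_bigr => mm _; rewrite rmorphM; congr (_ * _).
by rewrite /mmap1 rmorph_prod; apply: eq_bigr => i _; rewrite rmorphXn.
Qed.

Lemma gev_map B C (u : {lrmorphism B -> C}) (b : 'I_n -> B) : u (gev b) = gev (u \o b).
Proof.
rewrite /gev /mmap rmorph_sum; apply: eq_bigr => mm _; rewrite rmorphM; congr (_ * _).
  exact: (rmorph_alg u).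
by rewrite /mmap1 rmorph_prod; apply: eq_bigr => i _; rewrite rmorphXn.
Qed.

Lemma gev_map_mpoly R B (w : {lrmorphism R -> B}) (b : 'I_n -> B) :
  mmap w b (map_mpoly (in_alg R) D) = gev b.
Proof.
have [g1 [g1C g1X g1E]] := mmap_rmorph w b.
have [g2 [g2C g2X g2E]] := mmap_rmorph (in_algm B) b.
rewrite -g1E /gev -g2E.
apply: (mmap_uniq (g := g1 \o [the {rmorphism _ -> _} of map_mpoly (in_algm R)]) (g' := g2)) => [c|j] /=.
  by rewrite map_mpolyC g1C g2C; exact: (rmorph_alg w).
by rewrite map_mpolyX g1X g2X.
Qed.

(** T is R[t_1, ..., t_n][1/D]. The four properties say that D is inverted, that T is universal for
    this, and that its elements are fractions of polynomials with independent coefficients. *)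
Record poly_ext R T (i : {lrmorphism R -> T}) (t : 'I_n -> T) : Prop := PolyExt {
  pe_unit : gev t \is a GRing.unit;
  pe_univ : forall B (w : {lrmorphism R -> B}) (b : 'I_n -> B), gev b \is a GRing.unit ->
    exists v : {lrmorphism T -> B}, v \o i =1 w /\ v \o t =1 b;
  pe_coef : forall x : T, exists N (P : {mpoly R[n]}), x * gev t ^+ N = mmap i t P;
  pe_inj : forall P : {mpoly R[n]}, mmap i t P = 0 -> P = 0 }.

(** D is defined over the field k, so its leading coefficient stays a unit over every R. *)
Lemma mpoly_nzd R (N : nat) (P : {mpoly R[n]}) : map_mpoly (in_alg R) D ^+ N * P = 0 -> P = 0.
Proof.
have reg : GRing.lreg (map_mpoly (in_alg R) D).
  have Dl : mleadc D != 0 by rewrite mleadc_eq0.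
  have e : mlead (map_mpoly (in_alg R) D) = mlead D.
    rewrite /mlead; apply: perm_big; apply: uniq_perm; rewrite ?msupp_uniq // => m.
    by rewrite !mcoeff_msupp mcoeff_map_mpoly /= scaler_eq0 oner_eq0 orbF.
  apply: lreg_mleadc; rewrite e mcoeff_map_mpoly /=; apply/mulrI/(rmorph_unit (in_algm R)); rewrite unitfE.
  by [].
elim: N => [|N IH]; first by rewrite expr0 mul1r.
by rewrite exprS -mulrA => /eqP; rewrite mulrI_eq0 // => /eqP.
Qed.

Lemma poly_ext_exists R : exists T (i : {lrmorphism R -> T}) t, poly_ext i t.
Proof.
have [C [e [g [eK gK eC]]]] := mpoly_alg R n.
have [c cE] := lrmorph_of (f := e \o [the {rmorphism R -> _} of @mpolyC n R]) eC.
pose DR := map_mpoly (in_alg R) D.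
have eE (P : {mpoly R[n]}) : e P = mmap c (fun j => e 'X_j) P.
  rewrite {1}[P]mpolyE rmorph_sum; apply: eq_bigr => m _.
  rewrite -mul_mpolyC rmorphM -[e _%:MP]cE; congr (_ * _).
  by rewrite mpolyXE_id rmorph_prod; apply: eq_bigr => j _; rewrite rmorphXn.
have DRn N : (e DR) ^+ N != 0.
  rewrite -rmorphXn; apply/eqP => /(congr1 g); rewrite eK rmorph0 => h.
  by have := @mpoly_nzd R N 1; rewrite mulr1 => /(_ h) /eqP; rewrite oner_eq0.
have [T [u uL]] := loc_exists DRn; have [uU ub ua] := uL.
pose i := [the {lrmorphism R -> T} of u \o c]; pose t j := u (e 'X_j).
have ueE (P : {mpoly R[n]}) : u (e P) = mmap i t P.
  by rewrite eE mmap_comp; apply: eq_bigr.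
have gD : gev t = u (e DR).
  by rewrite ueE /DR gev_map_mpoly.
exists T, i, t; split.
- by rewrite gD.
- move=> B w b bU.
  have [v0 [v0C v0X v0E]] := mmap_rmorph w b.
  have hv0 (a : k) : (v0 \o g) a%:A = a%:A.
    by rewrite /= -eC eK v0C; exact: (rmorph_alg w).
  have [v1 v1E] := lrmorph_of hv0.
  have [|v vE] := loc_univ (v := v1) uL.
    by rewrite v1E /= eK v0E gev_map_mpoly.
  exists v; split=> [a|j].
    by rewrite /= -[v (u _)]/((v \o u) (c a)) vE v1E /= cE /= eK v0C.
  by rewrite /= -[v (u _)]/((v \o u) (e 'X_j)) vE v1E /= eK v0X.
- move=> x; have [a [N h]] := ub x; exists N, (g a).
  by rewrite gD h -ueE gK.
- move=> P; rewrite -ueE => /ua[N]; rewrite -rmorphXn -rmorphM => /(congr1 g).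
  by rewrite eK rmorph0; exact: mpoly_nzd.
Qed.

Section Properties.
Variables (R T : alg) (i : {lrmorphism R -> T}) (t : 'I_n -> T) (pe : poly_ext i t).
Let DR := map_mpoly (in_alg R) D.

Lemma pe_D : mmap i t DR = gev t.
Proof. exact: gev_map_mpoly. Qed.

Lemma pe_ev : exists g : {rmorphism {mpoly R[n]} -> T}, forall p, g p = mmap i t p.
Proof. by have [g [_ _ gE]] := mmap_rmorph i t; exists g. Qed.

Lemma pe_uniq B (v v' : {lrmorphism T -> B}) : v \o i =1 v' \o i -> v \o t =1 v' \o t -> v =1 v'.
Proof.
move=> e1 e2 x; have [N [P hP]] := pe_coef pe x.
have eD : v (gev t) = v' (gev t).
  rewrite !gev_map /gev /mmap; apply: eq_bigr => m _; congr (_ * _).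
  by apply: eq_bigr => j _; rewrite e2.
have DU : v (gev t) ^+ N \is a GRing.unit by rewrite unitrX // rmorph_unit //; exact: pe_unit pe.
have h (w : {lrmorphism T -> B}) : w x * w (gev t) ^+ N = w (mmap i t P).
  by rewrite -hP rmorphM rmorphXn.
apply: (mulIr DU); rewrite h eD h !mmap_comp.
apply: eq_bigr => m _; congr (_ * _); first exact: e1.
by apply: eq_bigr => j _; rewrite e2.
Qed.

Lemma pe_coef_point K (y0 : {lrmorphism T -> K}) (P : {mpoly R[n]}) :
  y0 (mmap i t P) != 0 -> exists m, y0 (i P@_m) != 0.
Proof.
move=> h; apply: contrapT => ne; move/eqP: h; apply.
rewrite /mmap rmorph_sum big1 // => m _; rewrite rmorphM.
have [h|h] := eqVneq (y0 (i P@_m)) 0; last by case: ne; exists m.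
by rewrite -[RHS](mul0r (y0 (mmap1 t m))); congr (_ * _).
Qed.

(** A divisibility over T descends to R: x becomes a polynomial over R after multiplication by a
    power of D, one of its coefficients does not vanish at [y0], and the relation is compared at
    that monomial. *)
Lemma pe_trick K (y0 : {lrmorphism T -> K}) (F U : R) (x z : T) : is_field K ->
  x * i F = i U * z -> y0 x != 0 -> exists r s, y0 (i r) != 0 /\ r * F = U * s.
Proof.
move=> hK e yx; have [g gE] := pe_ev.
have gC a : g a%:MP = i a by rewrite gE mmapC.
have [N [P hP]] := pe_coef pe x; have [M [Q hQ]] := pe_coef pe z.
have eq : P * DR ^+ M * F%:MP = U%:MP * (Q * DR ^+ N).
  apply/eqP; rewrite -subr_eq0; apply/eqP/(pe_inj pe); rewrite -gE rmorphB !rmorphM !rmorphXn.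
  rewrite !gE pe_D -hP -hQ !mmapC; apply/eqP; rewrite subr_eq0; apply/eqP.
  transitivity (x * i F * gev t ^+ N * gev t ^+ M); first by ring.
  by rewrite e; ring.
have [|m hm] := @pe_coef_point K y0 (P * DR ^+ M).
  rewrite -gE rmorphM rmorphXn !gE pe_D -hP !rmorphM !rmorphXn.
  have yD : y0 (gev t) != 0.
    by rewrite -(unit_field _ hK) rmorph_unit //; exact: pe_unit pe.
  apply/eqP => /(field_mul hK)[/(field_mul hK)[]|]; apply/eqP => //; exact: field_expf.
exists (P * DR ^+ M)@_m, (Q * DR ^+ N)@_m; split=> //.
have := congr1 (mcoeff m) eq; rewrite mcoeffCM => <-.
by rewrite [_ * F%:MP]mulrC mcoeffCM mulrC.
Qed.

Lemma pe_nzd (U : R) : (forall b, U * b = 0 -> b = 0) -> forall x, i U * x = 0 -> x = 0.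
Proof.
move=> hU x e; have [g gE] := pe_ev; have [N [P hP]] := pe_coef pe x.
have gC a : g a%:MP = i a by rewrite gE mmapC.
have P0 : P = 0.
  apply/mpolyP => m; rewrite mcoeff0; apply: hU; rewrite -mcoeffCM.
  rewrite (_ : U%:MP * P = 0) ?mcoeff0 //; apply: (pe_inj pe).
  by rewrite -gE rmorphM gC gE -hP mulrA e mul0r.
have : x * gev t ^+ N = 0 by rewrite hP P0 mmap0.
by move/(congr1 (fun a => a / gev t ^+ N)); rewrite mulrK ?mul0r // unitrX //; exact: pe_unit pe.
Qed.

(** The coefficients are reduced to the image of R in its local ring at the point, which is a domain
    by smoothness; a product of polynomials over a domain vanishes only if a factor does. *)
Lemma pe_dom K (y0 : {lrmorphism T -> K}) (x z : T) : fingen R -> fsmooth R -> is_field K ->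
  x * z = 0 -> y0 x != 0 -> exists2 s, y0 (i s) != 0 & i s * z = 0.
Proof.
move=> fg sm hK e yx; have [g gE] := pe_ev.
have gC a : g a%:MP = i a by rewrite gE mmapC.
have [N [P hP]] := pe_coef pe x; have [M [Q hQ]] := pe_coef pe z.
have DU : gev t \is a GRing.unit by exact: pe_unit pe.
have PQ : P * Q = 0.
  apply: (pe_inj pe); rewrite -gE rmorphM !gE -hP -hQ.
  by rewrite mulrACA e mul0r.
have [m Pm] : exists m, y0 (i P@_m) != 0.
  apply: pe_coef_point; rewrite -hP rmorphM rmorphXn; apply/eqP => /(field_mul hK)[].
    exact/eqP.
  by apply/eqP/field_expf => //; rewrite -(unit_field _ hK) rmorph_unit.
have [y yE] : exists y : {lrmorphism R -> K}, y =1 y0 \o i by exists (y0 \o i).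
have hI : ideal (germ0 y).
  split=> [|a b [s ys hs] [s' ys' hs']|a b [s ys hs]].
  - by exists 1; rewrite ?mulr0 // rmorph1 oner_eq0.
  - exists (s * s'); last by rewrite mulrDr -[s * s' * a]mulrAC hs mul0r -mulrA hs' mulr0 addr0.
    by rewrite rmorphM; apply/eqP => /(field_mul hK)[]; exact/eqP.
  - by exists s => //; rewrite mulrCA hs mulr0.
have I1 : ~ germ0 y 1.
  by move=> [s ys]; rewrite mulr1 => s0; move: ys; rewrite s0 rmorph0 eqxx.
have [L [f [fs fk]]] := ring_quotient hI I1.
have domL (a b : L) : a * b = 0 -> a = 0 \/ b = 0.
  have [a' <-] := fs a; have [b' <-] := fs b; rewrite -rmorphM => /fk h.
  by have [h'|h'] := germ0_mul fg sm hK h; [left|right]; apply/fk.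
have Q0 : map_mpoly f Q = 0.
  apply: contrapT => /eqP Qn.
  have Pn : map_mpoly f P != 0.
    apply/eqP => /(congr1 (mcoeff m)); rewrite mcoeff0 mcoeff_map_mpoly => /fk.
    by move/(germ0_point hK); rewrite yE; apply/eqP.
  have := mleadcM (map_mpoly f P) (map_mpoly f Q).
  rewrite -rmorphM PQ rmorph0 mcoeff0 => /esym/domL[]/eqP.
    by rewrite mleadc_eq0 (negbTE Pn).
  by rewrite mleadc_eq0 (negbTE Qn).
have [s ys hs] : exists2 s, y s != 0 & forall m, m \in msupp Q -> s * Q@_m = 0.
  elim: (msupp Q : seq _) => [|m' r [s ys hs]]; first by exists 1; rewrite // rmorph1 oner_eq0.
  have [s' ys' hs'] : germ0 y Q@_m'.
    by apply/fk; have := congr1 (mcoeff m') Q0; rewrite mcoeff_map_mpoly mcoeff0.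
  exists (s * s') => [|m2]; first by rewrite rmorphM; apply/eqP => /(field_mul hK)[]; exact/eqP.
  by rewrite inE => /predU1P[->|/hs h]; rewrite ?[s * s']mulrC -mulrA ?h ?mulr0 // mulrC -mulrA [_ * s']mulrC hs' mulr0.
exists s; first by rewrite -[y0 _]yE.
have : i s * z * gev t ^+ M = 0.
  rewrite -mulrA hQ /mmap mulr_sumr big_seq big1 // => m' hm'.
  by rewrite mulrA -rmorphM hs // rmorph0 mul0r.
by move/(congr1 (fun a => a / gev t ^+ M)); rewrite mulrK ?mul0r // unitrX.
Qed.
End Properties.

End Generic.
End PolynomialExtensions.

(** * Truncated polynomial rings *)

Section Truncation.
Variable k : fieldType.
Notation alg := (comUnitAlgType k).
Implicit Types A B C K R T : alg.

(** C is A[t]/(t^L) and z is evaluation at t = 0. The case L = 2 gives tangent vectors; larger L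
    gives the jets of a flow. *)
Record truncation A (L : nat) C (c : {lrmorphism A -> C}) (t : C) (z : {lrmorphism C -> A}) : Prop :=
  Truncation {
  tr_nil : t ^+ L = 0;
  tr_z : forall a, z (c a) = a;
  tr_zt : z t = 0;
  tr_sum : forall x, exists a : nat -> A, x = \sum_(i < L) c (a i) * t ^+ i;
  tr_inj : forall a : nat -> A, \sum_(i < L) c (a i) * t ^+ i = 0 -> forall i, (i < L)%N -> a i = 0;
  tr_univ : forall B (w : {lrmorphism A -> B}) (b : B), b ^+ L = 0 ->
    exists v : {lrmorphism C -> B}, v \o c =1 w /\ v t = b }.

Lemma truncation_exists A L : exists C (c : {lrmorphism A -> C}) t z, truncation L.+1 c t z.
Proof.
pose j : {rmorphism k -> {poly A}} := [the {rmorphism A -> _} of polyC] \o in_algm A.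
pose I (p : {poly A}) := forall i, (i < L.+1)%N -> p`_i = 0.
have hI : ideal I.
  split=> [i _|p r hp hr i iL|p r hr i iL]; first by rewrite coef0.
    by rewrite coefD hp // hr // addr0.
  rewrite coefM big1 // => l _; rewrite hr ?mulr0 //.
  exact: leq_ltn_trans (leq_subr _ _) iL.
have I1 : ~ I 1 by move=> /(_ 0%N isT); rewrite coef1 => /eqP; rewrite oner_eq0.
have [C [f [fj fs fk]]] := @quotient_alg k _ j I hI I1.
have [c cE] := lrmorph_of (f := f \o [the {rmorphism A -> _} of polyC]) fj.
have hdrop (p : {poly A}) : I p -> p = drop_poly L.+1 p * 'X^(L.+1).
  move=> Ip; rewrite -[LHS](poly_take_drop L.+1) [X in X + _](_ : _ = 0) ?add0r //.
  by apply/polyP => i; rewrite coef_take_poly coef0; case: ifP => // /Ip.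
have univ B (w : {lrmorphism A -> B}) (b : B) : b ^+ L.+1 = 0 ->
    exists v : {lrmorphism C -> B}, v \o c =1 w /\ v (f 'X) = b.
  move=> bL; have [g [gC gX]] := horner_rmorph w b.
  have [||||v vE] := @factor_surj k _ C B f g (fun a => (a%:A)%:P).
  - exact: fs.
  - by move=> p /fk/hdrop ->; rewrite rmorphM rmorphXn gX bL mulr0.
  - exact: fj.
  - by move=> a; rewrite gC; exact: (rmorph_alg w a).
  by exists v; split=> [a|]; rewrite /= ?cE vE ?gC ?gX.
have [z [zc zt]] := univ A [the {lrmorphism A -> A} of idfun] 0 (expr0n _ L.+1).
have fsum (a : nat -> A) : f (\poly_(i < L.+1) a i) = \sum_(i < L.+1) c (a i) * f 'X ^+ i.
  rewrite poly_def rmorph_sum; apply: eq_bigr => i _.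
  by rewrite -mul_polyC rmorphM rmorphXn cE.
exists C, c, (f 'X), z; split=> //.
- by rewrite -rmorphXn; apply/fk => i iL; rewrite coefXn (ltn_eqF iL).
- move=> x; have [p <-] := fs x; exists (fun i => p`_i); rewrite -fsum.
  apply/eqP; rewrite -subr_eq0 -rmorphB; apply/eqP/fk => i iL.
  by rewrite coefB coef_poly iL subrr.
- move=> a; rewrite -fsum => /fk h i iL; by have := h i iL; rewrite coef_poly iL.
Qed.
End Truncation.

(** * Charts of the loci cut out by matrix entries *)

Section OpenSubfunctors.
Variable k : fieldType.
Notation alg := (comUnitAlgType k).
Implicit Types A B C K R : alg.

Lemma pmap_eq (X : presheaf k) A B (u v : {lrmorphism A -> B}) (x : X A) : u =1 v -> pmap u x = pmap v x.
Proof.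
move=> e; rewrite (pmap_comp (u := [the {lrmorphism A -> A} of idfun]) (v := v)) => [|a].
  by rewrite pmap_id.
exact: e.
Qed.
Lemma pmap2 (X : presheaf k) A B C (u : {lrmorphism A -> B}) (v : {lrmorphism B -> C}) (x : X A) :
  pmap v (pmap u x) = pmap [the {lrmorphism A -> C} of v \o u] x.
Proof. by apply/esym/pmap_comp. Qed.

(* An open subfunctor of Z, detected on field-valued points. *)
Record popen (X : presheaf k) (Z U : subfun X) : Prop := POpen {
  po_sub : forall A x, U A x -> Z A x;
  po_map : forall A B (u : {lrmorphism A -> B}) x, U A x -> U B (pmap u x);
  po_loc : forall A x, Z A x ->
    (forall K (y : {lrmorphism A -> K}), is_field K -> U K (pmap y x)) -> U A x;
  po_open : forall A x K (y : {lrmorphism A -> K}), Z A x -> is_field K -> U K (pmap y x) ->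
    exists2 d, y d != 0 & forall K' (y' : {lrmorphism A -> K'}), is_field K' -> y' d != 0 ->
      U K' (pmap y' x) }.

Lemma unit_ideal_sub A (D D' : A -> Prop) : (forall a, D a -> D' a) -> unit_ideal D -> unit_ideal D'.
Proof. by move=> h [n [c [d [hd e]]]]; exists n, c, d; split=> // i; apply: h. Qed.
Lemma unit_ideal1 A (D : A -> Prop) a : D a -> a \is a GRing.unit -> unit_ideal D.
Proof.
move=> Da aU; exists 1%N, (fun=> a^-1), (fun=> a); split=> //.
by rewrite big_ord1 mulVr.
Qed.

Lemma open_popen (X : presheaf k) (U : subfun X) : open_sub U -> popen (fun _ _ => True) U.
Proof.
move=> oU; split=> //.
- move=> A B u x Ux; have [D hD] := oU A x; apply/hD.
  have /hD/(unit_ideal_map u) : U A (pmap [the {lrmorphism A -> A} of idfun] x) by rewrite pmap_id.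
  by apply: unit_ideal_sub => b [_ [a Da <-] <-]; exists a.
- move=> A x _ h; have [D hD] := oU A x.
  rewrite -[x](pmap_id (u := [the {lrmorphism A -> A} of idfun])) //; apply/hD.
  have [uD|[K [y [hK yD]]]] := point_or_unit D.
    by apply: unit_ideal_sub uD => a Da; exists a.
  have /hD/(unit_ideal_point [the {lrmorphism K -> K} of idfun])[_ [a Da <-]] := h K y hK.
  by rewrite /= yD // eqxx.
- move=> A x K y _ hK /= Uy; have [D hD] := oU A x.
  have /hD/(unit_ideal_point [the {lrmorphism K -> K} of idfun])[_ [a Da <-] ya] := Uy.
  exists a => // K' y' hK' ya'; apply/hD; apply: (unit_ideal1 (a := y' a)); first by exists a.
  by rewrite (unit_field _ hK').
Qed.

Lemma popen_open (X : presheaf k) (U : subfun X) : popen (fun _ _ => True) U -> open_sub U.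
Proof.
move=> pU A x; pose D d := forall K' (y' : {lrmorphism A -> K'}), is_field K' -> y' d != 0 -> U K' (pmap y' x).
exists D => B u; split=> [Uu|uD].
  have [//|[K [y [hK yD]]]] := point_or_unit (fun b : B => exists2 a, D a & u a = b).
  have := po_map pU y Uu; rewrite pmap2 => Uy.
  have [d yd hd] := po_open pU I hK Uy.
  by move: yd; rewrite /= yD ?eqxx //; exists d.
apply: (po_loc pU) => // K y hK; rewrite pmap2.
have [_ [a Da <-] ya] := unit_ideal_point y uD.
exact: Da.
Qed.

Lemma sqzero_point C C0 (p : {lrmorphism C -> C0}) K (y : {lrmorphism C -> K}) : sqzero_ext p ->
  is_field K -> exists y0 : {lrmorphism C0 -> K}, forall c, y0 (p c) = y c.
Proof.
move=> [ps pk] hK; apply: (factor_surj (j := in_alg C)) => //.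
- move=> c pc; have := pk _ _ pc pc => /(congr1 y); rewrite rmorphM rmorph0.
  by move/(field_mul hK) => [].
- by move=> a; rewrite /= (rmorph_alg p).
- by move=> a; rewrite /= (rmorph_alg y).
Qed.

Lemma sqzero_unit C C0 (p : {lrmorphism C -> C0}) a : sqzero_ext p ->
  p a \is a GRing.unit -> a \is a GRing.unit.
Proof.
move=> sq pa; apply: unit_of_points => K y hK; have [y0 <-] := sqzero_point y sq hK.
by rewrite -(unit_field _ hK) rmorph_unit.
Qed.

Lemma fingen_surj A B (f : {lrmorphism A -> B}) : (forall b, exists a, f a = b) -> fingen A -> fingen B.
Proof.
move=> fs [n [y hy]]; exists n, (f \o y) => b; have [a <-] := fs b; have [P <-] := hy a.
exists P; rewrite (mmap_comp (in_algm A : {rmorphism k^o -> A}) f); apply: eq_bigr => m _; congr (_ * _).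
exact/esym/(rmorph_alg f).
Qed.

Definition generated B n (y : 'I_n -> B) (b : B) : Prop :=
  exists p : {mpoly k^o[n]}, mmap (in_alg B) y p = b.

Lemma generatedD B n (y : 'I_n -> B) a b : generated y a -> generated y b -> generated y (a + b).
Proof. by move=> [p <-] [r <-]; exists (p + r); rewrite mmapD. Qed.
Lemma generatedM B n (y : 'I_n -> B) a b : generated y a -> generated y b -> generated y (a * b).
Proof.
move=> [p <-] [r <-]; have [g [_ _ gE]] := mmap_rmorph (in_algm B : {rmorphism k^o -> B}) y.
by exists (p * r); rewrite -!gE rmorphM.
Qed.
Lemma generatedX B n (y : 'I_n -> B) i : generated y (y i).
Proof.
have [g [_ gX gE]] := mmap_rmorph (in_algm B : {rmorphism k^o -> B}) y.
by exists 'X_i; rewrite -gE gX.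
Qed.
Lemma generatedC B n (y : 'I_n -> B) (c : k) : generated y c%:A.
Proof. by exists (c : k^o)%:MP; rewrite mmapC. Qed.
Lemma generated_pow B n (y : 'I_n -> B) a N : generated y a -> generated y (a ^+ N).
Proof.
move=> ga; elim: N => [|N IH]; first by rewrite expr0 -(scale1r 1); exact: generatedC.
by rewrite exprS; exact: generatedM.
Qed.
Lemma generated_div B n (y : 'I_n -> B) a b N : generated y a^-1 -> a \is a GRing.unit ->
  generated y (b * a ^+ N) -> generated y b.
Proof.
move=> ga aU gb; rewrite -[b](mulrK (unitrX N aU)) -exprVn.
by apply: generatedM => //; exact: generated_pow.
Qed.

Lemma fingen_loc A B (s : A) (l : {lrmorphism A -> B}) : is_loc s l -> fingen A -> fingen B.
Proof.
move=> [sU lb _] [n [y hy]].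
pose y' (j : 'I_(n + 1)) := match split j with inl i => l (y i) | inr _ => (l s)^-1 end.
exists (n + 1)%N, y' => b; have [a [N e]] := lb b.
have g0 : generated y' (l s)^-1.
  by have := generatedX y' (rshift n ord0); rewrite /y' (unsplitK (inr _ ord0)).
apply: (generated_div g0 sU (N := N)); rewrite e; have [P <-] := hy a.
rewrite (mmap_comp (in_algm A : {rmorphism k^o -> A}) l); apply: (mmap_closed (S := generated y')).
- exact: generatedD.
- exact: generatedM.
- by move=> c /=; rewrite (rmorph_alg l); exact: generatedC.
- move=> i /=; have := generatedX y' (lshift 1 i).
  by rewrite /y' (unsplitK (inl _ i)).
Qed.
End OpenSubfunctors.

Section Charts.
Variables (q : nat) (k : fieldType) (X : zip_space q k).
Notation alg := (comUnitAlgType k).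
Implicit Types A B C K R : alg.
Notation cset := (seq ('I_4 * 'I_4)).
Implicit Types (S : cset) (c : 'I_4 * 'I_4).

(* Formal smoothness of V over the locus of GL_4 where the entries in S vanish. *)
Definition liftable S (V : subfun X) : Prop :=
  forall C C0 (p : {lrmorphism C -> C0}), sqzero_ext p ->
  forall (x0 : X C0) (G : gl C), V C0 x0 -> gl_map p G = zphi X C0 x0 ->
    (forall ij, ij \in S -> gmat G ij.1 ij.2 = 0) ->
  exists x : X C, [/\ V C x, zphi X C x = G & pmap p x = x0].

(** An open part of the locus where the entries in S vanish, represented by R and formally smooth
    over the same locus of GL_4. Finite generation is split off in [chart] because it is reached
    only after shrinking. *)
Record prechart S R (xi : X R) (V : subfun X) : Prop := Prechart {
  ch_open : popen (Y (X := X) S) V;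
  ch_lift : liftable S V;
  ch_in : V R xi;
  ch_univ : forall A x, V A x -> exists v : {lrmorphism R -> A}, pmap v xi = x;
  ch_uniq : forall A (v v' : {lrmorphism R -> A}), pmap v xi = pmap v' xi -> v =1 v' }.

Record chart S R (xi : X R) (V : subfun X) : Prop := Chart {
  ch_pre :> prechart S xi V;
  ch_fg : fingen R }.

Lemma chart_Y S R (xi : X R) V : chart S xi V -> Y S xi.
Proof. by move=> ch; apply: (po_sub (ch_open ch)); apply: ch_in ch. Qed.

(** Smoothness over k is smoothness over a locus of GL_4 followed by smoothness of that locus: its
    points lift by lifting the entries outside S arbitrarily and taking 0 on S. *)
Lemma chart_fsmooth S R (xi : X R) V : chart S xi V -> fsmooth R.
Proof.
move=> ch C C0 p sq v; have [ps pk] := sq.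
have Vx : V C0 (pmap v xi) := po_map (ch_open ch) v (ch_in ch).
pose G0 : 'M[C]_4 := \matrix_(i, j) if (i, j) \in S then 0 else projT1 (cid (ps (gc (pmap v xi) i j))).
have pG0 : map_mx p G0 = gc (pmap v xi).
  apply/matrixP => i j; rewrite !mxE; case: ifP => [h|_]; last by case: cid.
  by rewrite rmorph0 ((po_sub (ch_open ch) Vx) (i, j)).
have GU : G0 \in unitmx.
  by rewrite unitmxE; apply: (sqzero_unit sq); rewrite -det_map_mx pG0 -unitmxE gc_unit.
have [|ij hij|x [Vxx _ px]] := ch_lift ch sq (G := ungmat GU) Vx.
- by apply: gmat_inj; rewrite gmat_map ungmatK pG0.
- by rewrite ungmatK mxE -surjective_pairing hij.
have [w wx] := ch_univ ch Vxx; exists w => r.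
by apply: (ch_uniq ch (v := [the {lrmorphism R -> C0} of p \o w])); rewrite -pmap2 wx.
Qed.

(** The point is lifted to the dual numbers by moving the entry c alone, with derivative 1. An
    element that is nonzero at the point lifts to a unit, so it cannot kill an entry that becomes
    nonzero. *)
Lemma chart_coord S R (xi : X R) V K (y : {lrmorphism R -> K}) c : chart S xi V -> is_field K ->
  c \notin S -> ~ germ0 y (gc xi c.1 c.2).
Proof.
move=> ch hK cS [s ys su]; have [C [cc [t [z tr]]]] := truncation_exists K 1.
have zsum x : exists a b, x = cc a + cc b * t.
  have [a ->] := tr_sum tr x; exists (a 0%N), (a 1%N).
  by rewrite big_ord_recl big_ord1 /= expr0 mulr1 expr1.
have zE a b : z (cc a + cc b * t) = a by rewrite rmorphD rmorphM /= !(tr_z tr) (tr_zt tr) mulr0 addr0.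
have sq : sqzero_ext z.
  split=> [a|a a']; first by exists (cc a); rewrite (tr_z tr).
  have [a1 [b1 ->]] := zsum a; have [a2 [b2 ->]] := zsum a'; rewrite !zE => -> ->.
  by rewrite rmorph0 !add0r mulrACA -[t * t]/(t ^+ 2) (tr_nil tr) mulr0.
have Vx : V K (pmap y xi) := po_map (ch_open ch) y (ch_in ch).
pose G0 : 'M[C]_4 := map_mx cc (gc (pmap y xi)) + t *: delta_mx c.1 c.2.
have zG0 : map_mx z G0 = gc (pmap y xi).
  by apply/matrixP => i j; rewrite !mxE rmorphD rmorphM /= (tr_z tr) (tr_zt tr) mul0r addr0.
have GU : G0 \in unitmx.
  by rewrite unitmxE; apply: (sqzero_unit sq); rewrite -det_map_mx zG0 -unitmxE gc_unit.
have [|ij hij|x [Vxx ex zx]] := ch_lift ch sq (G := ungmat GU) Vx.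
- by apply: gmat_inj; rewrite gmat_map ungmatK zG0.
- rewrite ungmatK !mxE ((po_sub (ch_open ch) Vx) ij) // rmorph0 add0r.
  have : ij != c by apply: contraNneq cS => <-.
  by rewrite (surjective_pairing ij) (surjective_pairing c) xpair_eqE /= => /negbTE->; rewrite mulr0.
have [w wx] := ch_univ ch Vxx.
have zw : z \o w =1 y.
  by apply: (ch_uniq ch (v := [the {lrmorphism R -> K} of z \o w])); rewrite -pmap2 wx.
have ws : w s \is a GRing.unit.
  by apply: (sqzero_unit sq); rewrite -[z _]/((z \o w) s) zw (unit_field _ hK).
have wu : w (gc xi c.1 c.2) = 0.
  by apply: (mulrI ws); rewrite mulr0 -rmorphM su rmorph0.
have : cc (gc (pmap y xi) c.1 c.2) + cc 1 * t = 0.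
  rewrite -wu; have -> : w (gc xi c.1 c.2) = gc x c.1 c.2 by rewrite -wx gc_map mxE.
  by rewrite /gc ex ungmatK !mxE !eqxx mulr1 rmorph1 mul1r.
move=> e; have := tr_inj tr (a := fun i => if i == 0%N then gc (pmap y xi) c.1 c.2 else 1).
rewrite big_ord_recl big_ord1 /= expr0 mulr1 expr1 => /(_ e 1%N isT) /eqP.
by rewrite oner_eq0.
Qed.

Lemma chart_nzd S R (xi : X R) V c b : chart S xi V -> c \notin S ->
  gc xi c.1 c.2 * b = 0 -> b = 0.
Proof.
move=> ch cS; apply: smooth_nonzerodivisor; [exact: ch_fg ch|exact: chart_fsmooth ch|].
by move=> K y hK; apply: (chart_coord ch).
Qed.

Lemma prechart_loc S R (xi : X R) V s K (v : {lrmorphism R -> K}) :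
  prechart S xi V -> is_field K -> v s != 0 ->
  exists R' (l : {lrmorphism R -> R'}) V' (v' : {lrmorphism R' -> K}),
    [/\ is_loc s l, prechart S (pmap l xi) V', v' \o l =1 v & forall A x, V' A x -> V A x].
Proof.
move=> ch hK vs; have [R' [l [v' [lL vE]]]] := loc_at hK vs; have [lU lb la] := lL.
pose V' A (x : X A) := V A x /\ forall u : {lrmorphism R -> A}, pmap u xi = x -> u s \is a GRing.unit.
exists R', l, V', v'; split=> //; last by move=> A x [].
have oV := ch_open ch.
split.
- split.
  + by move=> A x [Vx _]; exact: (po_sub oV Vx).
  + move=> A B u x [Vx us]; split; first exact: (po_map oV).
    move=> w wx; have [w0 w0x] := ch_univ ch Vx.
    have <- : (u \o w0) s = w s.
      by apply: (ch_uniq ch (v := [the {lrmorphism R -> B} of u \o w0])); rewrite -pmap2 w0x.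
    by apply: (rmorph_unit u); exact: (us w0 w0x).
  + move=> A x Yx h; have Vx : V A x by apply: (po_loc oV) => // K' y hK'; case: (h K' y hK').
    split=> // u ux; apply: unit_of_points => K' y hK'; have [_ hs] := h K' y hK'.
    rewrite -(unit_field _ hK'); apply: (hs [the {lrmorphism R -> K'} of y \o u]).
    by rewrite -pmap2 ux.
  + move=> A x K' y Yx hK' [Vy hs]; have [d yd hd] := po_open oV Yx hK' Vy.
    have [B [u [yB [uL yBE]]]] := loc_at hK' yd; have [uU ub ua] := uL.
    have VB : V B (pmap u x).
      apply: (po_loc oV); first exact: Y_map.
      move=> K2 y2 hK2; rewrite pmap2; apply: hd => //=.
      exact: is_field_of_loc uL.
    have [w wx] := ch_univ ch VB; have [a [N e]] := ub (w s).
    exists (d * a) => [|K2 y2 hK2].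
      have ya : y a = yB (w s) * yB (u d) ^+ N by rewrite -(yBE a) /= -e rmorphM rmorphXn.
      have yws : yB (w s) != 0.
        rewrite -(unit_field _ hK'); apply: (hs [the {lrmorphism R -> K'} of yB \o w]).
        by rewrite -pmap2 wx pmap2; apply: pmap_eq.
      have yud : yB (u d) ^+ N != 0 by apply: field_expf => //; exact: is_field_of_loc uL.
      rewrite rmorphM /= ya; apply/eqP => /(field_mul hK')[/eqP|/(field_mul hK')[]/eqP].
      - by rewrite (negbTE yd).
      - by rewrite (negbTE yws).
      - by rewrite (negbTE yud).
    rewrite rmorphM /= => nz; have y2d : y2 d != 0 by apply: contraNneq nz => ->; rewrite mul0r.
    have y2a : y2 a != 0 by apply: contraNneq nz => ->; rewrite mulr0.
    split; first exact: hd.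
    move=> w2 w2x; have [|yy yyE] := loc_univ (v := y2) uL; first by rewrite (unit_field _ hK2).
    have <- : (yy \o w) s = w2 s.
      apply: (ch_uniq ch (v := [the {lrmorphism R -> K2} of yy \o w])).
      by rewrite w2x -pmap2 wx pmap2; apply: pmap_eq.
    have : yy (w s) * yy (u d) ^+ N = y2 a by rewrite -yyE /= -e rmorphM rmorphXn.
    by rewrite (unit_field _ hK2) /= => e2; apply: contraNneq y2a => z0; rewrite -e2 z0 mul0r.
- move=> C C0 p sq x0 G [Vx0 h0] eG YG; have [x [Vx ex px]] := ch_lift ch sq Vx0 eG YG.
  exists x; split=> //; split=> // u ux; apply: (sqzero_unit sq).
  by apply: (h0 [the {lrmorphism R -> C0} of p \o u]); rewrite -pmap2 ux.
- split; first exact: (po_map oV l (ch_in ch)).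
  by move=> u /(ch_uniq ch) ->.
- move=> A x [Vx h]; have [u ux] := ch_univ ch Vx.
  have [w wE] := loc_univ lL (h u ux); exists w; rewrite pmap2 -ux; exact: pmap_eq.
- move=> A w w'; rewrite !pmap2 => /(ch_uniq ch) h; exact: (loc_hom_uniq lL).
Qed.

Lemma chart_loc S R (xi : X R) V s K (v : {lrmorphism R -> K}) :
  chart S xi V -> is_field K -> v s != 0 ->
  exists R' (l : {lrmorphism R -> R'}) V' (v' : {lrmorphism R' -> K}),
    [/\ is_loc s l, chart S (pmap l xi) V', v' \o l =1 v & forall A x, V' A x -> V A x].
Proof.
move=> ch hK vs; have [R' [l [V' [v' [lL ch' e sub]]]]] := prechart_loc ch hK vs.
exists R', l, V', v'; split=> //; split=> //; exact: fingen_loc lL (ch_fg ch).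
Qed.

Lemma chart_quot S R (xi : X R) V c K (v : {lrmorphism R -> K}) :
  chart S xi V -> is_field K -> v (gc xi c.1 c.2) = 0 ->
  exists R' (l : {lrmorphism R -> R'}) V' (v' : {lrmorphism R' -> K}),
    [/\ forall r', exists r, l r = r', forall r, l r = 0 <-> exists b, r = b * gc xi c.1 c.2,
      chart (c :: S) (pmap l xi) V', v' \o l =1 v & forall A x, V' A x <-> V A x /\ gc x c.1 c.2 = 0].
Proof.
move=> ch hK vu; set u := gc xi c.1 c.2 in vu *; pose I r := exists b, r = b * u.
have hI : ideal I.
  split=> [|_ _ [b ->] [b' ->]|a _ [b ->]]; first by exists 0; rewrite mul0r.
    by exists (b + b'); rewrite mulrDl.
  by exists (a * b); rewrite mulrA.
have I1 : ~ I 1 by move=> [b /(congr1 v)/eqP]; rewrite rmorph1 rmorphM /= vu mulr0 oner_eq0.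
have [R' [f [fj fs fk]]] := @quotient_alg k R (in_algm R) I hI I1.
have [l lE] := lrmorph_of fj.
have univ A (w : {lrmorphism R -> A}) : w u = 0 -> exists w' : {lrmorphism R' -> A}, w' \o l =1 w.
  move=> wu; have [r /fk[b ->]|||w' w'E] := factor_surj (f := f) (g := w) (j := in_alg R) fs.
  - by rewrite rmorphM /= wu mulr0.
  - exact: fj.
  - by move=> a; rewrite /= (rmorph_alg w).
  by exists w' => r; rewrite /= lE w'E.
have ls r' : exists r, l r = r' by have [r <-] := fs r'; exists r; rewrite lE.
have lk r : l r = 0 <-> exists b, r = b * u by rewrite lE fk.
have [v' v'E] := univ K v vu.
pose V' A (x : X A) := V A x /\ gc x c.1 c.2 = 0.
have oV := ch_open ch.
have lu : gc (pmap l xi) c.1 c.2 = 0 by rewrite gc_map mxE; apply/lk; exists 1; rewrite mul1r.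
exists R', l, V', v'; split=> //; split; last exact: fingen_surj ls (ch_fg ch).
split.
- split.
  + move=> A x [Vx x0] ij; rewrite inE => /predU1P[-> //|]; exact: (po_sub oV Vx).
  + move=> A B w x [Vx x0]; split; first exact: (po_map oV).
    by rewrite gc_map mxE x0 rmorph0.
  + move=> A x Yx h; split; last by apply: Yx; exact: mem_head.
    apply: (po_loc oV) => [ij hij|K' y hK']; last by case: (h K' y hK').
    by apply: Yx; rewrite inE hij orbT.
  + move=> A x K' y Yx hK' [Vy hs].
    have Yx' : Y S x by move=> ij hij; apply: Yx; rewrite inE hij orbT.
    have [d yd hd] := po_open oV Yx' hK' Vy; exists d => // K2 y2 hK2 y2d; split; first exact: hd.
    by rewrite gc_map mxE (Yx c) ?mem_head // rmorph0.
- move=> C C0 p sq x0 G [Vx0 h0] eG YG.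
  have [|x [Vx ex px]] := ch_lift ch sq Vx0 eG.
    by move=> ij hij; apply: YG; rewrite inE hij orbT.
  exists x; split=> //; split=> //; rewrite /gc ex; apply: YG; exact: mem_head.
- split=> //; exact: (po_map oV l (ch_in ch)).
- move=> A x [Vx h]; have [w wx] := ch_univ ch Vx.
  have [|w' w'E] := univ A w; first by rewrite -h -wx gc_map mxE.
  by exists w'; rewrite pmap2 -wx; exact: pmap_eq.
- move=> A w w'; rewrite !pmap2 => /(ch_uniq ch) h r'; have [r <-] := ls r'; exact: (h r).
Qed.
End Charts.

Section GenericMatrix.
Variable k : fieldType.
Notation alg := (comUnitAlgType k).
Implicit Types A B C K R : alg.

Definition vmat (Q : Type) (b : 'I_(4 * 4) -> Q) : 'M[Q]_4 := \matrix_(i, j) b (mxvec_index i j).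
Definition mxof (Q : Type) (M : 'M[Q]_4) : 'I_(4 * 4) -> Q := fun j => mxvec M 0 j.

Lemma vmatK (Q : Type) (M : 'M[Q]_4) : vmat (mxof M) = M.
Proof. by apply/matrixP => i j; rewrite mxE /mxof mxvecE. Qed.

Definition gdet : {mpoly k[4 * 4]} := \det (vmat (fun j => 'X_j)).

Lemma map_vmat (Q Q' : Type) (f : Q -> Q') b : map_mx f (vmat b) = vmat (f \o b).
Proof. by apply/matrixP => i j; rewrite !mxE. Qed.

Lemma gev_gdet B (b : 'I_(4 * 4) -> B) : gev gdet b = \det (vmat b).
Proof.
have [g [_ gX gE]] := mmap_rmorph (in_algm B) b.
rewrite /gev -gE /gdet -det_map_mx map_vmat; congr (\det _).
by apply/matrixP => i j; rewrite !mxE /= gX.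
Qed.

Lemma structure_map A : exists w : {lrmorphism k^o -> A}, forall c, w c = c%:A.
Proof.
have [|w wE] := @lrmorph_of k (k^o) A (in_algm A).
  by move=> a; rewrite /= -[a%:A]/(a * 1) mulr1.
by exists w.
Qed.

Lemma gdet_neq0 : gdet != 0.
Proof.
apply/eqP => e; have : gev gdet (mxof (1%:M : 'M[k^o]_4)) = 0 by rewrite e /gev mmap0.
by rewrite gev_gdet vmatK det1 => /eqP; rewrite oner_eq0.
Qed.

Lemma generic_gl : exists (T : alg) (i : {lrmorphism k^o -> T}) t (gu : gl T),
  [/\ poly_ext gdet i t, val gu = vmat t
    & forall A (G : gl A), exists a : {lrmorphism T -> A}, gl_map a gu = G].
Proof.
have [T [i [t pe]]] := poly_ext_exists gdet_neq0 (k^o : alg).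
have guU : vmat t \in unitmx by rewrite unitmxE -gev_gdet; exact: pe_unit pe.
exists T, i, t, (mkgl guU); split=> // A G.
have [wA _] := structure_map A.
have [|a [_ at_]] := pe_univ pe wA (b := mxof (val G)).
  by rewrite gev_gdet vmatK -unitmxE; exact: valP.
exists a; apply: gl_eq; rewrite /= map_vmat -[RHS]vmatK.
by apply/matrixP => i1 j; rewrite !mxE at_.
Qed.
End GenericMatrix.

Section ChartExistence.
Variables (q : nat) (k : fieldType) (X : zip_space q k).
Notation alg := (comUnitAlgType k).
Implicit Types A B C K R : alg.
Hypothesis smX : smooth_mor (zphi X).

(** The issue is finite generation over k. Smoothness makes R finitely presented over the algebra R'
    of a chart of GL_4, but that chart is an arbitrary affine open. After a function [d] of GL_4 is
    inverted, the image of R' comes from T[1/d], with T the coordinate ring of GL_4. *)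
Lemma chart_exists0 K (p : X K) : is_field K -> exists R (xi : X R) V, chart [::] xi V /\ V K p.
Proof.
move=> hK.
have [R [R' [xi [eta [U [V [h [[oU Uxi unU] [oV Veta unV] Up eh [fp sm]]]]]]]]] := smX p hK.
have pU := open_popen oU; have pV := open_popen oV.
have uniqU A (v v' : {lrmorphism R -> A}) : pmap v xi = pmap v' xi -> v =1 v'.
  move=> e; have [u [_ hu]] := unU _ _ (po_map pU v Uxi).
  by move=> r; rewrite (hu v) // (hu v').
have uniqV A (v v' : {lrmorphism R' -> A}) : pmap v eta = pmap v' eta -> v =1 v'.
  move=> e; have [u [_ hu]] := unV _ _ (po_map pV v Veta).
  by move=> r; rewrite (hu v) // (hu v').
have hxi A (v : {lrmorphism R -> A}) : zphi X A (pmap v xi) = pmap [the {lrmorphism R' -> A} of v \o h] eta.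
  by rewrite mor_nat -eh pmap2.
have UV A (x : X A) : U A x -> V A (zphi X A x).
  by move=> /unU[v [<- _]]; rewrite hxi; exact: (po_map pV).
have lift : liftable [::] U.
  move=> C C0 pp sq x0 G Ux0 eG _; have [v [vx _]] := unU _ _ Ux0.
  have VG : V C G.
    apply: (po_loc pV) => // K' y hK'; have [y0 y0E] := sqzero_point y sq hK'.
    have -> : pmap y (G : Gk k C) = pmap y0 (gl_map pp G : Gk k C0).
      by rewrite -[gl_map pp G]/(pmap pp (G : Gk k C)) pmap2; apply: pmap_eq => c; rewrite /= y0E.
    by rewrite eG; apply: (po_map pV); exact: UV.
  have [u [uG _]] := unV _ _ VG.
  have [|w [wh pw]] := sm _ _ pp sq u v.
    apply: (uniqV _ [the {lrmorphism R' -> C0} of v \o h] [the {lrmorphism R' -> C0} of pp \o u]).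
    by rewrite -hxi vx -pmap2 uG -eG.
  exists (pmap w xi); split; first exact: (po_map pU).
    by rewrite hxi -uG; apply: pmap_eq.
  by rewrite pmap2 -vx; apply: pmap_eq.
have pU' : popen (Y (X := X) [::]) U.
  case: pU => h1 h2 h3 h4; split=> // [A x _|A x K' y _]; [exact: h3|exact: h4].
have [v [vp _]] := unU _ _ Up.
have [T [i [t [gu [pe guE guP]]]]] := @generic_gl k.
have [y0 y0E] := guP K (zphi X K p); have [a aE] := guP R' eta.
have Vy0 : V K (pmap y0 (gu : Gk k T)).
  by rewrite -[pmap y0 _]/(gl_map y0 gu) y0E; exact: UV.
have [d yd hd] := po_open pV I hK Vy0.
have uniqT A (w w' : {lrmorphism T -> A}) : gl_map w gu = gl_map w' gu -> w =1 w'.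
  move=> e; apply: (pe_uniq pe) => [c|j].
    by rewrite /= -[c](mulr1 (c : k)) -[c * 1]/(c *: (1 : k^o)) !linearZ /= !rmorph1.
  have := congr1 (fun G : gl A => mxof (val G) j) e; rewrite /= guE !map_vmat.
  by rewrite /mxof; case/mxvec_indexP: j => i1 i2; rewrite !mxvecE !mxE.
have vha : [the {lrmorphism T -> K} of v \o [the {lrmorphism T -> R} of h \o a]] =1 y0.
  apply: uniqT; rewrite y0E -[p in RHS]vp hxi -aE.
  by apply: gl_eq; apply/matrixP => i1 i2; rewrite !mxE.
have vad : v (h (a d)) != 0 by rewrite -[v _]/((v \o (h \o a)) d) [X in X != 0](vha d).
have pch : prechart [::] xi U.
  split=> // A x /unU[u [ux _]]; by exists u.
have [Rs [l [U' [v' [lL pch' v'E sub]]]]] := prechart_loc pch hK vad.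
exists Rs, (pmap l xi), U'; split; last first.
  rewrite -vp (pmap_eq (v := [the {lrmorphism R -> K} of v' \o l])); last by move=> r; rewrite -v'E.
  by rewrite -pmap2; exact: (po_map (ch_open pch') v' (ch_in pch')).
split=> //; have [lU lb _] := lL.
have [Td [m [ym [mL ymE]]]] := loc_at hK yd; have [mU mb ma] := mL.
have VTd : V Td (pmap m (gu : Gk k T)).
  apply: (po_loc pV) => // K' y hK'; rewrite pmap2; apply: hd => //=.
  exact: is_field_of_loc mL.
have [b [bE _]] := unV _ _ VTd.
have [|e eE] := loc_univ (v := [the {lrmorphism T -> Rs} of l \o [the {lrmorphism T -> R} of h \o a]]) mL.
  exact: lU.
have eb : e \o b =1 l \o h.
  apply: (uniqV _ [the {lrmorphism R' -> Rs} of e \o b] [the {lrmorphism R' -> Rs} of l \o h]).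
  rewrite -pmap2 bE -(aE) pmap2 -[gl_map a gu]/(pmap a (gu : Gk k T)) pmap2; apply: pmap_eq => x.
  exact: eE.
have [n [z [_ [_ [hz _]]]]] := fp.
pose tt j := l (h (a (t j))).
have ttU : gev (gdet k) tt \is a GRing.unit.
  rewrite (_ : gev _ tt = l (h (a (gev (gdet k) t)))); last by rewrite !gev_map.
  by do 3 apply: rmorph_unit; exact: pe_unit pe.
(* The generators are those of R over R', the sixteen entries of the matrix, and the inverses of [d]
   and of the determinant. *)
pose gens (j : 'I_(n + (4 * 4 + 2))) := match split j with
  | inl j1 => l (z j1)
  | inr j2 => match split j2 with
    | inl j3 => tt j3
    | inr j4 => if j4 == 0 :> nat then (l (h (a d)))^-1 else (gev (gdet k) tt)^-1 end end.
have gz j : generated gens (l (z j)).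
  by have := generatedX gens (lshift _ j); rewrite /gens (unsplitK (inl _ j)).
have gt j : generated gens (tt j).
  by have := generatedX gens (rshift n (lshift 2 j)); rewrite /gens (unsplitK (inr _ _)) (unsplitK (inl _ j)).
have gs : generated gens (l (h (a d)))^-1.
  by have := generatedX gens (rshift n (rshift (4 * 4) (0 : 'I_2))); rewrite /gens !(unsplitK (inr _ _)).
have gD : generated gens (gev (gdet k) tt)^-1.
  by have := generatedX gens (rshift n (rshift (4 * 4) (1 : 'I_2))); rewrite /gens !(unsplitK (inr _ _)).
have gR' r' : generated gens (l (h r')).
  rewrite -[l _]/((l \o h) r') -eb /=; have [tau [N hN]] := mb (b r').
  apply: (generated_div gs lU (N := N)).
  have -> : l (h (a d)) = e (m d) by rewrite -[RHS]/((e \o m) d) eE.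
  have -> : e (b r') * e (m d) ^+ N = l (h (a tau)).
    by rewrite -rmorphXn -rmorphM hN; exact: (eE tau).
  have [M [P hP]] := pe_coef pe tau.
  apply: (generated_div gD ttU (N := M)).
  have -> : gev (gdet k) tt = l (h (a (gev (gdet k) t))) by rewrite !gev_map.
  have -> : l (h (a tau)) * l (h (a (gev (gdet k) t))) ^+ M = l (h (a (mmap i t P))).
    by rewrite -hP 3!rmorphM !rmorphXn.
  rewrite !mmap_comp; apply: (mmap_closed (S := generated gens)).
  - exact: generatedD.
  - exact: generatedM.
  - move=> c /=; rewrite -[c](mulr1 (c : k)) -[c * 1]/(c *: (1 : k^o)) !linearZ /= !rmorph1.
    exact: generatedC.
  - exact: gt.
exists _, gens => x; have [r [N e1]] := lb x.
apply: (generated_div gs lU (N := N)); rewrite e1; have [P <-] := hz r.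
rewrite mmap_comp; apply: (mmap_closed (S := generated gens)).
- exact: generatedD.
- exact: generatedM.
- exact: gR'.
- exact: gz.
Qed.
End ChartExistence.

Section LocalDivisibility.
Variable k : fieldType.
Notation alg := (comUnitAlgType k).
Implicit Types A B C K R T : alg.

Lemma loc_dvd A B (d : A) (l : {lrmorphism A -> B}) K (y : {lrmorphism B -> K}) (F U : A) (s b : B) :
  is_loc d l -> is_field K -> y s != 0 -> s * l F = l U * b ->
  exists r c, y (l r) != 0 /\ r * F = U * c.
Proof.
move=> lL hK ys e; have [lU lb la] := lL; have yd := is_field_of_loc y hK lL.
have [s' [N eN]] := lb s; have [b' [M eM]] := lb b.
have [L eL] : exists L, d ^+ L * (s' * d ^+ M * F - U * b' * d ^+ N) = 0.
  apply: la; rewrite rmorphB !rmorphM !rmorphXn /= -eN -eM.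
  apply/eqP; rewrite subr_eq0; apply/eqP.
  transitivity (s * l F * l d ^+ N * l d ^+ M); first by ring.
  by rewrite e; ring.
exists (d ^+ L * s' * d ^+ M), (d ^+ L * b' * d ^+ N); split.
  have e1 : l s' = s * l d ^+ N by rewrite eN.
  rewrite !rmorphM !rmorphXn /= e1 rmorphM rmorphXn.
  by apply/eqP => /(field_mul hK)[/(field_mul hK)[|/(field_mul hK)[]]|]; apply/eqP => //; exact: field_expf.
apply/eqP; rewrite -subr_eq0; apply/eqP; rewrite -[RHS]eL; ring.
Qed.

Lemma loc_nzd A B (d : A) (l : {lrmorphism A -> B}) (U : A) :
  is_loc d l -> (forall a, U * a = 0 -> a = 0) -> forall b, l U * b = 0 -> b = 0.
Proof.
move=> [lU lb la] hU b e; have [a [N h]] := lb b.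
have : l (U * a) = 0 by rewrite rmorphM /= -h mulrA e mul0r.
move=> /la[M]; rewrite mulrCA => /hU e2.
have : l (d ^+ M * a) = 0 by rewrite e2 rmorph0.
rewrite rmorphM rmorphXn /= -h => e3.
have dU : l d ^+ (M + N) \is a GRing.unit by rewrite unitrX.
by apply: (mulIr dU); rewrite mul0r exprD -[RHS]e3; ring.
Qed.

Lemma expr_nzd A (U : A) m : (forall a, U * a = 0 -> a = 0) -> forall a, U ^+ m * a = 0 -> a = 0.
Proof.
move=> hU; elim: m => [|m IH] a; first by rewrite expr0 mul1r.
by rewrite exprS -mulrA => /hU/IH.
Qed.

Lemma nzd_cancel A (U a b : A) : (forall c, U * c = 0 -> c = 0) -> U * a = U * b -> a = b.
Proof.
move=> hU e; apply/eqP; rewrite -subr_eq0; apply/eqP/hU.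
by rewrite mulrBr e subrr.
Qed.

Lemma has_point A : exists K (y : {lrmorphism A -> K}), is_field K.
Proof.
have [|K [y [hK _]]] := @point_exists k A 1; last by exists K, y.
by move=> n; rewrite expr1n oner_eq0.
Qed.
End LocalDivisibility.

(** * Generic elements of matrix groups with prescribed zeros *)

Section Families.
Variables (k : fieldType) (mask : 'I_4 -> 'I_4 -> bool).
Hypothesis mask_diag : forall i, mask i i.
Notation alg := (comUnitAlgType k).
Implicit Types A B C K R T : alg.

Definition shaped (Q : nmodType) (c : 'M[Q]_4) : Prop := forall i j, ~~ mask i j -> c i j = 0.
Definition emat (Q : nmodType) (b : 'I_(4 * 4 + 4) -> Q) : 'M[Q]_4 :=
  \matrix_(i, j) if mask i j then b (lshift 4 (mxvec_index i j)) else 0.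
Definition edet : {mpoly k[4 * 4 + 4]} := \det (emat (fun j => 'X_j)).

Lemma gev_edet B (b : 'I_(4 * 4 + 4) -> B) : gev edet b = \det (emat b).
Proof.
have [g [_ gX gE]] := mmap_rmorph (in_algm B) b.
rewrite /gev -gE /edet -det_map_mx; congr (\det _).
by apply/matrixP => i j; rewrite !mxE; case: ifP => _; rewrite ?rmorph0 ?gX.
Qed.

Definition epar (Q : nmodType) (c : 'M[Q]_4) (w : 'I_4 -> Q) (j : 'I_(4 * 4 + 4)) : Q :=
  match split j with inl j1 => mxof c j1 | inr j2 => w j2 end.
Lemma emat_epar (Q : nmodType) (c : 'M[Q]_4) w : shaped c -> emat (epar c w) = c.
Proof.
move=> cs; apply/matrixP => i j; rewrite mxE; case: ifP => [_|/negbT/cs -> //].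
by rewrite /epar (unsplitK (inl _ _)) /mxof mxvecE.
Qed.

Lemma edet_neq0 : edet != 0.
Proof.
have s1 : shaped (1%:M : 'M[k^o]_4).
  by move=> i j; rewrite mxE; have [->|//] := eqVneq i j; rewrite mask_diag.
apply/eqP => e; have : gev edet (epar (1%:M : 'M[k^o]_4) (fun=> 0)) = 0 by rewrite e /gev mmap0.
by rewrite gev_edet emat_epar // det1 => /eqP; rewrite oner_eq0.
Qed.

(* T is the coordinate ring over R of the group of parameters (c, w) with c
   supported on the mask. *)
Record efam R T (i : {lrmorphism R -> T}) (c : gl T) (w : 'I_4 -> T) : Prop := Efam {
  ef_shape : shaped (val c);
  ef_univ : forall B (f : {lrmorphism R -> B}) (cB : gl B) (wB : 'I_4 -> B), shaped (val cB) ->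
    exists v : {lrmorphism T -> B}, [/\ v \o i =1 f, gl_map v c = cB & v \o w =1 wB];
  ef_trick : forall K (y : {lrmorphism T -> K}) (F U : R) (x z : T), is_field K ->
    x * i F = i U * z -> y x != 0 -> exists r s, y (i r) != 0 /\ r * F = U * s;
  ef_nzd : forall U : R, (forall b, U * b = 0 -> b = 0) -> forall x, i U * x = 0 -> x = 0;
  ef_dom : forall K (y : {lrmorphism T -> K}) (x z : T), fingen R -> fsmooth R -> is_field K ->
    x * z = 0 -> y x != 0 -> exists2 s, y (i s) != 0 & i s * z = 0 }.

Lemma efam_exists R : exists T (i : {lrmorphism R -> T}) c w, efam i c w.
Proof.
have [T [i [t pe]]] := poly_ext_exists edet_neq0 R.
have cU : emat t \in unitmx by rewrite unitmxE -gev_edet; exact: pe_unit pe.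
exists T, i, (mkgl cU), (fun j => t (rshift (4 * 4) j)); split.
- by move=> i1 j nm; rewrite /= mxE (negbTE nm).
- move=> B f cB wB sB; have [|v [vi vt]] := pe_univ pe f (b := epar (val cB) wB).
    by rewrite gev_edet emat_epar // -unitmxE; exact: valP.
  exists v; split=> //.
    apply: gl_eq; rewrite /= -[RHS](emat_epar wB sB); apply/matrixP => i1 j.
    by rewrite !mxE; case: ifP => _; rewrite ?rmorph0 // -[v _]/((v \o t) _) vt.
  by move=> j; rewrite /= -[v _]/((v \o t) _) vt /epar (unsplitK (inr _ _)).
- move=> K y F U x z; exact: (pe_trick pe).
- exact: (pe_nzd pe).
- move=> K y x z; exact: (pe_dom pe).
Qed.
End Families.

Definition low_mask (i j : 'I_4) := ~~ (i < j)%N.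
Definition par_mask (i j : 'I_4) := ~~ ((i != ord_max) && (j == ord_max)).
Lemma low_diag i : low_mask i i. Proof. by rewrite /low_mask ltnn. Qed.
Lemma par_diag i : par_mask i i. Proof. by rewrite /par_mask; case: eqP. Qed.

Lemma shaped_P (Q : comUnitRingType) (c : 'M[Q]_4) :
  shaped par_mask c <-> Pshape c.
Proof.
split=> [h i ni|h i j]; first by apply: h; rewrite /par_mask ni eqxx.
by rewrite /par_mask negbK => /andP[ni /eqP->]; exact: h.
Qed.
Lemma shaped_lower (Q : comUnitRingType) (c : 'M[Q]_4) :
  shaped low_mask c <-> lower c.
Proof. by split=> h i j ij; apply: h; move: ij; rewrite /low_mask negbK. Qed.

(** * Semi-invariant functions and their restrictions *)

Section Germs.
Variables (q : nat) (k : fieldType) (X : zip_space q k).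
Notation alg := (comUnitAlgType k).
Implicit Types A B C K R : alg.
Hypothesis q0 : (0 < q)%N.
Hypothesis hfr : forall A, exists fr : {rmorphism A -> A}, forall a, fr a = a ^+ q.
Hypothesis smX : smooth_mor (zphi X).
Notation cset := (seq ('I_4 * 'I_4)).
Implicit Types (S : cset) (F U : forall A, X A -> A).

Lemma chart_exists S K (p : X K) : is_field K -> Y S p ->
  exists R (xi : X R) V (v : {lrmorphism R -> K}), chart S xi V /\ pmap v xi = p.
Proof.
move=> hK; elim: S => [_|c S IH Yp].
  have [R [xi [V [ch Vp]]]] := chart_exists0 smX p hK.
  by have [v vp] := ch_univ ch Vp; exists R, xi, V, v.
have [|R [xi [V [v [ch vp]]]]] := IH.
  by move=> ij h; apply: Yp; rewrite inE h orbT.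
have [|R' [l [V' [v' [_ _ ch' e _]]]]] := chart_quot (v := v) (c := c) ch hK.
  by have := Yp c (mem_head _ _); rewrite -vp gc_map mxE.
exists R', (pmap l xi), V', v'; split=> //.
by rewrite pmap2 -vp; exact: pmap_eq.
Qed.

(** Charts form a basis of neighbourhoods: after one localization an arbitrary family x factors
    through the chart, which is how facts proved on a chart reach all families. *)
Lemma chart_near S R (xi : X R) V r A (x : X A) K (y : {lrmorphism A -> K}) (v : {lrmorphism R -> K}) :
  chart S xi V -> Y S x -> is_field K -> pmap v xi = pmap y x -> v r != 0 ->
  exists2 d, y d != 0 & forall B (u : {lrmorphism A -> B}), u d \is a GRing.unit ->
    exists w : {lrmorphism R -> B}, pmap w xi = pmap u x /\ w r \is a GRing.unit.
Proof.
move=> ch Yx hK e vr; have [R' [l [V' [v' [lL ch' v'E _]]]]] := chart_loc ch hK vr.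
have oV := ch_open ch'; have [lU _ _] := lL.
have V'y : V' K (pmap y x).
  rewrite -e -(pmap_eq (u := [the {lrmorphism R -> K} of v' \o l])) // -pmap2.
  exact: (po_map oV v' (ch_in ch')).
have [d yd hd] := po_open oV Yx hK V'y; exists d => // B u ud.
have VB : V' B (pmap u x).
  apply: (po_loc oV); first exact: Y_map.
  move=> K2 y2 hK2; rewrite pmap2; apply: hd => //=.
  by rewrite -(unit_field _ hK2) rmorph_unit.
have [w wx] := ch_univ ch' VB; exists [the {lrmorphism R -> B} of w \o l].
by split; [rewrite -pmap2|rewrite /= rmorph_unit].
Qed.

(* U divides F in the local ring of Y S at p. *)
Definition dvd S U F K (p : X K) : Prop :=
  forall A (x : X A) (y : {lrmorphism A -> K}), Y S x -> pmap y x = p ->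
  exists s b, y s != 0 /\ s * F A x = U A x * b.
(** Vanishing near p is divisibility by zero, so openness and invariance under field extension are
    proved once for both notions. *)
Definition znear S F K (p : X K) : Prop := dvd S (fun A _ => 0) F p.

Lemma znear_germ S F K (p : X K) A (x : X A) (y : {lrmorphism A -> K}) :
  znear S F p -> Y S x -> pmap y x = p -> germ0 y (F A x).
Proof. by move=> h Yx e; have [s [b [ys]]] := h A x y Yx e; rewrite mul0r => e0; exists s. Qed.

Notation reg S F := (regular_on (Y (X := X) S) F).

Lemma reg0 S : reg S (fun A _ => 0).
Proof. by move=> A B u x _; rewrite rmorph0. Qed.

Lemma dvd_chart S U F R (xi : X R) V K (v : {lrmorphism R -> K}) s b : chart S xi V ->
  reg S F -> reg S U -> is_field K -> v s != 0 -> s * F R xi = U R xi * b -> dvd S U F (pmap v xi).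
Proof.
move=> ch rF rU hK vs e A x y Yx exy.
have [d yd hd] := chart_near ch Yx hK (esym exy) vs.
have [B [u [yB [uL yE]]]] := loc_at hK yd; have [uU _ _] := uL.
have [w [wx ws]] := hd B u uU; have Yxi := chart_Y ch.
have [||r [c [yr rc]]] := @loc_dvd k A B d u K yB (F A x) (U A x) (w s) (w b) uL hK.
- by rewrite -(unit_field _ hK) rmorph_unit.
- by rewrite -rF // -rU // -wx rF // rU // -!rmorphM e.
by exists r, c; split=> //; rewrite -(yE r).
Qed.

Lemma znear_chart S F R (xi : X R) V K (v : {lrmorphism R -> K}) : chart S xi V ->
  reg S F -> is_field K -> germ0 v (F R xi) -> znear S F (pmap v xi).
Proof.
move=> ch rF hK [s vs e]; apply: (dvd_chart (b := 0) ch rF (@reg0 S) hK vs).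
by rewrite mulr0.
Qed.

Lemma dvd_open S U F A (x : X A) K (y : {lrmorphism A -> K}) : reg S F -> reg S U -> Y S x -> is_field K ->
  dvd S U F (pmap y x) -> exists2 d, y d != 0 & forall K' (y' : {lrmorphism A -> K'}), is_field K' ->
    y' d != 0 -> dvd S U F (pmap y' x).
Proof.
move=> rF rU Yx hK h; have [R [xi [V [v [ch e]]]]] := chart_exists hK (Y_map y Yx).
have [s [b [vs eb]]] := h R xi v (chart_Y ch) e.
have [d yd hd] := chart_near ch Yx hK e vs; exists d => // K' y' hK' y'd.
have [|w [<- ws]] := hd K' y'; first by rewrite (unit_field _ hK').
by apply: (dvd_chart ch rF rU hK' _ eb); rewrite -(unit_field _ hK').
Qed.

Lemma nznear_open S F A (x : X A) K (y : {lrmorphism A -> K}) : reg S F -> Y S x -> is_field K ->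
  ~ znear S F (pmap y x) -> exists2 d, y d != 0 & forall K' (y' : {lrmorphism A -> K'}), is_field K' ->
    y' d != 0 -> ~ znear S F (pmap y' x).
Proof.
move=> rF Yx hK h; have [R [xi [V [v [ch e]]]]] := chart_exists hK (Y_map y Yx).
have ng : ~ germ0 v (F R xi) by move=> g; apply: h; rewrite -e; exact: (znear_chart ch).
have [r vr hr] := smooth_germ_open (ch_fg ch) (chart_fsmooth ch) hK ng.
have [d yd hd] := chart_near ch Yx hK e vr; exists d => // K' y' hK' y'd zn.
have [|w [ew wr]] := hd K' y'; first by rewrite (unit_field _ hK').
apply: (hr K' w hK'); first by rewrite -(unit_field _ hK').
exact: (znear_germ zn (chart_Y ch)).
Qed.

Lemma dvd_ext S U F K K' (i : {lrmorphism K -> K'}) (p : X K) : reg S F -> reg S U -> Y S p ->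
  is_field K -> is_field K' -> dvd S U F p <-> dvd S U F (pmap i p).
Proof.
move=> rF rU Yp hK hK'; split=> [h|h A x y Yx e].
  have [R [xi [V [v [ch e]]]]] := chart_exists hK Yp.
  have [s [b [vs eb]]] := h R xi v (chart_Y ch) e.
  rewrite -e pmap2; apply: (dvd_chart ch rF rU hK' _ eb) => /=.
  by rewrite -(unit_field _ hK') rmorph_unit // (unit_field _ hK).
have [|s [b [ys eb]]] := h A x [the {lrmorphism A -> K'} of i \o y] Yx; first by rewrite -pmap2 e.
by exists s, b; split=> //; apply: contraNneq ys => /= ->; rewrite rmorph0.
Qed.

Lemma lower_unit A (c : gl A) i : lower (val c) -> val c i i \is a GRing.unit.
Proof.
move=> cL; have cT : is_trig_mx (val c) by apply/is_trig_mxP => a b; exact: cL.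
have : \det (val c) \is a GRing.unit by rewrite -unitmxE; exact: valP.
by rewrite (det_trig cT) (bigD1 i) //= unitrM => /andP[].
Qed.

Lemma chi_unit nu A (c : gl A) : lower (val c) -> chi nu c \is a GRing.unit.
Proof.
move=> cL; rewrite /chi; apply: (big_ind (fun x : A => x \is a GRing.unit)) => [|a b aU bU|i _].
- exact: unitr1.
- by rewrite unitrM aU.
- by apply: unitrXz; exact: lower_unit.
Qed.

Lemma chi_map nu A B (u : {lrmorphism A -> B}) (c : gl A) : lower (val c) ->
  u (chi nu c) = chi nu (gl_map u c).
Proof.
move=> cL; rewrite /chi rmorph_prod; apply: eq_bigr => i _.
by rewrite mxE rmorphXz //; exact: lower_unit.
Qed.

Definition semi nu S F : Prop := forall A (x : X A) (c : gl A) (w : 'I_4 -> A),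
  Y S x -> lower (val c) -> F A (eact c w x) = chi nu c * F A x.

Lemma eact_ext A (c : gl A) (w w' : 'I_4 -> A) (p : X A) : w =1 w' -> eact c w p = eact c w' p.
Proof. by move=> e; congr (eact c _ p); apply: functional_extensionality_dep. Qed.

Lemma eact1 A (p : X A) : eact (gl1 A) (fun=> 0) p = p.
Proof.
rewrite /eact glV1 -[RHS]zact1; congr (zact _ _ p); apply: gl_eq.
have P1 : Pshape (val (gl1 A)) by move=> a na; rewrite /= mxE (negbTE na).
rewrite yofE //= -[RHS]Jconj1; congr Jconj; apply/matrixP => i j; rewrite !mxE.
have [->|nij] := eqVneq i j; first by rewrite eqxx andbN expr1n.
by case: ifP => // _; case: ifP; rewrite expr0n eqn0Ngt q0.
Qed.

(** The element c has coefficients in K only, so it cannot move the family x, defined over A. The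
    generic lower triangular element over A moves it; its specialization at the inverse of c returns
    to p, and [ef_trick] then removes the parameters. *)
Lemma dvd_stable S U F nu nu' K (p : X K) (c : gl K) (w : 'I_4 -> K) : reg S F -> reg S U ->
  stair S -> semi nu S F -> semi nu' S U -> is_field K -> Y S p -> lower (val c) ->
  dvd S U F p -> dvd S U F (eact c w p).
Proof.
move=> rF rU st sF sU hK Yp cL h A x y Yx e.
have [T [i [cT [wT ef]]]] := efam_exists low_diag A.
have cTL : lower (val cT) by apply/shaped_lower; exact: ef_shape ef.
have [w2 hw2] := eact_inv X hfr w (lower_P cL).
have cVL := lower_inv cL.
have [|v [vi vc vw]] := ef_univ ef y (cB := glV c) w2; first exact/shaped_lower.
have Yix : Y S (pmap i x) by exact: Y_map.
have [||s [b [vs eb]]] := h T (eact cT wT (pmap i x)) v.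
- exact: Y_eact.
- rewrite eact_nat //; last exact: lower_P.
  rewrite vc (eact_ext _ _ vw) pmap2 (pmap_eq (v := y)) // e; exact: hw2.
have [||r [z [vr ez]]] := ef_trick ef (F := F A x) (U := U A x) (x := s * chi nu cT) (z := chi nu' cT * b) hK (y := v).
- by move: eb; rewrite sF // sU // rF // rU // => eb; rewrite -mulrA eb; ring.
- rewrite rmorphM; apply/eqP => /(field_mul hK)[/eqP|]; first exact/negP.
  by apply/eqP; rewrite -(unit_field _ hK) rmorph_unit // chi_unit.
by exists r, z; split=> //; rewrite -(vi r).
Qed.

(** Under a general element of E, F is not multiplied by a unit, so the argument differs from that
    for divisibility. The zero germ at p says that F, pulled back to the generic translate of a
    chart at p, vanishes near the identity of the group; by [ef_dom] it then vanishes on all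
    translates of a neighbourhood of p. The family x is brought into this neighbourhood by a second
    generic element, whose inverse is one of those translations. *)
Lemma znear_E F K (p : X K) (c : gl K) (w : 'I_4 -> K) : reg [::] F -> is_field K ->
  Pshape (val c) -> znear [::] F p -> znear [::] F (eact c w p).
Proof.
move=> rF hK cP zp A x y Yx e.
have Y0 B (z : X B) : Y [::] z by [].
have [R [xi [V [v [ch vp]]]]] := chart_exists hK (Y0 K p).
have [T [i [cT [wT ef]]]] := efam_exists par_diag R.
have cTP : Pshape (val cT) by apply/shaped_P; exact: ef_shape ef.
have P1 : Pshape (val (gl1 K)) by move=> a na; rewrite /= mxE (negbTE na).
have s1 : shaped par_mask (val (gl1 K)) by apply/shaped_P.
have [y1 [y1i y1c y1w]] := ef_univ ef v (fun=> 0) s1.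
have [s ys es] : germ0 y1 (F T (eact cT wT (pmap i xi))).
  apply: (znear_germ zp) => //; rewrite eact_nat // y1c (eact_ext _ _ y1w) eact1 pmap2 -vp.
  exact: pmap_eq.
have [s' ys' es'] := ef_dom ef (ch_fg ch) (chart_fsmooth ch) hK es ys.
have vs' : v s' != 0 by rewrite -(y1i s').
have [T2 [i2 [c2 [w2 ef2]]]] := efam_exists par_diag A.
have c2P : Pshape (val c2) by apply/shaped_P; exact: ef_shape ef2.
have [wc hwc] := eact_inv X hfr w cP; have [wi hwi] := eact_inv X hfr w2 c2P.
have PV B (g : gl B) : Pshape (val g) -> Pshape (val (glV g)).
  by move=> gP; case: (Pshape_unit (mulmxV (valP g)) gP).
have [|y2 [y2i y2c y2w]] := ef_univ ef2 y (cB := glV c) wc; first by apply/shaped_P; apply: PV.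
pose x2 : X T2 := eact c2 w2 (pmap i2 x).
have y2x2 : pmap y2 x2 = p.
  rewrite /x2 eact_nat // y2c (eact_ext _ _ y2w) pmap2 (pmap_eq (v := y)) // e; exact: hwc.
have [|d yd hd] := chart_near ch (Y0 T2 x2) hK (y := y2) _ vs'; first by rewrite vp y2x2.
have [B [u [yB [uL yE]]]] := loc_at hK yd; have [uU _ _] := uL.
have [rho [rx rs]] := hd B u uU.
have [|t [ti tc tw]] := ef_univ ef rho (cB := gl_map u (glV c2)) (u \o wi).
  by apply/shaped_P => j nj; rewrite mxE (PV _ _ c2P) ?rmorph0.
have eh : t (F T (eact cT wT (pmap i xi))) = u (i2 (F A x)).
  rewrite -(rF T B t _ (Y0 _ _)) eact_nat // tc (eact_ext _ _ tw) pmap2 (pmap_eq (v := rho)) // rx.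
  rewrite -eact_nat //; last exact: PV.
  by rewrite hwi (rF _ _ u _ (Y0 _ _)) (rF _ _ i2 _ (Y0 _ _)).
have [||r [z [yr ez]]] := @loc_dvd k T2 B d u K yB (i2 (F A x)) 0 (rho s') 0 uL hK.
- by rewrite -(unit_field _ hK) rmorph_unit.
- by rewrite mulr0 -eh -(ti s') /= -rmorphM es' rmorph0.
have [||r' [z' [yr' ez']]] := ef_trick ef2 (F := F A x) (U := 0) (x := r) (z := 0) (y := y2) hK.
- by rewrite ez mul0r mulr0.
- by rewrite -(yE r).
by exists r', z'; split=> //; rewrite -(y2i r').
Qed.
End Germs.

Section Weights.
Variable q : nat.

Lemma chiD (a b : 'rV[int]_4) (A : comUnitRingType) (c : gl A) :
  (forall i, val c i i \is a GRing.unit) -> chi (a + b) c = chi a c * chi b c.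
Proof.
move=> cU; rewrite /chi -big_split; apply: eq_bigr => i _ /=.
by rewrite mxE exprzDr.
Qed.
Lemma chi0 (A : comUnitRingType) (c : gl A) : chi 0 c = 1.
Proof. by rewrite /chi big1 // => i _; rewrite mxE expr0z. Qed.
Lemma chiMn (a : 'rV[int]_4) m (A : comUnitRingType) (c : gl A) :
  (forall i, val c i i \is a GRing.unit) -> chi (a *+ m) c = chi a c ^+ m.
Proof.
move=> cU; elim: m => [|m IH]; first by rewrite mulr0n chi0 expr0.
by rewrite mulrS chiD // IH exprS.
Qed.
Lemma chiMz (a : 'rV[int]_4) z (A : comUnitRingType) (c : gl A) :
  (forall i, val c i i \is a GRing.unit) -> chi (a *~ z) c = chi a c ^ z.
Proof.
move=> cU; case: z => n; first by rewrite -pmulrn chiMn.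
have e : chi (a *+ n.+1) c * chi (a *~ Negz n) c = 1.
  by rewrite -chiD // NegzE mulrNz -pmulrn subrr chi0.
have U : chi (a *+ n.+1) c \is a GRing.unit by apply/unitrPr; exists (chi (a *~ Negz n) c).
by apply: (mulrI U); rewrite e chiMn // mulrV // -chiMn.
Qed.
Lemma chi_delta l (A : comUnitRingType) (c : gl A) : chi (delta_mx 0 l) c = val c l l.
Proof.
rewrite /chi (bigD1 l) //= big1 => [|i nil]; first by rewrite mxE !eqxx expr1z mulr1.
by rewrite mxE eqxx (negbTE nil) expr0z.
Qed.

(** The character by which E' rescales the entry c when c is a corner: the left factor contributes a
    q-th power at the index permuted by [w0I], the right factor the column index. *)
Definition tau (c : 'I_4 * 'I_4) : 'rV[int]_4 := delta_mx 0 (w0I c.1) *+ q + delta_mx 0 c.2.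

Lemma chi_tau c (A : comUnitRingType) (b : gl A) : (forall i, val b i i \is a GRing.unit) ->
  chi (tau c) b = val b (w0I c.1) (w0I c.1) ^+ q * val b c.2 c.2.
Proof. by move=> bU; rewrite chiD // chiMn // !chi_delta. Qed.
End Weights.

(** * Division of a semi-invariant function by a power of a coordinate *)

Section Division.
Variables (q : nat) (k : fieldType) (X : zip_space q k).
Notation alg := (comUnitAlgType k).
Implicit Types A B C K R : alg.
Hypothesis q0 : (0 < q)%N.
Hypothesis hfr : forall A, exists fr : {rmorphism A -> A}, forall a, fr a = a ^+ q.
Hypothesis smX : smooth_mor (zphi X).
Notation cset := (seq ('I_4 * 'I_4)).
Notation reg S F := (regular_on (Y (X := X) S) F).

Definition crd (c : 'I_4 * 'I_4) A (x : X A) : A := gc x c.1 c.2.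

Lemma crd_map c A B (u : {lrmorphism A -> B}) (x : X A) : crd c (pmap u x) = u (crd c x).
Proof. by rewrite /crd gc_map mxE. Qed.

Variables (S : cset) (c : 'I_4 * 'I_4) (m : nat) (F : forall A, X A -> A) (nu : 'rV[int]_4).
Hypotheses (cS : c \notin S) (st : stair S) (stc : stair (c :: S)).
Hypotheses (rF : reg S F) (sF : semi nu S F).

Notation um := (fun A (x : X A) => crd c x ^+ m).

Lemma reg_um : reg S um.
Proof. by move=> A B u x _; rewrite crd_map rmorphXn. Qed.

Lemma semi_crd : semi (tau q c) S (@crd c).
Proof.
move=> A x b w Yx bL; rewrite /crd (entry_eact q0 hfr w stc) // chi_tau //.
by move=> i; exact: lower_unit.
Qed.
Lemma semi_um : semi (tau q c *+ m) S um.
Proof.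
move=> A x b w Yx bL; rewrite semi_crd // exprMn chiMn // => i; exact: lower_unit.
Qed.

Definition good K (p : X K) := dvd S um F p.

Lemma good_eact K (p : X K) (b : gl K) (w : 'I_4 -> K) : is_field K -> Y S p -> lower (val b) ->
  good (eact b w p) <-> good p.
Proof.
move=> hK Yp bL; split=> h; last first.
  exact: (dvd_stable q0 hfr rF reg_um st sF semi_um).
have [w2 h2] := eact_inv X hfr w (lower_P bL); rewrite -(h2 p).
apply: (dvd_stable q0 hfr rF reg_um st sF semi_um hK _ (lower_inv bL) h).
exact: Y_eact.
Qed.

Lemma good_data K (p : X K) : is_field K -> Y S p -> good p ->
  exists R (xi : X R) V (psi : R) (v : {lrmorphism R -> K}),
    [/\ chart S xi V, F xi = um R xi * psi & pmap v xi = p].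
Proof.
move=> hK Yp gp; have [R [xi [V [v [ch vp]]]]] := chart_exists smX hK Yp.
have [s [b [vs e]]] := gp R xi v (chart_Y ch) vp.
have [R' [l [V' [v' [lL ch' v'E _]]]]] := chart_loc ch hK vs; have [lU _ _] := lL.
exists R', (pmap l xi), V', (l b / l s), v'; split=> //; last first.
  by rewrite pmap2 -vp; exact: pmap_eq.
have Yxi := chart_Y ch; rewrite rF // crd_map -rmorphXn.
by apply: (mulIr lU); rewrite -mulrA divrK // -!rmorphM -e mulrC.
Qed.

(* a is the value at x of the quotient of F by the m-th power of the coordinate. *)
Definition div_data B (x : X B) (a : B) : Prop :=
  exists R (xi : X R) V (psi : R) (v : {lrmorphism R -> B}),
    [/\ chart S xi V, F xi = um R xi * psi, pmap v xi = x & a = v psi].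

Lemma chart_crd_nzd R (xi : X R) V : chart S xi V -> forall b, crd c xi ^+ m * b = 0 -> b = 0.
Proof. by move=> ch; apply: expr_nzd => b; exact: (chart_nzd ch). Qed.

Lemma div_data_uniq B (x : X B) a a' : div_data x a -> div_data x a' -> a = a'.
Proof.
move=> [R1 [xi1 [V1 [psi1 [v1 [ch1 e1 vx1 ->]]]]]] [R2 [xi2 [V2 [psi2 [v2 [ch2 e2 vx2 ->]]]]]].
apply/eqP; rewrite -subr_eq0; apply/eqP; apply: local_zero_loc => K y hK.
have Y1 := chart_Y ch1; have Y2 := chart_Y ch2.
have [||d yd hd] := chart_near ch2 Y1 hK (y := [the {lrmorphism R1 -> K} of y \o v1])
  (v := [the {lrmorphism R2 -> K} of y \o v2]) (r := 1).
- by rewrite -!pmap2 vx1 vx2.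
- by rewrite rmorph1 oner_eq0.
have [R' [l [V' [v' [lL ch' v'E _]]]]] := chart_loc ch1 hK yd; have [lU _ _] := lL.
have [w [wx _]] := hd R' l lU.
exists (v1 d) => // B' u uL; have [uU _ _] := uL.
have [|e eE] := loc_univ (v := [the {lrmorphism R1 -> B'} of u \o v1]) lL; first exact: uU.
have epsi : l psi1 = w psi2.
  apply: (nzd_cancel (chart_crd_nzd ch')).
  have -> : crd c (pmap l xi1) ^+ m * l psi1 = F (pmap l xi1).
    by rewrite rF // e1 rmorphM crd_map rmorphXn.
  by rewrite -wx rF // e2 rmorphM crd_map rmorphXn.
have h1 : u (v1 psi1) = e (w psi2) by rewrite -epsi; exact/esym/(eE psi1).
rewrite rmorphB /= h1.
have -> : e (w psi2) = u (v2 psi2).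
  apply: (ch_uniq ch2 (v := [the {lrmorphism R2 -> B'} of e \o w]) (v' := [the {lrmorphism R2 -> B'} of u \o v2])).
  rewrite -!pmap2 wx pmap2 vx2 -vx1 pmap2; apply: pmap_eq => r; exact: (eE r).
by rewrite subrr.
Qed.

Variable Z : subfun X.
Hypothesis ZY : forall A (x : X A), Z x -> Y S x.
Hypothesis Zmap : forall A B (u : {lrmorphism A -> B}) (x : X A), Z x -> Z (pmap u x).
Hypothesis Zact : forall A (x : X A) (b : gl A) (w : 'I_4 -> A), lower (val b) -> Z x -> Z (eact b w x).
Hypothesis Zbad : forall A (x : X A) K (y : {lrmorphism A -> K}), Z x -> is_field K ->
  ~ good (pmap y x) -> exists2 d, y d != 0 & forall K' (y' : {lrmorphism A -> K'}), is_field K' ->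
    y' d != 0 -> ~ good (pmap y' x).

Definition all_bad A (x : X A) := forall K (y : {lrmorphism A -> K}), is_field K -> ~ good (pmap y x).

(** Points near which F is divisible form an open subset, and by [Zbad] their complement in Z is
    open too. The new function is the local quotient on the first part and 0 on the second.
    Quotients agree on overlaps because the coordinate is a nonzerodivisor on charts of [Y S], even
    if Z lies in its zero locus. *)
Lemma division : exists F' : (forall A, X A -> A),
  [/\ regular_on Z F',
      forall A (x : X A) (b : gl A) (w : 'I_4 -> A), Z x -> lower (val b) ->
        F' A (eact b w x) = chi (nu - tau q c *+ m) b * F' A x
    & forall R (xi : X R) V psi A (v : {lrmorphism R -> A}), chart S xi V ->
        F xi = um R xi * psi -> Z (pmap v xi) -> F' A (pmap v xi) = v psi].
Proof.
pose P A (x : X A) B (w : {lrmorphism A -> B}) (a : B) :=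
  div_data (pmap w x) a \/ (all_bad (pmap w x) /\ a = 0).
have Pmap A (x : X A) B C (u : {lrmorphism A -> B}) (v : {lrmorphism B -> C})
    (w : {lrmorphism A -> C}) a : w =1 v \o u -> P A x B u a -> P A x C w (v a).
  move=> e [[R [xi [V [psi [v0 [ch eF vx ->]]]]]]|[bad ->]]; [left|right].
    exists R, xi, V, psi, [the {lrmorphism R -> C} of v \o v0]; split=> //.
    by rewrite -pmap2 vx pmap2; apply: pmap_eq => r; rewrite e.
  split; last by rewrite rmorph0.
  move=> K y hK; have := bad K [the {lrmorphism B -> K} of y \o v] hK.
  by rewrite !pmap2 => h; rewrite (pmap_eq (v := [the {lrmorphism A -> K} of [the {lrmorphism B -> K} of y \o v] \o u])) // => r /=; rewrite e.
have mixed B (x : X B) a : Z x -> div_data x a -> ~ all_bad x.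
  move=> Zx [R [xi [V [psi [v0 [ch eF vx _]]]]]] bad; have [K [y hK]] := has_point B.
  apply: (bad K y hK); rewrite -vx pmap2.
  apply: (dvd_chart (s := 1) (b := psi) ch rF reg_um hK); first by rewrite rmorph1 oner_eq0.
  by rewrite mul1r.
have Puniq A (x : X A) : Z x -> forall B (u : {lrmorphism A -> B}) a a', P A x B u a -> P A x B u a' -> a = a'.
  move=> Zx B u a a' [h|[h ->]] [h'|[h' ->]] //; first exact: div_data_uniq h h'.
    by case: (mixed _ _ _ (Zmap u Zx) h).
  by case: (mixed _ _ _ (Zmap u Zx) h').
have Pex A (x : X A) : Z x -> forall K (y : {lrmorphism A -> K}), is_field K -> exists2 d, y d != 0 &
    exists B (u : {lrmorphism A -> B}) (a : B), is_loc d u /\ P A x B u a.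
  move=> Zx K y hK; have [g|b] := pselect (good (pmap y x)).
    have [R [xi [V [psi [v [ch eF vx]]]]]] := good_data hK (ZY (Zmap y Zx)) g.
    have [|d yd hd] := chart_near (r := 1) ch (ZY Zx) hK vx; first by rewrite rmorph1 oner_eq0.
    have [B [u [yB [uL _]]]] := loc_at hK yd; have [uU _ _] := uL.
    have [w [wx _]] := hd B u uU.
    by exists d => //; exists B, u, (w psi); split=> //; left; exists R, xi, V, psi, w.
  have [d yd hd] := Zbad Zx hK b; have [B [u [yB [uL _]]]] := loc_at hK yd.
  exists d => //; exists B, u, 0; split=> //; right; split=> // K' y' hK'.
  by rewrite pmap2; apply: hd => //=; exact: is_field_of_loc uL.
pose spec A (x : X A) (a : A) := forall B (w : {lrmorphism A -> B}) a', P A x B w a' -> w a = a'.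
have specE A (x : X A) : Z x -> exists a, spec A x a.
  move=> Zx; apply: affine_glue; [exact: Pmap|exact: Puniq|exact: Pex].
have specU A (x : X A) a a' : Z x -> spec A x a -> spec A x a' -> a = a'.
  move=> Zx h h'; apply/eqP; rewrite -subr_eq0; apply/eqP; apply: local_zero => K y hK.
  have [d yd [B [u [b [uL Pb]]]]] := Pex A x Zx K y hK; have [_ _ lk] := uL.
  have [|N e] := lk (a - a'); first by rewrite rmorphB /= (h _ _ _ Pb) (h' _ _ _ Pb) subrr.
  by exists (d ^+ N) => //; rewrite rmorphXn; exact: field_expf.
pose F' A (x : X A) : A := if pselect (exists a, spec A x a) is left h then projT1 (cid h) else 0.
have F'P A (x : X A) : Z x -> spec A x (F' A x).
  by move=> Zx; rewrite /F'; case: pselect => [h|/(_ (specE A x Zx)) //]; case: cid.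
have F'id A (x : X A) a : Z x -> P A x A [the {lrmorphism A -> A} of idfun] a -> F' A x = a.
  by move=> Zx /(F'P A x Zx).
have rF' : regular_on Z F'.
  move=> A B u x Zx; apply: (specU B (pmap u x)); [exact: Zmap|apply: F'P; exact: Zmap|].
  move=> C w a h; apply: (F'P A x Zx C [the {lrmorphism A -> C} of w \o u]).
  by move: h; rewrite /P pmap2.
have F'data R (xi : X R) V psi A (v : {lrmorphism R -> A}) : chart S xi V ->
    F xi = um R xi * psi -> Z (pmap v xi) -> F' A (pmap v xi) = v psi.
  move=> ch eF Zv; apply: F'id => //; left; exists R, xi, V, psi, v; split=> //.
  by rewrite pmap_id.
have F'bad A (x : X A) : Z x -> all_bad x -> F' A x = 0.
  by move=> Zx bad; apply: F'id => //; right; rewrite pmap_id.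
exists F'; split=> // A x b w Zx bL.
apply/eqP; rewrite -subr_eq0; apply/eqP; apply: local_zero_loc => K y hK.
have Zex : Z (eact b w x) by exact: Zact.
have [g|bad] := pselect (good (pmap y x)); last first.
  have [d yd hd] := Zbad Zx hK bad; exists d => // B u uL.
  have bB : all_bad (pmap u x).
    by move=> K' y' hK'; rewrite pmap2; apply: hd => //=; exact: is_field_of_loc uL.
  rewrite rmorphB rmorphM /= -!rF' // (F'bad B (pmap u x)) //; last exact: Zmap.
  rewrite mulr0 subr0 F'bad //; first exact: Zmap.
  move=> K' y' hK' g; apply: (bB K' y' hK'); move: g; rewrite !pmap2.
  rewrite eact_nat //; last exact: lower_P.
  have bL' : lower (val (gl_map [the {lrmorphism A -> K'} of y' \o u] b)).
    by move=> i j ij; rewrite mxE bL ?rmorph0.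
  rewrite good_eact //; apply: ZY; exact: Zmap.
have bLm B (u : {lrmorphism A -> B}) : lower (val (gl_map u b)).
  by move=> i j ij; rewrite mxE bL ?rmorph0.
have g2 : good (pmap y (eact b w x)).
  rewrite eact_nat //; last exact: lower_P.
  apply/good_eact => //; apply: ZY; exact: Zmap.
have [R1 [xi1 [V1 [psi1 [v1 [ch1 e1 vx1]]]]]] := good_data hK (ZY (Zmap y Zx)) g.
have [R2 [xi2 [V2 [psi2 [v2 [ch2 e2 vx2]]]]]] := good_data hK (ZY (Zmap y Zex)) g2.
have [|d1 yd1 hd1] := chart_near (r := 1) ch1 (ZY Zx) hK vx1; first by rewrite rmorph1 oner_eq0.
have [B1 [u1 [yB1 [uL1 yE1]]]] := loc_at hK yd1; have [uU1 ub1 _] := uL1.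
have [w1 [wx1 _]] := hd1 B1 u1 uU1.
(* On Z the coordinate may be zero, so the quotients at x and at its translate cannot be compared by
   cancelling it there. They are compared on the generic translate of a chart of [Y S], where it is
   a nonzerodivisor, and the identity is then specialized. *)
have [T [i [cT [wT ef]]]] := efam_exists low_diag R1.
have cTL : lower (val cT) by apply/shaped_lower; exact: ef_shape ef.
have [|t [ti tc tw]] := ef_univ ef w1 (cB := gl_map u1 b) (u1 \o w); first exact/shaped_lower.
have Y1 := chart_Y ch1; have Y2 := chart_Y ch2; have Yi : Y S (pmap i xi1) by exact: Y_map.
pose xT : X T := eact cT wT (pmap i xi1).
have txT : pmap t xT = pmap u1 (eact b w x).
  rewrite /xT !eact_nat //; try exact: lower_P.
  by rewrite tc (eact_ext _ _ tw) pmap2 (pmap_eq (v := w1)) // wx1.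
have YxT : Y S xT by exact: Y_eact.
have [||d2 yd2 hd2] := chart_near (r := 1) (A := T) (x := xT) (y := [the {lrmorphism T -> K} of yB1 \o t]) ch2 YxT hK (v := v2).
- by rewrite vx2 -pmap2 txT pmap2; apply: pmap_eq => r; rewrite -(yE1 r).
- by rewrite rmorph1 oner_eq0.
have [T2 [l [yT2 [lL _]]]] := loc_at hK yd2; have [lU _ _] := lL.
have [w2 [wx2 _]] := hd2 T2 l lU.
have bU B (u : {lrmorphism A -> B}) j : val (gl_map u b) j j \is a GRing.unit by exact: lower_unit.
have key : l (chi nu cT * i psi1) = l (chi (tau q c *+ m) cT) * w2 psi2.
  have nz : forall a, l (i (crd c xi1 ^+ m)) * a = 0 -> a = 0.
    apply: (loc_nzd lL); apply: (ef_nzd ef); exact: (chart_crd_nzd ch1).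
  apply: (nzd_cancel nz).
  transitivity (l (F xT)).
    by rewrite sF // rF // e1 -rmorphM; congr (l _); rewrite rmorphM mulrCA.
  have h1 : crd c (pmap l xT) ^+ m = l (chi (tau q c *+ m) cT) * l (i (crd c xi1 ^+ m)).
    by rewrite crd_map -rmorphXn -rmorphM; congr (l _); rewrite semi_um // crd_map rmorphXn.
  rewrite -rF // -wx2 rF // e2 rmorphM rmorphXn /= -crd_map wx2 h1.
  by rewrite mulrCA mulrA.
have [a [N ea]] := ub1 (t d2).
have yd : y (d1 * a) != 0.
  rewrite rmorphM /= -(yE1 a) /= -ea rmorphM rmorphXn.
  apply/eqP => /(field_mul hK)[/eqP|/(field_mul hK)[]/eqP]; first exact/negP.
    exact/negP.
  by apply/negP; apply: field_expf => //; exact: is_field_of_loc uL1.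
exists (d1 * a) => // B u uL; have [uU _ _] := uL.
move: (uU); rewrite rmorphM unitrM => /andP[ud1 ua].
have [eB eBE] := loc_univ uL1 ud1.
have etU : eB (t d2) \is a GRing.unit.
  have : eB (u1 a) \is a GRing.unit by rewrite -[eB _]/((eB \o u1) a) eBE.
  by rewrite -ea rmorphM unitrM => /andP[].
have [t2 t2E] := loc_univ (v := [the {lrmorphism T -> B} of eB \o t]) lL etU.
have ux : pmap u x = pmap [the {lrmorphism R1 -> B} of eB \o w1] xi1.
  by rewrite -pmap2 wx1 pmap2; apply/esym/pmap_eq.
have uex : pmap u (eact b w x) = pmap [the {lrmorphism R2 -> B} of t2 \o w2] xi2.
  rewrite -pmap2 wx2 pmap2 (pmap_eq (v := [the {lrmorphism T -> B} of eB \o t])) //.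
  by rewrite -pmap2 txT pmap2; apply/esym/pmap_eq.
have Zux := Zmap u Zx; have Zuex := Zmap u Zex.
rewrite rmorphB rmorphM /= -!rF' // uex ux.
rewrite (F'data R2 xi2 V2 psi2) // -?uex // (F'data R1 xi1 V1 psi1) // -?ux // chi_map //=.
have t2l r : t2 (l r) = eB (t r) by exact: (t2E r).
have E1 nu' : t2 (l (chi nu' cT)) = chi nu' (gl_map u b).
  rewrite t2l !chi_map //; last by rewrite tc.
  rewrite tc; congr (chi _ _); apply: gl_eq; apply/matrixP => j1 j2; rewrite !mxE.
  exact: (eBE (val b j1 j2)).
have := congr1 t2 key; rewrite !rmorphM /= !E1 t2l.
have -> : t (i psi1) = w1 psi1 by exact: (ti psi1).
have -> : chi nu (gl_map u b) = chi (nu - tau q c *+ m) (gl_map u b) * chi (tau q c *+ m) (gl_map u b).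
  by rewrite -chiD ?subrK.
have cU : chi (tau q c *+ m) (gl_map u b) \is a GRing.unit by apply: chi_unit; exact: bLm.
rewrite -mulrA [chi (tau q c *+ m) _ * _]mulrC mulrA [RHS]mulrC => /(mulIr cU) ->.
by rewrite subrr.
Qed.
End Division.

(** * Restriction to the zero locus of a coordinate *)

Section Step.
Variables (q : nat) (k : fieldType) (X : zip_space q k).
Notation alg := (comUnitAlgType k).
Implicit Types A B C K R : alg.
Hypothesis q0 : (0 < q)%N.
Hypothesis hfr : forall A, exists fr : {rmorphism A -> A}, forall a, fr a = a ^+ q.
Hypothesis smX : smooth_mor (zphi X).
Notation cset := (seq ('I_4 * 'I_4)).
Notation reg S F := (regular_on (Y (X := X) S) F).
Implicit Types (S : cset) (c : 'I_4 * 'I_4) (F U : forall A, X A -> A).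
Notation um c m := (fun A (x : X A) => crd c x ^+ m).

(* The points with [gc p] lower triangular are those of the closed stratum. *)
Definition live S F := exists K (p : X K), [/\ is_field K, lower (gc p) & ~ znear S F p].
Definition sect S nu F := [/\ reg S F, semi nu S F & live S F].

Lemma corner_Y S A (p : X A) : stair S -> lower (gc p) -> Y S p.
Proof. by move=> st pL ij /st[lt _]; exact: pL. Qed.

Lemma crd_corner S c A (p : X A) : stair (c :: S) -> lower (gc p) -> crd c p = 0.
Proof. by move=> st pL; apply: pL; case: (st c (mem_head _ _)). Qed.

Lemma dvd_le S c m m' F K (p : X K) : (m <= m')%N -> dvd S (um c m') F p -> dvd S (um c m) F p.
Proof.
move=> le h A x y Yx e; have [s [b [ys eb]]] := h A x y Yx e.
by exists s, (crd c x ^+ (m' - m) * b); split=> //; rewrite eb mulrA -exprD subnKC.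
Qed.

Lemma dvd0 S c F K (p : X K) : dvd S (um c 0) F p.
Proof.
move=> A x y Yx e; exists 1, (F A x); by rewrite rmorph1 oner_eq0 expr0.
Qed.

Lemma znear_of_dvd S c F K (p : X K) : reg S F -> is_field K -> Y S p -> crd c p = 0 ->
  (forall m, dvd S (um c m) F p) -> znear S F p.
Proof.
move=> rF hK Yp c0 h; have [R [xi [V [v [ch vp]]]]] := chart_exists smX hK Yp.
rewrite -vp; apply: (znear_chart ch rF hK).
apply: (germ0_krull (u := crd c xi) (ch_fg ch) hK); first by rewrite -crd_map vp.
move=> N; have [s [b [vs e]]] := h N R xi v (chart_Y ch) vp.
by exists s => //; exists b.
Qed.

(** The minimum is taken over all points with h lower triangular, so that divisibility holds at each
    of them while the restricted quotient stays nonzero at one. It is finite by Krull's intersection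
    theorem. *)
Lemma min_order S c nu F : stair S -> stair (c :: S) -> sect S nu F ->
  exists m, (exists K (p : X K), [/\ is_field K, lower (gc p) & ~ dvd S (um c m.+1) F p]) /\
    forall K (p : X K), is_field K -> lower (gc p) -> dvd S (um c m) F p.
Proof.
move=> st stc [rF sF [K [p [hK pL nz]]]].
pose Q m := `[< exists K (p : X K), [/\ is_field K, lower (gc p) & ~ dvd S (um c m) F p] >].
have exQ : exists m, Q m.
  apply: contrapT => nex; apply: nz; apply: (znear_of_dvd (c := c)) => //.
  - exact: corner_Y.
  - exact: (crd_corner stc pL).
  - by move=> m; apply: contrapT => h; apply: nex; exists m; apply/asboolP; exists K, p.
case: (ex_minnP exQ) => [[|m]] /asboolP hm min.
  by have [K' [p' [_ _ []]]] := hm; exact: dvd0.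
exists m; split=> // K' p' hK' pL'; apply: contrapT => h.
have /min : Q m by apply/asboolP; exists K', p'.
by rewrite ltnn.
Qed.

(** What later steps need of one division: m is the least order over the closed stratum, attained
    there, and the values of the new function are computed on any chart where the division is
    possible. *)
Record link S c m F F' : Prop := Link {
  link0 : exists K (p : X K), [/\ is_field K, lower (gc p) & ~ dvd S (um c m.+1) F p];
  link1 : forall K (p : X K), is_field K -> lower (gc p) -> dvd S (um c m) F p;
  link2 : forall R (xi : X R) V psi A (v : {lrmorphism R -> A}), chart S xi V ->
    F R xi = crd c xi ^+ m * psi -> Y (c :: S) (pmap v xi) -> F' A (pmap v xi) = v psi }.

Lemma Y_cons S c A (x : X A) : Y (c :: S) x <-> Y S x /\ crd c x = 0.
Proof.
split=> [h|[h h0] ij]; first by split=> [ij hij|]; apply: h; rewrite inE ?hij ?orbT ?eqxx.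
by rewrite inE => /predU1P[-> //|]; exact: h.
Qed.

Lemma quot_germ S c m F R (xi : X R) V psi K (v : {lrmorphism R -> K}) R' (l : {lrmorphism R -> R'})
    (v' : {lrmorphism R' -> K}) : chart S xi V -> reg S F -> is_field K ->
  F R xi = crd c xi ^+ m * psi -> (forall r', exists r, l r = r') ->
  (forall r, l r = 0 <-> exists b, r = b * crd c xi) -> v' \o l =1 v ->
  germ0 v' (l psi) -> dvd S (um c m.+1) F (pmap v xi).
Proof.
move=> ch rF hK eF ls lk v'E [s' vs' e']; have [s es] := ls s'; rewrite -es in vs' e'.
have [b eb] : exists b, s * psi = b * crd c xi by apply/lk; rewrite rmorphM.
apply: (dvd_chart (s := s) (b := b) ch rF (@reg_um _ _ X S c m.+1) hK).
  by rewrite -[v s]v'E.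
by rewrite eF exprS mulrCA eb; ring.
Qed.

(** At a bad point F has an exact order n < m. Divided by the n-th power and restricted to the zero
    locus of the coordinate, it has a nonzero germ, and having a nonzero germ is an open condition
    on that locus. *)
Lemma bad_open S c m nu F A (x : X A) K (y : {lrmorphism A -> K}) : c \notin S -> stair S ->
  stair (c :: S) -> sect S nu F -> Y (c :: S) x -> is_field K ->
  ~ dvd S (um c m) F (pmap y x) -> exists2 d, y d != 0 & forall K' (y' : {lrmorphism A -> K'}),
    is_field K' -> y' d != 0 -> ~ dvd S (um c m) F (pmap y' x).
Proof.
move=> cS st stc [rF sF _] /Y_cons[Yx x0] hK nd.
have exn : exists n, `[< ~ dvd S (um c n) F (pmap y x) >] by exists m; apply/asboolP.
case: (ex_minnP exn) => [[|n]] /asboolP hn min; first by case: hn; exact: dvd0.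
have dn : dvd S (um c n) F (pmap y x).
  apply: contrapT => h; have /min : `[< ~ dvd S (um c n) F (pmap y x) >] by apply/asboolP.
    by rewrite ltnn.
have nm : (n < m)%N by apply: min; apply/asboolP.
have [R [xi [V [psi [v [ch eF vx]]]]]] := good_data smX rF hK (Y_map y Yx) dn.
have [|R' [l [V' [v' [ls lk ch' v'E _]]]]] := chart_quot (v := v) (c := c) ch hK.
  by rewrite -[gc _ _ _]/(crd c xi) -crd_map vx crd_map x0 rmorph0.
have ng : ~ germ0 v' (l psi).
  by move=> g; apply: hn; rewrite -vx; exact: (quot_germ ch rF hK eF ls lk v'E).
have [r vr hr] := smooth_germ_open (ch_fg ch') (chart_fsmooth ch') hK ng.
have Ycx : Y (c :: S) x by apply/Y_cons.
have v'x : pmap v' (pmap l xi) = pmap y x by rewrite pmap2 -vx; exact: pmap_eq.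
have [d yd hd] := chart_near ch' Ycx hK v'x vr.
exists d => // K' y' hK' y'd dm.
have [|w [wx wr]] := hd K' y'; first by rewrite (unit_field _ hK').
have [||s [b [ws eb]]] := dvd_le nm dm (x := xi) (y := [the {lrmorphism R -> K'} of w \o l]).
- exact: chart_Y ch.
- by rewrite -pmap2.
apply: (hr K' w hK'); first by rewrite -(unit_field _ hK').
exists (l s) => //; rewrite -rmorphM; apply/lk; exists b.
apply: (nzd_cancel (chart_crd_nzd cS ch (m := n))).
transitivity (s * F R xi); first by rewrite eF; ring.
by rewrite eb /= exprSr mulrA mulrAC.
Qed.

Lemma sect_restrict S c nu F : c \notin S -> stair S -> stair (c :: S) -> sect S nu F ->
  exists m F', sect (c :: S) (nu - tau q c *+ m) F' /\ link S c m F F'.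
Proof.
move=> cS st stc sF; have [m [h0 h1]] := min_order st stc sF; have [rF smF _] := sF.
have [||||F' [rF' sF' dF']] := division (Z := Y (X := X) (c :: S)) (m := m) q0 hfr smX cS st stc rF smF.
- by move=> A x /Y_cons[].
- by move=> A B u x; exact: Y_map.
- by move=> A x b w bL Yx; exact: Y_eact.
- by move=> A x K y; exact: bad_open sF.
exists m, F'; split; last by split.
split=> //; have [K [p [hK pL nd]]] := h0; exists K, p; split=> // zn.
have Yp := corner_Y st pL.
have [R [xi [V [psi [v [ch eF vx]]]]]] := good_data smX rF hK Yp (h1 K p hK pL).
have [|R' [l [V' [v' [ls lk ch' v'E _]]]]] := chart_quot (v := v) (c := c) ch hK.
  by rewrite -[gc _ _ _]/(crd c xi) -crd_map vx; exact: (crd_corner stc pL).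
apply: nd; rewrite -vx; apply: (quot_germ ch rF hK eF ls lk v'E).
rewrite -(dF' R xi V psi R' l ch eF (chart_Y ch')).
apply: (znear_germ zn (chart_Y ch')); rewrite pmap2 -vx; exact: pmap_eq.
Qed.

(** When every zero of the coordinate has h lower triangular, the least order gives divisibility
    everywhere, so the quotient is defined on all of [Y S] and has a nonzero germ at a zero of the
    coordinate. *)
Lemma curve_division S c nu F : c \notin S -> stair S -> stair (c :: S) ->
  (forall K (p : X K), is_field K -> Y (c :: S) p -> lower (gc p)) -> sect S nu F ->
  exists m F', [/\ reg S F', semi (nu - tau q c *+ m) S F',
    exists K (p : X K), [/\ is_field K, lower (gc p) & ~ dvd S (um c m.+1) F p]
  & exists R (xi : X R) V K (v : {lrmorphism R -> K}), [/\ chart S xi V, is_field K,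
      lower (gc (pmap v xi)) & ~ germ0 v (F' R xi)]].
Proof.
move=> cS st stc hcor sF; have [m [h0 h1]] := min_order st stc sF; have [rF smF _] := sF.
have all_good K (p : X K) : is_field K -> Y S p -> dvd S (um c m) F p.
  move=> hK Yp; have [p0|pn] := eqVneq (crd c p) 0.
    by apply: h1 => //; apply: hcor => //; apply/Y_cons.
  move=> A x y Yx e; exists (crd c x ^+ m), (F A x); split=> //.
  by rewrite rmorphXn; apply: field_expf => //; rewrite /= -crd_map e.
have [||||F' [rF' sF' dF']] := division (Z := Y (X := X) S) (m := m) q0 hfr smX cS st stc rF smF.
- by [].
- by move=> A B u x; exact: Y_map.
- by move=> A x b w bL Yx; exact: Y_eact.
- by move=> A x K y Yx hK []; apply: all_good => //; exact: Y_map.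
exists m, F'; split=> //; have [K [p [hK pL nd]]] := h0.
have Yp := corner_Y st pL.
have [R [xi [V [psi [v [ch eF vx]]]]]] := good_data smX rF hK Yp (h1 K p hK pL).
exists R, xi, V, K, v; split=> //; first by rewrite vx.
have e1 : F' R xi = psi.
  have := dF' R xi V psi R [the {lrmorphism R -> R} of idfun] ch eF.
  by rewrite pmap_id // => ->; [|exact: chart_Y ch].
rewrite e1 => -[s vs es]; apply: nd; rewrite -vx.
apply: (dvd_chart (s := s) (b := 0) ch rF (@reg_um _ _ X S c m.+1) hK vs).
by rewrite eF mulrCA es !mulr0.
Qed.
End Step.

(** * Pseudo-completeness of the one-dimensional strata *)

Section SwapAndCurves.
Variables (q : nat) (k : fieldType) (X : zip_space q k).
Notation alg := (comUnitAlgType k).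
Implicit Types A B C K R : alg.
Hypothesis q0 : (0 < q)%N.
Hypothesis hfr : forall A, exists fr : {rmorphism A -> A}, forall a, fr a = a ^+ q.
Hypothesis smX : smooth_mor (zphi X).
Notation cset := (seq ('I_4 * 'I_4)).
Notation reg S F := (regular_on (Y (X := X) S) F).
Implicit Types (S : cset) (c d : 'I_4 * 'I_4) (F U : forall A, X A -> A).
Notation um c m := (fun A (x : X A) => crd c x ^+ m).

(* Divisibility of F by the power of d survives the division by the coordinate c,
   since c and d are part of a coordinate system. *)
Lemma dvd_restrict S c d a b F F1 : c \notin d :: S -> d \notin c :: S -> stair S -> stair (c :: S) ->
  stair (d :: S) -> reg S F -> reg (c :: S) F1 -> link S c a F F1 ->
  (forall K (p : X K), is_field K -> lower (gc p) -> dvd S (um d b) F p) ->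
  forall K (p : X K), is_field K -> lower (gc p) -> dvd (c :: S) (um d b) F1 p.
Proof.
move=> cdS dcS st stc std rF rF1 [_ l1 l2] hd K p hK pL.
have cS : c \notin S by move: cdS; rewrite inE negb_or => /andP[].
have dS : d \notin S by move: dcS; rewrite inE negb_or => /andP[].
have Yp := corner_Y st pL.
have [R [xi [V [psi [v [ch eF vx]]]]]] := good_data smX rF hK Yp (l1 K p hK pL).
have [s [e [vs es]]] := hd K p hK pL R xi v (chart_Y ch) vx.
have [|Rd [ld [Vd [vd [lds ldk chd _ _]]]]] := chart_quot (v := v) (c := d) ch hK.
  by rewrite -[gc _ _ _]/(crd d xi) -crd_map vx; exact: (crd_corner std pL).
have [|Rc [lc [Vc [vc [_ _ chc vcE _]]]]] := chart_quot (v := v) (c := c) ch hK.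
  by rewrite -[gc _ _ _]/(crd c xi) -crd_map vx; exact: (crd_corner stc pL).
(* Modulo the coordinate d, the coordinate c is still a nonzerodivisor; hence d divides psi, and one
   factor d is cancelled on both sides. *)
have ladder n : forall psi e, crd c xi ^+ a * psi = crd d xi ^+ n * e ->
    exists psi', psi = crd d xi ^+ n * psi'.
  elim: n => [|n IH] f g efg; first by exists f; rewrite expr0 mul1r.
  have [f' ef'] : exists b0, f = b0 * crd d xi.
    apply/ldk; apply: (expr_nzd (m := a) (U := crd c (pmap ld xi))).
      by move=> z; exact: (chart_nzd chd).
    have ld0 : ld (crd d xi) = 0 by apply/ldk; exists 1; rewrite mul1r.
    rewrite crd_map -rmorphXn -rmorphM efg exprS !rmorphM /= ld0.
    by rewrite !mul0r.
  have [|f2 ef2] := IH f' g.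
    apply: (nzd_cancel (U := crd d xi)); first by move=> z; exact: (chart_nzd ch dS).
    by transitivity (crd c xi ^+ a * f); [rewrite ef'; ring|rewrite efg exprS; ring].
  by exists f2; rewrite ef' ef2 exprSr; ring.
have [|psi' epsi] := ladder b (s * psi) e.
  by rewrite -es eF; ring.
have vcx : pmap vc (pmap lc xi) = p by rewrite pmap2 -vx; exact: pmap_eq.
rewrite -vcx; apply: (dvd_chart (s := lc s) (b := lc psi') chc rF1 (@reg_um _ _ X _ d b) hK).
  by rewrite -[vc _]/((vc \o lc) s) vcE.
rewrite (l2 R xi V psi Rc lc ch eF (chart_Y chc)) -rmorphM epsi rmorphM rmorphXn.
by rewrite crd_map.
Qed.

(* Only the entry c above the diagonal is free on Y S. *)
Definition simple_set c S := forall ij : 'I_4 * 'I_4, (ij.1 < ij.2)%N -> (ij \in S) = (ij != c).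

Lemma cell_inv (w : 'S_4) A (b b' : gl A) : gmat (glM (glM (glM b (perm_gl A w)) b') (glV (zgl A))) =
  val (glV b') *m perm_mx w^-1 *m val (glV b).
Proof.
apply: invmx_eq; rewrite -[val (glM _ (glV _))]/(val b *m perm_mx w *m val b' *m invmx (val (zgl A))).
rewrite mulmxKV; last exact: (valP (zgl A)).
rewrite -[val (glV b')]/(invmx (val b')) -[val (glV b)]/(invmx (val b)) !mulmxA mulmxK; last exact: valP.
rewrite -[val b *m perm_mx w *m perm_mx _]mulmxA -perm_mxM mulgV perm_mx1 mulmx1.
by rewrite mulmxV //; exact: valP.
Qed.

Lemma cell_Y c S A (x : X A) : c.2 = c.1.+1 :> nat -> simple_set c S ->
  (forall ij, ij \in S -> (ij.1 < ij.2)%N) ->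
  in_cell (tperm c.1 c.2) (zphi X A x) -> Y S x.
Proof.
move=> c12 hS up [b [b' [bB b'B ex]]] [i j] hij; have ij := up _ hij; rewrite /= in ij *.
rewrite /gc ex cell_inv tpermV -mulmxA mxE big1 // => a _.
have [ai|ia] := leqP a i; last by rewrite (lower_inv b'B) ?mul0r.
rewrite mxE big1 ?mulr0 // => y _; rewrite !mxE.
have [e|] := eqVneq (tperm c.1 c.2 a) y; last by rewrite mul0r.
rewrite mul1r; apply: (lower_inv bB); rewrite -e.
have nc : (i, j) != c by rewrite -hS.
case: tpermP => [ea|ea|_ _]; last exact: leq_ltn_trans ij.
  rewrite c12; move: ai ij; rewrite ea => ai ij.
  have : (c.1.+1 <= j)%N by exact: leq_ltn_trans ij.
  rewrite leq_eqVlt => /orP[/eqP ej|//]; case/negP: nc.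
  have ei : i = c.1 by apply/val_inj/eqP; rewrite eqn_leq ai -ltnS ej ij.
  by rewrite (surjective_pairing c) xpair_eqE ei eqxx -val_eqE /= c12 ej.
by apply: leq_ltn_trans ij; move: ai; rewrite ea c12; exact: ltnW.
Qed.

(** The Bruhat decomposition of h made explicit by one column operation and one swap. The diagonal
    entries outside the two indices are not touched, which makes them units. *)
Lemma Y_cell_decomp c S K (x : X K) : is_field K -> c.2 = c.1.+1 :> nat -> simple_set c S ->
  Y S x -> crd c x != 0 -> exists E L : gl K,
    [/\ lower (val E), lower (val L), gc x *m val E *m perm_mx (tperm c.1 c.2) = val L
      & forall l, l != c.1 -> l != c.2 -> val L l l = gc x l l].
Proof.
move=> hK c12 hS Yx t0; set i := c.1 in c12 *; set j := c.2 in c12 *.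
have ij : (i < j)%N by rewrite c12.
have nij : i != j by rewrite -val_eqE /= (ltn_eqF ij).
set G := gc x; have Gz (a b : 'I_4) : (a < b)%N -> (a, b) != c -> G a b = 0.
  by move=> ab nc; apply: (Yx (a, b)); rewrite hS.
have GU : G \in unitmx by exact: gc_unit.
(* The multiple of column j that kills the entry (i, i) of column i; after the swap that entry would
   stand above the diagonal. *)
pose al := G i i / crd c x; have tU : crd c x \is a GRing.unit by rewrite (unit_field _ hK).
pose E : 'M[K]_4 := 1%:M - al *: delta_mx j i.
have EE : E *m (1%:M + al *: delta_mx j i) = 1%:M.
  rewrite mulmxDr mulmx1 mulmxBl mul1mx -scalemxAl -scalemxAr mul_delta_mx_0 // !scaler0 subr0.
  by rewrite subrK.
have [EU _] := mulmx1_unit EE.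
have EL : lower E.
  move=> a b ab; rewrite !mxE -val_eqE (ltn_eqF ab) /= sub0r.
  have -> : (a == j) && (b == i) = false.
    by apply/negP => /andP[/eqP ea /eqP eb]; move: ab; rewrite ea eb ltnNge ltnW.
  by rewrite mulr0 oppr0.
pose L := G *m E *m perm_mx (tperm i j).
have LU : L \in unitmx by rewrite !unitmx_mul GU EU unitmx_perm.
have GE a b : (G *m E) a b = G a b - (if b == i then al * G a j else 0).
  rewrite mulmxBr mulmx1 -scalemxAr mxE; congr (_ + _); rewrite mxE; congr (- _); rewrite mxE [_ a b]mxE.
  have [->|nb] := eqVneq b i.
    rewrite (bigD1 j) //= big1 => [|y ny]; first by rewrite mxE !eqxx mulr1 addr0.
    by rewrite mxE (negbTE ny) mulr0.
  by rewrite big1 ?mulr0 // => y _; rewrite mxE (negbTE nb) andbF mulr0.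
have LL : lower L.
  move=> a b ab; rewrite /L -[X in _ *m perm_mx X]tpermV -col_permE mxE GE.
  have cij : (i, j) = c by rewrite -surjective_pairing.
  case: tpermP => [eb|eb|/eqP bi /eqP bj].
  - rewrite eq_sym (negbTE nij) subr0; apply: Gz; first by apply: ltn_trans ab _; rewrite eb.
    by rewrite -cij xpair_eqE eqxx andbT; apply: contraTneq ab => ->; rewrite eb ltnn.
  - rewrite eqxx; have [->|na] := eqVneq a i.
      by rewrite -[G i j]/(crd c x) /al divrK ?subrr.
    rewrite (Gz a i) ?(Gz a j) ?mulr0 ?subrr //.
    + by rewrite -eb.
    + by rewrite -cij xpair_eqE (negbTE na).
    + by move: ab; rewrite eb c12 ltnS leq_eqVlt val_eqE (negbTE na).
    + by rewrite -cij xpair_eqE (negbTE na).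
  - rewrite (negbTE bi) subr0; apply: Gz => //.
    by rewrite -cij xpair_eqE (negbTE bj) andbF.
exists (mkgl EU), (mkgl LU); split=> // l li lj; rewrite /= /L -[X in _ *m perm_mx X]tpermV -col_permE mxE GE.
by rewrite tpermD; [rewrite (negbTE li) subr0|rewrite eq_sym|rewrite eq_sym].
Qed.

Lemma Y_cell c S K (x : X K) : is_field K -> c.2 = c.1.+1 :> nat -> simple_set c S ->
  Y S x -> crd c x != 0 -> in_cell (tperm c.1 c.2) (zphi X K x).
Proof.
move=> hK c12 hS Yx t0; have [E [L [EL LL e _]]] := Y_cell_decomp hK c12 hS Yx t0.
exists E, (glV L); split=> //; first exact: lower_inv.
apply: gmat_inj; rewrite cell_inv tpermV glVV -[gmat (zphi _ _ _)]/(gc x) -e.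
rewrite -[_ *m perm_mx _ *m perm_mx _]mulmxA -perm_mxM tperm2 perm_mx1 mulmx1.
by rewrite mulmxK //; exact: valP.
Qed.
End SwapAndCurves.

(** * Invariant functions on the closure of a stratum of length one *)

Section CurveInequality.
Variables (q : nat) (k : fieldType) (X : zip_space q k).
Notation alg := (comUnitAlgType k).
Implicit Types A B C K R : alg.
Hypothesis q0 : (0 < q)%N.
Hypothesis hfr : forall A, exists fr : {rmorphism A -> A}, forall a, fr a = a ^+ q.
Hypothesis smX : smooth_mor (zphi X).
Notation cset := (seq ('I_4 * 'I_4)).
Notation reg S F := (regular_on (Y (X := X) S) F).
Implicit Types (S : cset) (c d : 'I_4 * 'I_4) (F U M : forall A, X A -> A).
Notation um c m := (fun A (x : X A) => crd c x ^+ m).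

(** An equation of a closed subscheme containing the stratum vanishes wherever the coordinate does
    not, so its product with the coordinate is nilpotent. The chart is reduced and the coordinate a
    nonzerodivisor, so the equation is zero. *)
Lemma chart_closure c S R (xi : X R) V : chart S xi V -> c.2 = c.1.+1 :> nat -> simple_set c S ->
  reduced_closure (flag_stratum (tperm c.1 c.2) : subfun X) xi.
Proof.
move=> ch c12 hS Z cZ hZ; have [D hD] := cZ R xi.
have cS : c \notin S by rewrite hS ?c12 // eqxx.
rewrite -[xi](pmap_id (u := [the {lrmorphism R -> R} of idfun])) //; apply/hD => a Da /=.
apply: (chart_nzd ch cS); rewrite -/(crd c xi).
have [n e] : exists n, (crd c xi * a) ^+ n = 0.
  apply: contrapT => nex; have [|K [y [hK]]] := @point_exists k R (crd c xi * a).
    by move=> n; apply/eqP => e; apply: nex; exists n.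
  rewrite rmorphM => /eqP; apply; have [y0|yn] := eqVneq (y (crd c xi)) 0.
    by rewrite /= y0 mul0r.
  have Zy : Z K (pmap y xi).
    apply: hZ => //; apply: (Y_cell hK c12 hS); first exact: Y_map (chart_Y ch).
    by rewrite crd_map.
  by have /hD/(_ a Da) /= -> := Zy; rewrite mulr0.
exact: (smooth_reduced (ch_fg ch) (chart_fsmooth ch) e).
Qed.

Lemma closure_Y c S A (x : X A) : c.2 = c.1.+1 :> nat -> simple_set c S ->
  (forall ij, ij \in S -> (ij.1 < ij.2)%N) ->
  reduced_closure (flag_stratum (tperm c.1 c.2) : subfun X) x -> Y S x.
Proof.
move=> c12 hS up; apply; last by move=> K y hK; exact: cell_Y.
move=> B z; exists (fun a => exists2 ij, ij \in S & a = crd ij z) => C u; split.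
  by move=> Yz _ [ij hij ->]; rewrite -crd_map; exact: Yz.
by move=> h ij hij; rewrite -[LHS]/(crd ij _) crd_map; apply: h; exists ij.
Qed.

(* Otherwise F'^N * c^j * M would be an invariant function on the closure of the
   stratum, hence locally constant there, and it vanishes where gc is lower
   triangular. *)
Lemma curve_core S c nu F : c.2 = c.1.+1 :> nat -> simple_set c S ->
  (forall ij, ij \in S -> (ij.1 < ij.2)%N) -> stair S -> stair (c :: S) ->
  flag_closure_pseudo_complete X (tperm c.1 c.2) -> sect S nu F ->
  exists m, (exists K (p : X K), [/\ is_field K, lower (gc p) & ~ dvd S (um c m.+1) F p]) /\
    forall N j M mu, (0 < j)%N -> reg S M -> semi mu S M ->
      (forall A (x : X A), Y S x -> M A x \is a GRing.unit) ->
      (nu - tau q c *+ m) *+ N + tau q c *+ j + mu = 0 -> False.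
Proof.
move=> c12 hS up st stc pc sF; have cS : c \notin S by rewrite hS ?c12 // eqxx.
have hcor K (p : X K) : is_field K -> Y (c :: S) p -> lower (gc p).
  move=> hK Yp i j ij; apply: (Yp (i, j)); rewrite inE hS //=.
  by case: eqVneq.
have [m [F' [rF' sF' h1 [R [xi [V [K [v [ch hK vL ng]]]]]]]]] := curve_division q0 hfr smX cS st stc hcor sF.
exists m; split=> // N j M mu j0 rM sM uM e.
pose f A (x : X A) : A := F' A x ^+ N * crd c x ^+ j * M A x.
have rf : regular_on (reduced_closure (flag_stratum (tperm c.1 c.2) : subfun X)) f.
  move=> A B u x /(closure_Y c12 hS up) Yx.
  by rewrite /f rF' // rM // crd_map !rmorphM !rmorphXn.
have inv A (x y : gl A) (p : X A) : zipE' q x y ->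
    reduced_closure (flag_stratum (tperm c.1 c.2) : subfun X) p -> f A (zact x y p) = f A p.
  move=> [zxy xB] /(closure_Y c12 hS up) Yp; have [b [w [bP eb _ ->]]] := zipE_eact X hfr zxy.
  have bL : lower (val b) by rewrite -[b]glVV -eb; apply: lower_inv.
  have bU i : val b i i \is a GRing.unit by exact: lower_unit.
  rewrite /f sF' // (semi_crd q0 hfr stc w Yp bL) sM // !exprMn -!chiMn //.
  transitivity (chi ((nu - tau q c *+ m) *+ N + tau q c *+ j + mu) b * (F' A p ^+ N * crd c p ^+ j * M A p)).
    by rewrite !chiD //; ring.
  by rewrite e chi0 mul1r.
have [n [g [cc [sg hg]]]] := pc f rf inv R xi (chart_closure ch c12 hS).
have [i vi] : exists i, v (g i) != 0.
  apply: contrapT => nex; have := congr1 v sg; rewrite rmorph_sum rmorph1 big1 => [|i _].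
    by move/esym/eqP; rewrite oner_eq0.
  by apply/eqP; apply: contrapT => /negP h; apply: nex; exists i.
have Yxi := chart_Y ch.
have vf : v (f R xi) = 0.
  have vc : v (crd c xi) = 0 by rewrite -crd_map (crd_corner stc vL).
  by rewrite /f !rmorphM !rmorphXn /= vc expr0n eqn0Ngt j0 mulr0 mul0r.
have ci : cc i = 0.
  have := congr1 v (hg i); rewrite rmorphM rmorphB /= vf sub0r rmorph0 => /(field_mul hK)[].
    by move/eqP; rewrite (negbTE vi).
  rewrite (rmorph_alg v) => /eqP; rewrite oppr_eq0 scaler_eq0 oner_eq0 orbF.
  by move/eqP.
have : germ0 v (f R xi) by exists (g i) => //; have := hg i; rewrite ci scale0r subr0.
have fg := ch_fg ch; have sm := chart_fsmooth ch.
have powg n' a : germ0 v (a ^+ n') -> germ0 v a.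
  elim: n' => [[s vs]|n' IH]; first by rewrite mulr1 => s0; move: vs; rewrite s0 rmorph0 eqxx.
  by rewrite exprS => /(germ0_mul fg sm hK)[].
move=> /(germ0_mul fg sm hK)[/(germ0_mul fg sm hK)[/powg //|/powg]|].
  exact: (chart_coord ch).
move/(germ0_point hK) => /eqP; apply/negP.
by rewrite -(unit_field _ hK) rmorph_unit // uM.
Qed.


Lemma semi_mul S mu mu' U U' : semi mu S U -> semi mu' S U' ->
  semi (mu + mu') S (fun A x => U A x * U' A x).
Proof.
move=> h h' A x b w Yx bL; rewrite h // h' // chiD; last by move=> i; exact: lower_unit.
by ring.
Qed.
Lemma semi_zpow S mu U (z : int) : semi mu S U -> (forall A (x : X A), Y S x -> U A x \is a GRing.unit) ->
  semi (mu *~ z) S (fun A x => U A x ^ z).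
Proof.
move=> h uU A x b w Yx bL; have bU i : val b i i \is a GRing.unit by exact: lower_unit.
have cU : chi mu b \is a GRing.unit by exact: chi_unit.
by rewrite /= h // chiMz // exprMz_comm ?uU //; exact: mulrC.
Qed.

Definition tdet : 'rV[int]_4 := \sum_i tau q (i, i).
Lemma semi_det S : semi tdet S (fun A (x : X A) => \det (gc x)).
Proof.
move=> A x b w Yx bL; rewrite gc_eact //; last exact: lower_P.
rewrite [\det (_ *m val b)]det_mulmx [\det (_ *m gc x)]det_mulmx mulrAC; congr (_ * _).
have detL (g : 'M[A]_4) : lower g -> \det g = \prod_i g i i.
  by move=> gL; apply: det_trig; apply/is_trig_mxP => a c; exact: gL.
have bU i : val b i i \is a GRing.unit by exact: lower_unit.
have mL : lower (bmat q (val b) w) by apply: bmat_lower.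
rewrite [\det (bmat _ _ _)]detL // [\det (val b)]detL //.
rewrite -big_split /tdet.
have chi_sum (s : seq 'I_4) : chi (\sum_(i <- s) tau q (i, i)) b = \prod_(i <- s) (bmat q (val b) w i i * val b i i).
  elim: s => [|i s IH]; first by rewrite !big_nil chi0.
  by rewrite !big_cons chiD // IH chi_tau // bmat_diag.
exact/esym/chi_sum.
Qed.

Lemma det_unit A (x : X A) : \det (gc x) \is a GRing.unit.
Proof. by rewrite -unitmxE; exact: gc_unit. Qed.

(** For l outside the pair c all entries above and to the right of (l, l) vanish on [Y S], so this
    diagonal entry transforms like a corner. Such units supply the factor M of [curve_core]. *)
Lemma semi_diag c S l : c.2 = c.1.+1 :> nat -> simple_set c S -> l != c.1 -> l != c.2 ->
  semi (tau q (l, l)) S (@crd _ _ X (l, l)).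
Proof.
move=> c12 hS l1 l2 A x b w Yx bL; have bU i : val b i i \is a GRing.unit by exact: lower_unit.
rewrite /crd /= gc_eact //; last exact: lower_P.
rewrite corner_entry //; last first.
- move=> a e al le ne; have ae : (a < e)%N.
    rewrite ltn_neqAle (leq_trans al le) andbT; apply: contraNneq ne => /val_inj ea.
    rewrite -ea in le *; have -> : a = l by apply/val_inj/eqP; rewrite eqn_leq al le.
    by rewrite eqxx.
  apply: (Yx (a, e)); rewrite hS //; apply: contraNneq l1 => ec.
  rewrite -ec /= in c12 l2 *; move: le; rewrite c12 leq_eqVlt => /orP[/eqP h|h].
    by case/negP: l2; rewrite -val_eqE /= c12 h.
  by rewrite -val_eqE /= eqn_leq al -ltnS h.
- exact: bmat_lower.
by rewrite bmat_diag chi_tau //= mulrAC.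
Qed.

Lemma diag_unit c S l A (x : X A) : c.2 = c.1.+1 :> nat -> simple_set c S -> l != c.1 -> l != c.2 ->
  Y S x -> crd (l, l) x \is a GRing.unit.
Proof.
move=> c12 hS l1 l2 Yx; apply: unit_of_points => K y hK; rewrite -crd_map.
have Yy : Y S (pmap y x) by exact: Y_map.
rewrite -(unit_field _ hK); have [t0|tn] := eqVneq (crd c (pmap y x)) 0; last first.
  have [E [L [_ LL _ e]]] := Y_cell_decomp hK c12 hS Yy tn.
  by rewrite /crd /= -e //; exact: lower_unit.
have gL : lower (val (mkgl (gc_unit (pmap y x)))).
  move=> a b ab; have [e|ne] := eqVneq (a, b) c; first by move: t0; rewrite /crd -e.
  by apply: (Yy (a, b)); rewrite hS.
exact: (lower_unit l gL).
Qed.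
End CurveInequality.

Definition o0 : 'I_4 := @Ordinal 4 0 isT.
Definition o1 : 'I_4 := @Ordinal 4 1 isT.
Definition o2 : 'I_4 := @Ordinal 4 2 isT.
Definition o3 : 'I_4 := @Ordinal 4 3 isT.

Lemma ord4P (P : 'I_4 -> Prop) : P o0 -> P o1 -> P o2 -> P o3 -> forall i, P i.
Proof.
move=> h0 h1 h2 h3 [[|[|[|[|i]]]] hi] //.
- by rewrite (_ : Ordinal hi = o0) //; apply: val_inj.
- by rewrite (_ : Ordinal hi = o1) //; apply: val_inj.
- by rewrite (_ : Ordinal hi = o2) //; apply: val_inj.
- by rewrite (_ : Ordinal hi = o3) //; apply: val_inj.
Qed.

Lemma w0IE : [/\ w0I o0 = o2, w0I o1 = o1, w0I o2 = o0 & w0I o3 = o3].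
Proof.
have e0 : inord 0 = o0 by apply: val_inj; rewrite /= inordK.
have e2 : inord 2 = o2 by apply: val_inj; rewrite /= inordK.
by rewrite /w0I e0 e2; split; rewrite permE.
Qed.

Lemma rv4P (a b : 'rV[int]_4) : a 0 o0 = b 0 o0 -> a 0 o1 = b 0 o1 -> a 0 o2 = b 0 o2 ->
  a 0 o3 = b 0 o3 -> a = b.
Proof. by move=> h0 h1 h2 h3; apply/rowP; exact: ord4P. Qed.

Lemma mxMn_int (a : 'rV[int]_4) n i : (a *+ n) 0 i = n%:Z * a 0 i.
Proof. by rewrite mulmxnE -mulr_natl natz. Qed.
Lemma mxMz_int (a : 'rV[int]_4) z i : (a *~ z) 0 i = z * a 0 i.
Proof.
case: z => n; first by rewrite -pmulrn mxMn_int.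
by rewrite NegzE mulrNz -pmulrn mxE mxMn_int mulNr.
Qed.

Lemma tauE q c i : tau q c 0 i = q%:Z * (w0I c.1 == i)%:R + (c.2 == i)%:R.
Proof. by rewrite mxE mxMn_int !mxE eqxx ![_ == i]eq_sym. Qed.

Lemma tdetE q i : tdet q 0 i = q%:Z + 1.
Proof.
have [h0 h1 h2 h3] := w0IE; rewrite /tdet !big_ord_recl big_ord0 !mxE !mxMn_int !mxE !eqxx /=.
have -> : (ord0 : 'I_4) = o0 by apply: val_inj.
have -> : lift o0 (ord0 : 'I_3) = o1 by apply: val_inj.
have -> : lift o0 (lift ord0 (ord0 : 'I_2)) = o2 by apply: val_inj.
have -> : lift o0 (lift ord0 (lift ord0 (ord0 : 'I_1))) = o3 by apply: val_inj.
by rewrite h0 h1 h2 h3; move: i; apply: ord4P => /=; ring.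
Qed.

Section ThreeCurves.
Variables (q : nat) (k : fieldType) (X : zip_space q k).
Notation alg := (comUnitAlgType k).
Implicit Types A B C K R : alg.
Hypothesis q0 : (0 < q)%N.
Hypothesis hfr : forall A, exists fr : {rmorphism A -> A}, forall a, fr a = a ^+ q.
Hypothesis smX : smooth_mor (zphi X).
Notation cset := (seq ('I_4 * 'I_4)).
Notation reg S F := (regular_on (Y (X := X) S) F).
Implicit Types (S : cset) (c d : 'I_4 * 'I_4) (F U M : forall A, X A -> A).
Notation um c m := (fun A (x : X A) => crd c x ^+ m).

Let Q : int := q%:Z.
Let D : int := Q ^+ 2 - Q + 1.

(** Each of the three forms is, up to scale, the one that kills the weights of the units on the
    corresponding curve: [tau q (l, l)] for the two other indices l, and [tdet q]. The scale is
    fixed by the value -D on the weight of the coordinate of the curve. *)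
Definition phi01 (v : 'rV[int]_4) : int := v 0 o0 + (Q - 1) * v 0 o1 - Q * v 0 o2.
Definition phi12 (v : 'rV[int]_4) : int := Q * v 0 o0 - (Q - 1) * v 0 o1 - v 0 o2.
Definition phi23 (v : 'rV[int]_4) : int := - Q * v 0 o0 + v 0 o2 + (Q - 1) * v 0 o3.

(** The identity solves the weight equation of [curve_core], with [D * Q * (Q + 1)] clearing the
    denominators. A positive value of [phi] would be a positive exponent of the coordinate, which is
    excluded. *)
Lemma curve_inequality S c nu F (phi : 'rV[int]_4 -> int) l1 l2 (a b g : 'rV[int]_4 -> int) :
  c.2 = c.1.+1 :> nat -> simple_set c S ->
  (forall ij, ij \in S -> (ij.1 < ij.2)%N) -> stair S -> stair (c :: S) ->
  flag_closure_pseudo_complete X (tperm c.1 c.2) ->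
  l1 != c.1 -> l1 != c.2 -> l2 != c.1 -> l2 != c.2 ->
  (forall v, v *~ (D * Q * (Q + 1)) + tau q c *~ (Q * (Q + 1) * phi v) + tau q (l1, l1) *~ a v
     + tau q (l2, l2) *~ b v + tdet q *~ g v = 0) ->
  sect S nu F ->
  exists m, (exists K (p : X K), [/\ is_field K, lower (gc p) & ~ dvd S (um c m.+1) F p]) /\
    phi (nu - tau q c *+ m) <= 0.
Proof.
move=> c12 hS up st stc pc n1 n2 n3 n4 id sF.
have [m [h1 h2]] := curve_core q0 hfr smX c12 hS up st stc pc sF; exists m; split=> //.
set v := nu - tau q c *+ m in h2 *; rewrite leNgt; apply/negP => pos.
have Q0 : 0 < Q by rewrite ltz_nat.
have D0 : 0 < D by rewrite /D; nia.
have N0 : 0 <= D * Q * (Q + 1) by nia.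
have j0 : 0 < Q * (Q + 1) * phi v by rewrite mulr_gt0 // mulr_gt0 // addr_gt0.
pose M A (x : X A) : A := crd (l1, l1) x ^ a v * crd (l2, l2) x ^ b v * (\det (gc x)) ^ g v.
refine (h2 (absz (D * Q * (Q + 1))) (absz (Q * (Q + 1) * phi v)) M
  (tau q (l1, l1) *~ a v + tau q (l2, l2) *~ b v + tdet q *~ g v) _ _ _ _ _).
- by rewrite absz_gt0 gt_eqF.
- move=> A B u x Yx; rewrite /M !rmorphM !rmorphXz ?crd_map //.
  + by rewrite gc_map det_map_mx.
  + exact: det_unit.
  + exact: (diag_unit c12 hS n3 n4 Yx).
  + exact: (diag_unit c12 hS n1 n2 Yx).
- have s1 := semi_zpow (a v) (semi_diag q0 hfr c12 hS n1 n2)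
    (fun A (x : X A) Yx => diag_unit c12 hS n1 n2 Yx).
  have s2 := semi_zpow (b v) (semi_diag q0 hfr c12 hS n3 n4)
    (fun A (x : X A) Yx => diag_unit c12 hS n3 n4 Yx).
  have s3 := semi_zpow (g v) (semi_det (S := S) q0 hfr) (fun A (x : X A) _ => det_unit x).
  exact: (semi_mul (semi_mul s1 s2) s3).
- move=> A x Yx; rewrite /M !unitrM !unitrXz ?det_unit //.
    exact: (diag_unit c12 hS n3 n4 Yx).
  exact: (diag_unit c12 hS n1 n2 Yx).
- rewrite !pmulrn !gez0_abs //; last exact: ltW.
  by rewrite -[RHS](id v) !addrA.
Qed.
Ltac weight_identity := let h0 := fresh in let h1 := fresh in let h2 := fresh in let h3 := fresh in
  case: w0IE => h0 h1 h2 h3 v; apply: rv4P; rewrite !mxE !mxMz_int !tauE !tdetE /= ?h0 ?h1 ?h2 ?h3 /=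
    /phi01 /phi12 /phi23 /D; ring.

Lemma curve01 S nu F : simple_set (o0, o1) S -> (forall ij, ij \in S -> (ij.1 < ij.2)%N) ->
  stair S -> stair ((o0, o1) :: S) -> flag_closure_pseudo_complete X (tperm o0 o1) -> sect S nu F ->
  exists m, (exists K (p : X K), [/\ is_field K, lower (gc p) & ~ dvd S (um (o0, o1) m.+1) F p]) /\
    phi01 (nu - tau q (o0, o1) *+ m) <= 0.
Proof.
move=> hS up st stc pc.
(* The coordinate of index 1, where both diagonal weights vanish, determines the coefficient of
   [tdet], hence [G]; the coordinates 0 and 3 then determine the other two. The next two lemmas are
   solved in the same way. *)
pose G (v : 'rV[int]_4) := Q * v 0 o2 - Q ^+ 2 * v 0 o1 - v 0 o0.
apply: (@curve_inequality S (o0, o1) nu F phi01 o2 o3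
  (fun v => - (D * (Q + 1) * v 0 o0 + (Q + 1) * G v))
  (fun v => - (D * Q * v 0 o3 + Q * G v)) (fun v => Q * G v)) => //.
rewrite /G; weight_identity.
Qed.

Lemma curve12 S nu F : simple_set (o1, o2) S -> (forall ij, ij \in S -> (ij.1 < ij.2)%N) ->
  stair S -> stair ((o1, o2) :: S) -> flag_closure_pseudo_complete X (tperm o1 o2) -> sect S nu F ->
  exists m, (exists K (p : X K), [/\ is_field K, lower (gc p) & ~ dvd S (um (o1, o2) m.+1) F p]) /\
    phi12 (nu - tau q (o1, o2) *+ m) <= 0.
Proof.
move=> hS up st stc pc.
pose G (v : 'rV[int]_4) := Q * v 0 o2 - v 0 o1 - Q ^+ 2 * v 0 o0.
apply: (@curve_inequality S (o1, o2) nu F phi12 o0 o3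
  (fun v => - (D * Q * (Q + 1) * v 0 o0 + Q * (Q + 1) * G v))
  (fun v => - (D * Q * v 0 o3 + Q * G v)) (fun v => Q * G v)) => //.
rewrite /G; weight_identity.
Qed.

Lemma curve23 S nu F : simple_set (o2, o3) S -> (forall ij, ij \in S -> (ij.1 < ij.2)%N) ->
  stair S -> stair ((o2, o3) :: S) -> flag_closure_pseudo_complete X (tperm o2 o3) -> sect S nu F ->
  exists m, (exists K (p : X K), [/\ is_field K, lower (gc p) & ~ dvd S (um (o2, o3) m.+1) F p]) /\
    phi23 (nu - tau q (o2, o3) *+ m) <= 0.
Proof.
move=> hS up st stc pc.
pose G (v : 'rV[int]_4) := Q * v 0 o0 - Q ^+ 2 * v 0 o3 - v 0 o2.
apply: (@curve_inequality S (o2, o3) nu F phi23 o0 o1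
  (fun v => - (D * (Q + 1) * v 0 o2 + (Q + 1) * G v))
  (fun v => - (D * Q * v 0 o1 + Q * G v)) (fun v => Q * G v)) => //.
rewrite /G; weight_identity.
Qed.
End ThreeCurves.

(** * Root subgroups of the Levi *)

Section Elementary.
Variables (q : nat) (A : comUnitRingType).
Implicit Types (t : A) (a b : 'I_4).

Lemma uel_unit a b t : a != b -> (1%:M + t *: delta_mx a b : 'M[A]_4) \in unitmx.
Proof.
move=> ab; suff h : (1%:M + t *: delta_mx a b) *m (1%:M - t *: delta_mx a b) = 1%:M :> 'M[A]_4.
  by case: (mulmx1_unit h).
rewrite mulmxDl mul1mx mulmxBr mulmx1 -scalemxAl -scalemxAr mul_delta_mx_0 1?eq_sym //.
by rewrite !scaler0 subr0 subrK.
Qed.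
Definition uel a b t : gl A := insubd (gl1 A) (1%:M + t *: delta_mx a b).
Lemma uelE a b t : a != b -> val (uel a b t) = 1%:M + t *: delta_mx a b.
Proof. by move=> ab; rewrite val_insubd uel_unit. Qed.

Lemma uel_P a b t : a != b -> b != ord_max -> Pshape (val (uel a b t)).
Proof.
move=> ab b3 i i3; rewrite uelE // !mxE (negbTE i3) [ord_max == b]eq_sym (negbTE b3) andbF.
by rewrite mulr0 addr0.
Qed.

Lemma bmat_uel a b t : (0 < q)%N -> a != b -> a != ord_max -> b != ord_max ->
  bmat q (val (uel a b t)) (fun=> 0) = 1%:M + (t ^+ q) *: delta_mx (w0I b) (w0I a).
Proof.
move=> q0 ab a3 b3; apply/matrixP => i j; rewrite bmatE uelE // !mxE !w0I_eqmax.
have e1 : (w0I j == a) = (j == w0I a) by rewrite -(inj_eq (@perm_inj _ w0I)) w0IK.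
have e2 : (w0I i == b) = (i == w0I b) by rewrite -(inj_eq (@perm_inj _ w0I)) w0IK.
rewrite e1 e2 (inj_eq perm_inj) [(i == w0I b) && _]andbC [j == i]eq_sym.
have [ei|ni] := eqVneq i ord_max; have [ej|nj] := eqVneq j ord_max => //=.
- rewrite ei ej eqxx; have -> : (ord_max == w0I b) = false.
    by rewrite -[in LHS]w0I_max (inj_eq perm_inj) eq_sym (negbTE b3).
  by rewrite /= ?andbF /= ?mulr0 ?addr0 ?expr1n ?expr0n ?eqn0Ngt ?q0 /= ?mulr0 ?addr0.
- rewrite ei eq_sym (negbTE nj); have -> : (ord_max == w0I b) = false.
    by rewrite -[in LHS]w0I_max (inj_eq perm_inj) eq_sym (negbTE b3).
  by rewrite /= ?andbF /= ?mulr0 ?addr0 ?expr1n ?expr0n ?eqn0Ngt ?q0 /= ?mulr0 ?addr0.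
- rewrite ej (negbTE ni); have -> : (ord_max == w0I a) = false.
    by rewrite -[in LHS]w0I_max (inj_eq perm_inj) eq_sym (negbTE a3).
  by rewrite /= ?andbF /= ?mulr0 ?addr0 ?expr1n ?expr0n ?eqn0Ngt ?q0 /= ?mulr0 ?addr0.
have [eij|nij] := eqVneq i j.
  rewrite eij; have -> : (j == w0I a) && (j == w0I b) = false.
    by apply/negP => /andP[/eqP-> ]; rewrite (inj_eq perm_inj) (negbTE ab).
  by rewrite !mulr0n !mulr0 !addr0 expr1n.
rewrite ?[j == i]eq_sym ?(negbTE nij) /= !add0r; case: (_ && _); rewrite ?mulr1 // !mulr0.
by rewrite expr0n eqn0Ngt q0.
Qed.

Lemma flow_entry (g : 'M[A]_4) (c d a b i : 'I_4) (s t : A) : b != ord_max ->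
  ((1%:M + s *: delta_mx c d) *m g *m (1%:M + t *: delta_mx a b)) i ord_max =
  g i ord_max + s * (i == c)%:R * g d ord_max.
Proof.
move=> b3; rewrite mulmxDr mulmx1 mxE [X in _ + X]mxE big1 ?addr0 => [|l _]; last first.
  by rewrite !mxE [ord_max == b]eq_sym (negbTE b3) andbF !mulr0.
rewrite mulmxDl mul1mx mxE -scalemxAl [X in _ + X]mxE [X in _ * X]mxE (bigD1 d) //=.
rewrite big1 ?addr0 => [|l nl]; last by rewrite mxE (negbTE nl) andbF mul0r.
by rewrite mxE eqxx andbT mulrA.
Qed.
End Elementary.

Section Line.
Variables (q : nat) (k : fieldType) (X : zip_space q k).
Notation alg := (comUnitAlgType k).
Implicit Types A B C K R : alg.
Variables (lam : 'rV[int]_4) (F : forall A, X A -> gl A -> A).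
Hypothesis hF : is_section lam F.

Lemma uel_map A B (u : {lrmorphism A -> B}) (a b : 'I_4) (t : A) : a != b ->
  gl_map u (uel a b t) = uel a b (u t).
Proof.
move=> ab; apply: gl_eq; rewrite /= !uelE //; apply/matrixP => i j; rewrite !mxE rmorphD rmorphM.
by rewrite !rmorph_nat.
Qed.

Definition blk A (a b : 'I_4) (x y z w : A) : 'M[A]_4 :=
  \matrix_(i, j) (if i == a then (if j == a then x else if j == b then y else 0) else
                  if i == b then (if j == a then z else if j == b then w else 0) else (i == j)%:R).

Lemma blkM A (a b : 'I_4) (x y z w x' y' z' w' : A) : a != b ->
  blk a b x y z w *m blk a b x' y' z' w' =
  blk a b (x * x' + y * z') (x * y' + y * w') (z * x' + w * z') (z * y' + w * w').
Proof.
move=> ab; have ba : (b == a) = false by rewrite eq_sym (negbTE ab).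
apply/matrixP => i j; rewrite !mxE (bigD1 a) //= (bigD1 b) /=; last by rewrite ba.
rewrite !mxE !eqxx ba addrA.
have [->|ia] := eqVneq i a.
  rewrite big1 => [|l /andP[la lb]]; last by rewrite !mxE eqxx (negbTE la) (negbTE lb) mul0r.
  have [ej|ja] := eqVneq j a; rewrite /= ?addr0 //.
  by have [_|jb] := eqVneq j b; rewrite /= ?addr0 // !mulr0 addr0.
have [->|ib] := eqVneq i b.
  rewrite big1 => [|l /andP[la lb]]; last by rewrite !mxE eqxx ba (negbTE la) (negbTE lb) mul0r.
  have [ej|ja] := eqVneq j a; rewrite /= ?addr0 //.
  by have [_|jb] := eqVneq j b; rewrite /= ?addr0 // !mulr0 addr0.
rewrite /= !mul0r !add0r (bigD1 i) /=; last by rewrite ia ib.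
rewrite !mxE eqxx ?(negbTE ia) ?(negbTE ib) mul1r big1 ?addr0 // => l /andP[/andP[la lb] li].
by rewrite !mxE (negbTE ia) (negbTE ib) eq_sym (negbTE li) mul0r.
Qed.

Lemma blk1 A (a b : 'I_4) : a != b -> blk a b 1 0 0 1 = 1%:M :> 'M[A]_4.
Proof.
move=> ab; apply/matrixP => i j; rewrite !mxE.
have [->|ia] := eqVneq i a.
  by rewrite [a == j]eq_sym; case: (j == a) => //; case: (j == b).
have [->|ib] := eqVneq i b => //; rewrite [b == j]eq_sym.
by have [ej|ja] := eqVneq j a; rewrite ?ej ?(negbTE ab) //; case: (j == b).
Qed.

Lemma blk_uel A (a b : 'I_4) (t : A) : a != b -> blk a b 1 t 0 1 = val (uel a b t).
Proof.
move=> ab; rewrite uelE //; apply/matrixP => i j; rewrite !mxE.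
have [->|ia] := eqVneq i a.
  rewrite [a == j]eq_sym; have [ej|ja] := eqVneq j a; first by rewrite ej (negbTE ab) /= mulr0 addr0.
  by case: (j == b); rewrite /= ?mulr1 ?mulr0 ?add0r.
have [->|ib] := eqVneq i b; rewrite /= mulr0 addr0 // [b == j]eq_sym.
by have [ej|ja] := eqVneq j a; rewrite ?ej ?(negbTE ab) //; case: (j == b).
Qed.

Lemma nel_unit A (a b : 'I_4) (s : A) : a != b -> blk a b 0 1 (-1) s \in unitmx.
Proof.
move=> ab; suff h : blk a b 0 1 (-1) s *m blk a b s (-1) 1 0 = 1%:M by case: (mulmx1_unit h).
by rewrite blkM // -(blk1 A ab); congr blk; ring.
Qed.

(* [uel a b t] is the product of a matrix depending polynomially on t^-1 and of a
   lower triangular one, which bounds the degree in t. *)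
Lemma section_degree (a b : 'I_4) A (p : X A) : a != b -> (a < b)%N -> b != ord_max ->
  exists P : {poly A}, (forall m : nat, lam 0 a - lam 0 b < m%:Z -> P`_m = 0) /\
    forall B (u : {lrmorphism A -> B}) (t : B), F (pmap u p) (uel a b t) = (map_poly u P).[t].
Proof.
move=> ab ltab b3; have [nat_F bor_F _] := hF.
have ba : (b == a) = false by rewrite eq_sym (negbTE ab).
have [C [e [g [eK gK eC]]]] := poly_alg A; have [c0 c0E] := polyC_lr eC.
set T := e 'X.
have nelP B (s : B) : in_P (mkgl (nel_unit s ab)).
  apply/in_PP => i i3; rewrite /= mxE [ord_max == b]eq_sym (negbTE b3).
  have a3 : (ord_max == a) = false.
    by apply/negP => /eqP ea; move: ltab; rewrite -ea ltnNge -ltnS ltn_ord.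
  by rewrite a3 (negbTE i3); do 2 case: ifP => //.
have uelP B (s : B) : in_P (uel a b s) by apply/in_PP/uel_P.
pose P := g (F (pmap c0 p) (uel a b T)); pose Qp := g (F (pmap c0 p) (mkgl (nel_unit T ab))).
have eP : e P = F (pmap c0 p) (uel a b T) by rewrite gK.
have eQ : e Qp = F (pmap c0 p) (mkgl (nel_unit T ab)) by rewrite gK.
have ev B (u : {lrmorphism A -> B}) (t : B) : exists v : {lrmorphism C -> B},
    [/\ v \o c0 =1 u, v T = t & forall R : {poly A}, v (e R) = (map_poly u R).[t]].
  have [h [hC hX]] := horner_rmorph u t.
  have h2 (z : k) : (h \o g) z%:A = z%:A by rewrite /= -eC eK hC; exact: (rmorph_alg u).
  have [v vE] := lrmorph_of h2; exists v; split=> [r||R].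
  - by rewrite /= vE /= c0E eK hC.
  - by rewrite vE /= eK hX.
  rewrite vE /= eK (@horner_coef_wide _ (size R)); last exact: size_poly.
  rewrite -{1}[R]coefK poly_def rmorph_sum; apply: eq_bigr => i _.
  by rewrite -mul_polyC rmorphM rmorphXn hC hX coef_map.
exists P; split; last first.
  move=> B u t; have [v [vc vT vE]] := ev B u t.
  rewrite -vE eP -nat_F // uel_map // vT pmap2; congr (F _ _); exact/esym/pmap_eq.
have [n1 [n2 en]] : exists n1 n2 : nat, lam 0 a - lam 0 b = n1%:Z - n2%:Z.
  by case: (lam 0 a - lam 0 b) => n; [exists n, 0%N|exists 0%N, n.+1]; rewrite ?subr0 ?sub0r ?NegzE.
have Tn N : T ^+ N != 0.
  apply/eqP; rewrite -rmorphXn => /(congr1 g); rewrite eK rmorph0 => /eqP.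
  by rewrite -size_poly_eq0 size_polyXn.
have [L [l lL]] := loc_exists Tn; have [lU _ lk] := lL.
have linj (R R' : {poly A}) : l (e R) = l (e R') -> R = R'.
  move=> h; apply/eqP; rewrite -subr_eq0.
  have [|N] := lk (e (R - R')); first by rewrite !rmorphB /= h subrr.
  rewrite -rmorphXn -rmorphM => /(congr1 g); rewrite eK rmorph0 => h0.
  apply/eqP/polyP => i; have := congr1 (fun D : {poly A} => D`_(N + i)) h0.
  by rewrite coefXnM ltnNge leq_addr /= addKn !coef0.
pose t := l T; pose s := t^-1; have ts : t * s = 1 by rewrite mulrV.
have [v [vc vT vE]] := ev L [the {lrmorphism A -> L} of l \o c0] s.
have belU : blk a b s 0 1 t \in unitmx.
  have := uel_unit t ab; rewrite -uelE // -blk_uel //.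
  have -> : blk a b 1 t 0 1 = blk a b 0 1 (-1) s *m blk a b s 0 1 t.
    by rewrite blkM //; congr blk; rewrite ?[s * t]mulrC ?ts; ring.
  by rewrite unitmx_mul => /andP[].
have eprod : uel a b t = glM (mkgl (nel_unit s ab)) (mkgl belU).
  apply: gl_eq; rewrite -blk_uel //= blkM //; congr blk; rewrite ?[s * t]mulrC ?ts; ring.
have belB : in_B (mkgl belU).
  move=> i j ij; rewrite /= !mxE; case: eqP => [ia|_].
    by case: eqP => [ja|_]; [move: ij; rewrite ia ja ltnn|case: eqP].
  case: eqP => [ib|_]; last by rewrite -val_eqE (ltn_eqF ij).
  case: eqP => [ja|_]; first by move: ij; rewrite ib ja ltnNge ltnW.
  by case: eqP => // jb; move: ij; rewrite ib jb ltnn.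
have chiE : chi lam (mkgl belU) * t ^+ n1 = t ^+ n2.
  have -> : chi lam (mkgl belU) = s ^ lam 0 a * t ^ lam 0 b.
    rewrite /chi (bigD1 a) //= (bigD1 b) /=; last by rewrite ba.
    rewrite !mxE !eqxx ba mulrA big1 ?mulr1 // => i /andP[ia ib].
    by rewrite mxE (negbTE ia) (negbTE ib) eqxx exp1rz.
  rewrite /s exprz_inv !exprnP -!exprzDr //; congr (_ ^ _).
  by apply/eqP; rewrite -subr_eq0; apply/eqP; move: en; lia.
have st (j n : nat) : (j <= n)%N -> s ^+ j * t ^+ n = t ^+ (n - j).
  by move=> jn; rewrite -[in LHS](subnKC jn) exprD mulrA -exprMn [s * t]mulrC ts expr1n mul1r.
(* [Q'] is T^d Qp(1/T), a polynomial of degree at most d. *)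
set d := size Qp; pose Q' : {poly A} := \sum_(j < d) Qp`_j *: 'X^(d - j).
have Q'0 i : (d < i)%N -> Q'`_i = 0.
  move=> di; rewrite coef_sum big1 // => j _; rewrite coefZ coefXn.
  by rewrite gtn_eqF ?mulr0 //; apply: leq_ltn_trans (leq_subr _ _) di.
have eQ' : v (e Qp) * t ^+ d = l (e Q').
  rewrite vE (@horner_coef_wide _ d); last exact: size_poly.
  rewrite mulr_suml !rmorph_sum; apply: eq_bigr => j _.
  rewrite -mul_polyC !rmorphM !rmorphXn -[e _%:P]c0E coef_map /= -/t -mulrA; congr (_ * _).
  exact/st/ltnW.
have relL : chi lam (mkgl belU) * l (e P) = v (e Qp).
  rewrite eP eQ -(nat_F _ _ l _ _ (uelP _ _)) -(nat_F _ _ v _ _ (nelP _ _)).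
  rewrite uel_map // -/t eprod (bor_F _ _ _ _ (nelP _ _) belB).
  rewrite mulrA mulrV ?mul1r; last by apply: chi_unit; exact: belB.
  rewrite !pmap2 (pmap_eq (v := [the {lrmorphism A -> L} of v \o c0])); last by move=> r; exact/esym/(vc r).
  congr (F _ _); apply: gl_eq; apply/matrixP => i j; rewrite !mxE.
  by do !case: ifP => _; rewrite ?rmorph0 ?rmorph1 ?rmorphN1 ?rmorph_nat ?vT.
(* The character of the lower triangular factor is t^(n2 - n1), so P is t^(n1 - n2) times a
   polynomial in 1/t; its degree is at most n1 - n2, the difference of the two weights. *)
have key : P * 'X^(n2 + d) = Q' * 'X^n1.
  have h (R : {poly A}) N : l (e (R * 'X^N)) = l (e R) * t ^+ N by rewrite !rmorphM !rmorphXn.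
  apply: linj; rewrite !h -eQ' -relL exprD -chiE.
  by ring.
move=> m hm; have n1m : (n1 < m + n2)%N by move: hm; rewrite en; lia.
have := congr1 (fun D : {poly A} => D`_(m + (n2 + d))) key.
rewrite !coefMXn ltnNge leq_addl /= addnK => ->.
rewrite ltnNge (leq_trans (ltnW n1m)) /=; last by rewrite addnA leq_addr.
by apply: Q'0; lia.
Qed.
End Line.

Section TruncatedFlow.
Variable k : fieldType.
Notation alg := (comUnitAlgType k).
Implicit Types A B C K R : alg.

(* Comparing the coefficients of t^(q m) in phi = u^m psi along the flow. *)
Lemma truncated_flow (q m : nat) R R2 (rho : {lrmorphism R -> R2}) C (c : {lrmorphism R -> C}) t
    (z : {lrmorphism C -> R}) (v : {lrmorphism R -> C}) (phi psi u x : R) (P : {poly R}) (n : int) :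
  truncation (q * m).+1 c t z -> z \o v =1 id -> phi = u ^+ m * psi -> v u = c u + t ^+ q * c x ->
  rho u = 0 -> v phi = (map_poly c P).[t] -> (forall i : nat, n < i%:Z -> P`_i = 0) ->
  n < (q * m)%:Z -> rho (x ^+ m * psi) = 0.
Proof.
move=> tr zv ephi vu ru vphi Pn nqm; set N := (q * m)%N in tr nqm *.
(* The jet is reduced along [rho], where u starts at 0 and becomes t^q x. As t^(N+1) = 0 with N = q
   m, only the value of psi at t = 0 survives next to u^m. *)
have [C2 [c2 [t2 [z2 tr2]]]] := truncation_exists R2 N.
have [h [hc ht]] := tr_univ tr [the {lrmorphism R -> C2} of c2 \o rho] (tr_nil tr2).
have hcE r : h (c r) = c2 (rho r) by exact: (hc r).
have [y ey] : exists y, v psi = c psi + t * y.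
  have [a ea] := tr_sum tr (v psi); exists (\sum_(i < N) c (a i.+1) * t ^+ i).
  have a0 : a 0%N = psi.
    have <- : z (v psi) = psi by exact: (zv psi).
    rewrite ea big_ord_recl rmorphD rmorph_sum /= expr0 mulr1 (tr_z tr) big1 ?addr0 // => i _.
    by rewrite rmorphM rmorphXn /= (tr_zt tr) exprS mul0r mulr0.
  rewrite ea big_ord_recl /= expr0 mulr1 a0 mulr_sumr; congr (_ + _); apply: eq_bigr => i _.
  by rewrite exprS mulrCA.
have e1 : h (v phi) = t2 ^+ N * c2 (rho (x ^+ m * psi)).
  rewrite ephi !rmorphM !rmorphXn /= vu ey !rmorphD !rmorphM !rmorphXn /= !hcE ht ru rmorph0 add0r.
  rewrite exprMn -exprM -/N mulrDr mulrA.
  transitivity (t2 ^+ N * c2 (rho x) ^+ m * c2 (rho psi) + t2 ^+ N.+1 * (c2 (rho x) ^+ m * h y)).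
    by rewrite exprSr; ring.
  by rewrite (tr_nil tr2) mul0r addr0 mulrA.
have e2 : h (v phi) = \sum_(i < N) c2 (rho P`_i) * t2 ^+ i.
  rewrite vphi (@horner_coef_wide _ N) ?rmorph_sum.
    by apply: eq_bigr => i _; rewrite coef_map rmorphM rmorphXn /= hcE ht.
  apply: leq_trans (size_poly _ _) _; apply/leq_sizeP => i iN; apply: Pn.
  by apply: lt_le_trans nqm _; rewrite lez_nat.
pose a i := if (i < N)%N then rho P`_i else - rho (x ^+ m * psi).
have : \sum_(i < N.+1) c2 (a i) * t2 ^+ i = 0.
  rewrite big_ord_recr /= /a ltnn rmorphN mulNr [X in _ - X]mulrC -e1 e2.
  apply/eqP; rewrite subr_eq0; apply/eqP; apply: eq_bigr => i _ /=.
  by rewrite ltn_ord.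
move/(tr_inj tr2) => /(_ N (ltnSn N)); rewrite /a ltnn => /eqP.
by rewrite oppr_eq0 => /eqP.
Qed.
End TruncatedFlow.

Section Flow.
Variables (q : nat) (k : fieldType) (X : zip_space q k).
Notation alg := (comUnitAlgType k).
Implicit Types A B C K R : alg.
Hypothesis q0 : (0 < q)%N.
Hypothesis hfr : forall A, exists fr : {rmorphism A -> A}, forall a, fr a = a ^+ q.
Hypothesis smX : smooth_mor (zphi X).
Notation cset := (seq ('I_4 * 'I_4)).
Notation reg S F := (regular_on (Y (X := X) S) F).
Implicit Types (S : cset) (d : 'I_4 * 'I_4).
Notation um c m := (fun A (x : X A) => crd c x ^+ m).

Lemma o3_max : o3 = ord_max. Proof. exact: val_inj. Qed.

Definition flow A (a b : 'I_4) (t : A) (x : X A) : X A := eact (uel a b t) (fun=> 0) x.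

Lemma flow_map A B (u : {lrmorphism A -> B}) (a b : 'I_4) (t : A) (x : X A) : a != b -> b != ord_max ->
  pmap u (flow a b t x) = flow a b (u t) (pmap u x).
Proof.
move=> ab b3; rewrite /flow eact_nat //; last exact: uel_P.
by rewrite uel_map //; apply: eact_ext => i /=; rewrite rmorph0.
Qed.

Lemma flow0 A (a b : 'I_4) (x : X A) : a != b -> flow a b 0 x = x.
Proof.
move=> ab; rewrite /flow (_ : uel a b 0 = gl1 A) ?eact1 //.
by apply: gl_eq; rewrite uelE // scale0r addr0.
Qed.

Lemma crd_flow A (a b i : 'I_4) (t : A) (x : X A) : a != b -> a != ord_max -> b != ord_max ->
  crd (i, o3) (flow a b t x) = crd (i, o3) x + t ^+ q * ((i == w0I b)%:R * crd (w0I a, o3) x).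
Proof.
move=> ab a3 b3; rewrite /crd /flow gc_eact //; last exact: uel_P.
by rewrite bmat_uel // uelE // o3_max /= flow_entry // mulrA.
Qed.

(** The parameter t is nilpotent, so the flow moves no field-valued point and stays in the open set
    V; this is why flows are truncated. *)
Lemma flow_chart S R (xi : X R) V C L (c : {lrmorphism R -> C}) t (z : {lrmorphism C -> R}) (a b : 'I_4) :
  chart S xi V -> a != b -> b != ord_max -> truncation L.+1 c t z ->
  Y S (flow a b t (pmap c xi)) ->
  exists v : {lrmorphism R -> C}, pmap v xi = flow a b t (pmap c xi) /\ z \o v =1 id.
Proof.
move=> ch ab b3 tr Yt; have [|v vE] := ch_univ ch (x := flow a b t (pmap c xi)).
  apply: (po_loc (ch_open ch)) => // K y hK; rewrite flow_map //.
  have -> : y t = 0.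
    apply/eqP; apply: contraT => h; have := field_expf L.+1 hK h.
    by rewrite -rmorphXn (tr_nil tr) rmorph0 eqxx.
  by rewrite flow0 // pmap2; apply: (po_map (ch_open ch)); exact: ch_in ch.
exists v; split=> //.
apply: (ch_uniq ch (v := [the {lrmorphism R -> R} of z \o v]) (v' := [the {lrmorphism R -> R} of idfun])).
rewrite -pmap2 vE flow_map // (tr_zt tr) flow0 // pmap2; apply: pmap_eq => r.
exact: (tr_z tr).
Qed.

Variables (lam : 'rV[int]_4) (F : forall A, X A -> gl A -> A).
Hypothesis hF : is_section lam F.
Let f A (x : X A) : A := F x (gl1 A).

(** Equivariance transfers the second argument of a section to the point, so a section is determined
    by its values at the identity of P. *)
Lemma section_eact A (c : gl A) (w : 'I_4 -> A) (x : X A) : Pshape (val c) ->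
  f (eact c w x) = F x c.
Proof.
have [_ _ act_F] := hF; move=> cP; rewrite /f /eact act_F ?glVV ?glM1 //; first exact: zipE_yof.
by apply/in_PP => i i3; rewrite /= mxE (negbTE i3).
Qed.

Lemma gl1_P A : in_P (gl1 A).
Proof. by apply/in_PP => i i3; rewrite /= mxE (negbTE i3). Qed.

Lemma section_reg : reg [::] f.
Proof.
have [nat_F _ _] := hF; move=> A B u x _; rewrite /f -nat_F; last exact: gl1_P.
by congr (F _ _); apply: gl_eq; rewrite /= map_mx1.
Qed.

Lemma section_semi : semi (- lam) [::] f.
Proof.
have [_ bor_F _] := hF; move=> A x c w _ cL; rewrite section_eact; last exact: lower_P.
rewrite -[c]gl1M bor_F //; last exact: gl1_P.
rewrite gl1M; congr (_ * _); have cU := chi_unit lam cL.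
apply: (mulrI cU); rewrite mulrV // -chiD ?subrr ?chi0 // => i; exact: lower_unit.
Qed.

Lemma section_line (a b : 'I_4) A (x : X A) : a != b -> (a < b)%N -> b != ord_max ->
  exists P : {poly A}, (forall m : nat, lam 0 a - lam 0 b < m%:Z -> P`_m = 0) /\
    forall B (u : {lrmorphism A -> B}) (t : B), f (flow a b t (pmap u x)) = (map_poly u P).[t].
Proof.
move=> ab lt b3; have [P [Pn PE]] := section_degree hF x ab lt b3; exists P; split=> // B u t.
by rewrite /flow section_eact ?PE //; exact: uel_P.
Qed.

Notation c03 := (o0, o3).
Notation c13 := (o1, o3).
Notation c23 := (o2, o3).

(** The flow along the root (1, 2) moves [h03] by t^q [h13]. If q m exceeded the degree bound, the
    coefficient of t^(q m) would give [h13]^m psi = 0 on [h03] = 0; there [h13] is a nonzerodivisor,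
    so psi would vanish, against the choice of m. *)
Lemma first_slope m (f1 : forall A, X A -> A) : link [::] c03 m f f1 ->
  reg [:: c03] f1 -> live [:: c03] f1 -> (q * m)%:Z <= lam 0 o1 - lam 0 o2.
Proof.
move=> [_ l1 l2] rf1 [K [p [hK pL nz]]]; rewrite leNgt; apply/negP => lt.
have [w0 w1 w2 w3] := w0IE.
have Yp : Y [::] p by [].
have [R [xi [V [psi [v0 [ch eF vx]]]]]] := good_data smX section_reg hK Yp (l1 K p hK pL).
have c0 : v0 (gc xi o0 o3) = 0 by rewrite -[gc _ _ _]/(crd c03 xi) -crd_map vx; exact: pL.
have [R2 [rho [V2 [v2 [ls lk ch2 v2E _]]]]] := chart_quot (c := c03) ch hK c0.
have [C [c [t [z tr]]]] := truncation_exists R (q * m)%N.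
have [|||v [vE zv]] := flow_chart (a := o1) (b := o2) ch _ _ tr => //.
have [P [Pn PE]] := section_line (a := o1) (b := o2) xi isT isT isT.
have : rho (crd c13 xi ^+ m * psi) = 0.
  apply: (truncated_flow (u := crd c03 xi) tr zv eF _ _ _ Pn lt).
  - by rewrite -crd_map vE crd_flow // w1 w2 eqxx mul1r !crd_map.
  - by apply/lk; exists 1; rewrite mul1r.
  - by rewrite -(section_reg v) // vE PE.
rewrite rmorphM rmorphXn /= -crd_map => /(expr_nzd (m := m)) h0.
have {}h0 : rho psi = 0 by apply: h0 => b; exact: (chart_nzd (c := c13) ch2).
apply: nz; have -> : p = pmap v2 (pmap rho xi) by rewrite pmap2 -vx; apply/esym/pmap_eq.
apply: (znear_chart ch2 rf1 hK); exists 1; first by rewrite rmorph1 oner_eq0.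
by rewrite mul1r (l2 R xi V psi R2 rho ch eF (chart_Y ch2)).
Qed.

(** The flow along the root (0, 1) preserves [h03], so it acts on its zero locus, where it moves
    [h13] by t^q [h23]. The argument of the first slope applies once the degree bound is known for
    the quotient by [h03]. *)
Lemma second_slope m1 m2 (f1 f2 : forall A, X A -> A) : link [::] c03 m1 f f1 ->
  reg [:: c03] f1 -> link [:: c03] c13 m2 f1 f2 -> reg [:: c13; c03] f2 -> live [:: c13; c03] f2 ->
  (q * m2)%:Z <= lam 0 o0 - lam 0 o1.
Proof.
move=> [_ l1 l2] rf1 [_ k1 k2] rf2 [K [p [hK pL nz]]]; rewrite leNgt; apply/negP => lt.
have [w0 w1 w2 w3] := w0IE.
have Yp : Y [::] p by [].
have Y1p : Y [:: c03] p by move=> ij; rewrite inE => /eqP->; exact: pL.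
have [R [xi [V [psi [v0 [ch eF vx]]]]]] := good_data smX section_reg hK Yp (l1 K p hK pL).
have [R1 [xi1 [V1 [psi1 [v1 [ch1 eF1 vx1]]]]]] := good_data smX rf1 hK Y1p (k1 K p hK pL).
have [|||d yd hd] := chart_near (x := xi1) (y := v1) (v := v0) (r := 1) ch _ hK => //.
- by rewrite vx vx1.
- by rewrite rmorph1 oner_eq0.
have [R' [l [V' [v' [lL ch' v'E _]]]]] := chart_loc ch1 hK yd; have [lU _ _] := lL.
have [w [wx _]] := hd R' l lU; set xi' := pmap l xi1 in ch' wx.
have v'x : pmap v' xi' = p by rewrite pmap2 -vx1; exact: pmap_eq.
have c1 : v' (gc xi' o1 o3) = 0 by rewrite -[gc _ _ _]/(crd c13 xi') -crd_map v'x; exact: pL.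
have [R2 [rho [V2 [v2 [ls lk ch2 v2E _]]]]] := chart_quot (c := c13) ch' hK c1.
have [C [c [t [z tr]]]] := truncation_exists R (q * m2)%N.
have [|||v [vE zv]] := flow_chart (a := o0) (b := o1) ch _ _ tr => //.
have [P [Pn PE]] := section_line (a := o0) (b := o1) xi isT isT isT.
(* As [h03] is constant along this flow and a nonzerodivisor, the coefficients of psi vanish in the
   same degrees as those of f. *)
have [P1 [P1n P1E]] : exists P1 : {poly R}, (forall i : nat, lam 0 o0 - lam 0 o1 < i%:Z -> P1`_i = 0) /\
    v psi = (map_poly c P1).[t].
  have e1 : c (crd c03 xi ^+ m1) * v psi = (map_poly c P).[t].
    rewrite -PE -vE (section_reg v) // eF rmorphM !rmorphXn; congr (_ ^+ _ * _).
    by rewrite /= -[RHS]crd_map vE crd_flow // w1 mul0r mulr0 addr0 crd_map.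
  have Ps : (size P <= (q * m2).+1)%N.
    apply/leq_sizeP => i iN; apply: Pn; apply: lt_le_trans lt _.
    by rewrite lez_nat ltnW.
  have [b eb] := tr_sum tr (v psi).
  have hb i : (i < (q * m2).+1)%N -> crd c03 xi ^+ m1 * b i = P`_i.
    move=> iN; apply/eqP; rewrite -subr_eq0; apply/eqP; move: i iN.
    apply: (tr_inj tr); under eq_bigr do rewrite rmorphB rmorphM mulrBl -mulrA.
    rewrite sumrB -mulr_sumr -eb e1 (horner_coef_wide _ (n := (q * m2).+1)).
      apply/eqP; rewrite subr_eq0; apply/eqP; apply: eq_bigr => i _; by rewrite coef_map.
    exact: leq_trans (size_poly _ _) Ps.
  exists (\poly_(i < (q * m2).+1) b i); split=> [i hi|].
    rewrite coef_poly; case: ifP => // iN.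
    by apply: (chart_crd_nzd (S := [::]) (c := c03) _ ch (m := m1)) => //; rewrite hb // Pn.
  rewrite eb (horner_coef_wide _ (n := (q * m2).+1)).
    by apply: eq_bigr => i _; rewrite coef_map coef_poly ltn_ord.
  exact: leq_trans (size_poly _ _) (size_poly _ _).
have [C' [c' [t' [z' tr']]]] := truncation_exists R' (q * m2)%N.
have Yxi' : Y [:: c03] xi' := chart_Y ch'.
have Yflow : Y [:: c03] (flow o0 o1 t' (pmap c' xi')).
  move=> ij; rewrite inE => /eqP->; rewrite -[gc _ _ _]/(crd c03 _) crd_flow // w1 mul0r mulr0 addr0.
  have xi0 : crd c03 xi' = 0 by exact: (Yxi' c03 (mem_head _ _)).
  by rewrite crd_map xi0 rmorph0.
have [|||u [uE zu]] := flow_chart (a := o0) (b := o1) ch' _ _ tr' => //.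
have [h [hc ht]] := tr_univ tr [the {lrmorphism R -> C'} of c' \o w] (tr_nil tr').
have rl : f1 R' xi' = crd c13 xi' ^+ m2 * l psi1.
  by rewrite (rf1 _ _ l _ (chart_Y ch1)) eF1 rmorphM rmorphXn crd_map.
have eflow : flow o0 o1 t' (pmap c' xi') = pmap [the {lrmorphism R -> C'} of h \o v] xi.
  rewrite -pmap2 vE flow_map // ht pmap2 (pmap_eq (v := [the {lrmorphism R -> C'} of c' \o w])) //.
  by rewrite -pmap2 wx.
have : rho (crd c23 xi' ^+ m2 * l psi1) = 0.
  apply: (truncated_flow (P := map_poly w P1) (u := crd c13 xi') tr' zu rl _ _ _ _ lt).
  - by rewrite -crd_map uE crd_flow // w1 w0 eqxx mul1r !crd_map.
  - by apply/lk; exists 1; rewrite mul1r.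
  - rewrite -(rf1 _ _ u _ Yxi') uE eflow (l2 R xi V psi) -?eflow // /= P1E.
    rewrite -[in LHS](horner_map h) /= ht -!map_poly_comp; congr (_.[_]).
    by apply: eq_map_poly => r; exact: (hc r).
  - by move=> i hi; rewrite coef_map /= (P1n _ hi) rmorph0.
rewrite rmorphM rmorphXn /= -crd_map => /(expr_nzd (m := m2)) h0.
have {}h0 : rho (l psi1) = 0 by apply: h0 => b; exact: (chart_nzd (c := c23) ch2).
apply: nz; have -> : p = pmap v2 (pmap rho xi') by rewrite pmap2 -v'x; apply/esym/pmap_eq.
apply: (znear_chart ch2 rf2 hK); exists 1; first by rewrite rmorph1 oner_eq0.
by rewrite mul1r (k2 R' xi' V' (l psi1) R2 rho ch' rl (chart_Y ch2)).
Qed.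
End Flow.

(** * Connected components of S *)

Section PrimeAvoidance.
Variables (R : comNzRingType) (I T : R -> Prop).
Hypotheses (hI : ideal I) (TM : forall a b, T a -> T b -> T (a * b)).
Hypothesis IT : forall a, I a -> ~ T a.

Record avoiding := Avoiding {
  av :> R -> Prop; avP : ideal av; avT : forall a, av a -> ~ T a; avI : forall a, I a -> av a }.

Lemma prime_avoiding : exists P : R -> Prop,
  [/\ ideal P, forall a, P a -> ~ T a, forall a, I a -> P a
    & forall a b, P (a * b) -> P a \/ P b].
Proof.
pose le (J J' : avoiding) := `[< forall a, J a -> J' a >].
have [||A tot|J maxJ] := @classical_sets.ZL_preorder avoiding (Avoiding hI IT (fun=> id)) le.
- by move=> J; apply/asboolP.
- by move=> J J' J'' /asboolP h /asboolP h'; apply/asboolP => a /h /h'.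
- have [[J0 AJ0]|A0] := pselect (exists J, A J); last first.
    exists (Avoiding hI IT (fun=> id)) => J AJ; case: A0; by exists J.
  pose U a := exists J : avoiding, A J /\ J a.
  have hU : ideal U.
    split=> [|a b [J [AJ Ja]] [J' [AJ' Jb]]|a b [J [AJ Jb]]].
    - by exists J0; split=> //; apply: (ideal0 (avP J0)).
    - have [/asboolP le1|/asboolP le1] := tot _ _ AJ AJ'.
        by exists J'; split=> //; apply: (idealD (avP J')) => //; apply: le1.
      by exists J; split=> //; apply: (idealD (avP J)) => //; apply: le1.
    - by exists J; split=> //; apply: (idealM (avP J)).
  have hUT a : U a -> ~ T a by move=> [J [_ /avT]].
  have hUI a : I a -> U a by exists J0; split=> //; apply: avI.
  exists (Avoiding hU hUT hUI) => J AJ; apply/asboolP => a Ja; by exists J.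
exists J; split; [exact: avP|exact: avT|exact: avI|move=> a b Jab].
have ext c : ~ J c -> exists x y, J x /\ T (x + y * c).
  move=> nJc; apply: contrapT => nex; pose J' z := exists x y, J x /\ z = x + y * c.
  have hJ' : ideal J'.
    split=> [|_ _ [x [y [Jx ->]]] [x' [y' [Jx' ->]]]|z _ [x [y [Jx ->]]]].
    - by exists 0, 0; split; [apply: (ideal0 (avP J))|rewrite mul0r addr0].
    - by exists (x + x'), (y + y'); split; [apply: (idealD (avP J))|ring].
    - by exists (z * x), (z * y); split; [apply: (idealM (avP J))|ring].
  have J'T z : J' z -> ~ T z by move=> [x [y [Jx ->]]] Tz; apply: nex; exists x, y.
  have JJ' z : J z -> J' z by move=> Jz; exists z, 0; split=> //; rewrite mul0r addr0.
  have J'I z : I z -> J' z by move=> /(avI J); apply: JJ'.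
  have /asboolP h := maxJ (Avoiding hJ' J'T J'I) (introT (asboolP _) JJ').
  apply: nJc; apply: h; exists 0, 1; split; first exact: (ideal0 (avP J)).
  by rewrite add0r mul1r.
have [Ja|nJa] := pselect (J a); [by left|right; apply: contrapT => nJb].
have [x [y [Jx Tx]]] := ext a nJa; have [x' [y' [Jx' Tx']]] := ext b nJb.
apply: (avT (a := (x + y * a) * (x' + y' * b)) (a0 := J) _ (TM Tx Tx')).
have -> : (x + y * a) * (x' + y' * b) = (x' + y' * b) * x + (y * a) * x' + y * y' * (a * b) by ring.
apply: (idealD (avP J)); last exact: (idealM (avP J)).
by apply: (idealD (avP J)); apply: (idealM (avP J)).
Qed.
End PrimeAvoidance.

Section EtaleImage.
Variable k : fieldType.
Notation alg := (comUnitAlgType k).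
Implicit Types A B C K L : alg.

Lemma etale_image_open A B (h : {lrmorphism A -> B}) (W : forall K, {lrmorphism A -> K} -> Prop) :
  etale_cover h ->
  (forall K L (y : {lrmorphism A -> K}) (y' : {lrmorphism A -> L}) (i : {lrmorphism K -> L}),
     is_field K -> is_field L -> y' =1 i \o y -> W K y <-> W L y') ->
  (forall K (y : {lrmorphism B -> K}), is_field K -> W K [the {lrmorphism A -> K} of y \o h] ->
     exists2 b, y b != 0 & forall L (y' : {lrmorphism B -> L}), is_field L -> y' b != 0 ->
       W L [the {lrmorphism A -> L} of y' \o h]) ->
  forall K (y : {lrmorphism A -> K}), is_field K -> W K y ->
  exists2 a, y a != 0 & forall L (y' : {lrmorphism A -> L}), is_field L -> y' a != 0 -> W L y'.
Proof.
move=> [sm _ surj] ext op K y hK Wy; apply: contrapT => nex.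
have [K' [i [yB [hK' yBE]]]] := surj K y hK.
have WB : W K' [the {lrmorphism A -> K'} of yB \o h] by apply/(ext _ _ y _ i).
have [b yb hb] := op K' yB hK' WB.
pose I (c : B) := forall L (y' : {lrmorphism B -> L}), is_field L ->
  ~ W L [the {lrmorphism A -> L} of y' \o h] -> y' c = 0.
have hI : ideal I.
  split=> [L y' _ _|c c' hc hc' L y' hL nW|c c' hc' L y' hL nW]; first by rewrite rmorph0.
    by rewrite rmorphD /= hc // hc' // addr0.
  by rewrite rmorphM /= hc' // mulr0.
(* A prime of B containing I and disjoint from T is a point in the closure of the complement whose
   image is a generization of y. *)
pose T (c : B) := exists2 a, y a != 0 & c = h a.
have T1 : T 1 by exists 1; rewrite ?rmorph1 // oner_eq0.
have TM c c' : T c -> T c' -> T (c * c').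
  move=> [a ya ->] [a' ya' ->]; exists (a * a'); last by rewrite rmorphM.
  by rewrite rmorphM; apply/eqP => /(field_mul hK)[]; exact/eqP.
have IT c : I c -> ~ T c.
  move=> Ic [a ya ec]; apply: nex; exists a => // L y' hL y'a; apply: contrapT => nW.
  have [L' [j [y'B [hL' y'BE]]]] := surj L y' hL.
  have nWB : ~ W L' [the {lrmorphism A -> L'} of y'B \o h].
    by move/(ext _ _ y' [the {lrmorphism A -> L'} of y'B \o h] j hL hL' y'BE).
  have := Ic L' y'B hL' nWB; rewrite ec => e; have := y'BE a; rewrite /= e => /esym/eqP.
  apply/negP; rewrite -(unit_field _ hL') rmorph_unit // (unit_field _ hL).
  exact: y'a.
have [P [hP PT PI Pp]] := prime_avoiding hI TM IT.
have P1 : ~ P 1 by move=> /PT.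
have [D [pi0 [pij pis pik]]] := @quotient_alg k B (in_algm B) P hP P1.
have [pi piE] := lrmorph_of pij.
have domD (u v : D) : u * v = 0 -> u = 0 \/ v = 0.
  have [u' <-] := pis u; have [v' <-] := pis v; rewrite -rmorphM => /pik/Pp[]/pik; by [left|right].
have [||C [iC [j [ij nb]]]] := @going_down k A B D K' h [the {lrmorphism A -> D} of pi \o h] yB b sm domD hK'.
- move=> a; rewrite /= piE => /pik Pa; have := yBE a; rewrite /= => ->.
  have [->|ya] := eqVneq (y a) 0; first by rewrite rmorph0.
  by case: (PT _ Pa); exists a.
- exact: yb.
have [L [e [hL eb]]] := point_exists nb.
have W1 := hb L [the {lrmorphism B -> L} of e \o iC] hL eb.
pose y2 := [the {lrmorphism B -> L} of e \o [the {lrmorphism B -> C} of j \o pi]].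
have W2 : W L [the {lrmorphism A -> L} of y2 \o h].
  apply/(ext _ _ [the {lrmorphism A -> L} of [the {lrmorphism B -> L} of e \o iC] \o h] _ [the {lrmorphism L -> L} of idfun] hL hL) => //.
  by move=> a; rewrite /= -[j _]/((j \o (pi \o h)) a) -ij.
have [b2 yb2 hb2] := op L y2 hL W2.
have : P b2.
  apply: PI => L' y' hL' nW; apply/eqP; apply: contraT => nz; case: nW; exact: hb2.
by move/pik; rewrite -piE => e0; move: yb2; rewrite /= e0 !rmorph0 eqxx.
Qed.
End EtaleImage.

Section Component.
Variables (k : fieldType) (S : presheaf k).
Notation alg := (comUnitAlgType k).
Implicit Types A B K : alg.

Lemma open_pset (U : subfun S) : open_sub U -> is_pset U.
Proof.
move=> /open_popen oU K K' u x hK hK'; split=> [|Ux]; first exact: (po_map oU).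
have [d ud hd] := po_open oU Logic.I hK' Ux.
rewrite -[x](pmap_id (u := [the {lrmorphism K -> K} of idfun])) //; apply: hd => //=.
by apply: contraNneq ud => ->; rewrite rmorph0.
Qed.

Lemma component_exists K1 (s1 : S K1) : is_field K1 ->
  exists Z : subfun S, connected_component Z /\ Z K1 s1.
Proof.
move=> hK1; pose C0 : subfun S := fun K t => forall U : subfun S, open_sub U -> U K t <-> U K1 s1.
have C0P : is_pset C0.
  by move=> K K' u x hK hK'; split=> h U oU; have := open_pset oU u x hK hK'; have := h U oU; tauto.
(* The class of points lying in the same opens as [s1] provides one connected set through [s1]; the
   component is the union of all of them. *)
have C0s : C0 K1 s1 by [].
have C0c : connected_pset C0.
  split=> [|U V oU oV _ [K [x [hK C0x Ux]]] [K' [x' [hK' C0x' Vx']]]]; first by exists K1, s1.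
  by exists K1, s1; split=> //; [apply/(C0x U oU)|apply/(C0x' V oV)].
pose Z : subfun S := fun K t => exists C : subfun S, [/\ is_pset C, connected_pset C, C K t & C K1 s1].
have Zs : Z K1 s1 by exists C0.
have half (U V : subfun S) : open_sub U -> open_sub V ->
    (forall K (x : S K), is_field K -> Z K x -> U K x \/ V K x) -> U K1 s1 -> meets Z V ->
    exists K (x : S K), [/\ is_field K, Z K x, U K x & V K x].
  move=> oU oV cov Us [K [x [hK [C [CP Cc Cx Cs]] Vx]]].
  have CZ K' (x' : S K') : C K' x' -> Z K' x' by move=> Cx'; exists C.
  have [_ conn] := Cc; have [|||K' [x' [hK' Cx' Ux' Vx']]] := conn U V oU oV.
  - by move=> K' x' hK' /CZ; apply: cov.
  - by exists K1, s1.
  - by exists K, x.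
  by exists K', x'; split=> //; apply: CZ.
exists Z; split=> //; split.
- move=> K K' u x hK hK'; split=> -[C [CP Cc Cx Cs]]; exists C; split=> //; by apply/(CP K K' u x).
- split=> [|U V oU oV cov mU mV]; first by exists K1, s1.
  have [Us|Vs] := cov K1 s1 hK1 Zs; first exact: half.
  have cov' K (x : S K) : is_field K -> Z K x -> V K x \/ U K x by move=> hK /(cov K x hK) [] ?; [right|left].
  by have [K [x [hK Zx Vx Ux]]] := half V U oV oU cov' Vs mU; exists K, x.
- move=> Z' Z'P Z'c sub K x hK Z'x; exists Z'; split=> //; exact: sub.
Qed.
End Component.

Section Connectivity.
Variables (q : nat) (k : fieldType) (S : presheaf k) (X : zip_mor q S).
Notation alg := (comUnitAlgType k).
Implicit Types A B C K L : alg.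
Hypothesis q0 : (0 < q)%N.
Hypothesis hfr : forall A, exists fr : {rmorphism A -> A}, forall a, fr a = a ^+ q.
Hypothesis smX : zip_smooth X.
Hypothesis hb : zip_surj_components X.
Variable f : forall A, X A -> A.
Hypothesis rf : regular_on (Y (X := X) [::]) f.

Definition germ_kind (b : bool) K (p : X K) : Prop :=
  if b then znear [::] f p else ~ znear [::] f p.

Lemma Ynil A (x : X A) : Y [::] x. Proof. by []. Qed.

Lemma germ_kind_open b A (x : X A) K (y : {lrmorphism A -> K}) : is_field K ->
  germ_kind b (pmap y x) -> exists2 d, y d != 0 & forall K' (y' : {lrmorphism A -> K'}), is_field K' ->
    y' d != 0 -> germ_kind b (pmap y' x).
Proof.
case: b => hK h; first exact: (dvd_open smX rf (@reg0 _ _ X [::]) (Ynil x) hK h).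
exact: (nznear_open smX rf (Ynil x) hK h).
Qed.
Lemma germ_kind_ext b K K' (i : {lrmorphism K -> K'}) (p : X K) : is_field K -> is_field K' ->
  germ_kind b p <-> germ_kind b (pmap i p).
Proof.
move=> hK hK'; have h := dvd_ext smX i rf (@reg0 _ _ X [::]) (Ynil p) hK hK'.
by case: b => //=; split=> n z; apply: n; apply/h.
Qed.
Lemma germ_kind_fiber b K (p p' : X K) : is_field K -> zpi X K p = zpi X K p' ->
  germ_kind b p -> germ_kind b p'.
Proof.
move=> hK /ztrans[x [y [zxy e]]].
have [c [w [cP _ _ ezact]]] := zipE_eact X hfr zxy; rewrite ezact in e.
have [w2 h2] := eact_inv X hfr w cP.
have icP : Pshape (val (glV c)) by case: (Pshape_unit (mulmxV (valP c)) cP).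
case: b => /=; rewrite -e; first exact: (znear_E q0 hfr smX rf hK cP).
by move=> n z; apply: n; rewrite -[p]h2; exact: (znear_E q0 hfr smX rf hK icP).
Qed.

(** The two points lie over the same s but over unrelated fields. Going down over the field K yields
    a common extension at which the first point may be replaced by one in its open neighbourhood d;
    the two are then in one orbit of E. *)
Lemma fiber_etale b K (s : S K) B (h : {lrmorphism K -> B}) (pB : X B) L (y2 : {lrmorphism B -> L})
    K' (i : {lrmorphism K -> K'}) (p : X K') : etale_cover h -> zpi X B pB = pmap h s ->
  is_field K -> is_field L -> is_field K' -> zpi X K' p = pmap i s ->
  germ_kind b (pmap y2 pB) -> germ_kind b p.
Proof.
move=> [sm _ _] epB hK hL hK' ep g; have [d yd hd] := germ_kind_open hL g.
have domK (u v : K') : u * v = 0 -> u = 0 \/ v = 0 by exact: field_mul.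
have [||C [iC [j [ij nb]]]] := @going_down k K B K' L h i y2 d sm domK hL.
- move=> a ia; have [->|an] := eqVneq a 0; first by rewrite !rmorph0.
  have : i a \is a GRing.unit by rewrite rmorph_unit // hK.
  by rewrite ia unitr0.
- exact: yd.
have [M [e [hM eb]]] := point_exists nb.
apply/(germ_kind_ext b [the {lrmorphism K' -> M} of e \o j] p hK' hM).
apply: (germ_kind_fiber hM _ (hd M [the {lrmorphism B -> M} of e \o iC] hM eb)).
rewrite !mor_nat epB ep !pmap2; apply: pmap_eq => a /=.
by rewrite -[iC _]/((iC \o h) a) ij.
Qed.

Lemma fiber_point K (s : S K) : is_field K -> exists L (i : {lrmorphism K -> L}) (p : X L),
  [/\ is_field L, zpi X L p = pmap i s
  & forall b, germ_kind b p -> forall K' (i' : {lrmorphism K -> K'}) (p' : X K'), is_field K' ->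
      zpi X K' p' = pmap i' s -> germ_kind b p'].
Proof.
move=> hK; have [B [h [pB [et epB]]]] := zlocal X s; have [L [y hL]] := has_point B.
exists L, [the {lrmorphism K -> L} of y \o h], (pmap y pB); split=> //.
  by rewrite mor_nat epB pmap2.
move=> b g K' i' p' hK' ep'; exact: (fiber_etale et epB hK hL hK' ep' g).
Qed.

(* Whether f vanishes near p depends only on the image s of p in S, which splits S
   into two open subsets. *)
Definition kind b K (s : S K) : Prop := exists K' (i : {lrmorphism K -> K'}) (p : X K'),
  [/\ is_field K', zpi X K' p = pmap i s & germ_kind b p].

Lemma germ_kindN b K (p : X K) : germ_kind b p \/ germ_kind (~~ b) p.
Proof. by have [h|h] := pselect (znear [::] f p); case: b; [left|right|right|left]. Qed.
Lemma germ_kindF b K (p : X K) : germ_kind b p -> germ_kind (~~ b) p -> False.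
Proof. by case: b => /= h h'; [apply: h'|apply: h]. Qed.

Lemma kind_point b K (s : S K) K' (i : {lrmorphism K -> K'}) (p : X K') : is_field K -> is_field K' ->
  zpi X K' p = pmap i s -> kind b s <-> germ_kind b p.
Proof.
move=> hK hK' ep; split=> [[K1 [i1 [p1 [hK1 ep1 g1]]]]|g]; last by exists K', i, p.
have [L [j [pL [hL epL hall]]]] := fiber_point s hK.
have [g|g] := germ_kindN b pL; first exact: (hall b g K' i p).
by case: (germ_kindF g1 (hall _ g K1 i1 p1 hK1 ep1)).
Qed.

Lemma kind_ext b K L (i : {lrmorphism K -> L}) (s : S K) : is_field K -> is_field L ->
  kind b s <-> kind b (pmap i s).
Proof.
move=> hK hL; have [M [j [p [hM ep _]]]] := fiber_point (pmap i s) hL.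
have ep' : zpi X M p = pmap [the {lrmorphism K -> M} of j \o i] s by rewrite ep pmap2.
by rewrite (kind_point b hL hM ep) (kind_point b hK hM ep').
Qed.

Definition kind_open b : subfun S := fun A s => forall K (y : {lrmorphism A -> K}), is_field K -> kind b (pmap y s).

Lemma kind_openE b K (s : S K) : is_field K -> kind_open b s <-> kind b s.
Proof.
move=> hK; split=> [h|h L y hL]; last exact/(kind_ext b y s hK hL).
by have := h K [the {lrmorphism K -> K} of idfun] hK; rewrite pmap_id.
Qed.

Lemma kind_open_sub b : open_sub (kind_open b).
Proof.
apply: popen_open; split=> //.
- by move=> A B u s h K y hK; rewrite pmap2; exact: h.
- by move=> A s _ h K y hK; apply/kind_openE => //; exact: h.
move=> A s K y _ hK /(kind_openE b _ hK) ky.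
have [B [h [pB [et epB]]]] := zlocal X s.
have [||d yd hd] := @etale_image_open k A B h (fun L y' => kind b (pmap y' s)) et _ _ K y hK ky.
- move=> L M y1 y2 i hL hM e; rewrite (kind_ext b i _ hL hM) pmap2.
  by rewrite (pmap_eq (v := y2)) // => a; rewrite e.
- move=> L y1 hL; rewrite -pmap2 -epB => /kind_point.
  have e1 : zpi X L (pmap y1 pB) = pmap [the {lrmorphism L -> L} of idfun] (pmap y1 (zpi X B pB)).
    by rewrite mor_nat pmap_id.
  move=> /(_ _ _ _ hL hL e1) g; have [d yd hd] := germ_kind_open hL g.
  exists d => // M y2 hM y2d; have g2 := hd M y2 hM y2d.
  exists M, [the {lrmorphism M -> M} of idfun], (pmap y2 pB); split=> //.
  by rewrite mor_nat epB pmap2 pmap_id.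
by exists d => // L y' hL y'd; apply/kind_openE => //; exact: hd.
Qed.

(** A nonzero germ of f lies over some component of S, and over this component there is a point with
    h equal to the identity. A zero germ there would split the component into two disjoint nonempty
    opens. *)
Lemma live_at_corner A (x : X A) : f x != 0 -> live [::] f.
Proof.
move=> fx; have [K1 [y1 [hK1 g1]]] : exists K (y : {lrmorphism A -> K}), is_field K /\ ~ znear [::] f (pmap y x).
  apply: contrapT => nex; move/eqP: fx; apply; apply: germ0_zero => K y hK.
  apply: (znear_germ _ (Ynil x)) => //; apply: contrapT => h; apply: nex.
  by exists K, y.
set p1 := pmap y1 x in g1; have [Z [cZ Zs]] := component_exists (zpi X K1 p1) hK1.
have g0U : (1%:M : 'M[K1]_4) \in unitmx by exact: unitmx1.
have [K2 [u [p2 [hK2 Zp2 ep2]]]] := hb cZ (ungmat g0U) hK1.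
exists K2, p2; split=> //.
  by rewrite /gc ep2 gmat_map ungmatK map_mx1 => i j ij; rewrite mxE -val_eqE (ltn_eqF ij).
move=> g2; have [_ [_ conn] _] := cZ.
have idE K (s : S K) : s = pmap [the {lrmorphism K -> K} of idfun] s by rewrite pmap_id.
have [|||K [s [hK _ U1 U2]]] := conn (kind_open false) (kind_open true) (kind_open_sub _) (kind_open_sub _).
- move=> K s hK _; have [L [j [p [hL ep hall]]]] := fiber_point s hK.
  by have [g|g] := germ_kindN true p; [right|left]; apply/kind_openE => //; exists L, j, p.
- exists K1, (zpi X K1 p1); split=> //; apply/kind_openE => //.
  by exists K1, [the {lrmorphism K1 -> K1} of idfun], p1; split=> //; exact: idE.
- exists K2, (zpi X K2 p2); split=> //; apply/kind_openE => //.
  by exists K2, [the {lrmorphism K2 -> K2} of idfun], p2; split=> //; exact: idE.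
have [L [j [p [hL ep _]]]] := fiber_point s hK.
move: U1 U2 => /(kind_openE _ _ hK)/(kind_point _ hK hL ep) /= n /(kind_openE _ _ hK)/(kind_point _ hK hL ep).
exact: n.
Qed.
End Connectivity.

(** * Upper bound *)

Section Staircases.
Implicit Types (S : seq ('I_4 * 'I_4)) (c : 'I_4 * 'I_4).

(** An explicit list, so that the Boolean tests below reduce by computation. *)
Definition ords : seq 'I_4 := [:: o0; o1; o2; o3].
Lemma mem_ords i : i \in ords. Proof. by move: i; apply: ord4P. Qed.

Definition stairb S : bool := all (fun ij : 'I_4 * 'I_4 => (ij.1 < ij.2)%N &&
  all (fun a : 'I_4 => all (fun b : 'I_4 => ((a <= ij.1)%N && (ij.2 <= b)%N) ==> ((a, b) \in S)) ords) ords) S.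
Lemma stairP S : stairb S -> stair S.
Proof.
move=> /allP h ij /h /andP[lt /allP h2]; split=> // -[a b] /= ha hb.
have /allP/(_ b (mem_ords b)) := h2 a (mem_ords a).
by rewrite ha hb.
Qed.

Definition simpleb c S : bool :=
  all (fun a : 'I_4 => all (fun b : 'I_4 => (a < b)%N ==> (((a, b) \in S) == ((a, b) != c))) ords) ords.
Lemma simpleP c S : simpleb c S -> simple_set c S.
Proof.
move=> /allP h [a b] /= ab; have /allP/(_ b (mem_ords b)) := h a (mem_ords a).
by rewrite ab => /eqP.
Qed.

Lemma length_tperm c : c \in [:: (o0, o1); (o1, o2); (o2, o3)] -> perm_length (tperm c.1 c.2) = 1%N.
Proof.
move=> hc; rewrite /perm_length (_ : [set _ | _] = [set c]) ?cards1 //.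
apply/setP => -[a b]; rewrite !inE; move: hc; rewrite !inE => /or3P[]/eqP->;
  move: a; apply: ord4P; move: b; apply: ord4P; by rewrite !permE.
Qed.
End Staircases.

Section UpperBound.
Variables (q : nat) (k : fieldType) (S : presheaf k) (X : zip_mor q S).
Notation alg := (comUnitAlgType k).
Implicit Types A B C K L : alg.
Hypothesis q1 : (1 < q)%N.
Hypothesis hfr : forall A, exists fr : {rmorphism A -> A}, forall a, fr a = a ^+ q.
Hypothesis smX : zip_smooth X.
Hypothesis hb : zip_surj_components X.
Hypothesis hc : forall w : 'S_4, perm_length w = 1%N -> flag_closure_pseudo_complete X w.
Let q0 : (0 < q)%N := ltnW q1.
Notation um c m := (fun A (x : X A) => crd c x ^+ m).
Notation c01 := (o0, o1).
Notation c12 := (o1, o2).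
Notation c23 := (o2, o3).
Notation c02 := (o0, o2).
Notation c13 := (o1, o3).
Notation c03 := (o0, o3).
Notation S3 := [:: c02; c13; c03].
Notation cset := (seq ('I_4 * 'I_4)).

Lemma not_dvd_le (T : cset) c m n (F : forall A, X A -> A) :
  (exists K (p : X K), [/\ is_field K, lower (gc p) & ~ dvd T (um c m.+1) F p]) ->
  (forall K (p : X K), is_field K -> lower (gc p) -> dvd T (um c n) F p) -> (n <= m)%N.
Proof.
move=> [K [p [hK pL nd]]] h; rewrite leqNgt; apply/negP => mn; apply: nd.
exact: dvd_le mn (h K p hK pL).
Qed.

(** The first restriction is to [h01] = 0 or to [h12] = 0, and each branch goes on to two curves.
    One chain alone bounds nothing, as its inequality involves the unknown orders met on the way;
    the orders met on the other chains compare with them by [dvd_restrict]. *)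
Lemma curve_bounds nu (f3 : forall A, X A -> A) : sect S3 nu f3 ->
  nu 0 o3 <= nu 0 o0.
Proof.
move=> s3; have [w0 w1 w2 w3] := w0IE.
have st3 : stair S3 by exact: stairP.
have stx : stair (c01 :: S3) by exact: stairP.
have sty : stair (c12 :: S3) by exact: stairP.
have stG1 : stair [:: c12, c01 & S3] by exact: stairP.
have stG2 : stair [:: c23, c01 & S3] by exact: stairP.
have stG3 : stair [:: c01, c12 & S3] by exact: stairP.
have stG4 : stair [:: c23, c12 & S3] by exact: stairP.
have stH1 : stair [:: c23, c12, c01 & S3] by exact: stairP.
have stH2 : stair [:: c12, c23, c01 & S3] by exact: stairP.
have stH3 : stair [:: c23, c01, c12 & S3] by exact: stairP.
have stH4 : stair [:: c01, c23, c12 & S3] by exact: stairP.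
have si1 : simple_set c23 [:: c12, c01 & S3] by exact: simpleP.
have si2 : simple_set c12 [:: c23, c01 & S3] by exact: simpleP.
have si3 : simple_set c23 [:: c01, c12 & S3] by exact: simpleP.
have si4 : simple_set c01 [:: c23, c12 & S3] by exact: simpleP.
have [a [F [sF lF]]] := sect_restrict (S := S3) (c := c01) q0 hfr smX isT st3 stx s3.
have [b [F' [sF' lF']]] := sect_restrict (S := S3) (c := c12) q0 hfr smX isT st3 sty s3.
have [y1 [G1 [sG1 lG1]]] := sect_restrict (S := c01 :: S3) (c := c12) q0 hfr smX isT stx stG1 sF.
have [c' [G2 [sG2 lG2]]] := sect_restrict (S := c01 :: S3) (c := c23) q0 hfr smX isT stx stG2 sF.
have [x3 [G3 [sG3 lG3]]] := sect_restrict (S := c12 :: S3) (c := c01) q0 hfr smX isT sty stG3 sF'.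
have [c'' [G4 [sG4 lG4]]] := sect_restrict (S := c12 :: S3) (c := c23) q0 hfr smX isT sty stG4 sF'.
have [r3 _ _] := s3; have [rF _ _] := sF; have [rF' _ _] := sF'.
have [rG1 _ _] := sG1; have [rG2 _ _] := sG2; have [rG3 _ _] := sG3; have [rG4 _ _] := sG4.
have up (T : cset) : stair T -> forall ij, ij \in T -> (ij.1 < ij.2)%N by move=> st ij /st[].
have pc c : c \in [:: c01; c12; c23] -> flag_closure_pseudo_complete X (tperm c.1 c.2).
  by move=> hcc; apply: hc; exact: length_tperm.
(* Divisibility by a power of [h12] survives restriction to [h01] = 0, so the order along [h12]
   cannot drop there; the five other comparisons have the same reason. *)
have by1 : (b <= y1)%N.
  apply: (not_dvd_le (link0 lG1)).
  exact: (dvd_restrict smX (S := S3) (c := c01) (d := c12) isT isT st3 stx sty r3 rF lF (link1 lF')).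
have ax3 : (a <= x3)%N.
  apply: (not_dvd_le (link0 lG3)).
  exact: (dvd_restrict smX (S := S3) (c := c12) (d := c01) isT isT st3 sty stx r3 rF' lF' (link1 lF)).
have [e1 [n1 P1]] := curve23 (S := [:: c12, c01 & S3]) q0 hfr smX si1 (up _ stG1) stG1 stH1 (pc c23 isT) sG1.
have [e2 [n2 P2]] := curve12 (S := [:: c23, c01 & S3]) q0 hfr smX si2 (up _ stG2) stG2 stH2 (pc c12 isT) sG2.
have [e3 [n3 P3]] := curve23 (S := [:: c01, c12 & S3]) q0 hfr smX si3 (up _ stG3) stG3 stH3 (pc c23 isT) sG3.
have [e4 [n4 P4]] := curve01 (S := [:: c23, c12 & S3]) q0 hfr smX si4 (up _ stG4) stG4 stH4 (pc c01 isT) sG4.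
have he1 : (c' <= e1)%N.
  apply: (not_dvd_le n1).
  exact: (dvd_restrict smX (S := c01 :: S3) (c := c12) (d := c23) isT isT stx stG1 stG2 rF rG1 lG1 (link1 lG2)).
have he2 : (y1 <= e2)%N.
  apply: (not_dvd_le n2).
  exact: (dvd_restrict smX (S := c01 :: S3) (c := c23) (d := c12) isT isT stx stG2 stG1 rF rG2 lG2 (link1 lG1)).
have he3 : (c'' <= e3)%N.
  apply: (not_dvd_le n3).
  exact: (dvd_restrict smX (S := c12 :: S3) (c := c01) (d := c23) isT isT sty stG3 stG4 rF' rG3 lG3 (link1 lG4)).
have he4 : (x3 <= e4)%N.
  apply: (not_dvd_le n4).
  exact: (dvd_restrict smX (S := c12 :: S3) (c := c23) (d := c01) isT isT sty stG4 stG3 rF' rG4 lG4 (link1 lG3)).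
move: P1 P2 P3 P4; rewrite /phi01 /phi12 /phi23.
have E i c (v : 'rV[int]_4) m : (v - tau q c *+ m) 0 i = v 0 i - m%:Z * (q%:Z * (w0I c.1 == i)%:R + (c.2 == i)%:R).
  by rewrite mxE [X in _ + X]mxE mxMn_int tauE.
rewrite !E /= !w0 !w1 !w2 /=.
move: (nu 0 o0) (nu 0 o1) (nu 0 o2) (nu 0 o3) => v0 v1 v2 v3.
have Q1 : 1 < q%:Z by rewrite ltz_nat.
move: Q1 by1 ax3 he1 he2 he3 he4; rewrite -!lez_nat.
move: (q%:Z) (a%:Z) (b%:Z) (y1%:Z) (x3%:Z) (c'%:Z) (c''%:Z) (e1%:Z) (e2%:Z) (e3%:Z) (e4%:Z)
  (le0z_nat c') (le0z_nat c'').
move=> Q A B Y1 X3 C1 C2 E1 E2 E3 E4 C10 C20 Q1 BY AX H1 H2 H3 H4.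
rewrite !(mulr0, mulr1, addr0, add0r, subr0) => P1 P2 P3 P4.
(* Q * P1 + P2 + P3 + P4, after bounding the E's from below. *)
have D0 : 0 <= Q * Q - Q + 1 by nia.
(* Once E1, E2, E3, E4 are replaced by C1, Y1, C2, X3, the orders contribute (Q - 1)^2 times (Y1 -
   B) + (X3 - A) + Q C1 + C2, because D - Q = (Q - 1)^2 for D = Q^2 - Q + 1. *)
have S0 : 0 <= (Q - 1) * (Q - 1) by nia.
have T1 : 0 <= Q * ((Q * Q - Q + 1) * (E1 - C1)) by rewrite !mulr_ge0 ?subr_ge0 //; lia.
have T2 : 0 <= (Q * Q - Q + 1) * (E2 - Y1) by rewrite mulr_ge0 ?subr_ge0.
have T3 : 0 <= (Q * Q - Q + 1) * (E3 - C2) by rewrite mulr_ge0 ?subr_ge0.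
have T4 : 0 <= (Q * Q - Q + 1) * (E4 - X3) by rewrite mulr_ge0 ?subr_ge0.
have T5 : 0 <= (Q - 1) * (Q - 1) * (Y1 - B) by rewrite mulr_ge0 ?subr_ge0.
have T6 : 0 <= (Q - 1) * (Q - 1) * (X3 - A) by rewrite mulr_ge0 ?subr_ge0.
have T7 := mulr_ge0 S0 C10; have T8 := mulr_ge0 S0 C20.
have T9 : 0 <= Q * ((Q - 1) * (Q - 1) * C1) by rewrite mulr_ge0 //; lia.
move: P1; rewrite -(ler_pM2l (_ : 0 < Q)) ?mulr0; last by lia.
move=> P1.
have : (Q * Q - 1) * (v3 - v0) <= 0.
  lia.
nia.
Qed.

(** A negative degree bound kills the whole polynomial along the root subgroup, in particular its
    value at t = 0. *)
Lemma section_dominant lam F (a b : 'I_4) : is_section lam F ->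
  (exists A (x : X A), F A x (gl1 A) != 0) -> (a < b)%N -> b != ord_max -> lam 0 b <= lam 0 a.
Proof.
move=> hF [A [x fx]] ab bm; have ab' : a != b by rewrite -(inj_eq val_inj) neq_ltn ab.
rewrite leNgt; apply/negP => lt; have [P [Pz /(_ A idfun 0)]] := section_line hfr hF x ab' ab bm.
rewrite (flow0 q0 hfr) // pmap_id // => e; move/eqP: fx; apply; rewrite e.
rewrite (_ : map_poly _ P = 0) ?horner0 //; apply/polyP => m; rewrite coef_map coef0 /= Pz //.
by apply: lt_le_trans (le0z_nat m); rewrite subr_lt0.
Qed.

Lemma upper_bound lam : C_S X lam ->
  [/\ lam 0 o1 <= lam 0 o0, lam 0 o2 <= lam 0 o1
    & (q%:Z - 1) * (lam 0 o0 - lam 0 o3) + (lam 0 o2 - lam 0 o3) <= 0].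
Proof.
move=> [F [hF [A [p [g [gP nz]]]]]].
have nz' : exists A (x : X A), F A x (gl1 A) != 0.
  exists A, (eact g (fun=> 0) p).
  by rewrite (section_eact hfr hF (fun=> 0) p) //; apply/in_PP.
split; [exact: section_dominant hF nz' _ _|exact: section_dominant hF nz' _ _|].
have [w0 w1 w2 w3] := w0IE.
have [B [x fx]] := nz'.
have rf := section_reg hF.
have lf := live_at_corner q0 hfr smX hb rf fx.
have s0 : sect [::] (- lam) (fun A x => F A x (gl1 A)).
  by split=> //; exact: (section_semi hfr hF).
have st0 : stair [::] by exact: stairP.
have st1 : stair [:: c03] by exact: stairP.
have st2 : stair [:: c13; c03] by exact: stairP.
have st3 : stair S3 by exact: stairP.
have [m1 [f1 [s1 l1]]] := sect_restrict (S := [::]) (c := c03) q0 hfr smX isT st0 st1 s0.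
have [m2 [f2 [s2 l2]]] := sect_restrict (S := [:: c03]) (c := c13) q0 hfr smX isT st1 st2 s1.
have [m3 [f3 [s3 l3]]] := sect_restrict (S := [:: c13; c03]) (c := c02) q0 hfr smX isT st2 st3 s2.
have [r1 _ v1] := s1; have [r2 _ v2] := s2.
have := first_slope q0 hfr smX hF l1 r1 v1.
have := second_slope q0 hfr smX hF l1 r1 l2 r2 v2.
have := curve_bounds s3.
have E i c (v : 'rV[int]_4) m : (v - tau q c *+ m) 0 i = v 0 i - m%:Z * (q%:Z * (w0I c.1 == i)%:R + (c.2 == i)%:R).
  by rewrite mxE [X in _ + X]mxE mxMn_int tauE.
rewrite !E /= !w0 !w1 /= !PoszM !mxE.
move: (lam 0 o0) (lam 0 o1) (lam 0 o2) (lam 0 o3) => a0 a1 a2 a3.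
have Q1 : 1 < q%:Z by rewrite ltz_nat.
move: Q1; move: (q%:Z) (m1%:Z) (m2%:Z) (m3%:Z) => Q M1 M2 M3 Q1.
rewrite !(mulr0, mulr1, addr0, add0r, subr0) => h1 h2 h3.
(* [curve_bounds] reads a0 - M1 - M2 <= a3; multiplied by Q and combined with the two slopes, Q M1
   <= a1 - a2 and Q M2 <= a0 - a1, it gives the third inequality. *)
have : Q * (a0 - M1 - M2) <= Q * a3 by rewrite ler_pM2l; lia.
lia.
Qed.
End UpperBound.

(** * Lower bound *)

Section HasseInvariants.
Variables (q : nat) (A : comUnitRingType) (fr : {rmorphism A -> A}).
Hypothesis frE : forall a, fr a = a ^+ q.
Hypothesis q0 : (0 < q)%N.
Implicit Types (G H c : 'M[A]_4) (e v : 'I_4 -> A).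

Lemma sum_ord4 (F : 'I_4 -> A) : \sum_i F i = F o0 + F o1 + F o2 + F o3.
Proof.
rewrite !big_ord_recl big_ord0 addr0 !addrA; congr (F _ + F _ + F _ + F _); exact: val_inj.
Qed.

(** The pairing of a covector with the Frobenius twist of a vector. When the vector changes by c and
    the covector by the twist of the transpose of c, the two changes cancel up to scalars. *)
Definition frob_pair e v : A := e o0 * v o0 ^+ q + e o1 * v o1 ^+ q + e o2 * v o2 ^+ q.

Lemma frob_pair_transform c (d g : A) e v e' v' : lower c ->
  (forall i : 'I_4, (i < 3)%N -> v i = g * (c i o0 * v' o0 + c i o1 * v' o1 + c i o2 * v' o2)) ->
  (forall i : 'I_4, (i < 3)%N -> e' i = d * (c o0 i ^+ q * e o0 + c o1 i ^+ q * e o1 + c o2 i ^+ q * e o2)) ->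
  g ^+ q * frob_pair e' v' = d * frob_pair e v.
Proof.
move=> cL hv he; rewrite /frob_pair !hv // !he // -!frE !(rmorphM, rmorphD) /=.
ring.
Qed.

Variables (c G G' H H' : 'M[A]_4) (w : 'I_4 -> A).
Hypothesis cL : lower c.
Hypothesis GE : G' = bmat q c w *m G *m c.
Hypothesis HE : H = c *m H' *m bmat q c w.

Definition hlast (M : 'M[A]_4) i : A := M i o3.
(* On these minors the unipotent part w of the zip group acts trivially. *)
Definition hminor (M : 'M[A]_4) i : A := M o0 o3 * M i o2 - M i o3 * M o0 o2.
(** The reindexing by [w0I] undoes the one in [bmat], so that the twist of c acts in the standard
    order. *)
Definition glast (M : 'M[A]_4) i : A := M (w0I i) o3.

Lemma hlast_transform (i : 'I_4) : (i < 3)%N ->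
  hlast H i = c o3 o3 ^+ q * (c i o0 * hlast H' o0 + c i o1 * hlast H' o1 + c i o2 * hlast H' o2).
Proof.
have [w0 w1 w2 w3] := w0IE.
move=> i3; rewrite /hlast HE mxE sum_ord4 !bmatE w0 w1 w2 w3 !mxE /= expr0n eqn0Ngt q0 /=.
by rewrite !sum_ord4 [c i o3]cL ?i3 //; ring.
Qed.
Lemma hcol_transform (i : 'I_4) : (i < 3)%N ->
  H i o2 = c o0 o0 ^+ q * (c i o0 * H' o0 o2 + c i o1 * H' o1 o2 + c i o2 * H' o2 o2)
         + w o0 * (c i o0 * hlast H' o0 + c i o1 * hlast H' o1 + c i o2 * hlast H' o2).
Proof.
have [w0 w1 w2 w3] := w0IE.
move=> i3; rewrite /hlast HE mxE sum_ord4 !bmatE w0 w1 w2 w3 !mxE /=.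
rewrite [c o0 o1]cL // [c o0 o2]cL // expr0n eqn0Ngt q0 /=.
by rewrite !sum_ord4 [c i o3]cL ?i3 //; ring.
Qed.
Lemma hminor_transform (i : 'I_4) : (i < 3)%N ->
  hminor H i = c o3 o3 ^+ q * c o0 o0 * c o0 o0 ^+ q *
    (c i o0 * hminor H' o0 + c i o1 * hminor H' o1 + c i o2 * hminor H' o2).
Proof.
move=> i3; rewrite /hminor -!/(hlast _ _) !hlast_transform // !hcol_transform //.
by rewrite [c o0 o1]cL // [c o0 o2]cL //; ring.
Qed.
Lemma glast_transform (i : 'I_4) : (i < 3)%N -> glast G' i =
  c o3 o3 * (c o0 i ^+ q * glast G o0 + c o1 i ^+ q * glast G o1 + c o2 i ^+ q * glast G o2).
Proof.
have [w0 w1 w2 w3] := w0IE; have z : (0 : A) ^+ q = 0 by rewrite expr0n eqn0Ngt q0.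
move=> i3; rewrite /glast GE mxE sum_ord4 [c o0 o3]cL // [c o1 o3]cL // [c o2 o3]cL //.
rewrite !mxE !sum_ord4 !bmatE w0IK w0 w1 w2 w3 !mxE /=.
have -> : (i == ord_max) = false by apply/negbTE; rewrite -lt3_max.
by rewrite /= ?z; ring.
Qed.
End HasseInvariants.

Lemma chi_weight n0 n1 n2 n3 (A : comUnitRingType) (c : gl A) :
  chi (weight n0 n1 n2 n3) c =
  val c o0 o0 ^ n0 * val c o1 o1 ^ n1 * val c o2 o2 ^ n2 * val c o3 o3 ^ n3.
Proof.
rewrite /chi !big_ord_recl big_ord0 mulr1 !mulrA !mxE /=.
by congr (_ * _ * _ * _); congr (val c _ _ ^ _); exact: val_inj.
Qed.

Section HasseSections.
Variables (q : nat) (k : fieldType) (X : zip_space q k).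
Notation alg := (comUnitAlgType k).
Implicit Types A B C K : alg.
Hypothesis q0 : (0 < q)%N.
Hypothesis hfr : forall A, exists fr : {rmorphism A -> A}, forall a, fr a = a ^+ q.

(** The converse of [section_semi]. The value does not depend on the unipotent parameter chosen for
    c: two choices differ by an element with trivial c, on which the character is 1. *)
Lemma semi_section nu (f : forall A, X A -> A) : regular_on (Y [::]) f -> semi nu [::] f ->
  is_section (- nu) (fun A p (c : gl A) => f A (eact c (fun=> 0) p)).
Proof.
move=> rf sf.
have indep A (c : gl A) w w' (p : X A) : Pshape (val c) -> f A (eact c w p) = f A (eact c w' p).
  move=> cP; have [w2 e2] := eact_inv X hfr w' cP.
  have iP : Pshape (val (glV c)) by case: (Pshape_unit (mulmxV (valP c)) cP).
  have [w3 e3] := eact_comp X hfr w w2 cP iP.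
  rewrite -[in LHS](e2 p) e3 sf //.
    rewrite (_ : glM _ _ = gl1 A); last by apply: gl_eq; rewrite /= mulVmx //; exact: valP.
    by rewrite /chi big1 ?mul1r // => i _; rewrite mxE eqxx exp1rz.
  by move=> i j ij; rewrite /= mulVmx ?(valP c) // mxE -val_eqE (ltn_eqF ij).
split=> [A B u p g /in_PP gP|A p g b /in_PP gP bB|A x y p g xyE /in_PP gP].
- rewrite -rf // eact_nat //; apply: indep => i ni; rewrite mxE gP ?rmorph0 //.
- have bL : lower (val b) by [].
  have [w2 e2] := eact_comp X hfr (fun=> 0) (fun=> 0) (lower_P bL) gP.
  have bgP : Pshape (val (glM g b)) by apply: PshapeM => //; exact: lower_P.
  rewrite (indep _ _ _ w2) // -e2 sf // (_ : _^-1 = chi nu b) //.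
  by rewrite -[nu in RHS]opprK -scaleN1r -mulrN1z chiMz //= => i; exact: lower_unit.
- have [c [w [cP -> _ ->]]] := zipE_eact X hfr xyE.
  have [w2 e2] := eact_comp X hfr (fun=> 0) w gP cP.
  by rewrite e2 glVV; apply: indep; exact: PshapeM.
Qed.

Lemma invmx_eact A (c : gl A) w (p : X A) : Pshape (val c) ->
  invmx (gc p) = val c *m invmx (gc (eact c w p)) *m bmat q (val c) w.
Proof.
move=> cP; have e := gc_eact hfr w p cP; apply: invmx_eq; apply: mulmx1C.
have gU := gc_unit (eact c w p); have cU := valP c.
move: (bmat q (val c) w) e => b; move: (gc (eact c w p)) gU (gc p) => G' gU G.
move: (val c) cU => C cU e.
have : C *m invmx G' *m b *m G *m C = C.
  by rewrite -!mulmxA [b *m _]mulmxA -e mulVmx // mulmx1.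
by move/(congr1 (mulmxr (invmx C))) => /=; rewrite mulmxK ?mulmxV.
Qed.

(* [hasse_mu] is the mu-ordinary Hasse invariant. *)
Definition hasse_mu A (p : X A) : A := frob_pair q (glast (gc p)) (hlast (invmx (gc p))).
Definition hasse_flag A (p : X A) : A := frob_pair q (glast (gc p)) (hminor (invmx (gc p))).
Definition hasse_line A (p : X A) : A := glast (gc p) o2.

Lemma semi_hasse_mu : semi (weight 0 0 0 (1 - (q * q)%:Z)) [::] hasse_mu.
Proof.
move=> A p c w _ cL; have [fr frE] := hfr A; have cU := @lower_unit _ A c _ cL.
have := frob_pair_transform frE cL (hlast_transform q0 cL (invmx_eact w p (lower_P cL)))
  (glast_transform q0 cL (gc_eact hfr w p (lower_P cL))).
rewrite -exprM -/(hasse_mu p) -/(hasse_mu (eact c w p)) chi_weight !expr0z !mul1r => h.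
apply: (mulrI (unitrX (q * q) (cU o3))); rewrite h mulrA.
by rewrite [in RHS]exprnP -exprzDr // addrC subrK expr1z.
Qed.

Lemma semi_hasse_flag : semi (weight (- (q + q * q)%:Z) 0 0 (1 - (q * q)%:Z)) [::] hasse_flag.
Proof.
move=> A p c w _ cL; have [fr frE] := hfr A; have cU := @lower_unit _ A c _ cL.
have := frob_pair_transform frE cL (hminor_transform q0 cL (invmx_eact w p (lower_P cL)))
  (glast_transform q0 cL (gc_eact hfr w p (lower_P cL))).
rewrite -/(hasse_flag p) -/(hasse_flag (eact c w p)) chi_weight !expr0z !mulr1 => h.
have e : (val c o3 o3 ^+ q * val c o0 o0 * val c o0 o0 ^+ q) ^+ q =
    val c o0 o0 ^+ (q + q * q) * val c o3 o3 ^+ (q * q).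
  by rewrite !exprMn -!exprM -mulrA -exprD mulrC.
move: h; rewrite e => h.
have U : val c o0 o0 ^+ (q + q * q) * val c o3 o3 ^+ (q * q) \is a GRing.unit.
  by rewrite unitrM !unitrX.
apply: (mulrI U); rewrite h [in RHS]mulrA mulrACA !exprnP -!exprzDr // subrr expr0z mul1r.
by rewrite addrC subrK expr1z.
Qed.

Lemma semi_hasse_line : semi (weight 0 0 q%:Z 1) [::] hasse_line.
Proof.
move=> A p c w _ cL; rewrite /hasse_line.
rewrite (glast_transform q0 cL (gc_eact hfr w p (lower_P cL))) // chi_weight.
rewrite [val c o0 o2]cL // [val c o1 o2]cL // expr0n eqn0Ngt q0 /= !expr0z !mul0r !add0r !mul1r expr1z.
by rewrite exprnP mulrA [_ * val c o3 o3]mulrC.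
Qed.

Definition hasse_section (x1 x2 x3 : nat) (d : int) A (p : X A) : A :=
  hasse_flag p ^+ x3 * hasse_line p ^+ x2 * hasse_mu p ^+ x1 * \det (gc p) ^ d.

Lemma hasse_section_reg x1 x2 x3 d : regular_on (Y [::]) (hasse_section x1 x2 x3 d).
Proof.
move=> A B u p _; have iE := invmx_map u (gc_unit p).
rewrite /hasse_section /hasse_flag /hasse_mu /hasse_line gc_map iE det_map_mx.
rewrite /frob_pair /hminor /hlast /glast !mxE.
by rewrite !(rmorphM, rmorphXn, rmorphD, rmorphN) /= rmorphXz -?unitmxE ?gc_unit.
Qed.

Lemma hasse_section_semi x1 x2 x3 d :
  semi (weight (- (q + q * q)%:Z) 0 0 (1 - (q * q)%:Z) *+ x3 + weight 0 0 q%:Z 1 *+ x2 +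
        weight 0 0 0 (1 - (q * q)%:Z) *+ x1 + tdet q *~ d)
    [::] (hasse_section x1 x2 x3 d).
Proof.
have powS nu (f : forall A, X A -> A) m : semi nu [::] f -> semi (nu *+ m) [::] (fun A p => f A p ^+ m).
  move=> h A p c w Yp cL; rewrite h // exprMn chiMn // => i; exact: lower_unit.
apply: semi_mul; last by apply: semi_zpow => [|A p _]; [exact: semi_det|rewrite -unitmxE gc_unit].
apply: semi_mul; last exact: (powS _ _ _ semi_hasse_mu).
apply: semi_mul; last exact: (powS _ _ _ semi_hasse_line).
exact: (powS _ _ _ semi_hasse_flag).
Qed.
End HasseSections.

Section LowerBound.
Variables (q : nat) (k : fieldType).
Notation alg := (comUnitAlgType k).
Hypothesis q1 : (1 < q)%N.
Hypothesis hfr : forall A : alg, exists fr : {rmorphism A -> A}, forall a, fr a = a ^+ q.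

(** At h equal to this matrix the three semi-invariants [hasse_flag], [hasse_line] and [hasse_mu]
    take the unit values (-1)^q, 1 and 1. *)
Definition hasse_point (A : comUnitRingType) : 'M[A]_4 := \matrix_(i, j)
  nth 0 (nth [::] [:: [:: 0; 0; 0; 1]; [:: 0; 1; 0; 0]; [:: 1; 0; 0; 0]; [:: 0; 0; 1; -1]] i) j.
Definition hasse_point_inv (A : comUnitRingType) : 'M[A]_4 := \matrix_(i, j)
  nth 0 (nth [::] [:: [:: 0; 0; 1; 0]; [:: 0; 1; 0; 0]; [:: 1; 0; 0; 1]; [:: 1; 0; 0; 0]] i) j.

Lemma hasse_pointK (A : comUnitRingType) : hasse_point A *m hasse_point_inv A = 1%:M.
Proof.
apply/matrixP => i j; rewrite mxE sum_ord4 !mxE.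
move: i; apply: ord4P; move: j; apply: ord4P; rewrite /= ?(mul0r, mul1r, addr0, add0r, mulr0) //.
by rewrite mulr1 subrr.
Qed.

Lemma hasse_section_neq0 (A : alg) x1 x2 x3 d :
  exists p : GZip q k A, hasse_section x1 x2 x3 d p != 0.
Proof.
have PU : hasse_point A \in unitmx by case: (mulmx1_unit (hasse_pointK A)).
exists (ungmat PU : gl A); have unit_neq0 (a : A) : a \is a GRing.unit -> a != 0.
  by apply: contraTneq => ->; rewrite unitr0.
apply: unit_neq0; have [w0 w1 w2 w3] := w0IE.
have z : (0 : A) ^+ q = 0 by rewrite expr0n eqn0Ngt (ltnW q1).
rewrite /hasse_section unitrM unitrXz -?unitmxE ?gc_unit // andbT !unitrM.
rewrite /hasse_flag /hasse_mu /hasse_line /frob_pair /hminor /hlast /glast /gc ungmatK.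
rewrite (invmx_eq (hasse_pointK A)) w0 w1 w2 !mxE /=.
rewrite ?(mul0r, mul1r, addr0, add0r, mulr0, z, sub0r, subr0, subrr, expr1n) !unitrX ?unitr1 ?unitrN1 //.
Qed.

(** Modulo the weight of det the cone is simplicial: up to positive factors, each exponent is the
    defect of one of the three inequalities. *)
Lemma lower_bound (lam : 'rV[int]_4) : lam 0 o1 <= lam 0 o0 -> lam 0 o2 <= lam 0 o1 ->
    (q%:Z - 1) * (lam 0 o0 - lam 0 o3) + (lam 0 o2 - lam 0 o3) <= 0 ->
  saturation (C_zip q k) lam.
Proof.
move=> h01 h12 h; have q0 := ltnW q1.
(* This multiple makes the three exponents and the power of det integral. *)
pose N := (q * (q * q - 1))%N; exists N; split.
  rewrite /N muln_gt0 q0 subn_gt0; nia.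
pose Q := q%:Z.
have [x1 e1] : exists x : nat, x%:Z = Q * lam 0 o3 - lam 0 o2 - (Q - 1) * lam 0 o0.
  by exists (absz (Q * lam 0 o3 - lam 0 o2 - (Q - 1) * lam 0 o0)%R); rewrite gez0_abs //; lia.
have [x2 e2] : exists x : nat, x%:Z = (Q * Q - 1) * (lam 0 o1 - lam 0 o2).
  by exists (absz ((Q * Q - 1) * (lam 0 o1 - lam 0 o2))%R); rewrite gez0_abs //; nia.
have [x3 e3] : exists x : nat, x%:Z = (Q - 1) * (lam 0 o0 - lam 0 o1).
  by exists (absz ((Q - 1) * (lam 0 o0 - lam 0 o1))%R); rewrite gez0_abs //; nia.
have EN : N%:Z = Q * (Q * Q - 1) by rewrite /N /Q; lia.
have := semi_section hfr (@hasse_section_reg q k (GZip q k) x1 x2 x3 (- (Q * (Q - 1) * lam 0 o1)))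
  (@hasse_section_semi q k (GZip q k) q0 hfr x1 x2 x3 _).
set nu := - (_ : 'rV[int]_4); have -> : nu = lam *+ N.
  rewrite /nu; have QE : (q + q * q)%N%:Z = Q + Q * Q by rewrite /Q; lia.
  have QQ : (q * q)%N%:Z = Q * Q by rewrite /Q; lia.
  rewrite QE QQ -/Q.
  have E n0 n1 n2 n3 i : weight n0 n1 n2 n3 0 i = nth 0 [:: n0; n1; n2; n3] i by rewrite mxE.
  apply/rowP => i; rewrite mxE 3![in - _]mxE mxMz_int tdetE !mxMn_int EN e1 e2 e3 !E.
  by move: i; apply: ord4P => /=; ring.
move=> hs; eexists; split; first exact: hs.
exists (k^o : alg); have [p nz] := hasse_section_neq0 (k^o : alg) x1 x2 x3 (- (Q * (Q - 1) * lam 0 o1)).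
exists p, (gl1 _); split; first exact: gl1_P.
by rewrite (eact1 q0 hfr).
Qed.
End LowerBound.

(** * Comparison of the two cones *)

Section Pullback.
Variables (q : nat) (k : fieldType) (S : presheaf k) (X : zip_mor q S).
Notation alg := (comUnitAlgType k).
Implicit Types A B C K L : alg.
Hypothesis q1 : (1 < q)%N.
Hypothesis hfr : forall A, exists fr : {rmorphism A -> A}, forall a, fr a = a ^+ q.
Hypothesis hS0 : nonempty_scheme S.
Hypothesis hb : zip_surj_components X.

Lemma is_section_pullback lam F : is_section (X := GZip q k) lam F ->
  is_section (X := X) lam (fun A p c => F A (zphi X A p) c).
Proof.
move=> [F1 F2 F3]; split=> [A B u p g gP|A p g b gP bB|A x y p g xyE gP].
- by rewrite mor_nat; exact: F1.
- exact: F2.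
- by rewrite zphi_equiv //; exact: (F3 A x y (zphi X A p)).
Qed.

Lemma field_morph_neq0 K K' (u : {lrmorphism K -> K'}) (a : K) : is_field K -> a != 0 -> u a != 0.
Proof.
move=> hK /hK aU; have : u a \is a GRing.unit by apply: rmorph_unit.
by apply: contraTneq => ->; rewrite unitr0.
Qed.

Lemma nonzero_at_field (f : forall A, gl A -> A) :
  (forall A B (u : {lrmorphism A -> B}) g, f B (gl_map u g) = u (f A g)) ->
  forall A (g : gl A), f A g != 0 -> exists K (h : gl K), is_field K /\ f K h != 0.
Proof.
move=> fN A g nz; have [T [i [t [gu [pe _ guP]]]]] := @generic_gl k; have [a aE] := guP A g.
have tn : f T gu != 0 by apply: contraNneq nz => z; rewrite -aE fN z rmorph0.
have [N [P hP]] := pe_coef pe (f T gu); have [ev evE] := pe_ev i t.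
have Pn : (P : {mpoly k[4 * 4]}) != 0.
  apply: contraNneq tn => P0; have DU := unitrX N (pe_unit pe).
  by apply/eqP; apply: (mulIr DU); rewrite mul0r hP -evE P0 rmorph0.
have [n|K [x [hK xn]]] := @point_exists k T (f T gu); last first.
  by exists K, (gl_map x gu); rewrite fN.
apply/eqP => z; have : (P : {mpoly k[4 * 4]}) ^+ n != 0 by exact: expf_neq0.
have : mmap i t (P ^+ n) = 0 by rewrite -evE rmorphXn /= evE -hP exprMn z mul0r.
by move=> /(pe_inj pe) e; rewrite [_ ^+ n]e eqxx.
Qed.

Lemma C_zip_sub lam : C_zip q k lam -> C_S X lam.
Proof.
move=> [F [hF [A [g [c [cP nz]]]]]].
have [F1 _ _] := hF.
(* The section is first moved to the identity of P, so that it becomes a function on GL_4 compatible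
   with base change. *)
have [||K [h [hK nzh]]] := @nonzero_at_field (fun A g => F A g (gl1 A)) _ A (eact (X := GZip q k) c (fun=> 0) g : gl A).
- move=> A' B u g'; rewrite -(F1 A' B u g' (gl1 A') (gl1_P A')); congr (F B _ _).
  by apply: gl_eq; rewrite /= map_mx1.
- by have /= -> := section_eact hfr hF (fun=> 0) g (proj1 (in_PP c) cP).
have [K1 [hK1 [s1]]] := hS0; have [Z [hZ _]] := component_exists s1 hK1.
have [K' [u [p [hK' _ pE]]]] := hb hZ h hK.
exists (fun A p c => F A (zphi X A p) c); split; first exact: is_section_pullback.
exists K', p, (gl1 K'); split; first exact: gl1_P.
have := field_morph_neq0 u hK nzh; rewrite -(F1 K K' u h (gl1 K) (gl1_P K)) pE.
by rewrite (_ : gl_map u (gl1 K) = gl1 K') //; apply: gl_eq; rewrite /= map_mx1.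
Qed.
End Pullback.

Theorem theorem4p3p7 (q : nat) (k : closedFieldType) (hk : is_Fq_closure q k)
    (S : presheaf k) (hS : is_scheme S) (hS0 : nonempty_scheme S)
    (zeta : zip_mor q S)
    (ha : zip_smooth zeta)
    (hb : zip_surj_components zeta)
    (hc : forall w : 'S_4, perm_length w = 1%N ->
            flag_closure_pseudo_complete zeta w)
    (a1 a2 a3 a4 : int) :
  (saturation (C_S zeta) (weight a1 a2 a3 a4) <->
     saturation (C_zip q k) (weight a1 a2 a3 a4)) /\
  (saturation (C_zip q k) (weight a1 a2 a3 a4) <->
     [/\ a1 >= a2, a2 >= a3
       & (q%:Z - 1) * (a1 - a4) + (a3 - a4) <= 0]).
Proof.
have q1 : (1 < q)%N.
  have [[p [e [pp e0 -> _]]] _] := hk.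
  by rewrite -(exp1n e) ltn_exp2r // prime_gt1.
have hfr A := frob_exists A hk.
have wE i : weight a1 a2 a3 a4 0 i = nth 0 [:: a1; a2; a3; a4] i by rewrite mxE.
have zS : saturation (C_zip q k) (weight a1 a2 a3 a4) -> saturation (C_S zeta) (weight a1 a2 a3 a4).
  by move=> [N [N0 h]]; exists N; split=> //; exact: C_zip_sub h.
have up : saturation (C_S zeta) (weight a1 a2 a3 a4) ->
    [/\ a1 >= a2, a2 >= a3 & (q%:Z - 1) * (a1 - a4) + (a3 - a4) <= 0].
  move=> [N [N0 /(upper_bound q1 hfr ha hb hc)]]; rewrite !mxMn_int !wE /= => -[h1 h2 h3].
  have NZ : 0 < N%:Z by rewrite ltz_nat.
  rewrite !ler_pM2l // in h1 h2; split=> //.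
  rewrite -(ler_pM2l NZ) mulr0; apply: le_trans h3.
  by rewrite le_eqVlt; apply/orP; left; apply/eqP; ring.
have low : [/\ a1 >= a2, a2 >= a3 & (q%:Z - 1) * (a1 - a4) + (a3 - a4) <= 0] ->
    saturation (C_zip q k) (weight a1 a2 a3 a4).
  by move=> [h1 h2 h3]; apply: (lower_bound q1 hfr); rewrite !wE.
by split; [split=> [/up/low|/zS]|split=> [/zS/up|/low]].
Qed.
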